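(* Let $W$ be a Weyl group, acting on an $n$-dimensional real vector space $V$ and generated by $n$ simple reflections, let $S$ be a subset of the set of simple reflections of $W$, and let $W_S$ be the parabolic subgroup of $W$ generated by $S$. Let $R$ be the coinvariant ring of $W$ and $R^{W_S}$ its subring of $W_S$-invariants. Then a homogeneous element $\ell\in R^{W_S}_1$ of degree one is a strong Lefschetz element of $R^{W_S}$ if and only if $\ell$ is not fixed by any reflection in $W\smallsetminus W_S$, i.e. $s(\ell)\neq\ell$ for every reflection $s\in W$ with $s\notin W_S$.
   Context: A Weyl group is a crystallographic finite Coxeter group, i.e. the Weyl group of a (crystallographic) root system; it is generated by $n$ simple reflections acting on the $n$-dimensional $\mathbb{R}$-vector space $V$ spanned by the root system. A reflection of $W$ is an element of $W$ acting on $V$ as a reflection. The group $W$ acts on the polynomial ring $\mathbb{R}[V]$. Let $J$ be the graded ideal of $\mathbb{R}[V]$ generated by the $W$-invariant polynomials without constant term. The coinvariant ring of $W$ is $R=\mathbb{R}[V]/J$, which inherits a grading and an action of $W$. For a subset $S$ of the set of simple reflections, $W_S$ denotes the subgroup generated by $S$ (a parabolic subgroup), and the parabolic invariant is the graded subalgebra $R^{W_S}=\{f\in R : f \text{ is } W_S\text{-invariant}\}$ of $R$. One has $R^{W_S}=\bigoplus_{d=0}^{m-m_S}R^{W_S}_d$, where $m$ and $m_S$ are the lengths of the longest elements of $W$ and $W_S$; its Hilbert function is symmetric. Strong Lefschetz element: for a graded ring $A=\bigoplus_{d=0}^{r}A_d$ with symmetric Hilbert function, an element $\ell\in A_1$ is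 a strong Lefschetz element of $A$ if the multiplication map $\times \ell^{r-2i}:A_i\to A_{r-i}$, $f\mapsto \ell^{r-2i}f$, is bijective for every $i=0,1,\ldots,\lfloor r/2\rfloor$ (for $A=R^{W_S}$, $r=m-m_S$). *)

(* Defs.v *)
From HB Require Import structures.
From mathcomp Require Import all_boot all_order all_algebra.
From mathcomp Require Import mpoly.
From mathcomp Require Import boolp classical_sets functions reals.

Set Implicit Arguments.
Unset Strict Implicit.
Unset Printing Implicit Defensive.

Import Order.TTheory GRing.Theory Num.Theory.

Local Open Scope classical_set_scope.
Local Open Scope ring_scope.
Local Open Scope quotient_scope.

(* V is R^n seen as column vectors (an arbitrary n-dimensional real vector space
   after a choice of basis; no scalar product is fixed).  Linear forms on V are
   row vectors, and a matrix g acts on V on the left, by v |-> g *m v. *)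

Section Roots.
Variables (R : realType) (n : nat).
Implicit Types (a v : 'cV[R]_n) (f : 'rV[R]_n) (g : 'M[R]_n).
Implicit Types (A W : set 'M[R]_n).

Definition pairing f v : R := (f *m v) 0 0.

(* v |-> v - f(v) a, which is a reflection when f(a) = 2 *)
Definition reflection a f : 'M[R]_n := 1%:M - a *m f.

(* A reduced crystallographic root system in V (Bourbaki, Lie VI.1).  The
   finite set of roots is given by an enumeration; the coroot of a root is
   uniquely determined, and the values of [coroot] away from the roots are
   irrelevant. *)
Record root_system := RootSystem {
  root_seq : seq 'cV[R]_n;
  coroot : 'cV[R]_n -> 'rV[R]_n;
  roots_span : <<root_seq>>%VS = fullv;
  roots_neq0 : 0 \notin root_seq;
  coroot_root : {in root_seq, forall a, pairing (coroot a) a = 2};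
  roots_stable : {in root_seq &, forall a b,
    reflection a (coroot a) *m b \in root_seq};
  roots_integral : {in root_seq &, forall a b,
    pairing (coroot a) b \is a Num.int};
  roots_reduced : {in root_seq, forall a (c : R),
    c *: a \in root_seq -> c = 1 \/ c = -1}
}.

Definition is_base (Phi : root_system) (Delta : n.-tuple 'cV[R]_n) : Prop :=
  [/\ {subset Delta <= root_seq Phi},
      basis_of fullv Delta
    & {in root_seq Phi, forall a, exists c : 'I_n -> nat,
        a = \sum_(i < n) (c i)%:R *: tnth Delta i \/
        a = - \sum_(i < n) (c i)%:R *: tnth Delta i}].

Inductive generated_subgroup A : set 'M[R]_n :=
| generated_in g : A g -> generated_subgroup A g
| generated_1 : generated_subgroup A 1%:M
| generated_mul g h :
    generated_subgroup A g -> generated_subgroup A h ->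
    generated_subgroup A (g *m h)
| generated_inv g : generated_subgroup A g -> generated_subgroup A (invmx g).

Definition weyl_group (Phi : root_system) : set 'M[R]_n :=
  generated_subgroup
    [set reflection a (coroot Phi a) | a in [set` root_seq Phi]].

(* A set of simple reflections is given by the set of its indices in Delta. *)
Definition simple_reflections (Phi : root_system) (Delta : n.-tuple 'cV[R]_n)
    (S : {set 'I_n}) : set 'M[R]_n :=
  [set reflection (tnth Delta i) (coroot Phi (tnth Delta i)) | i in [set` S]].

Definition parabolic (Phi : root_system) (Delta : n.-tuple 'cV[R]_n)
    (S : {set 'I_n}) : set 'M[R]_n :=
  generated_subgroup (simple_reflections Phi Delta S).

(* g fixes a hyperplane pointwise and maps some nonzero vector to its opposite *)
Definition is_reflection g : Prop :=
  (exists2 a : 'cV[R]_n, a != 0 & g *m a = - a) /\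
  (exists2 f : 'rV[R]_n, f != 0 & forall v, pairing f v = 0 -> g *m v = v).

Definition is_word_length A g (k : nat) : Prop :=
  exists s : seq 'M[R]_n, [/\ forall x, x \in s -> A x, size s = k
    & \big[mulmx/1%:M]_(x <- s) x = g].

Definition word_length A g : nat :=
  xget 0%N [set k | is_word_length A g k /\
                    forall j, is_word_length A g j -> (k <= j)%N].

(* The length, with respect to the generators A, of the longest element of W;
   the default value 0 of [xget] is not used when W is finite. *)
Definition longest_length W A : nat :=
  xget 0%N [set k | (exists2 g, W g & word_length A g = k) /\
                    forall g, W g -> (word_length A g <= k)%N].

End Roots.

Section Coinvariants.
Variables (R : realType) (n : nat).
Implicit Types (g : 'M[R]_n) (W H : set 'M[R]_n) (p q : {mpoly R[n]}).

(* R[V] is the ring of polynomial functions on V, 'X_i being the i-th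
   coordinate, and (g . p)(v) = p (g^-1 v). *)
Definition poly_act g p : {mpoly R[n]} :=
  p \mPo [tuple \sum_(j < n) invmx g i j *: 'X_j | i < n].

Definition invariant_poly W p : Prop := forall g, W g -> poly_act g p = p.

Definition in_coinvariant_ideal W p : Prop :=
  exists2 s : seq ({mpoly R[n]} * {mpoly R[n]}),
    forall x, x \in s -> invariant_poly W x.2 /\ x.2@_0%MM = 0
  & p = \sum_(x <- s) x.1 * x.2.

Definition coinvariant_ideal W : {mpoly R[n]} -> bool :=
  fun p => `[< in_coinvariant_ideal W p >].

Lemma coinvariant_idealP W : idealr_closed (coinvariant_ideal W).
Proof.
split.
- by apply/asboolP; exists [::] => //; rewrite big_nil.
- apply/negP => /asboolP[s Hs /(congr1 (mcoeff 0%MM))].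
  rewrite mcoeff1 eqxx raddf_sum big_seq big1 /= => [/eqP|x /Hs[_ x0]].
    by rewrite oner_eq0.
  by rewrite rmorphM /= x0 mulr0.
- move=> a u v /asboolP[s Hs ->] /asboolP[t Ht ->]; apply/asboolP.
  exists ([seq (a * x.1, x.2) | x <- s] ++ t) => [x|].
    by rewrite mem_cat => /orP[/mapP[y /Hs ? ->]|/Ht].
  rewrite big_cat big_map mulr_sumr /=; congr (_ + _).
  by apply: eq_bigr => x _; rewrite mulrA.
Qed.

HB.instance Definition _ W :=
  isIdealr.Build {mpoly R[n]} (coinvariant_ideal W) (coinvariant_idealP W).

Definition coinvariant_idealr W : idealr {mpoly R[n]} := coinvariant_ideal W.

Definition coinvariant_ring W : comNzRingType :=
  {ideal_quot (coinvariant_idealr W)}.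

Definition coinvariant_pi W p : coinvariant_ring W :=
  \pi_{ideal_quot (coinvariant_idealr W)} p.

Definition coinvariant_act W g (x : coinvariant_ring W) : coinvariant_ring W :=
  coinvariant_pi W
    (poly_act g (repr (x : {ideal_quot (coinvariant_idealr W)}))).

(* For g in W this is the action induced on the quotient. *)
Lemma coinvariant_act_pi W g p : W g ->
  coinvariant_act g (coinvariant_pi W p) = coinvariant_pi W (poly_act g p).
Proof.
move=> Wg; apply/eqP; rewrite /coinvariant_act /coinvariant_pi.
rewrite -Quotient.idealrBE; set q := repr _.
have /asboolP[s Hs Es] : coinvariant_ideal W (q - p).
  have : q - p \in coinvariant_ideal W by rewrite Quotient.idealrBE reprK.
  by [].
apply/asboolP; exists [seq (poly_act g x.1, x.2) | x <- s] => [x|].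
  by case/mapP => y /Hs ? ->.
rewrite /poly_act -rmorphB Es rmorph_sum big_map big_seq [RHS]big_seq /=.
apply: eq_bigr => x /Hs[/(_ g Wg) xg _]; rewrite rmorphM /=; congr (_ * _).
exact: xg.
Qed.

Definition coinvariant_degree W (d : nat) : set (coinvariant_ring W) :=
  [set coinvariant_pi W p | p in [set p | p \is d.-homog]].

(* The degree d component of the subring of H-invariants of the coinvariant
   ring of W *)
Definition coinvariant_inv W H (d : nat) : set (coinvariant_ring W) :=
  @coinvariant_degree W d `&` [set x | forall g, H g -> coinvariant_act g x = x].

End Coinvariants.

Arguments coinvariant_degree {R n} W d _.
Arguments coinvariant_inv {R n} W H d _.

(* The graded ring is the direct sum of the subsets A 0, ..., A r of an ambient
   commutative ring T. *)
Definition strong_lefschetz (T : comNzRingType) (A : nat -> set T) (r : nat)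
    (l : T) : Prop :=
  A 1%N l /\
  forall i : nat, (i <= r./2)%N ->
    set_bij (A i) (A (r - i)%N) (fun f : T => l ^+ (r - 2 * i) * f).

(* Main.v *)
Require Import Defs.
From HB Require Import structures.
From mathcomp Require Import all_boot all_order all_algebra.
From mathcomp Require Import mpoly.
From mathcomp Require Import boolp classical_sets functions reals.
From mathcomp Require Import polyrcf.
From mathcomp Require Import ring lra zify.

(** Let S = R[V], let A be the algebra of W_S-invariants of S and let the linear form
lambda represent l.  The Lefschetz property is obtained from Hodge theory for
Bott-Samelson bimodules, in the style of Elias and Williamson.  For a word s_1 ... s_k
of reflections, consider S (x) S (x) ... (x) S, tensored over the invariants of s_1,
..., s_k, as an (A, S)-bimodule, reduced to R on the right, with its intersection form
and with the left multiplication by lambda as Lefschetz operator.  By induction on the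
length, the simple summands D that are reached by adding one letter at a time satisfy
hard Lefschetz and the Hodge-Riemann relations: if t is a new letter and w a word for
D, the operator on the extension of D by t is deformed to L + zeta N with zeta >= 0,
which for large zeta is the operator of a product with a projective line, and the
signatures cannot change as long as hard Lefschetz holds.  When lambda (w a_t) > 0,
hard Lefschetz for all zeta follows from the Hodge-Riemann relations of shorter
summands and from a formula which writes lambda on D as a positive combination of
squares plus the scalar w^-1 lambda on the right.  Otherwise D is a summand for a word
that ends in t, by Matsumoto's theorem and a computation in rank two, and the
extension of D by t is merely a sum of two copies of D.

Replacing the base by a conjugate we may assume that lambda is dominant; the hypothesis
on l says that A is fixed by the simple reflections which fix lambda, which is what the
last case needs when lambda (w a_t) = 0.  Now let r = m - m_S, and let f in A_r and a
word u of length r be such that the divided difference of f along u is not 0.  The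
summand for u that contains the bottom vector v, with f v <> 0, satisfies hard
Lefschetz.  If lambda^(r - 2i) p lies in the coinvariant ideal J then p v = 0, hence
p q v = 0 and p q is in J for all q in A_(r-i), as f spans A_r modulo J; so p is in J
by Poincare duality, which is proved with the antisymmetrizer of W.  This gives
injectivity, and surjectivity follows from the duality.

Conversely, if a reflection outside W_S fixes lambda, then antisymmetrizing the product
Delta_S of the positive coroots of W_S over the stabilizer of lambda gives 0, as the
result is divisible by more linear forms than its degree.  Hence the antisymmetrization
of lambda^r Delta_S is 0, that is l^r = 0. *)

Set Implicit Arguments.
Unset Strict Implicit.
Unset Printing Implicit Defensive.

Import Order.TTheory GRing.Theory Num.Theory.
Local Open Scope ring_scope.

(** * Polynomial functions and divided differences *)

Section LinearForms.
Variables (R : realType) (n : nat).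
Implicit Types (f u : 'rV[R]_n) (g h : 'M[R]_n) (p q : {mpoly R[n]}).

(** Its part is taken by hard Lefschetz itself: between objects whose reductions satisfy it, a map
    of negative centred degree is 0 ([bhom_neg]) and a map of centred degree 0 is determined by its
    reduction ([ev_lift]). With the Hodge-Riemann relations, a simple object then splits off along
    every nonzero map of centred degree 0 ([simple_split]), which replaces the local endomorphism
    rings of Krull-Schmidt arguments. The price is that summands can be compared only once the
    relations are known for them, so everything is an induction along [chain]. The left action is
    restricted to [A] because of forms on walls: if lambda vanishes on a_i, then S (x) S over the
    s_i-invariants is indecomposable as an (S, S)-bimodule but violates hard Lefschetz, whereas over
    the s_i-invariant ring [A] it is a sum of two copies of S. Braid moves, on the contrary, take
    place in the middle of words and have to be made over all of S. *)

Lemma mpoly_ring_ind (P : {mpoly R[n]} -> Prop) :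
  (forall c, P c%:MP) -> (forall i, P 'X_i) ->
  (forall p q, P p -> P q -> P (p + q)) ->
  (forall p q, P p -> P q -> P (p * q)) -> forall p, P p.
Proof.
move=> PC PX PD PrM p; rewrite [p]mpolyE.
apply: (big_ind P) => [||m _]; [by rewrite -mpolyC0; apply: PC | exact: PD |].
rewrite -mul_mpolyC; apply: (PrM) => //; rewrite mpolyXE_id.
apply: (big_ind P) => [||i _]; [by rewrite -mpolyC1; apply: PC | exact: PrM |].
elim: (m i) => [|k IH]; first by rewrite expr0 -mpolyC1; apply: PC.
by rewrite exprS; apply: (PrM).
Qed.

Lemma homog_ind (P : nat -> {mpoly R[n]} -> Prop) :
  (forall d, P d 0) -> P 0%N 1 ->
  (forall d c p, P d p -> P d (c *: p)) ->
  (forall d p q, P d p -> P d q -> P d (p + q)) ->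
  (forall d p i, P d p -> P d.+1 ('X_i * p)) ->
  forall d p, p \is d.-homog -> P d p.
Proof.
move=> P0 P1 PZ PD PX.
have PM k m : mdeg m = k -> P k 'X_[m].
  elim: k m => [|k IH] m Em.
    by move/eqP: Em; rewrite mdeg_eq0 => /eqP ->; rewrite mpolyX0.
  have [i mi] : exists i, m i != 0%N.
    case: (pickP (fun i => m i != 0%N)) => [i|m0]; first by exists i.
    by move: Em; rewrite mdegE big1 // => i _; have /negbFE/eqP := m0 i.
  have lem : (U_(i) <= m)%MM by rewrite lep1mP.
  have -> : m = (U_(i) + (m - U_(i)))%MM by rewrite addmC submK.
  rewrite mpolyXD; apply/PX/IH.
  have := mdegD U_(i) (m - U_(i)); rewrite addmC submK // Em mdeg1; lia.
move=> d p hp; rewrite [p]mpolyE big_seq.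
apply: (big_ind (P d)) => [||m /(dhomog_mf hp) Em]; [exact: P0|exact: PD|].
by apply/PZ/PM.
Qed.

Definition mlin f : {mpoly R[n]} := \sum_(j < n) f 0 j *: 'X_j.

Fact mlin_is_linear : linear mlin.
Proof.
move=> c f u; rewrite /mlin scaler_sumr -big_split /=; apply: eq_bigr => j _.
by rewrite !mxE scalerDl scalerA.
Qed.
HB.instance Definition _ := GRing.isLinear.Build R _ _ _ mlin mlin_is_linear.

Lemma mmcoeff_lin f j : (mlin f)@_U_(j) = f 0 j.
Proof.
rewrite /mlin raddf_sum /= (bigD1 j) //= mcoeffZ mcoeffXU eqxx mulr1.
rewrite big1 ?addr0 // => i ne; rewrite mcoeffZ mcoeffXU.
by rewrite (negbTE ne) mulr0.
Qed.

Lemma mlin_inj : injective mlin.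
Proof. by move=> f u E; apply/rowP => j; rewrite -!mmcoeff_lin E. Qed.

Lemma mlin_eq0 f : (mlin f == 0) = (f == 0).
Proof. by rewrite -(inj_eq mlin_inj) linear0. Qed.

Lemma mlin_homog f : mlin f \is 1.-homog.
Proof.
by rewrite /mlin; apply: rpred_sum => j _; apply: dhomogZ; rewrite dhomogX /= mdeg1.
Qed.

Definition mev p : R := p@_0%MM.

HB.instance Definition _ := GRing.RMorphism.copy mev (mcoeff 0%MM).
HB.instance Definition _ :=
  GRing.isScalable.Build R {mpoly R[n]} R _ mev (fun c p => mcoeffZ c p 0%MM).

Lemma mev_homog d p : p \is d.-homog -> (0 < d)%N -> mev p = 0.
Proof. by move=> hp d0; apply: (dhomog_nemf_coeff hp); rewrite /= mdeg0; lia. Qed.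

Lemma mev_lin f : mev (mlin f) = 0.
Proof. exact: mev_homog (mlin_homog f) _. Qed.

Lemma homog0E p : p \is 0.-homog -> p = (mev p)%:MP.
Proof.
move=> hp; apply/mpolyP => m; rewrite mcoeffC.
have [->|nm] := eqVneq; first by rewrite mulr1.
by rewrite mulr0; apply: (dhomog_nemf_coeff hp); rewrite /= mdeg_eq0.
Qed.

(** Composition of a polynomial function with [g], hence a right action ([subM]); inverses enter
    only through [poly_actE]. *)
Definition sub g p : {mpoly R[n]} := p \mPo [tuple mlin (row i g) | i < n].

HB.instance Definition _ g :=
  GRing.RMorphism.copy (sub g) (comp_mpoly [tuple mlin (row i g) | i < n]).
HB.instance Definition _ g :=
  GRing.isScalable.Build R {mpoly R[n]} {mpoly R[n]} _ (sub g)
    (comp_mpoly_is_linear [tuple mlin (row i g) | i < n]).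

Lemma subX g i : sub g 'X_i = mlin (row i g).
Proof. by rewrite /sub comp_mpolyXU -tnth_nth tnth_mktuple. Qed.

Lemma subC g c : sub g c%:MP = c%:MP.
Proof. exact: comp_mpolyC. Qed.

Lemma msub_lin g f : sub g (mlin f) = mlin (f *m g).
Proof.
rewrite {1}/mlin raddf_sum /= [f *m g]mulmx_sum_row linear_sum /=.
by apply: eq_bigr => j _; rewrite linearZ /= subX linearZ.
Qed.

Lemma linX i : 'X_i = mlin (delta_mx 0 i).
Proof.
rewrite /mlin (bigD1 i) //= mxE !eqxx scale1r big1 ?addr0 // => j ne.
by rewrite mxE (negbTE ne) andbF scale0r.
Qed.

Lemma subM g h p : sub (g *m h) p = sub h (sub g p).
Proof.
elim/mpoly_ring_ind: p => [c|i|p q IHp IHq|p q IHp IHq].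
- by rewrite !subC.
- by rewrite linX !msub_lin mulmxA.
- by rewrite !raddfD /= IHp IHq.
- by rewrite !rmorphM /= IHp IHq.
Qed.

Lemma sub1 p : sub 1%:M p = p.
Proof.
elim/mpoly_ring_ind: p => [c|i|p q IHp IHq|p q IHp IHq].
- by rewrite !subC.
- by rewrite linX !msub_lin mulmx1.
- by rewrite !raddfD /= IHp IHq.
- by rewrite !rmorphM /= IHp IHq.
Qed.

Lemma sub_homog g d p : p \is d.-homog -> sub g p \is d.-homog.
Proof.
move: d p; apply: (homog_ind (P := fun d p => sub g p \is d.-homog)).
- by move=> d; rewrite raddf0 dhomog0.
- by rewrite rmorph1 dhomog1.
- by move=> d c p hp; rewrite linearZ /= dhomogZ.
- by move=> d p q hp hq; rewrite raddfD /= dhomogD.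
- by move=> d p i hp; rewrite rmorphM /= subX -add1n dhomogM ?mlin_homog.
Qed.

Lemma poly_actE g p : poly_act g p = sub (invmx g) p.
Proof.
rewrite /poly_act /sub; congr (_ \mPo _); apply: eq_from_tnth => i.
by rewrite !tnth_mktuple /mlin; apply: eq_bigr => j _; rewrite mxE.
Qed.

Lemma pairingE f (a : 'cV[R]_n) : f *m a = (pairing f a)%:M.
Proof. by rewrite [LHS]mx11_scalar. Qed.

Lemma pairingDl f u (a : 'cV[R]_n) : pairing (f + u) a = pairing f a + pairing u a.
Proof. by rewrite /pairing mulmxDl mxE. Qed.
Lemma pairingNl f (a : 'cV[R]_n) : pairing (- f) a = - pairing f a.
Proof. by rewrite /pairing mulNmx mxE. Qed.
Lemma pairingZl c f (a : 'cV[R]_n) : pairing (c *: f) a = c * pairing f a.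
Proof. by rewrite /pairing -scalemxAl mxE. Qed.
Lemma pairingDr f (a b : 'cV[R]_n) : pairing f (a + b) = pairing f a + pairing f b.
Proof. by rewrite /pairing mulmxDr mxE. Qed.
Lemma pairingNr f (a : 'cV[R]_n) : pairing f (- a) = - pairing f a.
Proof. by rewrite /pairing mulmxN mxE. Qed.
Lemma pairingZr c f (a : 'cV[R]_n) : pairing f (c *: a) = c * pairing f a.
Proof. by rewrite /pairing -scalemxAr mxE. Qed.
Lemma pairing_mul f g (a : 'cV[R]_n) : pairing (f *m g) a = pairing f (g *m a).
Proof. by rewrite /pairing mulmxA. Qed.

Lemma mul_reflection u f (a : 'cV[R]_n) :
  u *m reflection a f = u - pairing u a *: f.
Proof. by rewrite /reflection mulmxBr mulmx1 mulmxA pairingE mul_scalar_mx. Qed.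

Lemma reflection_mul (a b : 'cV[R]_n) f :
  reflection a f *m b = b - pairing f b *: a.
Proof. by rewrite /reflection mulmxBl mul1mx -mulmxA pairingE mul_mx_scalar. Qed.

End LinearForms.

(** A reflection with a chosen root and coroot, outside any root system: bimodules of words need no
    more, and positivity of roots enters only through the sign of a linear form. *)
Record letter (R : realType) (n : nat) := Letter {
  lroot : 'cV[R]_n;
  lform : 'rV[R]_n;
  letterP : pairing lform lroot = 2 }.

(** Keeping the ring of polynomial functions abstract prevents unification from unfolding
multivariate polynomials.  In [phom_coef], [phi] is the coefficient of a monomial of [p]. *)
Record polyring (R : realType) (n : nat) := PolyRing {
  psort :> idomainType;
  pC : {rmorphism R -> psort};
  ev : {rmorphism psort -> R};
  lin : {additive 'rV[R]_n -> psort};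
  act : 'M[R]_n -> {rmorphism psort -> psort};
  phom : nat -> psort -> bool;
  evC : forall c, ev (pC c) = c;
  ev_lin : forall u, ev (lin u) = 0;
  linZ : forall c u, lin (c *: u) = pC c * lin u;
  lin_inj : injective lin;
  act_lin : forall g u, act g (lin u) = lin (u *m g);
  actC : forall g c, act g (pC c) = pC c;
  actM : forall g h p, act (g *m h) p = act h (act g p);
  act1 : forall p, act 1%:M p = p;
  polyring_ind : forall P : psort -> Prop,
    (forall c, P (pC c)) -> (forall u, P (lin u)) ->
    (forall p q, P p -> P q -> P (p + q)) ->
    (forall p q, P p -> P q -> P (p * q)) -> forall p, P p;
  phom0 : forall d, phom d 0;
  phomC : forall c, phom 0 (pC c);
  phom_lin : forall u, phom 1 (lin u);
  phomD : forall d p q, phom d p -> phom d q -> phom d (p + q);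
  phomM : forall d e p q, phom d p -> phom e q -> phom (d + e) (p * q);
  phom_act : forall g d p, phom d p -> phom d (act g p);
  phom_ev : forall d p, phom d p -> (0 < d)%N -> ev p = 0;
  phom0C : forall p, phom 0 p -> p = pC (ev p);
  phom_linK : forall d u p, u != 0 -> phom d.+1 (lin u * p) -> phom d p;
  phom_ind : forall P : nat -> psort -> Prop,
    (forall d, P d 0) -> P 0%N 1 ->
    (forall d c p, P d p -> P d (pC c * p)) ->
    (forall d p q, P d p -> P d q -> P d (p + q)) ->
    (forall d p u, P d p -> P d.+1 (lin u * p)) ->
    forall d p, phom d p -> P d p;
  phom_coef : forall d p, phom d p -> p != 0 ->
    exists2 phi : {additive psort -> R}, phi p != 0 &
      forall e q r, (d <= e)%N -> phom e r -> phi (q * r) = ev q * phi r }.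

Arguments pC {R n _}.
Arguments ev {R n _}.
Arguments act {R n _} _.
Arguments phom {R n _} _ _.
Arguments lin {R n} _.
Arguments evC {R n} _ _.

Section Demazure.
Variables (R : realType) (n : nat) (S : polyring R n).
Implicit Types (s : letter R n) (p q : S) (u : 'rV[R]_n).
Notation lin := (lin S).

Definition lrefl s := reflection (lroot s) (lform s).
Definition lact s : S -> S := act (lrefl s).

HB.instance Definition _ s := GRing.RMorphism.copy (lact s) (act (lrefl s)).

Lemma lreflK s : lrefl s *m lrefl s = 1%:M.
Proof.
rewrite {2}/lrefl /reflection mulmxBr mulmx1 mulmxA reflection_mul letterP.
rewrite scaler_nat mulr2n opprD addrA subrr add0r mulNmx opprK.
by rewrite /lrefl /reflection subrK.
Qed.

Lemma lform_neq0 s : lform s != 0.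
Proof.
apply/eqP => f0; have /eqP := letterP s.
by rewrite f0 /pairing mul0mx mxE eq_sym pnatr_eq0.
Qed.

Lemma lactK s p : lact s (lact s p) = p.
Proof. by rewrite /lact -actM lreflK act1. Qed.

Lemma lact_lin s u :
  lact s (lin u) = lin u - pC (pairing u (lroot s)) * lin (lform s).
Proof. by rewrite /lact act_lin mul_reflection raddfB /= linZ. Qed.

Lemma lactC s c : lact s (pC c) = pC c.
Proof. exact: actC. Qed.

Lemma linf_neq0 s : lin (lform s) != 0.
Proof. by rewrite -(raddf0 lin) (inj_eq (@lin_inj _ _ S)) lform_neq0. Qed.

Lemma dem_exists s p : exists q, p - lact s p = lin (lform s) * q.
Proof.
elim/polyring_ind: p => [c|u|p q [p' Ep] [q' Eq]|p q [p' Ep] [q' Eq]].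
- by exists 0; rewrite lactC subrr mulr0.
- exists (pC (pairing u (lroot s))).
  by rewrite lact_lin opprB addrC subrK mulrC.
- by exists (p' + q'); rewrite mulrDr -Ep -Eq raddfD /=; ring.
- exists (p' * q + lact s p * q').
  have -> : lin (lform s) * (p' * q + lact s p * q') =
    (lin (lform s) * p') * q + lact s p * (lin (lform s) * q') by ring.
  by rewrite -Ep -Eq rmorphM /=; ring.
Qed.

(** The divided difference (Demazure operator). Choosing a quotient is harmless because S is a
    domain ([dem_uniq]). *)
Definition dem s p : S := sval (cid (dem_exists s p)).

Lemma demP s p : lin (lform s) * dem s p = p - lact s p.
Proof. by rewrite /dem; case: cid. Qed.

Lemma dem_uniq s p q : lin (lform s) * q = p - lact s p -> dem s p = q.
Proof. by rewrite -demP => /(mulfI (linf_neq0 s)). Qed.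

Fact dem_is_additive s : additive (dem s).
Proof.
move=> p q; apply: dem_uniq; rewrite mulrBr !demP raddfB /=; ring.
Qed.
HB.instance Definition _ s := GRing.isAdditive.Build S S (dem s) (dem_is_additive s).

Definition avg s p : S := pC 2^-1 * (p + lact s p).

Fact avg_is_additive s : additive (avg s).
Proof. by move=> p q; rewrite /avg -mulrBr raddfB /=; congr (_ * _); ring. Qed.
HB.instance Definition _ s := GRing.isAdditive.Build S S (avg s) (avg_is_additive s).

(** The factor 1/2 makes [avg s p] and [dem s p] the coordinates of p in the basis 1, [hform s] of S
    over the s-invariants. Products in these coordinates ([demM], [avgM]) are those of a quadratic
    extension in which the generator has square [qform s]. *)
Definition hform s : S := pC 2^-1 * lin (lform s).
Definition qform s : S := hform s * hform s.

Lemma pC_half2 : pC 2^-1 * 2 = 1 :> S.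
Proof. by rewrite -(rmorph_nat (@pC _ _ S)) -rmorphM mulVf ?rmorph1 // pnatr_eq0. Qed.

Lemma lact_lform s : lact s (lin (lform s)) = - lin (lform s).
Proof. by rewrite lact_lin letterP rmorph_nat; ring. Qed.

Lemma lact_hform s : lact s (hform s) = - hform s.
Proof. by rewrite /hform rmorphM /= lactC lact_lform mulrN. Qed.

Lemma hform2 s : hform s + hform s = lin (lform s).
Proof. by rewrite /hform -[RHS]mul1r -pC_half2; ring. Qed.

Lemma lact_dem s p : lact s (dem s p) = dem s p.
Proof.
apply: (mulfI (linf_neq0 s)); rewrite demP.
have: lact s (lin (lform s) * dem s p) = lact s (p - lact s p) by rewrite demP.
rewrite rmorphM /= raddfB /= lactK lact_lform mulNr.
by move/eqP; rewrite eqr_oppLR opprB => /eqP.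
Qed.

Lemma lact_avg s p : lact s (avg s p) = avg s p.
Proof. by rewrite /avg rmorphM raddfD /= lactC lactK addrC. Qed.

Lemma avg_dem s p : p = avg s p + hform s * dem s p.
Proof.
by rewrite /hform -mulrA demP /avg -[LHS]mul1r -pC_half2; ring.
Qed.

Lemma dem_inv s p : lact s p = p -> dem s p = 0.
Proof. by move=> Ep; apply: dem_uniq; rewrite Ep subrr mulr0. Qed.

Lemma avg_inv s p : lact s p = p -> avg s p = p.
Proof. by move=> Ep; rewrite {2}[p](avg_dem s) dem_inv // mulr0 addr0. Qed.

Lemma lact_avg_dem s p : lact s p = avg s p - hform s * dem s p.
Proof.
by rewrite {1}[p](avg_dem s) rmorphD rmorphM /= lact_dem lact_avg lact_hform mulNr.
Qed.

Lemma demM s p q : dem s (p * q) = dem s p * avg s q + avg s p * dem s q.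
Proof.
apply: dem_uniq; rewrite rmorphM /= !lact_avg_dem -hform2.
rewrite [X in _ = X * _ - _](avg_dem s) [X in _ = _ * X - _](avg_dem s); ring.
Qed.

Lemma avgM s p q : avg s (p * q) = avg s p * avg s q + qform s * (dem s p * dem s q).
Proof.
rewrite {1}/avg rmorphM /= !lact_avg_dem /qform.
rewrite [X in _ * (X * _ + _) = _](avg_dem s) [X in _ * (_ * X + _) = _](avg_dem s).
rewrite -[RHS]mul1r -pC_half2; ring.
Qed.

Lemma dem_lin s u : dem s (lin u) = pC (pairing u (lroot s)).
Proof. by apply: dem_uniq; rewrite lact_lin opprB addrC subrK mulrC. Qed.

Lemma demC s c : dem s (pC c) = 0.
Proof. by apply: dem_inv; rewrite lactC. Qed.

Lemma avgC s c : avg s (pC c) = pC c.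
Proof. by apply: avg_inv; rewrite lactC. Qed.

Lemma dem1 s : dem s 1 = 0. Proof. by rewrite -(rmorph1 pC) demC. Qed.
Lemma avg1 s : avg s 1 = 1. Proof. by rewrite -(rmorph1 pC) avgC. Qed.

Lemma demCM s c p : dem s (pC c * p) = pC c * dem s p.
Proof. by rewrite demM demC avgC mul0r add0r. Qed.

Lemma phomCM c d p : phom d p -> phom d (pC c * p).
Proof. by move=> hp; rewrite -[d]add0n phomM ?phomC. Qed.

Lemma avg_homog s d p : phom d p -> phom d (avg s p).
Proof. by move=> hp; rewrite /avg phomCM // phomD // phom_act. Qed.

Lemma hform_homog s : phom 1 (hform s).
Proof. by rewrite /hform phomCM // phom_lin. Qed.

Lemma qform_homog s : phom 2 (qform s).
Proof. by rewrite /qform -[2%N]/(1 + 1)%N phomM // hform_homog. Qed.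

Lemma dem_homog s d p : phom d p ->
  phom d.-1 (dem s p) /\ (d = 0%N -> dem s p = 0).
Proof.
move=> hp; suff [_ []] : phom d p /\
  phom d.-1 (dem s p) /\ (d = 0%N -> dem s p = 0) by [].
move: d p hp; apply: (phom_ind (P := fun d p => phom d p /\
  phom d.-1 (dem s p) /\ (d = 0%N -> dem s p = 0))).
- by move=> d; rewrite raddf0 !phom0.
- by rewrite dem1 phom0 -(rmorph1 pC) phomC.
- move=> d c p [hp [h0 h1]]; rewrite demCM !phomCM //; do 2!split=> //.
  by move=> /h1 ->; exact: mulr0.
- move=> d p q [hp [h p0]] [hq [h' q0]]; rewrite raddfD /= !phomD //.
  by do 2!split=> //; move=> d0; rewrite p0 // q0 // addr0.
move=> d p u [hp [h0 h1]]; split; first by rewrite -add1n phomM // phom_lin.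
split=> //=; rewrite demM dem_lin.
apply: phomD; first by apply/phomCM/avg_homog.
case: d hp h0 h1 => [|d] hp h0 h1; first by rewrite h1 // mulr0 phom0.
by apply: (phomM (d := 1)); first exact/avg_homog/phom_lin.
Qed.

End Demazure.

Arguments lact {R n S} s p.
Arguments dem {R n S} s p.
Arguments avg {R n S} s p.
Arguments hform {R n S} s.
Arguments qform {R n S} s.

Section PolynomialRing.
Variables (R : realType) (n : nat).

(** [phi] is the coefficient of the leading monomial of p. If r has no monomial of degree below d,
    only the constant term of q contributes to a coefficient of degree d in q * r. *)
Lemma mpoly_coef d (p : {mpoly R[n]}) : p \is d.-homog -> p != 0 ->
  exists2 phi : {additive {mpoly R[n]} -> R}, phi p != 0 &
    forall e (q r : {mpoly R[n]}), (d <= e)%N -> r \is e.-homog ->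
      phi (q * r) = mev q * phi r.
Proof.
move=> hp p0; have hm := mlead_supp p0; set m := mlead p in hm.
have dm : mdeg m = d by apply: (dhomog_mf hp).
exists (mcoeff m : {additive {mpoly R[n]} -> R}).
  by rewrite /= mcoeff_eq0 negbK.
move=> e q r le_de hr /=.
pose ge (r : {mpoly R[n]}) := forall k, (mdeg k < d)%N -> r@_k = 0.
suff main : forall q r, ge r -> ge (q * r) /\ (q * r)@_m = mev q * r@_m.
  apply: (main q r _).2 => k hk; apply: (dhomog_nemf_coeff hr) => /=; lia.
move=> {hr le_de e} {}q; elim/mpoly_ring_ind: q => [c|i|a b IHa IHb|a b IHa IHb] {}r hr.
- rewrite mul_mpolyC mcoeffZ /mev mcoeffC eqxx mulr1; split=> // k /hr E.
  by rewrite mcoeffZ E mulr0.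
- have E k : (mdeg k <= d)%N -> ('X_i * r)@_k = 0.
    move=> hk; apply/eqP; rewrite mcoeff_eq0 mulrC (perm_mem (msuppMX _ _)).
    apply/negP => /mapP[k' hk' Ek]; move: hk; rewrite Ek mdegD mdeg1 => hk.
    by move: hk'; rewrite mcoeff_msupp hr ?eqxx //; lia.
  rewrite E ?dm // linX mev_lin mul0r; split=> // k hk; rewrite -linX E //; lia.
- rewrite mulrDl mcoeffD; have [ha ->] := IHa _ hr; have [hb ->] := IHb _ hr.
  by rewrite raddfD mulrDl; split=> // k hk; rewrite mcoeffD ha // hb // addr0.
- rewrite -mulrA; have [hb Eb] := IHb _ hr; have [ha ->] := IHa _ hb.
  by split=> //; rewrite Eb rmorphM mulrA.
Qed.

(** The component of degree d + 1 of the product is the form times the component of degree d of p,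
    and S is a domain. *)
Lemma mlin_homogK d (u : 'rV[R]_n) p :
  u != 0 -> mlin u * p \is d.+1.-homog -> p \is d.-homog.
Proof.
move=> u0 h; have E : pihomog mdeg d.+1 (mlin u * p) = mlin u * pihomog mdeg d p.
  pose k := maxn (mmeasure mdeg p) d.+1.
  have lk : (mmeasure mdeg p <= k)%N by exact: leq_maxl.
  rewrite {1}(pihomog_partitionE lk) mulr_sumr raddf_sum /=.
  have dk : (d < k)%N by exact: leq_maxr.
  have hM j : mlin u * pihomog mdeg j p \is j.+1.-homog.
    by rewrite -add1n dhomogM ?mlin_homog ?pihomogP.
  rewrite (bigD1 (Ordinal dk)) //= pihomog_dE // big1 ?addr0 // => j ne.
  apply: (pihomog_ne0 _ (hM j)); rewrite eqSS.
  by apply: contraNneq ne => E; apply/eqP/val_inj.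
rewrite homog_piE; apply/eqP; rewrite (pihomog_dE h) in E.
by apply: (mulfI _ (esym E)); rewrite mlin_eq0.
Qed.

Fact mdhomogC c : (c%:MP : {mpoly R[n]}) \is 0.-homog.
Proof. by rewrite -[c%:MP]mulr1 mul_mpolyC dhomogZ // dhomog1. Qed.

Fact mlinZ c (u : 'rV[R]_n) : mlin (c *: u) = c%:MP * mlin u.
Proof.
rewrite mul_mpolyC /mlin scaler_sumr.
by apply: eq_bigr => j _; rewrite mxE scalerA.
Qed.

(** Kept transparent, so that at the end its carrier converts to the polynomials of the
    statement. *)
Definition mpoly_polyring : polyring R n.
Proof.
refine (@PolyRing R n {mpoly R[n]} (@mpolyC n R) (@mev R n) (@mlin R n)
  (@sub R n) (fun d p => p \is d.-homog) _ (@mev_lin R n) _ (@mlin_inj R n)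
  (@msub_lin R n) (@subC R n) (@subM R n) (@sub1 R n) _ (@dhomog0 n R mdeg)
  mdhomogC (@mlin_homog R n) _ _ (@sub_homog R n) _ _ mlin_homogK _ _).
- by move=> c; have := @mcoeffC n R c 0%MM; rewrite eqxx mulr1.
- exact: mlinZ.
- move=> P PC PL PD PM p; elim/mpoly_ring_ind: p => //.
  by move=> i; rewrite linX; apply: PL.
- by move=> d p q; apply: dhomogD.
- by move=> d e p q; apply: dhomogM.
- by move=> d p; apply: mev_homog.
- by move=> p; apply: homog0E.
- move=> P P0 P1 PZ PD PL; apply: homog_ind => //.
    by move=> d c p hp; rewrite -mul_mpolyC; apply: PZ.
  by move=> d p i; rewrite linX; apply: PL.
- exact: mpoly_coef.
Defined.

End PolynomialRing.

(** * Bott-Samelson bimodules *)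

Section Graded.
Variables (R : realType) (n : nat) (S : polyring R n).
Notation lin := (lin S).

(** Entries of graded maps have degrees which are differences of degrees of basis vectors; an entry
    of negative degree has to vanish. *)
Definition ihomog (z : int) (p : S) : bool :=
  if z is Posz d then phom d p else p == 0.

Lemma ihomog0 z : ihomog z 0.
Proof. by case: z => d //=; apply: phom0. Qed.

Lemma ihomogD z p q : ihomog z p -> ihomog z q -> ihomog z (p + q).
Proof.
case: z => d /=; first exact: phomD.
by move=> /eqP -> /eqP ->; rewrite addr0.
Qed.

Lemma ihomogN z p : ihomog z p -> ihomog z (- p).
Proof. case: z => d /=; last by rewrite oppr_eq0.
by move=> /(phomCM (- 1)); rewrite rmorphN1 mulN1r. Qed.

Lemma ihomogB z p q : ihomog z p -> ihomog z q -> ihomog z (p - q).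
Proof. by move=> hp hq; apply: ihomogD => //; apply: ihomogN. Qed.

Lemma ihomogZ z c p : ihomog z p -> ihomog z (pC c * p).
Proof.
case: z => d /=; first exact: phomCM.
by move/eqP ->; rewrite mulr0.
Qed.

Lemma ihomogM z1 z2 p q : ihomog z1 p -> ihomog z2 q -> ihomog (z1 + z2) (p * q).
Proof.
have [->|p0] := eqVneq p 0; first by rewrite mul0r => *; apply: ihomog0.
have [->|q0] := eqVneq q 0; first by rewrite mulr0 => *; apply: ihomog0.
case: z1 => d1 /=; last by rewrite (negbTE p0).
case: z2 => d2 /=; last by rewrite (negbTE q0).
exact: phomM.
Qed.

Lemma ihomog_sum z (I : Type) (r : seq I) (P : pred I) (F : I -> S) :
  (forall i, P i -> ihomog z (F i)) -> ihomog z (\sum_(i <- r | P i) F i).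
Proof.
by move=> h; apply: (big_ind (ihomog z)) => //; [exact: ihomog0|exact: ihomogD].
Qed.

Lemma ihomogC c : ihomog 0 (pC c).
Proof. exact: phomC. Qed.

Lemma ihomog_avg s z p : ihomog z p -> ihomog z (avg s p).
Proof.
case: z => d /=; first exact: avg_homog.
by move/eqP ->; rewrite raddf0.
Qed.

Lemma ihomog_dem s z p : ihomog z p -> ihomog (z - 1) (dem s p).
Proof.
case: z => d /= h; last by rewrite (eqP h) raddf0.
have [h1 h0] := dem_homog s h.
case: d h h1 h0 => [|d] h h1 h0; first by rewrite h0 //; exact: ihomog0.
by rewrite -[d.+1]addn1 PoszD addrK.
Qed.

Lemma ihomog_ev z p : ihomog z p -> z != 0 -> ev p = 0.
Proof.
case: z => [d|d] /= hp z0; last by rewrite (eqP hp) raddf0.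
by apply: (phom_ev hp); lia.
Qed.

Lemma ihomog_le0 z p : ihomog z p -> z <= 0 -> p = pC (ev p).
Proof.
case: z => [[|d]|d] //= hp; first by move=> _; apply: phom0C.
by rewrite (eqP hp) !raddf0.
Qed.

Definition homm d d' (g : 'I_d -> nat) (g' : 'I_d' -> nat) (D : int)
  (f : 'M[S]_(d', d)) :=
  forall i j, ihomog ((g j)%:Z + D - (g' i)%:Z) (f i j).

Section Homm.
Variables (d d' : nat) (g : 'I_d -> nat) (g' : 'I_d' -> nat).

Lemma homm0 D : homm g g' D 0.
Proof. by move=> i j; rewrite mxE ihomog0. Qed.

Lemma hommD D f1 f2 : homm g g' D f1 -> homm g g' D f2 -> homm g g' D (f1 + f2).
Proof. by move=> h1 h2 i j; rewrite mxE ihomogD. Qed.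

Lemma hommN D f : homm g g' D f -> homm g g' D (- f).
Proof. by move=> h i j; rewrite mxE ihomogN. Qed.

Lemma hommB D f1 f2 : homm g g' D f1 -> homm g g' D f2 -> homm g g' D (f1 - f2).
Proof. by move=> h1 h2; apply: hommD => //; apply: hommN. Qed.

Lemma hommZ D c f : homm g g' D f -> homm g g' D ((pC c) *: f).
Proof. by move=> h i j; rewrite mxE ihomogZ. Qed.

Lemma homm_sum D (I : Type) (r : seq I) (P : pred I) (F : I -> 'M[S]_(d', d)) :
  (forall i, P i -> homm g g' D (F i)) -> homm g g' D (\sum_(i <- r | P i) F i).
Proof.
by move=> h; apply: (big_ind (homm g g' D)) => //; [exact: homm0|exact: hommD].
Qed.

End Homm.

Lemma hommM d1 d2 d3 (g1 : 'I_d1 -> nat) (g2 : 'I_d2 -> nat) (g3 : 'I_d3 -> nat)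
  D D' (f : 'M[S]_(d3, d2)) (f' : 'M[S]_(d2, d1)) :
  homm g2 g3 D f -> homm g1 g2 D' f' -> homm g1 g3 (D + D') (f *m f').
Proof.
move=> h h' i j; rewrite mxE; apply: ihomog_sum => k _.
rewrite (_ : _ - _ = ((g2 k)%:Z + D - (g3 i)%:Z) + ((g1 j)%:Z + D' - (g2 k)%:Z)).
  exact: ihomogM.
by ring.
Qed.

Lemma homm1 d (g : 'I_d -> nat) : homm g g 0 1%:M.
Proof.
move=> i j; rewrite mxE; have [->|_] := eqVneq; last by rewrite ihomog0.
by rewrite addr0 subrr -(rmorph1 pC) ihomogC.
Qed.

Lemma hommS d (g : 'I_d -> nat) z p : ihomog z p -> homm g g z p%:M.
Proof.
move=> hp i j; rewrite mxE; have [->|_] := eqVneq; last by rewrite ihomog0.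
by rewrite [_ + z]addrC addrK.
Qed.

End Graded.

Section Words.
Variables (R : realType) (n : nat) (S : polyring R n).
Notation lin := (lin S).
Implicit Types (s t : letter R n) (w : seq (letter R n)).

Lemma PoszS k : (k.+1)%:Z = k%:Z + 1.
Proof. by rewrite -addn1 PoszD. Qed.

Lemma map_mx_scalar d (D : {additive S -> S}) (p : S) :
  map_mx D (p%:M : 'M_d) = (D p)%:M.
Proof. by apply/matrixP => i j; rewrite !mxE raddfMn. Qed.

Definition evm d d' (f : 'M[S]_(d', d)) : 'M[R]_(d', d) := map_mx (@ev R n S) f.

(* The matrix of the tensor product of [f] and of the identity of S, over the invariants
   of [s]; S has the basis [1, hform s] over them and [f] = avg f + hform s * dem f. *)
Definition extm s d d' (f : 'M[S]_(d', d)) : 'M[S]_(d' + d', d + d) :=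
  block_mx (map_mx (avg s) f) (qform s *: map_mx (dem s) f)
           (map_mx (dem s) f) (map_mx (avg s) f).

Definition egr d (g : 'I_d -> nat) (i : 'I_(d + d)) : nat :=
  match fintype.split i with inl j => g j | inr j => (g j).+1 end.

(** If e_i is the basis of a module, its extension has the right basis e_i (x) 1, e_i [hform s] (x)
    1. Then [mlow] is the multiplication map back to the module and [mupp] is the action of
    [hform s] (x) 1 + 1 (x) [hform s]: the two dots of Soergel calculus, adjoint to each other
    ([adj_mlow]). *)
Definition mlow s d : 'M[S]_(d, d + d) := row_mx 1%:M (hform s : S)%:M.
Definition mupp s d : 'M[S]_(d + d, d) := col_mx (hform s : S)%:M 1%:M.

Lemma map_avgM s d1 d2 d3 (f : 'M[S]_(d3, d2)) (g : 'M[S]_(d2, d1)) :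
  map_mx (avg s) (f *m g) = map_mx (avg s) f *m map_mx (avg s) g
    + qform s *: (map_mx (dem s) f *m map_mx (dem s) g).
Proof.
apply/matrixP => i j; rewrite !mxE raddf_sum mulr_sumr -big_split /=.
by apply: eq_bigr => k _; rewrite !mxE avgM.
Qed.

Lemma map_demM s d1 d2 d3 (f : 'M[S]_(d3, d2)) (g : 'M[S]_(d2, d1)) :
  map_mx (dem s) (f *m g) = map_mx (dem s) f *m map_mx (avg s) g
    + map_mx (avg s) f *m map_mx (dem s) g.
Proof.
apply/matrixP => i j; rewrite !mxE raddf_sum -big_split /=.
by apply: eq_bigr => k _; rewrite !mxE demM.
Qed.

Lemma extmM s d1 d2 d3 (f : 'M[S]_(d3, d2)) (g : 'M[S]_(d2, d1)) :
  extm s (f *m g) = extm s f *m extm s g.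
Proof.
rewrite /extm mulmx_block map_avgM map_demM !scalerDr -!scalemxAl -!scalemxAr.
congr (block_mx _ _ _ _); exact: addrC.
Qed.

Lemma extmD s d d' (f g : 'M[S]_(d', d)) : extm s (f + g) = extm s f + extm s g.
Proof. by rewrite /extm add_block_mx !map_mxD scalerDr. Qed.

Fact extm_is_additive s d d' : additive (@extm s d d').
Proof.
by move=> f g; apply: (addIr (extm s g)); rewrite -extmD !subrK.
Qed.
HB.instance Definition _ s d d' := GRing.isAdditive.Build
  'M[S]_(d', d) 'M[S]_(d' + d', d + d) (@extm s d d') (@extm_is_additive s d d').

Lemma extm_scalar s d (p : S) : extm s (p%:M : 'M_d) =
  block_mx (avg s p)%:M (qform s * dem s p)%:M (dem s p)%:M (avg s p)%:M.
Proof.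
by rewrite /extm !map_mx_scalar scale_scalar_mx.
Qed.

Lemma extm1 s d : extm s (1%:M : 'M[S]_d) = 1%:M.
Proof. by rewrite extm_scalar dem1 avg1 mulr0 raddf0 scalar_mx_block. Qed.

Lemma extmZ s d d' p (f : 'M[S]_(d', d)) : lact s p = p ->
  extm s (p *: f) = p *: extm s f.
Proof.
move=> sp; rewrite -mul_scalar_mx extmM extm_scalar dem_inv // avg_inv // mulr0.
by rewrite !raddf0 -scalar_mx_block mul_scalar_mx.
Qed.

Lemma extmZC s d d' c (f : 'M[S]_(d', d)) : extm s ((pC c) *: f) = (pC c) *: extm s f.
Proof. by rewrite extmZ // lactC. Qed.

Lemma mlow_nat s d d' (f : 'M[S]_(d', d)) : mlow s d' *m extm s f = f *m mlow s d.
Proof.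
rewrite /mlow /extm mul_row_block !mul1mx mul_mx_row mulmx1 mul_scalar_mx.
rewrite mul_scalar_mx mul_mx_scalar; congr row_mx; apply/matrixP => i j; rewrite !mxE.
  by rewrite [in RHS](avg_dem s (f i j)).
by rewrite [in RHS](avg_dem s (f i j)) /qform; ring.
Qed.

Lemma mup_nat s d d' (f : 'M[S]_(d', d)) : extm s f *m mupp s d = mupp s d' *m f.
Proof.
rewrite /mupp /extm mul_block_col !mulmx1 mul_col_mx mul1mx mul_scalar_mx.
rewrite !mul_mx_scalar; congr col_mx; apply/matrixP => i j; rewrite !mxE.
  by rewrite [in RHS](avg_dem s (f i j)) /qform; ring.
by rewrite [in RHS](avg_dem s (f i j)) addrC.
Qed.

Lemma mlow_mup s d : mlow s d *m mupp s d = (lin (lform s))%:M.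
Proof.
by rewrite /mlow /mupp mul_row_col mul1mx mulmx1 -raddfD /= hform2.
Qed.

(** Moving a linear form past a tensor factor costs its pairing with the root, times the composite
    through the shorter word. The sign of this pairing governs the whole induction. *)
Lemma extm_lin s d u : extm s ((lin u)%:M : 'M_d) =
  (lact s (lin u))%:M + pC (pairing u (lroot s)) *: (mupp s d *m mlow s d).
Proof.
rewrite extm_scalar dem_lin /mupp /mlow mul_col_row !mulmx1 mul1mx -scalar_mxM.
rewrite -[lact s _](subrK (lin u)) -opprB -demP dem_lin scalar_mx_block.
rewrite scale_block_mx add_block_mx !add0r !scale_scalar_mx mulr1 -!raddfD /=.
have Ea : avg s (lin u) = lin u - hform s * dem s (lin u).
  by rewrite {2}[lin u](avg_dem s) addrK.
rewrite Ea dem_lin -hform2 /qform.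
by congr (block_mx _%:M _%:M _%:M _%:M); ring.
Qed.

(** [qform s] and [hform s] vanish at 0, so the reduction of an extension is block triangular; this
    shape is abstracted in [extH]. *)
Lemma evm_extm s d d' (f : 'M[S]_(d', d)) :
  evm (extm s f) = block_mx (evm f) 0 (evm (map_mx (dem s) f)) (evm f).
Proof.
have evq (p : S) : ev (qform s * p) = 0.
  by rewrite rmorphM /= (phom_ev (qform_homog S s)) ?mul0r.
have eva (p : S) : ev (avg s p) = ev p.
  rewrite {2}[p](avg_dem s) raddfD /= rmorphM /= (phom_ev (hform_homog S s)) //.
  by rewrite mul0r addr0.
rewrite /evm /extm map_block_mx; congr block_mx; apply/matrixP => i j.
- by rewrite !mxE eva.
- by rewrite !mxE evq.
- by rewrite !mxE eva.
Qed.

Lemma evmM d1 d2 d3 (f : 'M[S]_(d3, d2)) (g : 'M[S]_(d2, d1)) :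
  evm (f *m g) = evm f *m evm g.
Proof. exact: map_mxM. Qed.
Lemma evmD d d' (f g : 'M[S]_(d', d)) : evm (f + g) = evm f + evm g.
Proof. exact: map_mxD. Qed.
Lemma evmB d d' (f g : 'M[S]_(d', d)) : evm (f - g) = evm f - evm g.
Proof. exact: map_mxB. Qed.
Lemma evm1 d : evm (1%:M : 'M[S]_d) = 1%:M.
Proof. exact: map_mx1. Qed.
Lemma evmZ d d' p (f : 'M[S]_(d', d)) : evm (p *: f) = ev p *: evm f.
Proof. exact: map_mxZ. Qed.
Lemma evmT d d' (f : 'M[S]_(d', d)) : evm f^T = (evm f)^T.
Proof. by apply/matrixP => i j; rewrite !mxE. Qed.
Lemma evm_sum d d' (I : Type) (r : seq I) (P : pred I) (F : I -> 'M[S]_(d', d)) :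
  evm (\sum_(i <- r | P i) F i) = \sum_(i <- r | P i) evm (F i).
Proof. exact: (raddf_sum (map_mx (@ev R n S))). Qed.
Lemma evm_mlow s d : evm (mlow s d) = row_mx 1%:M 0.
Proof.
rewrite /evm /mlow map_row_mx map_mx1; congr row_mx.
by rewrite map_scalar_mx /= (phom_ev (hform_homog S s)) // raddf0.
Qed.
Lemma evm_mup s d : evm (mupp s d) = col_mx 0 1%:M.
Proof.
rewrite /evm /mupp map_col_mx map_mx1; congr col_mx.
by rewrite map_scalar_mx /= (phom_ev (hform_homog S s)) // raddf0.
Qed.

Lemma egr_lshift d (g : 'I_d -> nat) i : egr g (lshift d i) = g i.
Proof. by rewrite /egr -[lshift d i]/(unsplit (inl i)) unsplitK. Qed.
Lemma egr_rshift d (g : 'I_d -> nat) i : egr g (rshift d i) = (g i).+1.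
Proof. by rewrite /egr -[rshift d i]/(unsplit (inr i)) unsplitK. Qed.

Lemma homm_extm s d d' (g : 'I_d -> nat) (g' : 'I_d' -> nat) D f :
  homm g g' D f -> homm (egr g) (egr g') D (extm s f).
Proof.
move=> h i j; rewrite -[i]splitK -[j]splitK.
case: (fintype.split i) => {}i; case: (fintype.split j) => {}j; rewrite /= ?egr_lshift ?egr_rshift.
- by rewrite block_mxEul mxE ihomog_avg.
- rewrite block_mxEur !mxE.
  rewrite (_ : _ - _ = 2%:Z + ((g j)%:Z + D - (g' i)%:Z - 1)); last first.
    by rewrite -addn1 PoszD; ring.
  by apply: ihomogM; [exact: qform_homog | exact: ihomog_dem].
- rewrite block_mxEdl !mxE -addn1 PoszD opprD addrA; exact: ihomog_dem.
- rewrite block_mxEdr !mxE !PoszS.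
  rewrite (_ : _ - _ = (g j)%:Z + D - (g' i)%:Z); last by ring.
  exact: ihomog_avg.
Qed.

Lemma homm_mlow s d (g : 'I_d -> nat) : homm (egr g) g 0 (mlow s d).
Proof.
move=> i j; rewrite -[j]splitK; case: (fintype.split j) => {}j /=.
  by rewrite egr_lshift row_mxEl; apply: homm1.
rewrite egr_rshift row_mxEr -addn1 PoszD.
rewrite (_ : _ - _ = (g j)%:Z + 1 - (g i)%:Z); last by ring.
by apply: hommS; exact: hform_homog.
Qed.

Lemma homm_mup s d (g : 'I_d -> nat) : homm g (egr g) 1 (mupp s d).
Proof.
move=> i j; rewrite -[i]splitK; case: (fintype.split i) => {}i /=.
  by rewrite egr_lshift col_mxEu; apply: hommS; exact: hform_homog.
rewrite egr_rshift col_mxEd -addn1 PoszD.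
rewrite (_ : _ - _ = (g j)%:Z + 0 - (g i)%:Z); last by ring.
exact: homm1.
Qed.

(** Words are read backwards: the head of a list is the last tensor factor.  The
Bott-Samelson bimodule of [w] is free as a right module, with a basis graded by [wgr w],
and [Lam w p] is the matrix of the left multiplication by [p]; [wJ w] is the matrix of
the intersection form. *)
Fixpoint wdim w : nat := if w is _ :: w' then wdim w' + wdim w' else 1.

Fixpoint wgr w : 'I_(wdim w) -> nat :=
  if w is _ :: w' then egr (@wgr w') else fun=> 0%N.

Fixpoint Lam w (p : S) : 'M[S]_(wdim w) :=
  if w is s :: w' then extm s (Lam w' p) else p%:M.

Fixpoint wJ (A : pzRingType) w : 'M[A]_(wdim w) :=
  if w is _ :: w' then block_mx 0 (wJ A w') (wJ A w') 0 else 1%:M.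

Lemma LamD w p q : Lam w (p + q) = Lam w p + Lam w q.
Proof.
by elim: w => [|s w IH] /=; [rewrite raddfD | rewrite IH extmD].
Qed.

Lemma LamM w p q : Lam w (p * q) = Lam w p *m Lam w q.
Proof.
by elim: w => [|s w IH] /=; [rewrite scalar_mxM | rewrite IH extmM].
Qed.

Lemma Lam1 w : Lam w 1 = 1%:M.
Proof. by elim: w => [|s w IH] //=; rewrite IH extm1. Qed.

Fact Lam_is_additive w : additive (Lam w).
Proof.
by move=> p q; apply: (addIr (Lam w q)); rewrite -LamD !subrK.
Qed.
HB.instance Definition _ w := GRing.isAdditive.Build S 'M[S]_(wdim w) (Lam w)
  (Lam_is_additive w).

Lemma LamC w c : Lam w (pC c) = ((pC c))%:M.
Proof.
elim: w => [|s w IH] //=.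
by rewrite IH -[X in extm s X]scalemx1 extmZC extm1 scalemx1.
Qed.

Lemma Lam_homog w d p : phom d p -> homm (@wgr w) (@wgr w) d%:Z (Lam w p).
Proof.
by move=> hp; elim: w => [|s w IH] /=; [apply: hommS | apply: homm_extm].
Qed.

Lemma wJ_tr (A : pzRingType) w : (wJ A w)^T = wJ A w.
Proof.
elim: w => [|s w IH] /=; first exact: trmx1.
by rewrite tr_block_mx IH !trmx0.
Qed.

Lemma wJK (A : pzRingType) w : wJ A w *m wJ A w = 1%:M.
Proof.
elim: w => [|s w IH] /=; first by rewrite mulmx1.
by rewrite mulmx_block IH !mulmx0 !mul0mx !addr0 add0r -scalar_mx_block.
Qed.

Lemma evm_wJ w : evm (wJ S w) = wJ R w.
Proof.
elim: w => [|s w IH] /=; first exact: map_mx1.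
by rewrite /evm map_block_mx !map_mx0 -/(evm _) IH.
Qed.

Lemma wJ_gr (A : pzRingType) w i j : wJ A w i j != 0 ->
  (wgr i + wgr j)%N = size w.
Proof.
elim: w i j => [|s w IH] //= i j.
rewrite -[i]splitK -[j]splitK.
case: (fintype.split i) => {}i; case: (fintype.split j) => {}j; rewrite /= ?egr_lshift ?egr_rshift.
- by rewrite block_mxEul mxE eqxx.
- by rewrite block_mxEur => /IH <-; rewrite addnS.
- by rewrite block_mxEdl => /IH <-.
- by rewrite block_mxEdr mxE eqxx.
Qed.

Definition adj w w' (f : 'M[S]_(wdim w', wdim w)) : 'M[S]_(wdim w, wdim w') :=
  wJ S w *m f^T *m wJ S w'.

Arguments adj : clear implicits.

Lemma adjK w w' f : adj w' w (adj w w' f) = f.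
Proof.
rewrite /adj !trmx_mul trmxK !wJ_tr !mulmxA wJK mul1mx -mulmxA.
by rewrite wJK mulmx1.
Qed.

Lemma adjM w1 w2 w3 (f : 'M[S]_(wdim w3, wdim w2)) (g : 'M[S]_(wdim w2, wdim w1)) :
  adj w1 w3 (f *m g) = adj w1 w2 g *m adj w2 w3 f.
Proof.
by rewrite /adj trmx_mul -!mulmxA (mulmxA (wJ S w2) (wJ S w2)) wJK mul1mx.
Qed.

Lemma adj1 w : adj w w 1%:M = 1%:M.
Proof. by rewrite /adj trmx1 mulmx1 wJK. Qed.

Lemma adjD w w' f g : adj w w' (f + g) = adj w w' f + adj w w' g.
Proof. by rewrite /adj raddfD mulmxDr mulmxDl. Qed.
Lemma adjB w w' f g : adj w w' (f - g) = adj w w' f - adj w w' g.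
Proof. by rewrite /adj raddfB mulmxBr mulmxBl. Qed.
Lemma adjZ w w' p f : adj w w' (p *: f) = p *: adj w w' f.
Proof. by rewrite /adj linearZ /= -scalemxAr -scalemxAl. Qed.
Lemma adj0 w w' : adj w w' 0 = 0.
Proof. by rewrite /adj trmx0 mulmx0 mul0mx. Qed.
Lemma adj_sum w w' (I : Type) (r : seq I) (P : pred I) F :
  adj w w' (\sum_(i <- r | P i) F i) = \sum_(i <- r | P i) adj w w' (F i).
Proof.
by apply: (big_morph (adj w w')); [exact: adjD | exact: adj0].
Qed.

Lemma wJ_const w (D : S -> S) : (forall c, D (pC c) = 0) ->
  map_mx D (wJ S w) = 0.
Proof.
move=> h; have D0 : D 0 = 0 by have := h 0; rewrite rmorph0.
have D1 : D 1 = 0 by have := h 1; rewrite rmorph1.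
elim: w => [|s w IH] /=.
  by apply/matrixP => i j; rewrite !mxE; case: eqP; rewrite ?D1 ?D0.
rewrite map_block_mx IH.
have -> : map_mx D (0 : 'M[S]_(wdim w)) = 0.
  by apply/matrixP => i j; rewrite !mxE D0.
by rewrite block_mx0.
Qed.

(** The intersection form has constant entries, which [avg] fixes and [dem] kills. *)
Lemma adj_extm s w w' (f : 'M[S]_(wdim w', wdim w)) :
  adj (s :: w) (s :: w') (extm s f) = extm s (adj w w' f).
Proof.
have avJ v : map_mx (avg s) (wJ S v) = wJ S v.
  have D0 := wJ_const v (demC S s).
  apply/matrixP => i j; move/matrixP: D0 => /(_ i j); rewrite !mxE => D0.
  by rewrite [RHS](avg_dem s) D0 mulr0 addr0.
have dJ v : map_mx (dem s) (wJ S v) = 0 by apply/wJ_const => c; exact: demC.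
rewrite /adj /extm /= tr_block_mx !mulmx_block !mul0mx !mulmx0 !add0r !addr0.
rewrite !map_demM !map_avgM !avJ !dJ !map_trmx !mulmx0 !mul0mx.
rewrite !scaler0 !addr0 !add0r.
by rewrite [(qform s *: _)^T]linearZ /= -scalemxAr -scalemxAl map_trmx.
Qed.

Lemma adj_mlow s w : adj (s :: w) w (mlow s (wdim w)) = mupp s (wdim w).
Proof.
rewrite /adj /mlow /mupp /= tr_row_mx trmx1 tr_scalar_mx.
rewrite mul_block_col !mul0mx addr0 add0r !mul_col_mx mulmx1 wJK.
by rewrite mul_mx_scalar -scalemxAl wJK scale_scalar_mx mulr1.
Qed.

Lemma adj_mup s w : adj w (s :: w) (mupp s (wdim w)) = mlow s (wdim w).
Proof. by rewrite -adj_mlow adjK. Qed.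

Lemma adj_Lam w p : adj w w (Lam w p) = Lam w p.
Proof.
elim: w => [|s w IH]; first by rewrite /adj /= mulmx1 mul1mx tr_scalar_mx.
by rewrite [Lam _ _]/= adj_extm IH.
Qed.

Lemma adj_homm w w' D f : homm (@wgr w) (@wgr w') D f ->
  homm (@wgr w') (@wgr w) (D + (size w)%:Z - (size w')%:Z) (adj w w' f).
Proof.
move=> h i j; rewrite /adj mxE; apply: ihomog_sum => k _.
rewrite mxE mulr_suml; apply: ihomog_sum => l _; rewrite mxE.
have [->|n1] := eqVneq (wJ S w i l) 0; first by rewrite !mul0r ihomog0.
have [->|n2] := eqVneq (wJ S w' k j) 0; first by rewrite !mulr0 ihomog0.
have E1 := wJ_gr n1; have E2 := wJ_gr n2.
rewrite (_ : _ - _ = (wgr l)%:Z + D - (wgr k)%:Z); last by rewrite -E1 -E2 !PoszD; ring.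
have cJ v i0 j0 : ihomog 0 (wJ S v i0 j0).
  elim: v i0 j0 => [|s0 v IH] //= i0 j0.
    by rewrite mxE; case: eqP => _; [rewrite -(rmorph1 pC); exact: phomC | exact: phom0].
  rewrite -[i0]splitK -[j0]splitK.
  case: (fintype.split i0) => {}i0; case: (fintype.split j0) => {}j0 /=.
  - by rewrite block_mxEul mxE phom0.
  - by rewrite block_mxEur; apply: IH.
  - by rewrite block_mxEdl; apply: IH.
  - by rewrite block_mxEdr mxE phom0.
rewrite -[X in ihomog X]addr0 -[X in ihomog (X + _)]add0r.
by apply: ihomogM; first apply: ihomogM.
Qed.

Lemma evm_adj w w' f : evm (adj w w' f) = wJ R w *m (evm f)^T *m wJ R w'.
Proof. by rewrite /adj !evmM evmT !evm_wJ. Qed.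

End Words.
Arguments adj {R n S} w w' f.
Arguments extm {R n S} s {d d'} f.
Arguments mlow {R n} S s d.
Arguments mupp {R n} S s d.
Arguments Lam {R n S} w p.

(** * Hodge-Riemann relations *)

Section RegularElement.
Variable (F : fieldType).

(** Removing the power of X from the characteristic polynomial leaves q with q(0) <> 0, and g q(g) =
    0 because ker g^2 = ker g; this is solved for g. The point is that the projection onto the image
    of g becomes a polynomial in g, so it is self-adjoint and commutes with A whenever g does. *)
Lemma regular_mx_inverse d (g : 'M[F]_d) :
  (forall v : 'cV_d, g *m (g *m v) = 0 -> g *m v = 0) ->
  exists N (c : nat -> F), g = g *m g *m \sum_(i < N) c i *: g ^+ i.
Proof.
case: d g => [|d] g reg; first by exists 0%N, (fun=> 0); apply/matrixP => -[].
have regM (M : 'M[F]_d.+1) : g *m (g *m M) = 0 -> g *m M = 0.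
  move=> E; apply/matrixP => i j.
  have := reg (M *m delta_mx j 0); rewrite mulmxA in E.
  rewrite !mulmxA E mul0mx => /(_ erefl)/colP/(_ i).
  by rewrite -colE !mxE.
have regX k (M : 'M[F]_d.+1) : g ^+ k *m M = 0 -> g *m M = 0.
  elim: k => [|k IH]; first by rewrite expr0 mul1mx => ->; rewrite mulmx0.
  case: k IH => [|k] IH; first by rewrite expr1.
  rewrite exprS exprS -!mulmxE -!mulmxA => /regM; rewrite mulmxA mulmxE -exprS.
  exact: IH.
have nz : char_poly g != 0 by rewrite -size_poly_eq0 size_char_poly.
have [k [q q0 Eq]] := multiplicity_XsubC (char_poly g) 0.
rewrite nz /= in q0.
have qg : g *m horner_mx g q = 0.
  apply: (regX k); have := Cayley_Hamilton g.
  rewrite Eq subr0 mulrC rmorphM rmorphXn /= horner_mx_X.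
  by rewrite mulmxE.
move: q0; rewrite rootE horner_coef0 => q0.
exists (size q).-1, (fun i => - (q`_0)^-1 * q`_i.+1).
have szq : (0 < size q)%N.
  by rewrite lt0n size_poly_eq0; apply: contraNneq q0 => ->; rewrite coef0.
move: qg; rewrite -{1}[q]coefK poly_def rmorph_sum /= -(prednK szq) big_ord_recl /=.
rewrite expr0 alg_polyC horner_mx_C mulmxDr mul_mx_scalar => /eqP.
rewrite addr_eq0 => /eqP Eg.
rewrite -[LHS](scalerK q0) Eg scalerN -scaleNr -mulmxA scalemxAr; congr (_ *m _).
rewrite !mulmx_sumr scaler_sumr; apply: eq_bigr => i _.
rewrite linearZ /= rmorphXn /= horner_mx_X exprS -mulmxE.
by rewrite scalerA -scalemxAr.
Qed.

End RegularElement.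

(** * Real quadratic forms and the invariance of signatures along a path *)

Section Sylvester.
Variable (R : realType).

(** A nonisotropic vector exists by polarization; normalized to value 1 or -1 it is split off. *)
Lemma sylvester_diag r (A : 'M[R]_r) : A^T = A -> A \in unitmx ->
  exists (M : 'M[R]_r) (s : 'I_r -> bool), M \in unitmx /\
    M^T *m A *m M = diag_mx (\row_i (-1) ^+ s i).
Proof.
elim: r A => [|r IH]; last rewrite -[r.+1]add1n; move=> A Asym Aun.
  exists 1%:M, (fun=> false); rewrite unitmx1; split=> //.
  by apply/matrixP => -[].
have [v vAv] : exists v : 'cV_(1 + r), (v^T *m A *m v) 0 0 != 0.
  have pol (v w : 'cV[R]_(1 + r)) : ((v + w)^T *m A *m (v + w)) 0 0 =
    (v^T *m A *m v) 0 0 + (w^T *m A *m w) 0 0 + 2 * (v^T *m A *m w) 0 0.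
    have aD (X Y : 'M[R]_1) : (X + Y) 0 0 = X 0 0 + Y 0 0 by rewrite mxE.
    have Esy : (w^T *m A *m v) 0 0 = (v^T *m A *m w) 0 0.
      by rewrite -[LHS]trace_mx11 -mxtrace_tr !trmx_mul Asym trmxK mulmxA trace_mx11.
    rewrite [(v + w)^T]raddfD /= !mulmxDl !mulmxDr !aD Esy; ring.
  apply: contrapT => nex.
  have q0 (v : 'cV[R]_(1 + r)) : (v^T *m A *m v) 0 0 = 0.
    by apply/eqP; apply: contrapT => /negP h; apply: nex; exists v.
  have A0 : A = 0.
    apply/matrixP => i j.
    have := pol (delta_mx i 0) (delta_mx j 0); rewrite !q0 !add0r => /esym/eqP.
    rewrite mulf_eq0 pnatr_eq0 /= trmx_delta -rowE -colE !mxE => /eqP -> //.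
  by move: Aun; rewrite A0 unitmxE det0 unitr0.
set c := (v^T *m A *m v) 0 0 in vAv.
pose v1 := (Num.sqrt `|c|)^-1 *: v.
have c0 : 0 < `|c| by rewrite normr_gt0.
have Ev1 : v1^T *m A *m v1 = ((-1) ^+ (c < 0)%R)%:M.
  rewrite [LHS]mx11_scalar; congr (_%:M).
  rewrite /v1 [(_ *: v)^T]linearZ /= -!scalemxAl -scalemxAr scalerA mxE -/c.
  rewrite -expr2 exprVn sqr_sqrtr ?normr_ge0 //.
  apply: (mulfI (lt0r_neq0 c0)); rewrite mulrA mulfV ?gt_eqF // mul1r.
  by rewrite mulrC -numEsign.
have v10 : v1 != 0.
  apply/eqP => E; move/matrixP: Ev1 => /(_ 0 0); rewrite E mulmx0 !mxE eqxx.
  by move/esym/eqP; rewrite mulr1n signr_eq0.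
(* The vector is completed to a basis, with [v1] as first column, by means of its rank
   factorization. *)
have [U [Uun EU]] : exists U : 'M[R]_(1 + r), U \in unitmx /\
    U *m col_mx 1%:M 0 = v1.
  have rk : \rank v1 = 1%N.
    apply/eqP; rewrite eqn_leq rank_leq_col lt0n mxrank_eq0 //.
  exists (col_ebase v1 *m block_mx (row_ebase v1) 0 0 1%:M).
  rewrite unitmx_mul col_ebase_unit; split=> //=.
    rewrite unitmxE det_lblock det1 mulr1 -unitmxE; exact: row_ebase_unit.
  rewrite -mulmxA mul_block_col !mulmx0 !mul0mx !addr0 mulmx1.
  rewrite -[RHS]mulmx_ebase rk -mulmxA; congr (_ *m _).
  rewrite -[RHS](_ : col_mx 1%:M 0 *m row_ebase v1 = _); last first.
    congr (_ *m _); apply/matrixP => i j; rewrite !mxE (ord1 j).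
    case: splitP => k ->; rewrite ?ord1 mxE //= andbT.
  by rewrite mul_col_mx mul1mx mul0mx.
set e := (-1) ^+ (c < 0)%R : R in Ev1.
have ee : e * e = 1 by rewrite -expr2 sqrr_sign.
pose B : 'M_(1 + r) := U^T *m A *m U.
have Bsym : B^T = B by rewrite /B !trmx_mul trmxK Asym mulmxA.
have B00 : ulsubmx B = e%:M.
  rewrite -Ev1 -EU trmx_mul tr_col_mx trmx1 trmx0 !mulmxA.
  have -> : (row_mx 1%:M 0 : 'M_(1, 1 + r)) *m U^T *m A *m U *m col_mx 1%:M 0 =
    row_mx 1%:M 0 *m B *m col_mx 1%:M 0 by rewrite /B !mulmxA.
  rewrite -{2}[B]submxK mul_row_block !mul1mx !mul0mx !addr0 mul_row_col.
  by rewrite mulmx1 mulmx0 addr0.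
pose b := ursubmx B.
have Bdl : dlsubmx B = b^T by rewrite /b trmx_ursub Bsym.
pose W : 'M[R]_(1 + r) := block_mx 1%:M (- e *: b) 0 1%:M.
have EW : W^T *m B *m W = block_mx e%:M 0 0 (drsubmx B - e *: (b^T *m b)).
  rewrite -{1}[B]submxK B00 Bdl -/b /W tr_block_mx !trmx1 trmx0.
  rewrite !mulmx_block !mul1mx !mul0mx !mulmx1 !mulmx0 !addr0 [(- e *: b)^T]linearZ /=.
  have E1 : (- e *: b^T) *m e%:M + b^T = 0.
    by rewrite mul_mx_scalar scalerA mulrN ee scaleN1r addNr.
  have E2 : e%:M *m (- e *: b) + b = 0.
    by rewrite mul_scalar_mx scalerA mulrN ee scaleN1r addNr.
  by rewrite E1 E2 mul0mx add0r -scalemxAl scaleNr addrC.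
have Wun : W \in unitmx by rewrite unitmxE det_ublock !det1 mulr1 unitr1.
have Cun : (drsubmx B - e *: (b^T *m b)) \in unitmx.
  have : W^T *m B *m W \in unitmx.
    by rewrite !unitmx_mul !unitmx_tr Wun Uun Aun.
  by rewrite EW unitmxE det_lblock unitrM -unitmxE => /andP[].
have Csym : (drsubmx B - e *: (b^T *m b))^T = drsubmx B - e *: (b^T *m b).
  by rewrite raddfB /= [(e *: _)^T]linearZ /= trmx_mul trmxK trmx_drsub Bsym.
have [M [s [Mun EM]]] := IH _ Csym Cun.
exists (U *m W *m block_mx 1%:M 0 0 M).
exists (fun i : 'I_(1 + r) => match fintype.split i with
  inl _ => (c < 0)%R | inr j => s j end).
rewrite !unitmx_mul Uun Wun /=; split.
  by rewrite unitmxE det_lblock det1 mul1r -unitmxE.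
rewrite !trmx_mul -!mulmxA (mulmxA U^T) (mulmxA (U^T *m A)) -/B.
rewrite (mulmxA W^T) (mulmxA (W^T *m B)) EW tr_block_mx trmx1 !trmx0.
rewrite !mulmx_block !mul1mx !mul0mx !mulmx1 !mulmx0 !addr0 !add0r mulmxA EM.
rewrite ?mulmx0 ?mul0mx; apply/matrixP => i j.
rewrite -[i]splitK -[j]splitK.
have spl k : fintype.split (lshift r k : 'I_(1 + r)) = inl k := unsplitK (inl k).
have spr k : fintype.split (rshift 1 k : 'I_(1 + r)) = inr k := unsplitK (inr k).
case: (fintype.split i) => {}i; case: (fintype.split j) => {}j /=.
- by rewrite block_mxEul !mxE eq_lshift spl !ord1 /= mulr1n.
- by rewrite block_mxEur !mxE eq_lrshift.
- by rewrite block_mxEdl !mxE eq_rlshift.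
- by rewrite block_mxEdr !mxE eq_rshift spr.
Qed.

Definition posdef p (B : 'M[R]_p) :=
  forall z : 'cV_p, z != 0 -> 0 < (z^T *m B *m z) 0 0.

Lemma qformE p (B : 'M[R]_p) (z : 'cV_p) :
  (z^T *m B *m z) 0 0 = \sum_i \sum_j z i 0 * B i j * z j 0.
Proof.
rewrite mxE exchange_big /=; apply: eq_bigr => j _; rewrite mxE mulr_suml.
by apply: eq_bigr => i _; rewrite !mxE.
Qed.

(** By 2|xy| <= x^2 + y^2, a perturbation with entries below 1/(r + 1) changes the form by at most
    r/(r + 1) times the squared norm, which cannot reverse the sign. *)
Lemma near_diag r (s : 'I_r -> bool) (B : 'M[R]_r) (b : bool) (z : 'cV_r) :
  (forall i j, `|B i j - (diag_mx (\row_i (-1) ^+ s i)) i j| < (r.+1)%:R^-1) ->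
  z != 0 -> (forall i, z i 0 != 0 -> s i = b) ->
  0 < (-1) ^+ b * (z^T *m B *m z) 0 0.
Proof.
move=> hB z0 hz.
have [i0 zi0] : exists i, z i 0 != 0.
  apply: contrapT => nex; move/eqP: z0; apply; apply/colP => i; rewrite mxE.
  by apply/eqP; apply: contrapT => /negP h; apply: nex; exists i.
pose N := \sum_i z i 0 ^+ 2.
have N0 : 0 < N.
  rewrite /N (bigD1 i0) //= ltr_wpDr ?exprn_even_gt0 //.
  by apply: sumr_ge0 => i _; apply: sqr_ge0.
pose d := (r.+1)%:R^-1 : R.
have d0 : 0 < d by rewrite invr_gt0 ltr0n.
pose D := diag_mx (\row_i (-1) ^+ s i : 'rV[R]_r).
have Esplit : (z^T *m B *m z) 0 0 = (z^T *m D *m z) 0 0 + (z^T *m (B - D) *m z) 0 0.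
  by rewrite -{1}[B](subrK D) mulmxDr mulmxDl [LHS]mxE addrC.
have ED : (-1) ^+ b * (z^T *m D *m z) 0 0 = N.
  rewrite qformE mulr_sumr; apply: eq_bigr => i _.
  rewrite (bigD1 i) //= big1 ?addr0; last first.
    by move=> j ne; rewrite !mxE eq_sym (negbTE ne) mulr0n mulr0 mul0r.
  rewrite !mxE eqxx mulr1n; have [->|/hz ->] := eqVneq (z i 0) 0.
    by rewrite !mul0r mulr0 expr0n.
  by case: (b); rewrite ?expr0 ?expr1; ring.
have bd : `|(-1) ^+ b * (z^T *m (B - D) *m z) 0 0| <= d * r%:R * N.
  rewrite normrM normr_sign mul1r qformE.
  apply: (@le_trans _ _ (\sum_i \sum_j d / 2 * (z i 0 ^+ 2 + z j 0 ^+ 2))).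
    apply: le_trans (ler_norm_sum _ _ _) _; apply: ler_sum => i _.
    apply: le_trans (ler_norm_sum _ _ _) _; apply: ler_sum => j _.
    rewrite mulrAC normrM.
    have h1 : `|z i 0 * z j 0| <= 2^-1 * (z i 0 ^+ 2 + z j 0 ^+ 2).
      rewrite normrM -[z i 0 ^+ 2]real_normK ?num_real //.
      rewrite -[z j 0 ^+ 2]real_normK ?num_real //.
      have := sqr_ge0 (`|z i 0| - `|z j 0|); rewrite !expr2; lra.
    have h2 : `|(B - D) i j| <= d by have := hB i j; rewrite [(B - D) i j]mxE [(- D) i j]mxE => /ltW.
    rewrite -mulrA [d * _]mulrC; by apply: ler_pM.
  under eq_bigr => i _ do rewrite -mulr_sumr big_split /= sumr_const card_ord.
  rewrite -mulr_sumr big_split /= sumr_const card_ord sumrMnl -/N.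
  by rewrite -mulr_natr; lra.
have dr : d * r%:R < 1.
  by rewrite /d mulrC ltr_pdivrMr ?ltr0n // mul1r ltr_nat.
rewrite Esplit mulrDr ED.
have : d * r%:R * N < N by rewrite -[ltRHS]mul1r ltr_pM2r.
by move: bd; rewrite ler_norml => /andP[]; lra.
Qed.

(** Connectedness of [0, 1], by a supremum, for a property that is locally constant. *)
Lemma real_segment_ind (P : R -> Prop) : P 0 ->
  (forall t0 : R, 0 <= t0 <= 1 -> exists2 d : R, 0 < d &
     forall t t' : R, 0 <= t <= 1 -> 0 <= t' <= 1 -> `|t - t0| < d -> `|t' - t0| < d ->
       P t -> P t') -> P 1.
Proof.
move=> P0 loc.
pose E : set R := (fun t : R => 0 <= t <= 1 /\ P t).
have E0 : E 0 by split=> //; rewrite lexx ler01.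
have supE : has_sup E.
  by split; [exists 0 | exists 1 => t [/andP[]]].
pose u := sup E.
have u01 : 0 <= u <= 1.
  rewrite (ub_le_sup _ E0) /=; last exact: supE.2.
  by apply: ge_sup => [|t [/andP[]]] //; exists 0.
have [d d0 hd] := loc _ u01.
have [t [t01 Pt] ht] := sup_adherent d0 supE.
have tu : `|t - u| < d.
  rewrite ltr_norml; have : t <= u by apply: ub_le_sup => //; exact: supE.2.
  by rewrite -/u in ht; move: ht => h1 h2; apply/andP; split; lra.
pose t' := Num.min 1 (u + d / 2).
have t'01 : 0 <= t' <= 1.
  by rewrite /t' le_min ge_min lexx ler01 /= ; apply/andP; split=> //; lra.
have t'u : `|t' - u| < d.
  rewrite /t' ltr_norml minElt; case: ifP => h; apply/andP; split; lra.
have Pt' : P t' by apply: (hd t).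
have : t' <= u by apply: ub_le_sup; [exact: supE.2 | split].
rewrite {1}/t' ge_min => /orP[h|]; last by lra.
by apply: (hd t) => //; [rewrite lexx ler01 | rewrite ltr_norml; apply/andP; split; lra].
Qed.

(** Near t0 the form is close to a diagonal matrix of signs in suitable coordinates; positive
    definite subspaces of dimension p exist nearby only if there are at least p plus signs, and then
    they exist at all nearby points. *)
Lemma inertia r (A : 'M[{poly R}]_r) p :
  A^T = A ->
  (forall t : R, 0 <= t <= 1 -> map_mx (horner^~ t) A \in unitmx) ->
  (exists M : 'M_(r, p), posdef (M^T *m map_mx (horner^~ 0) A *m M)) ->
  exists M : 'M_(r, p), posdef (M^T *m map_mx (horner^~ 1) A *m M).
Proof.
move=> Asym Aun; set At := fun t : R => map_mx (horner^~ t) A.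
move=> h0; apply: (@real_segment_ind (fun t =>
  exists M : 'M_(r, p), posdef (M^T *m At t *m M)) h0) => t0 t01.
have Atsym t : (At t)^T = At t.
  by apply/matrixP => i j; rewrite !mxE -[in RHS]Asym mxE.
have [M [s [Mun EM]]] := sylvester_diag (Atsym t0) (Aun _ t01).
pose AP : 'M[{poly R}]_r := map_mx polyC M^T *m A *m map_mx polyC M.
have EAP t : M^T *m At t *m M = map_mx (horner^~ t) AP.
  rewrite /AP !(map_mxM (horner_eval t)) /=; congr (_ *m _ *m _);
    by apply/matrixP => i j; rewrite ?mxE /horner_eval ?hornerC.
have [d d0 hd] : exists2 d, 0 < d & forall t, `|t - t0| < d -> forall i j,
    `|(M^T *m At t *m M) i j - (diag_mx (\row_i (-1) ^+ s i)) i j| < (r.+1)%:R^-1.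
  have r0 : 0 < (r.+1)%:R^-1 :> R by rewrite invr_gt0 ltr0n.
  have H i j : exists d, 0 < d /\ forall t, `|t - t0| < d ->
      `|(AP i j).[t] - (AP i j).[t0]| < (r.+1)%:R^-1.
    by have [d d0 hd] := poly_cont t0 (AP i j) r0; exists d; split=> // t; apply: hd.
  have [D hD] := choice (fun ij : 'I_r * 'I_r => H ij.1 ij.2).
  exists (\big[Num.min/1]_ij D ij).
    by apply: (big_ind (fun x => 0 < x)) => // [x y|ij _]; rewrite ?lt_min ?(hD ij).1 // => -> ->.
  move=> t ht i j; rewrite EAP -EM EAP ![map_mx _ _ _ _]mxE; apply: (hD (i, j)).2.
  by apply: lt_le_trans ht _; rewrite (bigD1 (i, j)) //= ge_min lexx.
exists d => // t t' _ _ /hd ht /hd ht' [M1 pos1].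
pose a := #|[pred i | ~~ s i]|.
(* Otherwise some nonzero vector of the definite subspace has no coordinate on the positive axes,
   where the form is negative. *)
have le_pa : (p <= a)%N.
  rewrite leqNgt; apply/negP => lt_ap.
  pose K : 'M[R]_(a, p) := \matrix_(i, j) (invmx M *m M1) (enum_val i) j.
  have /rowV0Pn[v vK v0] : kermx K^T != 0.
    rewrite kermx_eq0 /row_free; apply/eqP => E.
    by have := rank_leq_col K^T; rewrite E leqNgt lt_ap.
  have {}vK : K *m v^T = 0.
    by apply: trmx_inj; rewrite trmx_mul trmxK trmx0; apply/sub_kermxP.
  have v0' : v^T != 0 by rewrite -trmx0 (inj_eq trmx_inj).
  pose y := invmx M *m M1 *m v^T.
  have EMy : M *m y = M1 *m v^T by rewrite /y !mulmxA mulmxV // mul1mx.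
  have y0 : y != 0.
    apply/eqP => y0; have := pos1 _ v0'.
    rewrite -mulmxA -[M1^T *m _ *m M1 *m v^T]mulmxA -EMy y0 mulmx0 !mulmx0 mxE.
    by rewrite ltxx.
  have sy i : y i 0 != 0 -> s i = true.
    apply: contraNeq; rewrite eqb_id => si.
    have hi : i \in [pred i | ~~ s i] by [].
    move/colP: vK => /(_ (enum_rank_in hi i)); rewrite !mxE => E.
    rewrite -[eqbRHS]E; apply/eqP; apply: eq_bigr => j _.
    by rewrite [K _ _]mxE enum_rankK_in.
  clearbody y; have := near_diag ht y0 sy; rewrite expr1 mulN1r.
  have -> : y^T *m (M^T *m At t *m M) *m y = (M *m y)^T *m At t *m (M *m y).
    by rewrite trmx_mul !mulmxA.
  rewrite EMy trmx_mul; have := pos1 _ v0'; rewrite !mulmxA; lra.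
pose E : 'M[R]_(r, p) := \matrix_(i, j) (i == enum_val (widen_ord le_pa j))%:R.
exists (M *m E) => z z0.
have -> : z^T *m ((M *m E)^T *m At t' *m (M *m E)) *m z =
    (E *m z)^T *m (M^T *m At t' *m M) *m (E *m z) by rewrite !trmx_mul !mulmxA.
have EE : E^T *m E = 1%:M.
  apply/matrixP => i j; rewrite !mxE (bigD1 (enum_val (widen_ord le_pa i))) //=.
  rewrite big1 ?addr0 => [|k ne]; last by rewrite !mxE (negbTE ne) mul0r.
  rewrite !mxE eqxx mul1r (inj_eq enum_val_inj).
  by congr (_%:R); rewrite -!val_eqE.
rewrite -[X in 0 < X]mul1r -[1](expr0 (-1)); apply: (near_diag (b := false) ht').
  apply/eqP => E0; move/eqP: z0; apply.
  by rewrite -[z]mul1mx -EE -mulmxA E0 mulmx0.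
move=> i; apply: contraNeq; rewrite eqbF_neg negbK => si.
rewrite mxE big1 // => j _; rewrite mxE; case: eqP => [Ei|_]; last by rewrite mul0r.
by have := enum_valP (widen_ord le_pa j); rewrite -Ei inE si.
Qed.

End Sylvester.

(** * Homogeneous matrices and vectors over the reals *)

Section Shift.
Variable (R : realType).

Definition shiftm d d' (g : 'I_d -> nat) (g' : 'I_d' -> nat) (D : int)
  (M : 'M[R]_(d', d)) := forall i j, M i j != 0 -> (g' i)%:Z = (g j)%:Z + D.

Definition homv d (g : 'I_d -> nat) (k : int) (v : 'cV[R]_d) :=
  forall i, v i 0 != 0 -> (g i)%:Z = k.

Lemma sum_neq0 (I : finType) (F : I -> R) : \sum_i F i != 0 ->
  exists i, F i != 0.
Proof.
move=> h; apply: contrapT => nex; move/eqP: h; apply; apply: big1 => i _.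
by apply/eqP; apply: contrapT => /negP h; apply: nex; exists i.
Qed.

Lemma shiftmM d1 d2 d3 (g1 : 'I_d1 -> nat) (g2 : 'I_d2 -> nat) (g3 : 'I_d3 -> nat)
  D D' (M : 'M[R]_(d3, d2)) (M' : 'M[R]_(d2, d1)) :
  shiftm g2 g3 D M -> shiftm g1 g2 D' M' -> shiftm g1 g3 (D' + D) (M *m M').
Proof.
move=> h h' i j; rewrite mxE => /sum_neq0[k]; rewrite mulf_eq0 negb_or.
by case/andP => /h -> /h' ->; rewrite addrA.
Qed.

Lemma homv_mul d d' (g : 'I_d -> nat) (g' : 'I_d' -> nat) D M k v :
  shiftm g g' D M -> homv g k v -> homv g' (k + D) (M *m v).
Proof.
move=> h h' i; rewrite mxE => /sum_neq0[j]; rewrite mulf_eq0 negb_or.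
by case/andP => /h -> /h' ->.
Qed.

Lemma shiftm1 d (g : 'I_d -> nat) : shiftm g g 0 1%:M.
Proof. by move=> i j; rewrite mxE addr0; have [->|_] := eqVneq i j; rewrite ?mulr0n ?eqxx. Qed.

Lemma shiftmX d (g : 'I_d -> nat) M j : shiftm g g 1 M -> shiftm g g j%:Z (M ^+ j).
Proof.
move=> h; elim: j => [|j IH]; first by rewrite expr0; exact: shiftm1.
by rewrite exprS PoszS -mulmxE; exact: (shiftmM h IH).
Qed.

Lemma shiftmD d d' (g : 'I_d -> nat) (g' : 'I_d' -> nat) D (M N : 'M[R]_(d', d)) :
  shiftm g g' D M -> shiftm g g' D N -> shiftm g g' D (M + N).
Proof.
move=> h h' i j; rewrite mxE; have [-> | /h //] := eqVneq (M i j) 0.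
by rewrite add0r => /h'.
Qed.

Lemma shiftmZ d d' (g : 'I_d -> nat) (g' : 'I_d' -> nat) D c (M : 'M[R]_(d', d)) :
  shiftm g g' D M -> shiftm g g' D (c *: M).
Proof. by move=> h i j; rewrite mxE mulf_eq0 negb_or => /andP[_ /h]. Qed.

Lemma shiftm0 d d' (g : 'I_d -> nat) (g' : 'I_d' -> nat) D :
  shiftm g g' D (0 : 'M[R]_(d', d)).
Proof. by move=> i j; rewrite mxE eqxx. Qed.

Lemma shiftm_evm n (S : polyring R n) d d' (g : 'I_d -> nat) (g' : 'I_d' -> nat) D
  (f : 'M[S]_(d', d)) : homm g g' D f -> shiftm g g' D (evm f).
Proof.
move=> h i j; rewrite mxE; apply: contraNeq => ne; apply/eqP.
by apply: (ihomog_ev (h i j)); rewrite subr_eq0 eq_sym.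
Qed.

Definition gproj d (g : 'I_d -> nat) (k : int) : 'M[R]_d :=
  diag_mx (\row_i ((g i)%:Z == k)%:R).

Lemma homvP d (g : 'I_d -> nat) k v : homv g k v <-> gproj g k *m v = v.
Proof.
split=> [h|E i].
  apply/colP => i; rewrite mul_diag_mx !mxE.
  have [->|/h ->] := eqVneq (v i 0) 0; first by rewrite mulr0.
  by rewrite eqxx mul1r.
have := congr1 (fun w : 'cV_d => w i 0) E; rewrite mul_diag_mx !mxE.
by case: eqP => // _ <-; rewrite mul0r eqxx.
Qed.

Lemma gproj_comm d (g : 'I_d -> nat) k M : shiftm g g 0 M ->
  gproj g k *m M = M *m gproj g k.
Proof.
move=> h; apply/matrixP => i j; rewrite mul_diag_mx mul_mx_diag !mxE.
have [->|/h] := eqVneq (M i j) 0; first by rewrite mulr0 mul0r.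
by rewrite addr0 => ->; rewrite mulrC.
Qed.

Lemma gproj_idem d (g : 'I_d -> nat) k : gproj g k *m gproj g k = gproj g k.
Proof.
rewrite /gproj mulmx_diag; congr diag_mx; apply/rowP => i; rewrite !mxE.
by case: eqP; rewrite ?mulr1 ?mulr0.
Qed.

End Shift.

Section HodgeSpaces.
Variable (R : realType).

(** The underlying space is the image of the idempotent [hE], the form is given by [hJ]
and the Lefschetz operator is [hL]. *)
Record hspace := HSpace {
  hd : nat; hn : nat; hg : 'I_hd -> nat;
  hJ : 'M[R]_hd; hE : 'M[R]_hd; hL : 'M[R]_hd;
  hJ_tr : hJ^T = hJ;
  hJK : hJ *m hJ = 1%:M;
  hJ_deg : forall i j, hJ i j != 0 -> (hg i + hg j)%N = hn;
  hE_idem : hE *m hE = hE;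
  hE_adj : hE^T *m hJ = hJ *m hE;
  hE_deg : shiftm hg hg 0 hE;
  hL_deg : shiftm hg hg 1 hL;
  hL_adj : hL^T *m hJ = hJ *m hL;
  hEL : hE *m hL = hL *m hE }.

Definition inV X (k : int) (v : 'cV[R]_(hd X)) := hE X *m v = v /\ homv (@hg X) k v.

Definition hB X (u v : 'cV[R]_(hd X)) : R := (u^T *m hJ X *m v) 0 0.

(** Injectivity is enough, since the form makes complementary degrees equidimensional
    ([HL_surj]). *)
Definition hard_lefschetz X := forall k j : nat, (k + k + j)%N = hn X ->
  forall v, inV k%:Z v -> hL X ^+ j *m v = 0 -> v = 0.

(** The sign is tied to the degree k inside the ambient graded space, not counted from the lowest
    nonzero degree of the image of [hE]; hence summands inherit the relations without a change of
    sign. *)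
Definition hodge_riemann X := forall k j : nat, (k + k + j)%N = hn X ->
  forall v, inV k%:Z v -> hL X ^+ j.+1 *m v = 0 -> v != 0 ->
  0 < (-1) ^+ k * hB v (hL X ^+ j *m v).

Definition HLR X := hard_lefschetz X /\ hodge_riemann X.

Variable X : hspace.
Implicit Types (u v w x y : 'cV[R]_(hd X)).
Notation L := (hL X).
Notation J := (hJ X).
Notation E := (hE X).
Notation n := (hn X).

Lemma mulX_comp i j v : L ^+ i *m (L ^+ j *m v) = L ^+ (i + j) *m v.
Proof. by rewrite mulmxA exprD mulmxE. Qed.

Lemma mulXS j v : L ^+ j.+1 *m v = L ^+ j *m (L *m v).
Proof. by rewrite exprSr mulmxA mulmxE. Qed.

Lemma mulXSl j v : L ^+ j.+1 *m v = L *m (L ^+ j *m v).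
Proof. by rewrite exprS mulmxA mulmxE. Qed.

Lemma hBsym u v : hB u v = hB v u.
Proof.
by rewrite /hB -[LHS]trace_mx11 -mxtrace_tr !trmx_mul hJ_tr trmxK mulmxA trace_mx11.
Qed.

Lemma hB_mx11 (A B : 'M[R]_1) : (A + B) 0 0 = A 0 0 + B 0 0.
Proof. by rewrite mxE. Qed.

Lemma hBDl u v w : hB (u + v) w = hB u w + hB v w.
Proof. by rewrite /hB [(u + v)^T]raddfD /= !mulmxDl hB_mx11. Qed.
Lemma hBDr u v w : hB w (u + v) = hB w u + hB w v.
Proof. by rewrite hBsym hBDl !(hBsym w). Qed.
Lemma hBZl c u w : hB (c *: u) w = c * hB u w.
Proof. by rewrite /hB [(c *: u)^T]linearZ /= -!scalemxAl mxE. Qed.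
Lemma hBZr c u w : hB w (c *: u) = c * hB w u.
Proof. by rewrite hBsym hBZl hBsym. Qed.
Lemma hB0l w : hB 0 w = 0.
Proof. by rewrite -(scale0r (0 : 'cV_(hd X))) hBZl mul0r. Qed.
Lemma hB0r w : hB w 0 = 0.
Proof. by rewrite hBsym hB0l. Qed.

Lemma hB_L u v : hB (L *m u) v = hB u (L *m v).
Proof. by rewrite /hB trmx_mul -!mulmxA (mulmxA L^T) hL_adj !mulmxA. Qed.

Lemma hB_LX j u v : hB (L ^+ j *m u) v = hB u (L ^+ j *m v).
Proof.
elim: j u v => [|j IH] u v; first by rewrite expr0 !mul1mx.
by rewrite exprS -mulmxE -mulmxA hB_L IH mulmxA mulmxE -exprSr exprS.
Qed.

Lemma hEX j : E *m L ^+ j = L ^+ j *m E.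
Proof.
elim: j => [|j IH]; first by rewrite expr0 mul1mx mulmx1.
by rewrite exprS -mulmxE mulmxA hEL -mulmxA IH mulmxA.
Qed.

Lemma hg_le (i : 'I_(hd X)) : (hg i <= n)%N.
Proof.
have : (J *m J) i i != 0 by rewrite hJK mxE eqxx oner_eq0.
rewrite mxE => /sum_neq0[j]; rewrite mulf_eq0 negb_or => /andP[/hJ_deg <- _].
exact: leq_addr.
Qed.

Lemma inV_out (k : int) v : inV k v -> (k < 0) || (n%:Z < k) -> v = 0.
Proof.
move=> [_ h] hk; apply/colP => i; rewrite mxE; apply/eqP.
apply: contraTT hk => /h <-; have := hg_le i; lia.
Qed.

Lemma inV0 k : inV k (0 : 'cV[R]_(hd X)).
Proof. by split; [rewrite mulmx0 | move=> i; rewrite mxE eqxx]. Qed.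

Lemma inVD k u v : inV k u -> inV k v -> inV k (u + v).
Proof.
move=> [Eu hu] [Ev hv]; split; first by rewrite mulmxDr Eu Ev.
by move: hu hv; rewrite !homvP mulmxDr => -> ->.
Qed.

Lemma inVZ k c u : inV k u -> inV k (c *: u).
Proof.
move=> [Eu hu]; split; first by rewrite -scalemxAr Eu.
by move: hu; rewrite !homvP -scalemxAr => ->.
Qed.

Lemma inVB k u v : inV k u -> inV k v -> inV k (u - v).
Proof. by move=> hu hv; rewrite -scaleN1r; apply: inVD => //; apply: inVZ. Qed.

Lemma inVL k j v : inV k v -> inV (k + j%:Z) (L ^+ j *m v).
Proof.
move=> [Ev hv]; split; first by rewrite mulmxA hEX -mulmxA Ev.
by apply: homv_mul hv; apply/shiftmX/hL_deg.
Qed.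

Definition hP (k : int) : 'M[R]_(hd X) := gproj R (@hg X) k *m E.

Lemma hP_idem k : hP k *m hP k = hP k.
Proof.
rewrite /hP -mulmxA (mulmxA E) -(gproj_comm _ (@hE_deg X)) -!mulmxA hE_idem.
by rewrite mulmxA gproj_idem.
Qed.

Lemma inVP k v : inV k v <-> hP k *m v = v.
Proof.
split=> [[Ev /homvP hv]|h]; first by rewrite -mulmxA Ev hv.
have Ev : E *m v = v.
  have EP : E *m hP k = hP k.
    by rewrite /hP mulmxA -(gproj_comm _ (@hE_deg X)) -mulmxA hE_idem.
  by rewrite -h mulmxA EP.
by split=> //; apply/homvP; rewrite -[in LHS]Ev mulmxA.
Qed.

Lemma inV_P k v : inV k (hP k *m v).
Proof. by apply/inVP; rewrite mulmxA hP_idem. Qed.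

Lemma hP_dual (k : int) : (hP k)^T = J *m hP (n%:Z - k) *m J.
Proof.
have EJ : E^T = J *m E *m J by rewrite -hE_adj -mulmxA hJK mulmx1.
have Jg : gproj R (@hg X) k *m J = J *m gproj R (@hg X) (n%:Z - k).
  apply/matrixP => i j; rewrite mul_diag_mx mul_mx_diag !mxE.
  have [->|/hJ_deg <-] := eqVneq (J i j) 0; first by rewrite mulr0 mul0r.
  by rewrite mulrC; congr (_ * _%:R); rewrite PoszD; lia.
rewrite /hP trmx_mul tr_diag_mx EJ -/(gproj _ _ _) (gproj_comm _ (@hE_deg X)).
rewrite -!mulmxA; congr (_ *m (_ *m _)).
have : J *m (gproj R (@hg X) k *m J) *m J = J *m (J *m gproj R (@hg X) (n%:Z - k)) *m J.
  by rewrite Jg.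
by rewrite !mulmxA hJK mul1mx -!mulmxA hJK mulmx1.
Qed.

Lemma hP_rank (k : int) : \rank (hP (n%:Z - k)) = \rank (hP k).
Proof.
rewrite -(mxrank_tr (hP k)) hP_dual.
have Jun : J \in unitmx by have /mulmx1_unit[] := hJK X.
apply/esym; rewrite mxrankMfree ?row_free_unit // -[LHS]mxrank_tr trmx_mul.
by rewrite mxrankMfree ?mxrank_tr // row_free_unit unitmx_tr.
Qed.

Lemma inV_decomp v : hE X *m v = v ->
  v = \sum_(k < n.+1) hP k%:Z *m v.
Proof.
move=> Ev; rewrite -mulmx_suml /hP -mulmx_suml.
rewrite [X in X *m _ *m _](_ : _ = 1%:M) ?mul1mx ?Ev //.
apply/matrixP => i j; rewrite summxE (bigD1 (inord (hg i))) //= !mxE.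
rewrite eqz_nat inordK ?ltnS ?hg_le // eqxx big1 ?addr0 // => k.
rewrite -val_eqE /= inordK ?ltnS ?hg_le // => ne; rewrite !mxE.
by rewrite eqz_nat eq_sym (negbTE ne) mul0rn.
Qed.

Hypothesis HL : hard_lefschetz X.

(** An injective map between spaces which have the same dimension by [hP_rank]. *)
Lemma HL_surj (k j : nat) y : (k + k + j)%N = n -> inV (k%:Z + j%:Z) y ->
  exists2 x, inV k%:Z x & L ^+ j *m x = y.
Proof.
move=> kj hy; pose M := L ^+ j *m hP k%:Z.
have EM : hP (k%:Z + j%:Z) *m M = M.
  apply/matrixP => a b; have /inVP := inVL j (inV_P k%:Z (delta_mx b 0)).
  rewrite (mulmxA (L ^+ j)) -/M mulmxA -!colE => /colP/(_ a).
  by rewrite ![col _ _ _ _]mxE.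
have ker0 : (((hP k%:Z)^T :&: kermx (L ^+ j)^T) <= (0 : 'M_(hd X)))%MS.
  apply/rV_subP => v; rewrite sub_capmx => /andP[/submxP[z Ez] /sub_kermxP kv].
  have hv : v^T = hP k%:Z *m z^T by rewrite Ez trmx_mul trmxK.
  suff -> : v = 0 by exact: sub0mx.
  apply: trmx_inj; rewrite trmx0; apply: (HL kj); rewrite hv; first exact: inV_P.
  by rewrite -hv -[L ^+ j]trmxK -trmx_mul kv trmx0.
have rM : \rank M = \rank (hP (k%:Z + j%:Z)).
  rewrite -mxrank_tr trmx_mul.
  have := mxrank_mul_ker (hP k%:Z)^T (L ^+ j)^T.
  move: ker0; rewrite submx0 => /eqP ->; rewrite mxrank0 addn0 => ->.
  rewrite mxrank_tr -hP_rank; congr (\rank (hP _)); lia.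
have sub : (M^T <= (hP (k%:Z + j%:Z))^T)%MS.
  by rewrite -[in X in (X <= _)%MS]EM trmx_mul submxMl.
have /submxP[Z EZ] : ((hP (k%:Z + j%:Z))^T <= M^T)%MS.
  by rewrite -(geq_leqif (mxrank_leqif_sup sub)) !mxrank_tr rM.
exists (hP k%:Z *m (Z^T *m y)); first exact: inV_P.
rewrite mulmxA -/M; move/inVP: hy => {2}<-.
by rewrite -[X in _ = X *m _]trmxK EZ trmx_mul trmxK mulmxA.
Qed.

Lemma HL_inj (k j i : nat) v : (k + k + j)%N = n -> (i <= j)%N -> inV k%:Z v ->
  L ^+ i *m v = 0 -> v = 0.
Proof.
move=> kj ij hv h; apply: (HL kj hv).
by rewrite -(subnK ij) -mulX_comp h mulmx0.
Qed.

(** [v1] is obtained by solving L^(j + 2) v1 = L^(j + 1) v. *)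
Lemma HL_prim (k j : nat) v : (k + k + j)%N = n -> inV k%:Z v ->
  exists v0 v1, [/\ inV k%:Z v0, inV (k%:Z - 1) v1, v = v0 + L *m v1
    & L ^+ j.+1 *m v0 = 0].
Proof.
move=> kj hv; case: k kj hv => [|k] kj hv.
  exists v, 0; split=> //; [exact: inV0 | by rewrite mulmx0 addr0 |].
  by apply: (inV_out (inVL j.+1 hv)); lia.
have e : (k + k + j.+2)%N = n by lia.
have hk : inV (k%:Z + j.+2%:Z) (L ^+ j.+1 *m v).
  by have := inVL j.+1 hv; rewrite (_ : _ + _ = k%:Z + j.+2%:Z) //; lia.
have [y hy Ey] := HL_surj e hk.
exists (v - L *m y), y; split.
- apply: inVB => //; rewrite -[L]expr1 (_ : k.+1%:Z = k%:Z + 1%:Z); last lia.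
  exact: inVL.
- by rewrite (_ : k.+1%:Z - 1 = k%:Z) //; lia.
- by rewrite subrK.
- by rewrite mulmxBr -mulXS Ey subrr.
Qed.

End HodgeSpaces.
Arguments inV {R X} k v.
Arguments hB {R X} u v.
Arguments hP {R} X k.

(** * Morphisms of Hodge spaces: vanishing and regularity *)

Section HodgeMorphisms.
Variable (R : realType).
Implicit Types (X Y : hspace R).

Definition ishom X Y (D : int) (f : 'M[R]_(hd Y, hd X)) :=
  [/\ shiftm (@hg R X) (@hg R Y) D f, f *m hL X = hL Y *m f, f *m hE X = f
    & hE Y *m f = f].

Definition hadj X Y (f : 'M[R]_(hd Y, hd X)) : 'M[R]_(hd X, hd Y) :=
  hJ X *m f^T *m hJ Y.

Lemma hB_adj X Y (f : 'M[R]_(hd Y, hd X)) u v :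
  hB (f *m u) v = hB u (hadj f *m v).
Proof.
by rewrite /hB /hadj trmx_mul !mulmxA -(mulmxA u^T (hJ X)) hJK mulmx1.
Qed.

Lemma hom_LX X Y D f j (v : 'cV[R]_(hd X)) : ishom (X := X) (Y := Y) D f ->
  f *m (hL X ^+ j *m v) = hL Y ^+ j *m (f *m v).
Proof.
move=> [_ fL _ _]; elim: j v => [|j IH] v; first by rewrite !expr0 !mul1mx.
by rewrite !mulXS IH !mulmxA -!(mulmxA (hL Y ^+ j)) fL.
Qed.

Lemma hom_inV X Y D f k v : ishom (X := X) (Y := Y) D f -> inV k v ->
  inV (k + D) (f *m v).
Proof.
move=> [fD _ _ Ef] [Ev hv]; split; first by rewrite mulmxA Ef.
exact: homv_mul hv.
Qed.

Lemma hom_comp X Y Z D D' f f' : ishom (X := Y) (Y := Z) D f ->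
  ishom (X := X) (Y := Y) D' f' -> ishom (X := X) (Y := Z) (D' + D) (f *m f').
Proof.
move=> [fD fL fE Ef] [fD' fL' fE' Ef']; split.
- exact: shiftmM fD'.
- by rewrite -mulmxA fL' !mulmxA fL.
- by rewrite -mulmxA fE'.
- by rewrite mulmxA Ef.
Qed.

Lemma hom_adj X Y D f : ishom (X := X) (Y := Y) D f ->
  ishom (X := Y) (Y := X) (D + (hn X)%:Z - (hn Y)%:Z) (hadj f).
Proof.
move=> [fD fL fE Ef]; rewrite /hadj.
have EJ (Z : hspace R) : (hE Z)^T = hJ Z *m hE Z *m hJ Z.
  by rewrite -hE_adj -mulmxA hJK mulmx1.
have LJ (Z : hspace R) : (hL Z)^T = hJ Z *m hL Z *m hJ Z.
  by rewrite -hL_adj -mulmxA hJK mulmx1.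
have JJl (Z : hspace R) m (A : 'M_(hd Z, m)) : hJ Z *m (hJ Z *m A) = A.
  by rewrite mulmxA hJK mul1mx.
split.
- move=> i j; rewrite mxE => /sum_neq0[k]; rewrite mulf_eq0 negb_or => /andP[].
  rewrite mxE => /sum_neq0[l]; rewrite mulf_eq0 negb_or mxE => /andP[/hJ_deg <- /fD El].
  by move=> /hJ_deg <-; rewrite !PoszD; lia.
- have := congr1 trmx fL; rewrite !trmx_mul !LJ => /(congr1 (mulmx (hJ X))).
  rewrite -!mulmxA JJl => /(congr1 (mulmx^~ (hJ Y))) /=.
  by rewrite -!mulmxA hJK mulmx1 !mulmxA => ->.
- by rewrite -[in RHS]Ef trmx_mul EJ -!mulmxA hJK mulmx1.
- by rewrite -[in RHS]fE trmx_mul EJ -!mulmxA JJl.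
Qed.

Lemma mx_eq0_cV d d' (f : 'M[R]_(d', d)) : (forall v : 'cV_d, f *m v = 0) -> f = 0.
Proof.
by move=> h; apply/matrixP => i j; have /colP/(_ i) := h (delta_mx j 0); rewrite -colE !mxE.
Qed.

(** Vectors above the middle are images under powers of L of vectors below it. *)
Lemma hom_eq_inV X Y D f : hard_lefschetz X -> ishom (X := X) (Y := Y) D f ->
  (forall k j : nat, (k + k + j)%N = hn X -> forall v, inV k%:Z v -> f *m v = 0) ->
  f = 0.
Proof.
move=> HL hf h; apply: mx_eq0_cV => v; case: (hf) => _ _ fE _; rewrite -fE -mulmxA.
rewrite (@inV_decomp _ X (hE X *m v)); last by rewrite mulmxA hE_idem.
rewrite mulmx_sumr big1 // => -[k hk] _ /=.
have {hk} hk : (k <= hn X)%N by [].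
have := inV_P k%:Z (hE X *m v); move: (hP X k%:Z *m _) => {}v hv.
have [le|lt] := leqP (k + k) (hn X); first by apply: (h k (hn X - (k + k))%N) => //; lia.
have [||x hx <-] := @HL_surj _ X HL (hn X - k)%N (k + k - hn X)%N v; first by lia.
  by rewrite (_ : _ + _ = k%:Z) //; lia.
rewrite (hom_LX _ _ hf) (h (hn X - k)%N (k + k - hn X)%N) ?mulmx0 //; lia.
Qed.

(** The inequality says that f has negative centred degree. The image of a primitive vector is then
    killed by a power of L which is still injective in its degree. *)
Lemma hom_neg_eq0 X Y D f : hard_lefschetz X -> hard_lefschetz Y ->
  ishom (X := X) (Y := Y) D f -> D + D + (hn X)%:Z < (hn Y)%:Z -> f = 0.
Proof.
move=> HX HY hf hD; apply: (hom_eq_inV HX hf); elim=> [|k IH] j kj v hv.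
all: have [v0 [v1 [hv0 hv1 -> Lv0]]] := HL_prim HX kj hv.
all: have fv0 : f *m v0 = 0.
1,3: have hf0 := hom_inV hf hv0;
  have Lf0 : hL Y ^+ j.+1 *m (f *m v0) = 0 by rewrite -(hom_LX _ _ hf) Lv0 mulmx0.
- case E : (0 + D) hf0 => [k2|k2] hf0; last by apply: (inV_out hf0).
  by apply: (@HL_inj _ Y HY k2 (hn Y - (k2 + k2))%N j.+1) => //; lia.
- case E : (k.+1%:Z + D) hf0 => [k2|k2] hf0; last by apply: (inV_out hf0).
  by apply: (@HL_inj _ Y HY k2 (hn Y - (k2 + k2))%N j.+1) => //; lia.
- by rewrite (inV_out hv1) // mulmx0 addr0.
- rewrite mulmxDr fv0 add0r -[hL X]expr1 (hom_LX _ _ hf).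
  rewrite (IH j.+2) ?mulmx0 //; first by lia.
  by move: hv1; rewrite (_ : k.+1%:Z - 1 = k%:Z) //; lia.
Qed.

(** In centred degree 0, f sends primitive vectors to primitive vectors, on which the form of Y is
    definite; so a primitive vector killed by the adjoint composed with f is killed by f. The rest
    is induction along v = v0 + L v1. *)
Lemma hom_reg_inV X Y D f : HLR X -> HLR Y -> ishom (X := X) (Y := Y) D f ->
  D + D + (hn X)%:Z = (hn Y)%:Z ->
  forall k j : nat, (k + k + j)%N = hn X -> forall v, inV k%:Z v ->
  hadj f *m (f *m v) = 0 -> f *m v = 0.
Proof.
move=> [HX RX] [HY RY] hf hD.
have hg := hom_comp (hom_adj hf) hf.
have Lg j (v : 'cV[R]_(hd X)) : hadj f *m (f *m (hL X ^+ j *m v)) = hL X ^+ j *m (hadj f *m (f *m v)).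
  by rewrite !(mulmxA (hadj f)) (hom_LX _ _ hg).
have prim k j v0 : (k + k + j)%N = hn X -> inV k%:Z v0 -> hL X ^+ j.+1 *m v0 = 0 ->
    hadj f *m (f *m v0) = 0 -> f *m v0 = 0.
  move=> kj hv0 Lv0 gv0; have hf0 := hom_inV hf hv0.
  have Lf0 : hL Y ^+ j.+1 *m (f *m v0) = 0 by rewrite -(hom_LX _ _ hf) Lv0 mulmx0.
  case E : (k%:Z + D) hf0 => [k2|k2] hf0; last by apply: (inV_out hf0).
  apply/eqP; apply: contraT => nz.
  have kj2 : (k2 + k2 + j)%N = hn Y by lia.
  have := RY k2 j kj2 _ hf0 Lf0 nz.
  by rewrite -(hom_LX _ _ hf) hB_adj Lg gv0 mulmx0 hB0r mulr0 ltxx.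
have fD (v0 v1 : 'cV[R]_(hd X)) : hadj f *m (f *m (v0 + hL X *m v1)) =
    hadj f *m (f *m v0) + hL X *m (hadj f *m (f *m v1)).
  by rewrite !mulmxDr -[X in f *m (X *m v1)]expr1 Lg expr1.
elim=> [|k IH] j kj v hv gv.
all: have [v0 [v1 [hv0 hv1 Ev Lv0]]] := HL_prim HX kj hv.
  move: gv Ev; rewrite (inV_out hv1) // mulmx0 addr0 => gv Ev.
  by rewrite Ev in gv *; apply: (prim 0%N j).
have {}hv1 : inV k%:Z v1 by move: hv1; rewrite (_ : k.+1%:Z - 1 = k%:Z) //; lia.
have kj2 : (k + k + j.+2)%N = hn X by lia.
have g1 : hadj f *m (f *m v1) = 0.
  have hi : inV k%:Z (hadj f *m (f *m v1)).
    have := hom_inV hg hv1; rewrite mulmxA (_ : k%:Z + _ = k%:Z) //; lia.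
  apply: (HX _ _ kj2 _ hi); rewrite mulXS.
  move: gv; rewrite Ev fD => /(congr1 (mulmx (hL X ^+ j.+1))).
  by rewrite mulmxDr -Lg Lv0 !mulmx0 add0r.
have g0 : hadj f *m (f *m v0) = 0.
  by move: gv; rewrite Ev fD g1 mulmx0 addr0.
rewrite Ev mulmxDr (prim _ _ _ kj hv0 Lv0 g0) add0r.
by rewrite -[hL X]expr1 (hom_LX _ _ hf) (IH _ kj2) ?mulmx0.
Qed.

(** This says that the adjoint composed with f has no nilpotent part, which is what
    [regular_mx_inverse] asks for. *)
Lemma hom_reg X Y D f : HLR X -> HLR Y -> ishom (X := X) (Y := Y) D f ->
  D + D + (hn X)%:Z = (hn Y)%:Z ->
  forall v : 'cV[R]_(hd X), hadj f *m (f *m v) = 0 -> f *m v = 0.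
Proof.
move=> HX HY hf hD v gv; case: (hf) => fD fL fE Ef.
have hg := hom_comp (hom_adj hf) hf.
have [gD _ _ _] := hg.
rewrite -fE -mulmxA (@inV_decomp _ X (hE X *m v)); last by rewrite mulmxA hE_idem.
rewrite mulmx_sumr big1 // => -[k hk] _ /=.
have {hk} hk : (k <= hn X)%N by [].
have hv := inV_P k%:Z (hE X *m v).
have gv' : hadj f *m (f *m (hP X k%:Z *m (hE X *m v))) = 0.
  rewrite /hP -!mulmxA (mulmxA (hE X) (hE X)) hE_idem (mulmxA _ (hE X)).
  rewrite (gproj_comm _ (@hE_deg R X)) -(mulmxA (hE X)) (mulmxA f) fE.
  have D0 : D + (D + (hn X)%:Z - (hn Y)%:Z) = 0 by lia.
  rewrite D0 in gD; rewrite !mulmxA -(gproj_comm _ gD).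
  by rewrite -(mulmxA (gproj _ _ _)) -(mulmxA (hadj f)) gv mulmx0.
move: (hP X k%:Z *m _) hv gv' => {gv}v hv gv.
have [le|lt] := leqP (k + k) (hn X).
  by apply: (hom_reg_inV HX HY hf hD (k := k) (j := (hn X - (k + k))%N)) => //; lia.
have [||x hx Ex] := @HL_surj _ X HX.1 (hn X - k)%N (k + k - hn X)%N v; first by lia.
  by rewrite (_ : _ + _ = k%:Z) //; lia.
have kj : (hn X - k + (hn X - k) + (k + k - hn X))%N = hn X by lia.
rewrite -Ex (hom_LX _ _ hf) (hom_reg_inV HX HY hf hD kj hx) ?mulmx0 //.
apply: (HX.1 _ _ kj).
  have := hom_inV hg hx; rewrite mulmxA (_ : (hn X - k)%N%:Z + _ = (hn X - k)%N%:Z) //; lia.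
by rewrite (mulmxA (hadj f)) -(hom_LX _ _ hg) Ex -(mulmxA (hadj f)).
Qed.

End HodgeMorphisms.

(** * Extension by a second copy, and the product with a projective line *)

Section Extension.
Variable (R : realType).
Implicit Types (X : hspace R).

Definition compat X (M : 'M[R]_(hd X)) :=
  [/\ shiftm (@hg R X) (@hg R X) 0 M, M^T *m hJ X = hJ X *m M
    & hE X *m M = M *m hE X].

Lemma compat_affine X M a b : compat (X := X) M -> compat (X := X) (a *: M + b *: 1%:M).
Proof.
move=> [MD MJ EM]; split.
- by apply: shiftmD; apply: shiftmZ => //; exact: shiftm1.
- rewrite raddfD /= ![(_ *: _)^T]linearZ /= trmx1 mulmxDl mulmxDr -!scalemxAl -!scalemxAr.
  by rewrite MJ mul1mx mulmx1.
- by rewrite mulmxDl mulmxDr -!scalemxAl -!scalemxAr EM mul1mx mulmx1.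
Qed.

Lemma block_shift d d' (g : 'I_d -> nat) (g' : 'I_d' -> nat) D
  (A B C E : 'M[R]_(d', d)) :
  shiftm g g' D A -> shiftm g g' (D + 1) B -> shiftm g g' (D - 1) C ->
  shiftm g g' D E -> shiftm (egr g) (egr g') D (block_mx A B C E).
Proof.
move=> hA hB hC hE i j; rewrite -[i]splitK -[j]splitK.
case: (fintype.split i) => {}i; case: (fintype.split j) => {}j /=;
  rewrite ?egr_lshift ?egr_rshift ?PoszS.
- by rewrite block_mxEul => /hA.
- by rewrite block_mxEur => /hB ->; ring.
- by rewrite block_mxEdl => /hC ->; ring.
- by rewrite block_mxEdr => /hE ->; ring.
Qed.

Lemma ext_deg d (g : 'I_d -> nat) m (J : 'M[R]_d) :
  (forall i j, J i j != 0 -> (g i + g j)%N = m) ->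
  forall i j, (block_mx 0 J J 0 : 'M_(d + d)) i j != 0 ->
  (egr g i + egr g j)%N = m.+1.
Proof.
move=> h i j; rewrite -[i]splitK -[j]splitK.
case: (fintype.split i) => {}i; case: (fintype.split j) => {}j /=;
  rewrite ?egr_lshift ?egr_rshift.
- by rewrite block_mxEul mxE eqxx.
- by rewrite block_mxEur => /h <-; rewrite addnS.
- by rewrite block_mxEdl => /h <-; rewrite addSn.
- by rewrite block_mxEdr mxE eqxx.
Qed.

(** The reduced form of an extension by one letter. [M] need not commute with [hL X]; for M = 1 this
    is the tensor product with the cohomology of a projective line. *)
Definition extH X M (c : compat (X := X) M) : hspace R.
Proof.
refine (@HSpace R (hd X + hd X) (hn X).+1 (egr (@hg R X))
  (block_mx 0 (hJ X) (hJ X) 0) (block_mx (hE X) 0 0 (hE X))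
  (block_mx (hL X) 0 M (hL X)) _ _ _ _ _ _ _ _ _).
- by rewrite tr_block_mx !trmx0 hJ_tr.
- by rewrite mulmx_block !mul0mx !mulmx0 hJK !addr0 !add0r -scalar_mx_block.
- exact/ext_deg/hJ_deg.
- by rewrite mulmx_block !mul0mx !mulmx0 hE_idem !addr0 !add0r.
- by rewrite tr_block_mx !trmx0 !mulmx_block !mul0mx !mulmx0 !addr0 !add0r hE_adj.
- by apply: block_shift; rewrite ?addr0 ?add0r; try exact: shiftm0; exact: hE_deg.
- case: c => cD _ _; apply: block_shift; try exact: shiftm0; try exact: hL_deg.
  by rewrite subrr.
- case: c => _ cJ _; rewrite tr_block_mx !trmx0 !mulmx_block.
  by rewrite !mul0mx !mulmx0 !addr0 !add0r hL_adj cJ.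
- case: c => _ _ cE; rewrite !mulmx_block !mul0mx !mulmx0 !addr0 !add0r.
  by rewrite hEL cE.
Defined.

Lemma inV_ext X M (c : compat (X := X) M) k u w :
  inV (X := extH c) k (col_mx u w) <-> inV k u /\ inV (k - 1) w.
Proof.
have h0 : homv (@hg R (extH c)) k (col_mx u w) <->
    homv (@hg R X) k u /\ homv (@hg R X) (k - 1) w.
  split=> [h|[h h'] i].
    split=> i hi.
      by have := h (lshift _ i); rewrite col_mxEu /= egr_lshift => /(_ hi).
    have := h (rshift _ i); rewrite col_mxEd /= egr_rshift => /(_ hi) <-.
    by rewrite PoszS addrK.
  rewrite -[i]splitK; case: (fintype.split i) => {}i /=.
    by rewrite col_mxEu egr_lshift => /h.
  by rewrite col_mxEd egr_rshift PoszS => /h' ->; rewrite subrK.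
rewrite /inV h0 /= mul_block_col !mul0mx addr0 add0r.
split=> [[/eq_col_mx[-> ->] [h1 h2]]|[[-> h1] [-> h2]]] //.
Qed.

Lemma hB_ext X M (c : compat (X := X) M) u w u' w' :
  hB (X := extH c) (col_mx u w) (col_mx u' w') = hB u w' + hB w u'.
Proof.
rewrite /hB /= tr_col_mx mul_row_block !mulmx0 add0r addr0 mul_row_col.
by rewrite hB_mx11 addrC.
Qed.

Lemma ext_LX1 X (c : compat (X := X) 1%:M) j (u w : 'cV[R]_(hd X)) :
  hL (extH c) ^+ j.+1 *m col_mx u w =
  col_mx (hL X ^+ j.+1 *m u) (hL X ^+ j.+1 *m w + (j.+1)%:R *: (hL X ^+ j *m u)).
Proof.
elim: j u w => [|j IH] u w.
  by rewrite !expr1 expr0 scale1r /= mul_block_col mul0mx addr0 !mul1mx addrC.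
rewrite mulXS /= mul_block_col mul0mx addr0 mul1mx IH -!mulXS; congr col_mx.
rewrite mulmxDr -[in X in _ + X + _ = _]mulXS [(j.+2)%:R]mulrS scalerDl scale1r.
by rewrite [_ *m u + _]addrC -addrA.
Qed.

Lemma compat1 X : compat (X := X) 1%:M.
Proof. by split; [exact: shiftm1 | rewrite trmx1 mul1mx mulmx1 | rewrite mul1mx mulmx1]. Qed.

(** The primitive vectors of the product are determined explicitly: (u, w) with u = u0 + L u1 is
    primitive only if w = - (j + 2) u1, and its form is a positive combination of those of u0 and
    u1, which lie in consecutive degrees and so enter with opposite signs. *)
Lemma ext_product X (c : compat (X := X) 1%:M) : HLR X -> HLR (extH c).
Proof.
move=> [HX RX]; have inVk (k : nat) u : inV (k.+1%:Z - 1) u -> inV (X := X) k%:Z u.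
  by rewrite (_ : k.+1%:Z - 1 = k%:Z) //; lia.
split.
  move=> k j kj v; rewrite -[v]vsubmxK inV_ext; set u := usubmx v; set w := dsubmx v.
  case: j kj => [|j] kj [hu hw]; first by rewrite expr0 mul1mx.
  rewrite ext_LX1 => /eqP; rewrite col_mx_eq0 => /andP[/eqP Lu /eqP Lw].
  have kj' : (k + k + j)%N = hn X by move: kj => /=; lia.
  have w0 : w = 0.
    case: k kj kj' hu hw => [|k] kj kj' hu hw; first by apply: (inV_out hw).
    apply: (@HX k j.+2 _ _ (inVk _ _ hw)); first by lia.
    move/(congr1 (mulmx (hL X))): Lw; rewrite mulmxDr -scalemxAr mulmx0.
    by rewrite -!mulXSl Lu scaler0 addr0.
  move/eqP: Lw; rewrite w0 mulmx0 add0r; rewrite scaler_eq0 pnatr_eq0 /= => /eqP Lu'.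
  by rewrite (HX k j kj' u hu Lu') col_mx0.
move=> k j kj v; rewrite -[v]vsubmxK inV_ext; set u := usubmx v; set w := dsubmx v.
move=> [hu hw]; rewrite ext_LX1 => /eqP; rewrite col_mx_eq0 => /andP[/eqP Lu /eqP Lw] nz.
case: j kj Lu Lw => [|j] kj Lu Lw.
  case: k kj hu hw => [|k] kj hu hw; first by move: kj => /=; lia.
  have {}hw := inVk _ _ hw; have kj' : (k + k + 1)%N = hn X by move: kj => /=; lia.
  have Eu : u = - (hL X *m w).
    move: Lw; rewrite expr1 expr0 mul1mx scale1r => /eqP; rewrite addrC addr_eq0.
    by move/eqP.
  rewrite expr0 mul1mx hB_ext Eu -scaleN1r hBZl hBZr hBsym exprS.
  have w0 : w != 0.
    by apply: contraNneq nz => w0; rewrite Eu w0 mulmx0 oppr0 col_mx0.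
  have LLw : hL X ^+ 2 *m w = 0.
    move: Lu; rewrite Eu expr1 mulmxN => /eqP; rewrite oppr_eq0 mulmxA mulmxE -expr2.
    by move/eqP.
  by have := RX k 1%N kj' w hw LLw w0; rewrite expr1; lra.
rewrite ext_LX1 hB_ext hBDr hBZr -(hB_LX _ w u) (hBsym u (_ *m w)).
have kj' : (k + k + j)%N = hn X by move: kj => /=; lia.
have [u0 [u1 [hu0 hu1 Eu Lu0]]] := HL_prim HX kj' hu.
have fin0 : u1 = 0 -> w = 0 -> 0 < (-1) ^+ k * (hB (hL X ^+ j.+1 *m w) u +
    j.+1%:R * hB u (hL X ^+ j *m u) + hB (hL X ^+ j.+1 *m w) u).
  move=> u10 w0; rewrite w0 mulmx0 hB0l add0r addr0 mulrCA mulr_gt0 ?ltr0n //.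
  move: Eu Lu0; rewrite u10 mulmx0 addr0 => <- Lu0; apply: RX => //.
  by apply: contraNneq nz => u00; rewrite u00 w0 col_mx0.
case: k kj kj' hu hw hu0 hu1 fin0 => [|k] kj kj' hu hw hu0 hu1 fin0.
  by apply: fin0; [apply: (inV_out hu1) | apply: (inV_out hw)].
have {}hw := inVk _ _ hw; have {}hu1 := inVk _ _ hu1.
have kj2 : (k + k + j.+2)%N = hn X by lia.
have L1 : hL X ^+ j.+3 *m u1 = 0.
  move: Lu; rewrite Eu mulmxDr -mulXS => E; rewrite -E.
  by rewrite (mulXSl j.+1 u0) Lu0 mulmx0 add0r.
(* From L^(j + 2) w + (j + 2) L^(j + 1) u = 0 and L^(j + 1) u0 = 0, as L^(j + 2) is injective in the
   degree of w. *)
have Ew : w = - (j.+2%:R *: u1).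
  apply/eqP; rewrite -subr_eq0 opprK; apply/eqP.
  apply: (HX _ _ kj2); first by apply: inVD => //; apply: inVZ.
  move: Lw; rewrite Eu mulmxDr -mulXS Lu0 add0r => <-.
  by rewrite mulmxDr -scalemxAr.
have [u10|u1n] := eqVneq u1 0.
  by apply: fin0 => //; rewrite Ew u10 scaler0 oppr0.
have P1 := RX k j.+2 kj2 u1 hu1 L1 u1n.
set b := hB u1 _ in P1.
have E1 : hB (hL X ^+ j.+1 *m w) u = - (j.+2%:R * b).
  have Eb : hB (hL X ^+ j.+1 *m u1) u = b.
    by rewrite Eu hBDr !hB_LX Lu0 hB0r add0r -mulXS.
  rewrite Ew mulmxN -scalemxAr -scaleN1r !hBZl Eb; ring.
have E2 : hB u (hL X ^+ j *m u) = hB u0 (hL X ^+ j *m u0) + b.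
  rewrite {1}Eu hBDl Eu !mulmxDr !hBDr -!mulXS.
  have -> : hB u0 (hL X ^+ j.+1 *m u1) = 0 by rewrite -hB_LX Lu0 hB0l.
  have -> : hB (hL X *m u1) (hL X ^+ j *m u0) = 0.
    by rewrite hB_L mulmxA mulmxE -exprS Lu0 hB0r.
  have -> : hB (hL X *m u1) (hL X ^+ j.+1 *m u1) = b.
    by rewrite hB_L mulmxA mulmxE -exprS.
  by rewrite addr0 add0r.
have P0 : 0 <= (-1) ^+ k.+1 * hB u0 (hL X ^+ j *m u0).
  have [->|u0n] := eqVneq u0 0; first by rewrite hB0l mulr0.
  exact/ltW/(RX k.+1 j kj').
have sg : (-1) ^+ k.+1 = - (-1) ^+ k :> R by rewrite exprS mulN1r.
rewrite E1 E2; move: P0; rewrite sg; set x := hB u0 _; set s := (-1) ^+ k in P1 *.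
have -> : - s * (- (j.+2%:R * b) + j.+1%:R * (x + b) - j.+2%:R * b) =
  (j.+1%:R : R) * (- s * x) + (2 * j.+2%:R - j.+1%:R) * (s * b) by ring.
move=> P0; apply: ltr_wpDl; first by rewrite mulr_ge0 ?ler0n.
apply: mulr_gt0 => //; rewrite [j.+2%:R]mulrS; have := ler0n R j.+1; lra.
Qed.

End Extension.

(** * The Hodge-Riemann relations read off from dimensions of definite subspaces *)

Section Signature.
Variable (R : realType).
Implicit Types (Z : hspace R).

Definition hrk Z (k : nat) : nat := \rank (hP Z k%:Z).

(** An alternating sum of dimensions: by the Lefschetz decomposition, the dimension of a maximal
    subspace of degree k on which the form has sign (-1)^k. It depends on graded dimensions only, so
    it is constant in a deformation. *)
Fixpoint hpk Z (k : nat) : nat :=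
  if k is k'.+1 then (hrk Z k - hpk Z k')%N else hrk Z 0.

Definition defsub Z (k j : nat) (s : R) (W : 'M[R]_(hd Z)) :=
  (W <= (hP Z k%:Z)^T)%MS /\ forall x : 'cV_(hd Z), (x^T <= W)%MS -> x != 0 ->
  0 < s * hB x (hL Z ^+ j *m x).

Lemma inV_sub Z (k : int) (x : 'cV_(hd Z)) : inV k x <-> (x^T <= (hP Z k)^T)%MS.
Proof.
split=> [/inVP <-|/submxP[z Ez]]; first by rewrite trmx_mul submxMl.
by rewrite -[x]trmxK Ez trmx_mul trmxK; exact: inV_P.
Qed.

Lemma inVS Z (k : nat) (x : 'cV_(hd Z)) : inV k%:Z x -> inV k.+1%:Z (hL Z *m x).
Proof. by move/(inVL 1%N); rewrite expr1 (_ : _ + _ = k.+1%:Z) //; lia. Qed.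

(** L is an isometry from degree k with L^(j + 2) to degree k + 1 with L^j; definiteness makes it
    injective on W. *)
Lemma defsub_image Z (k j : nat) s W : defsub (Z := Z) k j.+2 s W ->
  defsub (Z := Z) k.+1 j s (W *m (hL Z)^T) /\ \rank (W *m (hL Z)^T) = \rank W.
Proof.
move=> [sW pW].
have inW x : (x^T <= W *m (hL Z)^T)%MS -> exists2 y, (y^T <= W)%MS & x = hL Z *m y.
  case/submxP => z Ez; exists (z *m W)^T; first by rewrite trmxK submxMl.
  by rewrite -[x]trmxK Ez mulmxA trmx_mul trmxK.
split; [split|].
- apply/rV_subP => v; rewrite -[v]trmxK => /inW[y hy ->]; apply/inV_sub/inVS/inV_sub.
  exact: submx_trans sW.
- move=> x /inW[y hy ->] nz; rewrite hB_L -mulXSl -mulXS; apply: pW => //.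
  by apply: contraNneq nz => ->; rewrite mulmx0.
- have := mxrank_mul_ker W (hL Z)^T; rewrite (_ : (_ :&: _)%MS = 0) ?mxrank0 ?addn0 //.
  apply/eqP/rowV0P => v; rewrite sub_capmx => /andP[vW /sub_kermxP vL].
  apply: trmx_inj; rewrite trmx0; apply/eqP; apply: contraT => nz.
  have := pW v^T; rewrite trmxK => /(_ vW nz).
  rewrite mulXS -[hL Z]trmxK -trmx_mul vL trmx0 mulmx0 hB0r mulr0 ltxx.
  by [].
Qed.

Definition hprim Z (k j : nat) : 'M[R]_(hd Z) :=
  ((hP Z k%:Z)^T :&: kermx (hL Z ^+ j.+1)^T)%MS.

Lemma hprimP Z k j (x : 'cV_(hd Z)) :
  (x^T <= hprim Z k j)%MS <-> inV k%:Z x /\ hL Z ^+ j.+1 *m x = 0.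
Proof.
rewrite /hprim sub_capmx inV_sub; split=> [/andP[-> /sub_kermxP h]|[-> h]].
  by split=> //; apply: trmx_inj; rewrite trmx_mul h trmx0.
by apply/sub_kermxP; rewrite -trmx_mul h trmx0.
Qed.

Lemma hprim_rank Z (k j : nat) : hard_lefschetz Z -> (k.+1 + k.+1 + j)%N = hn Z ->
  (hrk Z k + \rank (hprim Z k.+1 j))%N = hrk Z k.+1.
Proof.
move=> HZ kj; have := mxrank_mul_ker (hP Z k.+1%:Z)^T (hL Z ^+ j.+1)^T.
rewrite -/(hprim _ _ _) mxrank_tr -/(hrk _ _) => <-; congr (_ + _)%N.
rewrite /hrk -hP_rank -mxrank_tr; apply/eqP; rewrite eqn_leq !mxrankS //; last first.
  apply/rV_subP => v; rewrite -[v]trmxK => /inV_sub hv.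
  have kj2 : (k + k + j.+2)%N = hn Z by lia.
  rewrite (_ : (hn Z)%:Z - k%:Z = k%:Z + j.+2%:Z) in hv; last by lia.
  have [x hx <-] := HL_surj HZ kj2 hv.
  rewrite mulXS trmx_mul; apply: submxMr; apply/inV_sub; exact: inVS.
apply/rV_subP => v /submxP[z]; rewrite mulmxA => ->.
rewrite -[z *m _]trmxK -trmx_mul; apply/inV_sub.
have := inVL j.+1 (inV_P (X := Z) k.+1%:Z z^T); rewrite trmx_mul trmxK.
by rewrite (_ : k.+1%:Z + _ = (hn Z)%:Z - k%:Z) //; lia.
Qed.

(** Degree k + 1 is the orthogonal sum of its primitive part and the image of degree k. As the
    expected sign alternates with the degree, subspaces of both signs have to be carried through the
    induction. *)
Lemma HLR_definite Z : HLR Z -> forall k j : nat, (k + k + j)%N = hn Z ->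
  [/\ (hpk Z k <= hrk Z k)%N,
    exists2 W, \rank W = hpk Z k & defsub (Z := Z) k j ((-1) ^+ k) W
  & exists2 W, \rank W = (hrk Z k - hpk Z k)%N &
      defsub (Z := Z) k j (- (-1) ^+ k) W].
Proof.
move=> [HZ RZ]; elim=> [|k IH] j kj.
  split=> //.
    exists (hP Z 0)^T; first by rewrite mxrank_tr.
    split=> // x /inV_sub hx nz; apply: RZ => //.
    by apply: (inV_out (inVL j.+1 hx)); lia.
  exists 0; rewrite ?mxrank0 /= ?subnn //.
  by split=> [|x]; [exact: sub0mx | rewrite submx0 -trmx0 (inj_eq trmx_inj) => /eqP ->; rewrite eqxx].
have kj2 : (k + k + j.+2)%N = hn Z by lia.
have [le1 [W1 r1 d1] [W2 r2 d2]] := IH _ kj2.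
have [d1' r1'] := defsub_image d1; have [d2' r2'] := defsub_image d2.
have le2 : (hpk Z k <= hrk Z k.+1)%N.
  by rewrite -r1 -r1' /hrk -(mxrank_tr (hP _ _)) mxrankS //; case: d1'.
have sg : (-1) ^+ k.+1 = - (-1) ^+ k :> R by rewrite exprS mulN1r.
have pr := hprim_rank HZ kj.
have cross (x0 x2 : 'cV_(hd Z)) : hL Z ^+ j.+1 *m x0 = 0 ->
    hB x0 (hL Z ^+ j *m (hL Z *m x2)) = 0.
  by move=> h; rewrite -mulXS -hB_LX h hB0l.
split=> /=; first exact: leq_subr.
  exists (hprim Z k.+1 j + W2 *m (hL Z)^T)%MS.
    have := mxrank_sum_cap (hprim Z k.+1 j) (W2 *m (hL Z)^T).
    rewrite (_ : (_ :&: _)%MS = 0) ?mxrank0 ?addn0 => [->|]; first by rewrite r2' r2; lia.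
    apply/eqP/rowV0P => v; rewrite -[v]trmxK sub_capmx => /andP[/hprimP[hv Lv]].
    case/submxP => z Ez; apply: trmx_inj; rewrite trmxK trmx0.
    apply/eqP; apply: contraT => nz.
    have Ev : v^T = hL Z *m (z *m W2)^T by rewrite -[v^T]trmxK Ez mulmxA trmx_mul trmxK.
    by have := RZ _ _ kj _ hv Lv nz; rewrite {2}Ev cross // mulr0 ltxx.
  split.
    by rewrite addsmx_sub capmxSl; case: d2'.
  move=> x /sub_addsmxP[[z1 z2] Ex] nz.
  have /hprimP[h0 L0] : ((z1 *m hprim Z k.+1 j)^T^T <= hprim Z k.+1 j)%MS.
    by rewrite trmxK submxMl.
  have h2 : ((z2 *m (W2 *m (hL Z)^T))^T^T <= W2 *m (hL Z)^T)%MS by rewrite trmxK submxMl.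
  have Ey : (z2 *m (W2 *m (hL Z)^T))^T = hL Z *m (z2 *m W2)^T.
    by rewrite mulmxA trmx_mul trmxK.
  move: Ex h0 L0 h2; rewrite /= -[z1 *m _]trmxK -[z2 *m _]trmxK -raddfD /=.
  move/trmx_inj; rewrite !trmxK; set x0 := (z1 *m _)^T; set x1 := (z2 *m _)^T.
  move=> Ex h0 L0 h2; have Ex1 : x1 = hL Z *m (z2 *m W2)^T := Ey; move: x1 Ex Ex1 h2 => x1 Ex Ex1 h2.
  have c1 : hB x0 (hL Z ^+ j *m x1) = 0 by rewrite Ex1 cross.
  have c2 : hB x1 (hL Z ^+ j *m x0) = 0 by rewrite -hB_LX hBsym c1.
  have -> : hB x (hL Z ^+ j *m x) = hB x0 (hL Z ^+ j *m x0) + hB x1 (hL Z ^+ j *m x1).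
    by rewrite Ex hBDl mulmxDr !hBDr c1 c2 addr0 add0r.
  have P0 : x0 != 0 -> 0 < (-1) ^+ k.+1 * hB x0 (hL Z ^+ j *m x0) by exact: RZ.
  have P1 : x1 != 0 -> 0 < (-1) ^+ k.+1 * hB x1 (hL Z ^+ j *m x1).
    move=> nz1; rewrite sg; case: d2' => _; apply=> //.
    by rewrite Ex1 trmx_mul trmxK -mulmxA submxMl.
  rewrite mulrDr; have [x00|x0n] := eqVneq x0 0.
    rewrite x00 hB0l mulr0 add0r; apply: P1; apply: contraNneq nz => x10.
    by rewrite Ex x00 x10 addr0.
  have [->|x1n] := eqVneq x1 0; first by rewrite hB0l mulr0 addr0 P0.
  by rewrite addr_gt0 ?P0 ?P1.
exists (W1 *m (hL Z)^T); first by rewrite r1' r1; lia.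
by rewrite sg opprK.
Qed.

(** A primitive vector x of the wrong sign, added to the image of a definite subspace one degree
    lower, gives a space of dimension [hpk Z k] + 1 on which the form is semidefinite of the wrong
    sign; for dimension reasons it meets the definite subspace W. *)
Lemma definite_HR Z : hard_lefschetz Z ->
  (forall k j : nat, (k + k + j)%N = hn Z -> (hpk Z k <= hrk Z k)%N /\
    exists2 W, \rank W = hpk Z k & defsub (Z := Z) k j ((-1) ^+ k) W) ->
  hodge_riemann Z.
Proof.
move=> HZ PD [|k] j kj x hx Lx nz.
  have [_ [W rW [sW dW]]] := PD _ _ kj; apply: dW => //.
  suff : ((hP Z 0)^T <= W)%MS by apply: submx_trans; apply/inV_sub.
  by rewrite -(geq_leqif (mxrank_leqif_sup sW)) mxrank_tr rW.
have kj2 : (k + k + j.+2)%N = hn Z by lia.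
have [le1 [W1 r1 d1]] := PD _ _ kj2; have [d1' r1'] := defsub_image d1.
have [_ [W rW [sW dW]]] := PD _ _ kj.
have sg : (-1) ^+ k.+1 = - (-1) ^+ k :> R by rewrite exprS mulN1r.
rewrite ltNge; apply/negP => Qx.
pose N := (x^T + W1 *m (hL Z)^T)%MS.
have rN : \rank N = (hpk Z k).+1.
  have := mxrank_sum_cap x^T (W1 *m (hL Z)^T).
  rewrite (_ : (_ :&: _)%MS = 0) ?mxrank0 ?addn0 => [->|].
    rewrite r1' r1 (_ : \rank x^T = 1%N) //; apply/eqP; rewrite eqn_leq rank_leq_row.
    by rewrite lt0n mxrank_eq0 -trmx0 (inj_eq trmx_inj).
  apply/eqP/rowV0P => v; rewrite sub_capmx => /andP[/sub_rVP[c Ev] /submxP[z Ez]].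
  rewrite Ev; have [->|c0] := eqVneq c 0; first by rewrite scale0r.
  have Ex : x = hL Z *m (c^-1 *: (z *m W1)^T).
    apply: (scalerI c0); rewrite -scalemxAr scalerA mulfV // scale1r.
    by apply: trmx_inj; rewrite linearZ /= -Ev Ez trmx_mul trmxK mulmxA.
  case/eqP: nz; rewrite Ex (_ : _ *: _ = 0) ?mulmx0 //.
  have hW : ((c^-1 *: (z *m W1)^T)^T <= W1)%MS.
    by rewrite linearZ /= trmxK scalemx_sub // submxMl.
  apply/eqP; apply: contraT => nz'; case: d1 => _ /(_ _ hW nz').
  by rewrite mulXS -Ex mulXS -[X in hL Z ^+ j *m X]/(hL Z *m x) -mulXS Lx hB0r mulr0 ltxx.
have sN : (N <= (hP Z k.+1%:Z)^T)%MS.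
  by rewrite addsmx_sub; apply/andP; split; [apply/inV_sub | case: d1'].
have : (W :&: N)%MS != 0.
  apply/eqP => E0; have := mxrank_sum_cap W N; rewrite E0 mxrank0 addn0 rW rN /=.
  have le3 : (hpk Z k <= hrk Z k.+1)%N.
    by rewrite -r1 -r1' /hrk -(mxrank_tr (hP _ _)) mxrankS //; case: d1'.
  have : (\rank (W + N) <= hrk Z k.+1)%N.
    by rewrite /hrk -(mxrank_tr (hP _ _)) mxrankS // addsmx_sub sW sN.
  by move=> /= h1 h2; lia.
case/rowV0Pn => v; rewrite sub_capmx => /andP[vW vN] v0.
have v0' : v^T != 0 by rewrite -trmx0 (inj_eq trmx_inj).
have := dW v^T; rewrite trmxK => /(_ vW v0'); apply/negP; rewrite -leNgt.
case/sub_addsmxP: vN => -[z1 z2] /= Ev.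
have [c Ez1] : exists c, z1 *m x^T = c *: x^T.
  by exists (z1 0 0); rewrite [z1]mx11_scalar mul_scalar_mx mxE.
pose y := (z2 *m W1)^T.
have Ev' : v^T = c *: x + hL Z *m y.
  by rewrite Ev raddfD /= Ez1 linearZ /= trmxK mulmxA trmx_mul trmxK.
have cross : hB (hL Z *m y) (hL Z ^+ j *m x) = 0 by rewrite hB_L -mulXSl Lx hB0r.
have Qy : 0 <= (-1) ^+ k * hB (hL Z *m y) (hL Z ^+ j *m (hL Z *m y)).
  have [->|y0] := eqVneq y 0; first by rewrite mulmx0 hB0l mulr0.
  rewrite hB_L -mulXSl -mulXS; apply/ltW; case: d1 => _; apply=> //.
  by rewrite trmxK submxMl.
have cross2 : hB x (hL Z ^+ j *m (hL Z *m y)) = 0 by rewrite -mulXS -hB_LX Lx hB0l.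
rewrite Ev' mulmxDr hBDl !hBDr -!scalemxAr !hBZl !hBZr cross cross2.
rewrite !mulr0 addr0 add0r sg in Qx *.
have cc : 0 <= c * c by rewrite -expr2 sqr_ge0.
have := mulr_ge0_le0 cc Qx; move: Qy; set a := hB _ _; set b := hB _ _; set s := (-1) ^+ k.
have -> : - s * (c * (c * b) + a) = c * c * (- s * b) - s * a by ring.
lra.
Qed.

End Signature.

(** * Deformation of the Lefschetz operator *)

Section PathOfOperators.
Variable (R : realType).

Lemma map_mxX (A B : nzRingType) (h : {rmorphism A -> B}) d (L : 'M[A]_d) j :
  map_mx h (L ^+ j) = map_mx h L ^+ j.
Proof.
elim: j => [|j IH]; first by rewrite !expr0 map_mx1.
by rewrite !exprS -!mulmxE map_mxM IH.
Qed.

Lemma sym_pow (A : comNzRingType) d (J L : 'M[A]_d) j : J^T = J ->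
  L^T *m J = J *m L -> (J *m L ^+ j)^T = J *m L ^+ j.
Proof.
move=> Jt LJ; rewrite trmx_mul Jt; elim: j => [|j IH].
  by rewrite expr0 trmx1 mul1mx mulmx1.
by rewrite {1}exprS exprSr -!mulmxE trmx_mul -mulmxA LJ (mulmxA _ J) IH mulmxA.
Qed.

Lemma defsub_mx (Z : hspace R) (k j p : nat) (s : R) r (C : 'M_(r, hd Z)) :
  (C == (hP Z k%:Z)^T)%MS -> row_free C ->
  (exists2 W, \rank W = p & defsub (Z := Z) k j s W) <->
  (exists M : 'M_(r, p), posdef (M^T *m (s *: (C *m (hJ Z *m hL Z ^+ j) *m C^T)) *m M)).
Proof.
move=> /andP[CP PC] freeC.
have form (z : 'cV_r) : (z^T *m (s *: (C *m (hJ Z *m hL Z ^+ j) *m C^T)) *m z) 0 0 =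
    s * hB (C^T *m z) (hL Z ^+ j *m (C^T *m z)).
  by rewrite -scalemxAr -scalemxAl mxE /hB trmx_mul trmxK !mulmxA.
split=> [[W rW [sW dW]]|[M pM]].
  have /submxP[Y EY] : (row_base W <= C)%MS.
    by rewrite eq_row_base (submx_trans sW).
  subst p; exists Y^T => z z0.
  have Ex : C^T *m (Y^T *m z) = (z^T *m row_base W)^T.
    by rewrite EY !trmx_mul trmxK mulmxA.
  have -> : z^T *m (Y^T^T *m (s *: (C *m (hJ Z *m hL Z ^+ j) *m C^T)) *m Y^T) *m z =
    (Y^T *m z)^T *m (s *: (C *m (hJ Z *m hL Z ^+ j) *m C^T)) *m (Y^T *m z).
    by rewrite !trmx_mul !mulmxA.
  rewrite form Ex; apply: dW.
    by rewrite trmxK -(eq_row_base W) submxMl.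
  apply: contraNneq z0 => /(congr1 trmx); rewrite trmxK trmx0 => E.
  apply/eqP/trmx_inj; rewrite trmx0; apply: (row_free_inj (row_base_free W)).
  by rewrite E mul0mx.
have MC (v : 'rV_p) : v != 0 ->
    0 < s * hB (v *m (M^T *m C))^T (hL Z ^+ j *m (v *m (M^T *m C))^T).
  move=> v0; have := pM v^T; rewrite -trmx0 (inj_eq trmx_inj) => /(_ v0).
  have -> : v^T^T *m (M^T *m (s *: (C *m (hJ Z *m hL Z ^+ j) *m C^T)) *m M) *m v^T =
    (M *m v^T)^T *m (s *: (C *m (hJ Z *m hL Z ^+ j) *m C^T)) *m (M *m v^T).
    by rewrite !trmx_mul !mulmxA.
  by rewrite form !trmx_mul trmxK !mulmxA.
exists <<M^T *m C>>%MS.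
  rewrite mxrank_gen; apply/eqP; rewrite -/(row_free _) -kermx_eq0.
  apply/rowV0P => v /sub_kermxP Ev; apply/eqP; apply: contraT => /MC.
  by rewrite Ev trmx0 hB0l mulr0 ltxx.
split; first by rewrite genmxE (submx_trans _ CP) // submxMl.
move=> x; rewrite genmxE => /submxP[v Ex] x0; rewrite -[x]trmxK Ex; apply: MC.
by apply: contraNneq x0 => v0; rewrite -[x]trmxK Ex v0 mul0mx trmx0.
Qed.

Lemma extH_irr (X : hspace R) M1 M2 (c1 : compat (X := X) M1) (c2 : compat (X := X) M2) :
  M1 = M2 -> HLR (extH c1) -> HLR (extH c2).
Proof. by move=> E; subst M2; rewrite (Prop_irrelevance c1 c2). Qed.

(** Rescaling the second copy by t conjugates the operator with block M into the one with block t
    M. *)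
Lemma HL_scale (X : hspace R) M t (c : compat (X := X) M)
  (c' : compat (X := X) (t *: M)) : t != 0 ->
  hard_lefschetz (extH c) -> hard_lefschetz (extH c').
Proof.
move=> t0 HL k j kj v; rewrite -[v]vsubmxK; set u := usubmx v; set w := dsubmx v.
have main i (a b : 'cV[R]_(hd X)) : exists a' b',
    hL (extH c') ^+ i *m col_mx a b = col_mx a' b' /\
    hL (extH c) ^+ i *m col_mx a (t^-1 *: b) = col_mx a' (t^-1 *: b').
  elim: i => [|i [a' [b' [E1 E2]]]]; first by exists a, b; rewrite !expr0 !mul1mx.
  exists (hL X *m a'), (t *: M *m a' + hL X *m b').
  rewrite !mulXSl E1 E2 /= !mul_block_col !mul0mx !addr0; split=> //.
  by rewrite scalerDr -scalemxAl scalerA mulVf // scale1r -scalemxAr.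
have [a' [b' [E1 E2]]] := main j u w.
move=> /inV_ext[hu hw]; rewrite E1 => /eqP; rewrite col_mx_eq0 => /andP[/eqP a0 /eqP b0].
have := HL k j kj (col_mx u (t^-1 *: w)); rewrite E2 a0 b0 scaler0 col_mx0.
have hw' : inV (k%:Z - 1) (t^-1 *: w) by apply: inVZ.
move=> /(_ _ erefl); rewrite inV_ext => /(_ (conj hu hw')) /eqP.
rewrite col_mx_eq0 scaler_eq0 invr_eq0 (negbTE t0) /= => /andP[/eqP -> /eqP ->].
by rewrite col_mx0.
Qed.

(** The segment joins the operator to that of the product with a projective line, where the
    relations are known; hard Lefschetz along it keeps all the forms nondegenerate, so their
    signatures are constant. *)
Lemma ext_path (X : hspace R) M (c : compat (X := X) M) : HLR X ->
  (forall t : R, 0 <= t <= 1 ->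
     hard_lefschetz (extH (compat_affine t (1 - t) c))) ->
  HLR (extH c).
Proof.
move=> HRX HLt; pose Y t := extH (compat_affine t (1 - t) c).
apply: (@extH_irr _ _ _ (compat_affine 1 (1 - 1) c)); first by rewrite subrr scale1r scale0r addr0.
have HL1 : hard_lefschetz (Y 1) by apply: HLt; rewrite lexx ler01.
split=> //; apply: definite_HR => //.
have HR0 : HLR (Y 0).
  apply: (@extH_irr _ _ _ (compat1 X)); last exact: ext_product.
  by rewrite subr0 scale0r scale1r add0r.
have rkE t k : hrk (Y t) k = hrk (Y 0) k by [].
have pkE t k : hpk (Y t) k = hpk (Y 0) k.
  by elim: k => [|k IH] //=; rewrite IH -/(hrk (Y t) _) -/(hrk (Y 0) _) (rkE t).
move=> k j kj; have [le0 D0 _] := HLR_definite HR0 kj.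
split; first by rewrite pkE rkE.
(* One basis of the part of degree k serves for all t, as [hP] does not involve the operator. *)
have [r [C [eC fC]]] : exists r (C : 'M_(r, hd X + hd X)),
    (forall t, (C == (hP (Y t) k%:Z)^T)%MS) /\ row_free C.
  exists (\rank (hP (Y 0) k%:Z)^T), (row_base (hP (Y 0) k%:Z)^T).
  by split=> [t|]; [rewrite !eq_row_base !submx_refl | exact: row_base_free].
have {D0} := (defsub_mx j (hpk (Y 0) k) ((-1) ^+ k) (eC 0) fC).1 D0.
move=> D0; apply/(defsub_mx j (hpk (Y 1) k) ((-1) ^+ k) (eC 1) fC); rewrite pkE.
pose pc := map_mx (@polyC R).
pose LP : 'M[{poly R}]_(hd X + hd X) :=
  block_mx (pc _ _ (hL X)) 0 ('X *: pc _ _ M + (1 - 'X) *: 1%:M) (pc _ _ (hL X)).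
pose JP : 'M[{poly R}]_(hd X + hd X) := pc _ _ (hJ (Y 0)).
pose CP := pc _ _ C.
pose A := ((-1) ^+ k)%:P *: (CP *m (JP *m LP ^+ j) *m CP^T).
have pcK t m1 m2 (B : 'M_(m1, m2)) : map_mx (horner_eval t) (pc _ _ B) = B.
  by apply/matrixP => i i'; rewrite !mxE /horner_eval hornerC.
have EL t : map_mx (horner_eval t) LP = hL (Y t).
  rewrite /LP /= map_block_mx !pcK map_mx0 map_mxD !map_mxZ pcK map_mx1.
  by rewrite /= /horner_eval hornerX hornerD hornerN hornerX hornerC.
have EA t : map_mx (horner^~ t) A = (-1) ^+ k *: (C *m (hJ (Y t) *m hL (Y t) ^+ j) *m C^T).
  rewrite -[LHS]/(map_mx (horner_eval t) A) /A map_mxZ !map_mxM /= map_trmx !pcK.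
  by rewrite map_mxX EL /horner_eval hornerC.
rewrite -EA; apply: inertia; last by rewrite EA.
  rewrite /A [LHS]linearZ /= !trmx_mul trmxK.
  have pcT m1 m2 (B : 'M_(m1, m2)) : (pc _ _ B)^T = pc _ _ B^T.
    by rewrite /pc map_trmx.
  have JPt : JP^T = JP by rewrite /JP pcT; congr (pc _ _ _); exact: (hJ_tr (Y 0)).
  have := @sym_pow _ _ JP LP j JPt; rewrite trmx_mul JPt => ->; first by rewrite !mulmxA.
  have [_ MJ _] := c.
  have pcM m1 m2 m3 (B : 'M_(m1, m2)) (B' : 'M_(m2, m3)) : pc _ _ (B *m B') = pc _ _ B *m pc _ _ B'.
    exact: map_mxM.
  have E1 : (pc _ _ (hL X))^T *m pc _ _ (hJ X) = pc _ _ (hJ X) *m pc _ _ (hL X).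
    by rewrite pcT -!pcM hL_adj.
  have E2 : (pc _ _ M)^T *m pc _ _ (hJ X) = pc _ _ (hJ X) *m pc _ _ M.
    by rewrite pcT -!pcM MJ.
  rewrite /JP /LP /= /pc map_block_mx !map_mx0 -/pc tr_block_mx trmx0.
  rewrite !mulmx_block !mul0mx !mulmx0 !addr0 !add0r E1.
  congr (block_mx _ _ _ _).
  rewrite raddfD /= ![(_ *: _)^T]linearZ /= trmx1 mulmxDl mulmxDr.
  by rewrite -!scalemxAl -!scalemxAr E2 mul1mx mulmx1.
(* A kernel vector gives x of degree k with L^j x orthogonal to degree k; the duality of degrees k
   and k + j makes L^j x vanish, and hard Lefschetz makes x vanish. *)
move=> t t01; rewrite EA unitmxZ ?unitrX ?unitrN1 // -row_free_unit -kermx_eq0.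
apply/rowV0P => v /sub_kermxP; set B := _ *m _ *m _ => vB.
have Bsym : B^T = B.
  have S := sym_pow j (hJ_tr (Y t)) (hL_adj (Y t)).
  by rewrite /B -[RHS]mulmxA trmx_mul trmxK (trmx_mul C) S.
have Bv : C *m (hJ (Y t) *m (hL (Y t) ^+ j *m (C^T *m v^T))) = 0.
  by have := congr1 trmx vB; rewrite trmx_mul Bsym trmx0 /B !mulmxA.
set x := C^T *m v^T in Bv.
have hx : inV (X := Y t) k%:Z x.
  apply/inV_sub; rewrite /x trmx_mul !trmxK.
  by have /andP[h _] := eC t; apply: submx_trans h; exact: submxMl.
have x0 : x = 0.
  apply: (HLt t t01 k j kj x hx).
  have hy := inVL j hx; move/inVP: (hy) => <-.
  have /andP[_ /submxP[Q EQ]] := eC t.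
  have : (hP (Y t) k%:Z)^T *m (hJ (Y t) *m (hL (Y t) ^+ j *m x)) = 0.
    by rewrite EQ -mulmxA Bv mulmx0.
  rewrite hP_dual -!mulmxA (mulmxA (hJ (Y t)) (hJ (Y t))) hJK mul1mx.
  move/(congr1 (mulmx (hJ (Y t)))); rewrite mulmxA hJK mul1mx mulmx0.
  have kjt : (k + k + j)%N = hn (Y t) := kj.
  by rewrite (_ : (hn (Y t))%:Z - k%:Z = k%:Z + j%:Z) //; lia.
apply: (row_free_inj fC); rewrite mul0mx; apply: trmx_inj.
by rewrite trmx_mul -/x x0 trmx0.
Qed.

(** For t > 0 the block t M + (1 - t) is t times M + z with z = (1 - t) / t; the infinite value of z
    is the product. *)
Theorem ext_HLR (X : hspace R) M (c : compat (X := X) M) : HLR X ->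
  (forall z : R, 0 <= z -> hard_lefschetz (extH (compat_affine 1 z c))) ->
  HLR (extH c).
Proof.
move=> HRX HLz; apply: ext_path => // t /andP[t0 t1].
have [->|tn] := eqVneq t 0.
  have [+ _] := ext_product (compat1 X) HRX.
  have := compat_affine 0 (1 - 0) c.
  rewrite {1}(_ : 0 *: M + (1 - 0) *: 1%:M = 1%:M); last by rewrite scale0r subr0 scale1r add0r.
  move=> c' h; case: (@extH_irr _ _ _ (compat1 X) (compat_affine 0 (1 - 0) c)) => //.
    by rewrite scale0r subr0 scale1r add0r.
  exact: ext_product.
have tp : 0 < t by rewrite lt0r tn.
have z0 : 0 <= (1 - t) / t by rewrite divr_ge0 ?subr_ge0.
have := HLz _ z0; set c1 := compat_affine 1 _ c => H1.
have E : t *: M + (1 - t) *: 1%:M = t *: (1 *: M + ((1 - t) / t) *: 1%:M).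
  by rewrite scalerDr !scalerA mulr1 mulrCA mulfV // mulr1.
move: (compat_affine t (1 - t) c); rewrite E => c2.
exact: (HL_scale tn H1).
Qed.

End PathOfOperators.

(** * Bimodules, their reductions and their simple summands *)

Section Bimodules.
Variables (R : realType) (n : nat) (S : polyring R n).
Variables (A : S -> Prop) (la : 'rV[R]_n).
Hypothesis A_la : A (lin S la).
Notation word := (seq (letter R n)).

Definition intertwines (w w' : word) (f : 'M[S]_(wdim w', wdim w)) :=
  forall p, A p -> f *m Lam w p = Lam w' p *m f.

Definition wmap (w w' : word) D (f : 'M[S]_(wdim w', wdim w)) :=
  homm (@wgr R n w) (@wgr R n w') D f /\ intertwines f.

(** The image of a self-adjoint idempotent of degree 0 of a Bott-Samelson bimodule. *)
Record bobj := BObj {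
  bw : word;
  be : 'M[S]_(wdim bw);
  be_idem : be *m be = be;
  be_adj : adj bw bw be = be;
  be_wmap : wmap 0 be }.

Implicit Types X Y Z : bobj.

Definition bhom X Y D (f : 'M[S]_(wdim (bw Y), wdim (bw X))) :=
  [/\ wmap D f, f *m be X = f & be Y *m f = f].

Definition blen X := size (bw X).

Lemma wmapM w1 w2 w3 D D' f f' : wmap (w := w2) (w' := w3) D f ->
  wmap (w := w1) (w' := w2) D' f' -> wmap (D + D') (f *m f').
Proof.
move=> [h i] [h' i']; split; first exact: hommM h h'.
by move=> p Ap; rewrite -mulmxA i' // !mulmxA i.
Qed.

Lemma wmapD w1 w2 D f f' : wmap (w := w1) (w' := w2) D f -> wmap D f' ->
  wmap D (f + f').
Proof.
move=> [h i] [h' i']; split; first exact: hommD.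
by move=> p Ap; rewrite mulmxDl mulmxDr i // i'.
Qed.

Lemma wmapB w1 w2 D f f' : wmap (w := w1) (w' := w2) D f -> wmap D f' ->
  wmap D (f - f').
Proof.
move=> [h i] [h' i']; split; first exact: hommB.
by move=> p Ap; rewrite mulmxBl mulmxBr i // i'.
Qed.

Lemma wmapZ w1 w2 D c f : wmap (w := w1) (w' := w2) D f -> wmap D (pC c *: f).
Proof.
move=> [h i]; split; first exact: hommZ.
by move=> p Ap; rewrite -scalemxAl -scalemxAr i.
Qed.

Lemma wmap0 w1 w2 D : wmap (w := w1) (w' := w2) D 0.
Proof. by split; [exact: homm0 | move=> p _; rewrite mul0mx mulmx0]. Qed.

Lemma wmap1 w : wmap (w := w) (w' := w) 0 1%:M.
Proof. by split; [exact: homm1 | move=> p _; rewrite mulmx1 mul1mx]. Qed.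

Lemma wmap_adj w1 w2 D f : wmap (w := w1) (w' := w2) D f ->
  wmap (D + (size w1)%:Z - (size w2)%:Z) (adj w1 w2 f).
Proof.
move=> [h i]; split; first exact: adj_homm.
by move=> p Ap; rewrite -[Lam w2 p]adj_Lam -adjM -i // adjM adj_Lam.
Qed.

Lemma wmap_ext s w1 w2 D f : wmap (w := w1) (w' := w2) D f ->
  wmap (w := s :: w1) (w' := s :: w2) D (extm s f).
Proof.
by move=> [h i]; split; [exact: homm_extm | move=> p Ap; rewrite -!extmM i].
Qed.

Lemma wmap_mlow s w : wmap (w := s :: w) (w' := w) 0 (mlow S s (wdim w)).
Proof. by split; [exact: homm_mlow | move=> p _; rewrite -mlow_nat]. Qed.

Lemma wmap_mup s w : wmap (w := w) (w' := s :: w) 1 (mupp S s (wdim w)).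
Proof. by split; [exact: homm_mup | move=> p _; rewrite mup_nat]. Qed.

Lemma bhom_e X : bhom (X := X) (Y := X) 0 (be X).
Proof. by split; [exact: be_wmap | exact: be_idem | exact: be_idem]. Qed.

Lemma bhom_comp X Y Z D D' f f' : bhom (X := Y) (Y := Z) D f ->
  bhom (X := X) (Y := Y) D' f' -> bhom (X := X) (Y := Z) (D + D') (f *m f').
Proof.
move=> [h fe ef] [h' fe' ef']; split; first exact: wmapM h h'.
  by rewrite -mulmxA fe'.
by rewrite mulmxA ef.
Qed.

Lemma bhomD X Y D f f' : bhom (X := X) (Y := Y) D f -> bhom (X := X) (Y := Y) D f' ->
  bhom (X := X) (Y := Y) D (f + f').
Proof.
move=> [h fe ef] [h' fe' ef']; split; first exact: wmapD.
  by rewrite mulmxDl fe fe'.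
by rewrite mulmxDr ef ef'.
Qed.

Lemma bhomB X Y D f f' : bhom (X := X) (Y := Y) D f -> bhom (X := X) (Y := Y) D f' ->
  bhom (X := X) (Y := Y) D (f - f').
Proof.
move=> [h fe ef] [h' fe' ef']; split; first exact: wmapB.
  by rewrite mulmxBl fe fe'.
by rewrite mulmxBr ef ef'.
Qed.

Lemma bhomZ X Y D c f : bhom (X := X) (Y := Y) D f ->
  bhom (X := X) (Y := Y) D (pC c *: f).
Proof.
move=> [h fe ef]; split; first exact: wmapZ.
  by rewrite -scalemxAl fe.
by rewrite -scalemxAr ef.
Qed.

Lemma bhom0 X Y D : bhom (X := X) (Y := Y) D 0.
Proof. by split; [exact: wmap0 | rewrite mul0mx | rewrite mulmx0]. Qed.

Lemma bhom_sum X Y D (I : Type) (r : seq I) (P : pred I) F :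
  (forall i, P i -> bhom (X := X) (Y := Y) D (F i)) ->
  bhom (X := X) (Y := Y) D (\sum_(i <- r | P i) F i).
Proof.
by move=> h; apply: (big_ind (bhom (X := X) (Y := Y) D)) => //;
  [exact: bhom0 | exact: bhomD].
Qed.

Definition badj X Y (f : 'M[S]_(wdim (bw Y), wdim (bw X))) := adj (bw X) (bw Y) f.

Lemma bhom_adj X Y D f : bhom (X := X) (Y := Y) D f ->
  bhom (X := Y) (Y := X) (D + (blen X)%:Z - (blen Y)%:Z) (badj f).
Proof.
move=> [h fe ef]; split; first exact: wmap_adj.
  by rewrite /badj -{1}(be_adj Y) -adjM ef.
by rewrite /badj -{1}(be_adj X) -adjM fe.
Qed.

Definition extO X (s : letter R n) : bobj.
Proof.
refine (@BObj (s :: bw X) (extm s (be X)) _ _ _).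
- by rewrite -extmM be_idem.
- by rewrite adj_extm be_adj.
- exact/wmap_ext/be_wmap.
Defined.

Lemma bhom_ext s X Y D f : bhom (X := X) (Y := Y) D f ->
  bhom (X := extO X s) (Y := extO Y s) D (extm s f).
Proof.
move=> [h fe ef]; split; first exact: wmap_ext.
  by rewrite /= -extmM fe.
by rewrite /= -extmM ef.
Qed.

Definition blow X s := mlow S s (wdim (bw X)) *m be (extO X s).
Definition bup X s := mupp S s (wdim (bw X)) *m be X.

Lemma blowE X s : blow X s = be X *m mlow S s (wdim (bw X)).
Proof. by rewrite /blow /= mlow_nat. Qed.

Lemma bupE X s : bup X s = be (extO X s) *m mupp S s (wdim (bw X)).
Proof. by rewrite /bup /= mup_nat. Qed.

Lemma bhom_low X s : bhom (X := extO X s) (Y := X) 0 (blow X s).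
Proof.
split; first by rewrite -[0]addr0; apply: wmapM (wmap_mlow _ _) (be_wmap (extO X s)).
  by rewrite /blow -mulmxA (be_idem (extO X s)).
by rewrite blowE mulmxA be_idem.
Qed.

Lemma bhom_up X s : bhom (X := X) (Y := extO X s) 1 (bup X s).
Proof.
split; first by rewrite -[1]addr0; apply: wmapM (wmap_mup _ _) (be_wmap X).
  by rewrite /bup -mulmxA be_idem.
by rewrite bupE mulmxA be_idem.
Qed.

Lemma badj_low X s : badj (X := extO X s) (Y := X) (blow X s) = bup X s.
Proof.
rewrite /badj blowE.
by rewrite (@adjM _ _ _ (s :: bw X) (bw X) (bw X)) be_adj (@adj_mlow _ _ S s (bw X)).
Qed.

Lemma evm_self_adj w (f : 'M[S]_(wdim w)) : adj w w f = f ->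
  (evm f)^T *m wJ R w = wJ R w *m evm f.
Proof. by move=> af; rewrite -{2}af evm_adj !mulmxA wJK mul1mx. Qed.

Definition hs X : hspace R.
Proof.
refine (@HSpace R (wdim (bw X)) (blen X) (@wgr R n (bw X)) (wJ R (bw X))
  (evm (be X)) (evm (Lam (bw X) (lin S la))) _ _ _ _ _ _ _ _ _).
- exact: wJ_tr.
- exact: wJK.
- exact: wJ_gr.
- by rewrite -evmM be_idem.
- exact/evm_self_adj/be_adj.
- by apply: shiftm_evm; case: (be_wmap X).
- by apply: shiftm_evm; apply: Lam_homog; exact: phom_lin.
- exact/evm_self_adj/adj_Lam.
- by rewrite -!evmM; case: (be_wmap X) => _ /(_ _ A_la) ->.
Defined.

Lemma hs_hom X Y D f : bhom (X := X) (Y := Y) D f ->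
  ishom (X := hs X) (Y := hs Y) D (evm f).
Proof.
move=> [[h i] fe ef]; split=> /=.
- exact: shiftm_evm.
- by rewrite -!evmM i.
- by rewrite -evmM fe.
- by rewrite -evmM ef.
Qed.

Lemma hs_adj X Y f : evm (badj (X := X) (Y := Y) f) = hadj (X := hs X) (Y := hs Y) (evm f).
Proof. by rewrite /badj evm_adj. Qed.

(* The lowest order coefficients of the entries of [f] form a matrix over [R]
   which commutes with the Lefschetz operators and has negative degree. *)
Lemma ev_lift X Y D f : hard_lefschetz (hs X) -> hard_lefschetz (hs Y) ->
  bhom (X := X) (Y := Y) D f -> D + D + (blen X)%:Z <= (blen Y)%:Z ->
  evm f = 0 -> f = 0.
Proof.
move=> HX HY [[h i] fe ef] hD f0.
pose deg (ij : 'I_(wdim (bw Y)) * 'I_(wdim (bw X))) :=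
  (wgr ij.2)%:Z + D - (wgr ij.1)%:Z.
have hdeg ij : f ij.1 ij.2 != 0 -> exists2 d : nat, deg ij = d%:Z & (0 < d)%N.
  move=> nz; have := h ij.1 ij.2; rewrite -/(deg ij).
  case: (deg ij) => [d|d] /= hd; last by rewrite (eqP hd) eqxx in nz.
  exists d => //; rewrite lt0n; apply: contraNneq nz => d0; rewrite d0 in hd.
  rewrite (phom0C hd); move/matrixP/(_ ij.1 ij.2): f0; rewrite !mxE => ->.
  by rewrite raddf0.
apply: contrapT => fn0.
pose P d := `[< exists2 ij, f ij.1 ij.2 != 0 & deg ij = d%:Z >].
have exP : exists d, P d.
  have [[i0 j0] hij] : exists ij : _ * _, f ij.1 ij.2 != 0.
    apply: contrapT => nex; apply: fn0; apply/matrixP => i0 j0; rewrite mxE.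
    by apply/eqP; apply: contrapT => /negP nz; apply: nex; exists (i0, j0).
  by have [d Ed _] := hdeg _ hij; exists d; apply/asboolP; exists (i0, j0).
case: (ex_minnP exP) => d0 /asboolP[[i0 j0] /= nz Ed0] dmin.
have [d' Ed' d0'] := hdeg (i0, j0) nz; have Edd : d' = d0 by move: Ed'; rewrite Ed0 => -[].
subst d'.
have hij : phom d0 (f i0 j0) by have := h i0 j0; rewrite -/(deg (i0, j0)) Ed0.
have [phi phin phiM] := phom_coef hij nz.
have hge i1 j1 : exists2 d, (d0 <= d)%N & phom d (f i1 j1).
  have [->|nz1] := eqVneq (f i1 j1) 0; first by exists d0 => //; exact: phom0.
  have [d Ed _] := hdeg (i1, j1) nz1; exists d.
    by apply: dmin; apply/asboolP; exists (i1, j1).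
  by have := h i1 j1; rewrite -/(deg (i1, j1)) Ed.
have phi0 d p : (d0 < d)%N -> phom d p -> phi p = 0.
  move=> hd hp; suff [] : ((d0 < d)%N -> phi p = 0) /\ phom d p by move=> /(_ hd).
  move: d p hp {hd}; apply: (phom_ind (P := fun d p => ((d0 < d)%N -> phi p = 0) /\ phom d p)).
  - by move=> d; rewrite raddf0 phom0.
  - by rewrite ltn0 -(rmorph1 pC) phomC.
  - move=> d c p [IH hp]; rewrite phomCM //; split=> // hd.
    by rewrite (phiM d) // ?IH ?mulr0 // ltnW.
  - by move=> d p q [IH hp] [IH' hq]; rewrite phomD //; split=> // hd; rewrite raddfD IH // IH' // addr0.
  - move=> d p u [IH hp]; split; last by apply: (phomM (d := 1)) => //; exact: phom_lin.
    move=> hd.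
    by rewrite (phiM d) // ev_lin mul0r.
pose F := map_mx phi f.
have FM m (g : 'M[S]_(wdim (bw X), m)) : map_mx phi (f *m g) = F *m evm g.
  apply/matrixP => i1 j1; rewrite !mxE raddf_sum; apply: eq_bigr => k _; rewrite !mxE.
  by have [d hd hf] := hge i1 k; rewrite mulrC (phiM d) // mulrC.
have MF m (g : 'M[S]_(m, wdim (bw Y))) : map_mx phi (g *m f) = evm g *m F.
  apply/matrixP => i1 j1; rewrite !mxE raddf_sum; apply: eq_bigr => k _; rewrite !mxE.
  by have [d hd hf] := hge k j1; rewrite (phiM d).
have F0 : F = 0.
  apply: (@hom_neg_eq0 _ (hs X) (hs Y) (D - d0%:Z)) => //; last first.
    by move: hD d0'; rewrite /=; lia.
  split=> /=.
  - move=> i1 j1; rewrite mxE => nz1.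
    have nf : f i1 j1 != 0 by apply: contraNneq nz1 => ->; rewrite raddf0.
    have [d Ed _] := hdeg (i1, j1) nf.
    have hd : phom d (f i1 j1) by have := h i1 j1; rewrite -/(deg (i1, j1)) Ed.
    have le : (d0 <= d)%N by apply: dmin; apply/asboolP; exists (i1, j1).
    have : d = d0.
      apply/eqP; rewrite eqn_leq le andbT leqNgt; apply: contraNN nz1 => lt.
      by rewrite (phi0 d).
    by move=> E2; move: Ed; rewrite E2 /deg /=; lia.
  - by rewrite -FM -MF i.
  - by rewrite -FM fe.
  - by rewrite -MF ef.
by move/matrixP/(_ i0 j0): F0; rewrite !mxE => /eqP; rewrite (negbTE phin).
Qed.

(** The substitute for the vanishing of Hom spaces in negative degrees: it is a consequence of hard
    Lefschetz, not an input. *)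
Lemma bhom_neg X Y D f : hard_lefschetz (hs X) -> hard_lefschetz (hs Y) ->
  bhom (X := X) (Y := Y) D f -> D + D + (blen X)%:Z < (blen Y)%:Z -> f = 0.
Proof.
move=> HX HY hf hD; apply: (ev_lift HX HY hf (ltW hD)).
exact: (hom_neg_eq0 HX HY (hs_hom hf)).
Qed.

Definition isproj X (f : 'M[S]_(wdim (bw X))) :=
  [/\ bhom (X := X) (Y := X) 0 f, f *m f = f & adj (bw X) (bw X) f = f].

Lemma isproj_wmap X f : isproj (X := X) f -> wmap 0 f.
Proof. by case=> -[]. Qed.
Lemma isproj_idem X f : isproj (X := X) f -> f *m f = f.
Proof. by case. Qed.
Lemma isproj_adj X f : isproj (X := X) f -> adj (bw X) (bw X) f = f.
Proof. by case. Qed.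

Definition subO X f (hf : isproj (X := X) f) : bobj :=
  BObj (isproj_idem hf) (isproj_adj hf) (isproj_wmap hf).

(** Simplicity is tested on self-adjoint idempotents only; they are the ones whose images inherit
    the form. *)
Definition bsimple X := be X != 0 /\
  forall f, isproj (X := X) f -> f = 0 \/ f = be X.

Lemma bobj_eq w e i1 i2 a1 a2 h1 h2 :
  @BObj w e i1 a1 h1 = @BObj w e i2 a2 h2.
Proof.
by rewrite (Prop_irrelevance i1 i2) (Prop_irrelevance a1 a2) (Prop_irrelevance h1 h2).
Qed.

(** Basis degrees start at 0 and linear forms have degree 1; once both sides are centred and degrees
    doubled, a map of degree D has degree 2 D + blen X - blen Y. *)
Definition bdeg0 X Y D := D + D + (blen X)%:Z = (blen Y)%:Z.

Lemma bhom_pow X Y D g f i : bhom (X := Y) (Y := Y) 0 g ->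
  bhom (X := X) (Y := Y) D f -> bhom (X := X) (Y := Y) D (g ^+ i *m f).
Proof.
move=> hg hf; elim: i => [|i IH]; first by rewrite expr0 mul1mx.
by rewrite exprS -mulmxE -mulmxA -[D]add0r; apply: bhom_comp IH.
Qed.

Definition bpoly d (N : nat) (c : nat -> R) (g : 'M[S]_d) : 'M[S]_d :=
  \sum_(i < N) pC (c i) *: g ^+ i.

Lemma bhom_poly X Y D N c g f : bhom (X := Y) (Y := Y) 0 g ->
  bhom (X := X) (Y := Y) D f -> bhom (X := X) (Y := Y) D (bpoly N c g *m f).
Proof.
move=> hg hf; rewrite /bpoly mulmx_suml; apply: bhom_sum => i _.
by rewrite -scalemxAl; apply/bhomZ/bhom_pow.
Qed.

Lemma bpoly_comm d N c (g : 'M[S]_d) : g *m bpoly N c g = bpoly N c g *m g.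
Proof.
rewrite /bpoly mulmx_suml mulmx_sumr; apply: eq_bigr => i _.
by rewrite -scalemxAl -scalemxAr !mulmxE -exprS -exprSr.
Qed.

Lemma adj_poly w N c (g : 'M[S]_(wdim w)) : adj w w g = g ->
  adj w w (bpoly N c g) = bpoly N c g.
Proof.
move=> ag; rewrite /bpoly adj_sum; apply: eq_bigr => i _; rewrite adjZ.
congr (_ *: _); elim: (nat_of_ord i) => [|j IH]; first by rewrite expr0 adj1.
by rewrite exprS -mulmxE adjM IH ag mulmxE -exprSr exprS.
Qed.

(** The polynomial identity of the reduction lifts to S because maps of degree 0 are detected at
    0. *)
Lemma bregular X g : HLR (hs X) -> bhom (X := X) (Y := X) 0 g ->
  (forall v : 'cV_(wdim (bw X)), evm g *m (evm g *m v) = 0 -> evm g *m v = 0) ->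
  exists N c, g = g *m g *m bpoly N c g.
Proof.
move=> [HX _] hg reg; have [N [c Ec]] := regular_mx_inverse reg.
exists N, c; apply/eqP; rewrite -subr_eq0; apply/eqP.
apply: (ev_lift HX HX (D := 0)); last 2 first.
- by rewrite add0r.
- rewrite evmB !evmM {1}Ec; apply/eqP; rewrite subr_eq0; apply/eqP; congr (_ *m _).
  rewrite /bpoly evm_sum; apply: eq_bigr => i _; rewrite evmZ evC; congr (_ *: _).
  by rewrite /evm map_mxX.
apply: bhomB => //; rewrite -mulmxA bpoly_comm mulmxA bpoly_comm -mulmxA.
by apply: bhom_poly => //; have := bhom_comp hg hg; rewrite addr0.
Qed.

(** A form of Schur's lemma: the projection onto the image of g, the adjoint of f composed with f,
    is a self-adjoint idempotent of X. If it were 0 then g would be 0, and f with it by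
    [hom_reg]. *)
Lemma simple_split X Y D f : bsimple X -> HLR (hs X) -> HLR (hs Y) ->
  bhom (X := X) (Y := Y) D f -> bdeg0 X Y D -> f != 0 ->
  exists2 f', bhom (X := Y) (Y := X) (- D) f' & f' *m f = be X.
Proof.
move=> [e0 simp] HX HY hf hD f0.
have hfa := bhom_adj hf; have D0 : D + (blen X)%:Z - (blen Y)%:Z = - D by rewrite -hD; ring.
rewrite D0 in hfa; pose g := badj f *m f.
have hg : bhom (X := X) (Y := X) 0 g by rewrite -(addNr D); apply: bhom_comp hfa hf.
have ga : adj (bw X) (bw X) g = g by rewrite /g /badj (adjM (w2 := bw Y)) adjK.
have Eg : evm g = hadj (X := hs X) (Y := hs Y) (evm f) *m evm f.
  by rewrite /g evmM -hs_adj.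
have reg0 (v : 'cV_(wdim (bw X))) : evm g *m v = 0 -> evm f *m v = 0.
  by rewrite Eg -mulmxA => h; apply: (hom_reg HX HY (hs_hom hf) hD).
have reg (v : 'cV_(wdim (bw X))) : evm g *m (evm g *m v) = 0 -> evm g *m v = 0.
  have h := hs_adj (X := X) (Y := X) g; rewrite /badj ga in h.
  rewrite {1}h; apply: (hom_reg HX HX (hs_hom hg)) => //=.
have [N [c Ec]] := bregular HX hg reg.
(* The projection onto the image of g, a polynomial in the self-adjoint g. *)
pose p := bpoly N c g *m g.
have pg : p *m g = g by rewrite /p -bpoly_comm -mulmxA -bpoly_comm mulmxA -Ec.
have pp : p *m p = p by rewrite {2}/p -bpoly_comm mulmxA pg bpoly_comm.
have hp : isproj (X := X) p.
  split=> //; first exact: bhom_poly.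
  by rewrite /p (adjM (w2 := bw X)) adj_poly // ga bpoly_comm.
case: (simp p hp) => Ep; last first.
  exists (bpoly N c g *m badj f); first exact: bhom_poly.
  by rewrite -mulmxA -/g -/p.
case/eqP: f0; apply: (ev_lift HX.1 HY.1 hf); first by rewrite hD.
have g0 : g = 0 by rewrite -pg Ep mul0mx.
by apply: mx_eq0_cV => v; apply: reg0; rewrite g0 /evm map_mx0 mul0mx.
Qed.

Lemma subO_HLR X f (hf : isproj (X := X) f) : HLR (hs X) -> HLR (hs (subO hf)).
Proof.
have [[_ _ ef] _ _] := hf.
have sub k v : inV (X := hs (subO hf)) k v -> inV (X := hs X) k v.
  by case=> /= Ev hv; split=> //=; rewrite -Ev mulmxA -evmM ef.
move=> [HX RX]; split=> k j kj v /sub hv; first exact: (HX k j kj v hv).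
exact: (RX k j kj v hv).
Qed.

Lemma isproj_sub X f (hf : isproj (X := X) f) g :
  isproj (X := subO hf) g -> isproj (X := X) g.
Proof.
have [[_ fe ef] _ _] := hf; move=> [[gw /= gf fg] gg ga]; split=> //; split=> //.
  by rewrite -gf -mulmxA fe.
by rewrite -fg mulmxA ef.
Qed.

Lemma isproj_compl X f : isproj (X := X) f -> isproj (X := X) (be X - f).
Proof.
move=> [hf ff fa]; have [_ fe ef] := hf; split.
- by apply: bhomB => //; exact: bhom_e.
- by rewrite mulmxBl !mulmxBr be_idem fe ef ff subrr subr0.
- by rewrite adjB be_adj fa.
Qed.

(** The rank of the reduction measures progress in [simple_decomposition]. *)
Lemma isproj_rank X f : HLR (hs X) -> isproj (X := X) f -> f != be X ->
  (\rank (evm f) < \rank (evm (be X)))%N.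
Proof.
move=> [HX _] hf nfe; have [[_ fe ef] ff _] := hf.
have sub : (evm f <= evm (be X))%MS by rewrite -fe evmM submxMl.
rewrite ltn_neqAle (mxrankS sub) andbT; apply: contraNneq nfe => Er.
have /submxP[Q EQ] : (evm (be X) <= evm f)%MS.
  by rewrite -(geq_leqif (mxrank_leqif_sup sub)) Er.
rewrite eq_sym -subr_eq0; apply/eqP.
have [h _ _] := isproj_compl hf.
apply: (ev_lift HX HX h); first by rewrite add0r.
rewrite evmB; apply/eqP; rewrite subr_eq0; apply/eqP.
by rewrite -[X in _ = evm X]ef evmM EQ -mulmxA -evmM ff.
Qed.

Lemma simple_decomposition X : HLR (hs X) -> exists r : seq 'M[S]_(wdim (bw X)),
  (forall f, f \in r -> exists hf : isproj (X := X) f, bsimple (subO hf)) /\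
  \sum_(f <- r) f = be X.
Proof.
have [m] := ubnP (\rank (evm (be X))); elim: m X => // m IH X hm HX.
have [e0|e0] := eqVneq (be X) 0.
  by exists [::]; split=> //; rewrite big_nil.
have [simp|nsimp] := pselect (forall f, isproj (X := X) f -> f = 0 \/ f = be X).
  exists [:: be X]; rewrite big_seq1; split=> // f; rewrite inE => /eqP ->.
  have hf : isproj (X := X) (be X).
    by split; [exact: bhom_e | exact: be_idem | exact: be_adj].
  exists hf; split=> // g /isproj_sub; exact: simp.
have [f [hf f0 fe]] : exists f, [/\ isproj (X := X) f, f != 0 & f != be X].
  apply: contrapT => nex; apply: nsimp => f hf; apply: contrapT => nf.
  apply: nex; exists f; split=> //; apply/eqP => E; apply: nf; by [left | right].
have hc := isproj_compl hf.
have fc : be X - f != be X by rewrite -subr_eq0 addrAC subrr add0r oppr_eq0.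
have [|r1 [h1 E1]] := IH (subO hf) _ (subO_HLR hf HX).
  by apply: leq_trans (isproj_rank HX hf fe) _; rewrite -ltnS.
have [|r2 [h2 E2]] := IH (subO hc) _ (subO_HLR hc HX).
  by apply: leq_trans (isproj_rank HX hc fc) _; rewrite -ltnS.
exists (r1 ++ r2); rewrite big_cat /= E1 E2 /= addrC subrK; split=> // g.
rewrite mem_cat => /orP[/h1|/h2] [hg sg]; exists (isproj_sub hg);
  by rewrite /subO (bobj_eq _ (isproj_idem hg) _ (isproj_adj hg) _ (isproj_wmap hg)).
Qed.

End Bimodules.

(** * Transfer along isometries, and scalar extensions *)

Section Embeddings.
Variable (R : realType).
Implicit Types (X Y Z : hspace R).

(** This survives when an extension is a sum of two copies, where hard Lefschetz fails at z = 0. *)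
Definition semipos Z := forall k j : nat, (k + k + j)%N = hn Z ->
  forall v, inV (X := Z) k%:Z v -> hL Z ^+ j.+1 *m v = 0 ->
  0 <= (-1) ^+ k * hB v (hL Z ^+ j *m v).

Lemma HLR_semipos Z : HLR Z -> semipos Z.
Proof.
move=> [HZ RZ] k j kj v hv Lv; have [->|nz] := eqVneq v 0.
  by rewrite hB0l mulr0.
exact/ltW/RZ.
Qed.

Lemma HL_emb X Y D f f' : ishom (X := Y) (Y := X) D f -> f' *m f = hE Y ->
  D + D + (hn Y)%:Z = (hn X)%:Z -> hard_lefschetz X -> hard_lefschetz Y.
Proof.
move=> hf f'f hD HX k j kj v hv Lv.
have Ev : f *m v = 0 -> v = 0.
  by case: hv => Ew _ fv0; rewrite -Ew -f'f -mulmxA fv0 mulmx0.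
apply: Ev; have := hom_inV hf hv; case E : (k%:Z + D) => [k'|k'] hv'.
  apply: (HX k' j) => //; first by lia.
  by rewrite -(hom_LX _ _ hf) Lv mulmx0.
exact: (inV_out hv').
Qed.

Lemma emb_form X Y f u v : hadj (X := Y) (Y := X) f *m f = hE Y -> hE Y *m v = v ->
  hB (f *m u) (f *m v) = hB u v.
Proof. by move=> ff Ev; rewrite hB_adj mulmxA ff Ev. Qed.

Lemma HLR_emb X Y f : ishom (X := Y) (Y := X) 0 f ->
  hadj (X := Y) (Y := X) f *m f = hE Y -> hn Y = hn X -> HLR X -> HLR Y.
Proof.
move=> hf ff hn_eq [HX RX]; split.
  by apply: (HL_emb hf ff) HX; rewrite hn_eq.
move=> k j kj v hv Lv nz; have hv' := hom_inV hf hv; rewrite addr0 in hv'.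
have := RX k j _ _ hv'; rewrite -!(hom_LX _ _ hf) Lv mulmx0 -hn_eq.
move=> /(_ kj erefl); rewrite (emb_form _ ff); last first.
  by case: (inVL j hv).
apply; apply: contraNneq nz => E0; case: hv => <- _.
by rewrite -ff -mulmxA E0 mulmx0.
Qed.

Lemma semipos_emb X Y f : ishom (X := Y) (Y := X) 0 f ->
  hadj (X := Y) (Y := X) f *m f = hE Y -> hn Y = hn X -> semipos X -> semipos Y.
Proof.
move=> hf ff hn_eq sX k j kj v hv Lv.
have hv' := hom_inV hf hv; rewrite addr0 in hv'.
have := sX k j _ _ hv'; rewrite -!(hom_LX _ _ hf) Lv mulmx0 -hn_eq.
move=> /(_ kj erefl); rewrite (emb_form _ ff) //.
by case: (inVL j hv).
Qed.

Lemma HLR_scale X M t (c : compat (X := X) M) (c' : compat (X := X) (t *: M)) :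
  0 < t -> HLR (extH c) -> HLR (extH c').
Proof.
move=> t0 [HM RM]; have tn : t != 0 by rewrite gt_eqF.
split; first exact: HL_scale HM.
move=> k j kj v; rewrite -[v]vsubmxK; set u := usubmx v; set w := dsubmx v.
have main i (a b : 'cV[R]_(hd X)) : exists a' b',
    hL (extH c') ^+ i *m col_mx a b = col_mx a' b' /\
    hL (extH c) ^+ i *m col_mx a (t^-1 *: b) = col_mx a' (t^-1 *: b').
  elim: i => [|i [a' [b' [E1 E2]]]]; first by exists a, b; rewrite !expr0 !mul1mx.
  exists (hL X *m a'), (t *: M *m a' + hL X *m b').
  rewrite !mulXSl E1 E2 /= !mul_block_col !mul0mx !addr0; split=> //.
  by rewrite scalerDr -scalemxAl scalerA mulVf // scale1r -scalemxAr.
have [a' [b' [E1 E2]]] := main j u w; have [a1 [b1 [F1 F2]]] := main j.+1 u w.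
move=> /inV_ext[hu hw]; rewrite F1 => /eqP; rewrite col_mx_eq0 => /andP[/eqP a0 /eqP b0] nz.
have hw' : inV (k%:Z - 1) (t^-1 *: w) by apply: inVZ.
have := RM k j kj (col_mx u (t^-1 *: w)); rewrite F2 a0 b0 scaler0 col_mx0 inV_ext.
move=> /(_ (conj hu hw') erefl); rewrite E1 E2 !hB_ext hBZl hBZr.
rewrite -mulrDr mulrCA pmulr_rgt0 ?invr_gt0 //; apply.
by move: nz; rewrite !col_mx_eq0 scaler_eq0 invr_eq0 (negbTE tn).
Qed.

Lemma compatZ X z : compat (X := X) (z *: 1%:M).
Proof.
have := compat_affine 0 z (compat1 X); by rewrite scale0r add0r.
Qed.

Lemma ext_scalar_HLR X z : 0 < z -> HLR X -> HLR (extH (compatZ X z)).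
Proof.
move=> z0 HX; apply: (@HLR_scale _ _ _ (compat1 X)) => //; exact: ext_product.
Qed.

Lemma ext0_L X j (u w : 'cV[R]_(hd X)) :
  hL (extH (compatZ X 0)) ^+ j *m col_mx u w = col_mx (hL X ^+ j *m u) (hL X ^+ j *m w).
Proof.
elim: j => [|j IH]; first by rewrite !expr0 !mul1mx.
rewrite mulXSl IH /= mul_block_col mul0mx addr0 scale0r mul0mx add0r.
by rewrite -!mulXSl.
Qed.

Lemma ext_scalar_semipos X z : 0 <= z -> HLR X -> semipos (extH (compatZ X z)).
Proof.
rewrite le_eqVlt => /orP[/eqP <-|z0] HX; last exact/HLR_semipos/ext_scalar_HLR.
move=> k j kj v; rewrite -[v]vsubmxK; set u := usubmx v; set w := dsubmx v.
rewrite inV_ext !ext0_L => -[hu hw] /eqP; rewrite col_mx_eq0 => /andP[/eqP Lu /eqP Lw].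
suff w0 : w = 0 by rewrite hB_ext w0 mulmx0 hB0l hB0r addr0 mulr0.
case: k kj hu hw => [|k] kj hu hw; first by apply: (inV_out hw).
move: hw; rewrite (_ : k.+1%:Z - 1 = k%:Z); last by lia.
by move=> hw; apply: (HX.1 k j.+1 _ w hw Lw); move: kj => /=; lia.
Qed.

(** With M = 0 the extension is X plus a shift of X. The first copy is centred half a degree too
    low, so the power of L that should be injective on its lowest degree k leads to degree hn X + 1
    - k, where it is 0. *)
Lemma ext0_not_HL X : hard_lefschetz X -> hE X != 0 ->
  ~ hard_lefschetz (extH (compatZ X 0)).
Proof.
move=> HX E0 H0.
have exk : exists k : nat, hP X k%:Z != 0.
  apply: contrapT => nex; move/eqP: E0; apply; apply: mx_eq0_cV => v.
  rewrite (@inV_decomp _ X (hE X *m v)); last by rewrite mulmxA hE_idem.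
  rewrite big1 // => k _; suff -> : hP X k%:Z = 0 by rewrite mul0mx.
  by apply/eqP; apply: contrapT => /negP h; apply: nex; exists (nat_of_ord k).
case: (ex_minnP exk) => k Pk kmin.
have Pdual (i : nat) : (i <= hn X)%N -> (hP X (hn X - i)%N%:Z == 0) = (hP X i%:Z == 0).
  move=> hi; rewrite -!mxrank_eq0 -(hP_rank X i%:Z).
  by rewrite (_ : (hn X - i)%N%:Z = (hn X)%:Z - i%:Z) //; lia.
have kn : (k <= hn X)%N.
  rewrite leqNgt; apply: contraNN Pk => lt; apply/eqP/mx_eq0_cV => v.
  by apply: (inV_out (inV_P k%:Z v)); lia.
have k2 : (k + k <= hn X)%N.
  rewrite leqNgt; apply/negP => lt; have := kmin (hn X - k)%N.
  by rewrite Pdual // Pk => /(_ isT); lia.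
have [v nz] : exists v : 'cV[R]_(hd X), hP X k%:Z *m v != 0.
  apply: contrapT => nex; move/eqP: Pk; apply; apply: mx_eq0_cV => v.
  by apply/eqP; apply: contrapT => /negP h; apply: nex; exists v.
have hv := inV_P k%:Z v; move: (hP X k%:Z *m v) nz hv => {}v nz hv.
have := H0 k ((hn X).+1 - (k + k))%N _ (col_mx v 0); rewrite inV_ext ext0_L mulmx0.
have e : (k + k + ((hn X).+1 - (k + k)))%N = hn (extH (compatZ X 0)) by rewrite /=; lia.
move=> /(_ e (conj hv (inV0 _ _))) h; move: nz.
have Lv := inVL ((hn X).+1 - (k + k))%N hv.
have : hL X ^+ ((hn X).+1 - (k + k)) *m v = 0.
  case: k kmin kn k2 hv Lv {Pk h e} => [|k] kmin kn k2 hv Lv.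
    by apply: (inV_out Lv); lia.
  have P0 : hP X (hn X - k)%N%:Z = 0.
    apply/eqP; rewrite Pdual; last by lia.
    by apply: contraTT isT => /kmin; rewrite ltnn.
  by move/inVP: Lv => <-; rewrite (_ : _ + _ = (hn X - k)%N%:Z) ?P0 ?mul0mx //; lia.
move=> E; move: h; rewrite E col_mx0 => /(_ erefl)/eqP; rewrite col_mx_eq0.
by move=> /andP[->].
Qed.

End Embeddings.

(** * Extension by one letter: the deformed operator and the stable case *)

Section Towers.
Variables (R : realType) (n : nat) (S : polyring R n).
Variables (A : S -> Prop) (la : 'rV[R]_n).
Hypothesis A_la : A (lin S la).
Notation bobj := (bobj A).
Notation hs := (hs A_la).
Implicit Types (X Y Z : bobj) (s t : letter R n).

Definition nilm X s : 'M[S]_(wdim (bw X) + wdim (bw X)) :=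
  mupp S s (wdim (bw X)) *m mlow S s (wdim (bw X)).

Lemma nilm_ext X Y s (f : 'M[S]_(wdim (bw Y), wdim (bw X))) :
  extm s f *m nilm X s = nilm Y s *m extm s f.
Proof. by rewrite /nilm mulmxA mup_nat -!mulmxA mlow_nat. Qed.

Lemma nilm_adj X s : adj (s :: bw X) (s :: bw X) (nilm X s) = nilm X s.
Proof.
by rewrite /nilm (@adjM _ _ _ (s :: bw X) (bw X) (s :: bw X)) adj_mup adj_mlow.
Qed.

Lemma nilm_homm X s : homm (egr (@wgr R n (bw X))) (egr (@wgr R n (bw X))) 1 (nilm X s).
Proof. by rewrite -[1]addr0; apply: hommM (homm_mup _ _ _) (homm_mlow _ _ _). Qed.

Definition hsz X s (z : R) : hspace R.
Proof.
refine (@HSpace R (wdim (bw X) + wdim (bw X)) (blen X).+1 (egr (@wgr R n (bw X)))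
  (wJ R (s :: bw X)) (evm (be (extO X s)))
  (evm (Lam (s :: bw X) (lin S la)) + z *: evm (nilm X s)) _ _ _ _ _ _ _ _ _).
- exact: (@hJ_tr _ (hs (extO X s))).
- exact: (@hJK _ (hs (extO X s))).
- exact: (@hJ_deg _ (hs (extO X s))).
- exact: (@hE_idem _ (hs (extO X s))).
- exact: (@hE_adj _ (hs (extO X s))).
- exact: (@hE_deg _ (hs (extO X s))).
- apply: shiftmD; first exact: (@hL_deg _ (hs (extO X s))).
  by apply: shiftmZ; apply: shiftm_evm; exact: nilm_homm.
- rewrite raddfD /= [(_ *: _)^T]linearZ /= mulmxDl mulmxDr -scalemxAl -scalemxAr.
  rewrite (@hL_adj _ (hs (extO X s))); congr (_ + _ *: _).
  exact: (evm_self_adj (w := s :: bw X) (nilm_adj X s)).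
- rewrite mulmxDl mulmxDr -scalemxAl -scalemxAr (@hEL _ (hs (extO X s))).
  by congr (_ + _ *: _); rewrite -!evmM /= nilm_ext.
Defined.

(* At [z = 0] this is the operator of [extO X s]; for [z] large it is close to that of
   the product of [X] with a projective line. *)
Definition HLall X s := forall z, 0 <= z -> hard_lefschetz (hsz X s z).

Lemma hsz_hom X Y s z D f : bhom (X := X) (Y := Y) D f ->
  ishom (X := hsz X s z) (Y := hsz Y s z) D (evm (extm s f)).
Proof.
move=> hf; have [h1 h2 h3 h4] := hs_hom A_la (bhom_ext s hf).
split=> //=; rewrite mulmxDl mulmxDr -scalemxAl -scalemxAr h2.
by congr (_ + _ *: _); rewrite -!evmM nilm_ext.
Qed.

Lemma evm_nilm X s : evm (nilm X s) = block_mx 0 0 1%:M 0.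
Proof.
by rewrite /nilm evmM evm_mlow evm_mup mul_col_row !(mul0mx, mulmx0, mul1mx).
Qed.

Lemma hsz_low X s z : ishom (X := hsz X s z) (Y := hs X) 0 (evm (blow X s)).
Proof.
have [h1 h2 h3 h4] := hs_hom A_la (bhom_low X s); split=> //=.
rewrite mulmxDr h2 -scalemxAr [X in _ + _ *: X](_ : _ = 0) ?scaler0 ?addr0 //.
rewrite -evmM blowE -mulmxA /nilm (mulmxA (mlow _ _ _)) mlow_mup.
rewrite mul_scalar_mx !evmM evmZ ev_lin scale0r mulmx0.
by [].
Qed.

Section Bridge.
Variables (X : bobj) (s : letter R n) (z : R).
Let e := evm (be X).
Let h := evm (map_mx (dem s) (be X)).
Let L := evm (Lam (bw X) (lin S la)).
Let L' := evm (map_mx (dem s) (Lam (bw X) (lin S la))).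
Let M := e *m L' *m e.

Let Eext : evm (be (extO X s)) = block_mx e 0 h e.
Proof. by rewrite /= evm_extm. Qed.
Let Lext : evm (Lam (s :: bw X) (lin S la)) = block_mx L 0 L' L.
Proof. by rewrite /= evm_extm. Qed.
Let ee : e *m e = e. Proof. by rewrite /e -evmM be_idem. Qed.
Let eL : e *m L = L *m e. Proof. exact: (@hEL _ (hs X)). Qed.
Let he : h *m e + e *m h = h.
Proof.
have := congr1 (@evm _ _ S _ _) (be_idem (extO X s)); rewrite evmM Eext mulmx_block.
by rewrite !mul0mx !mulmx0 !addr0 !add0r => /eq_block_mx[_ _].
Qed.
Let ehe : e *m h *m e = 0.
Proof.
have := congr1 (fun B => e *m B *m e) he.
rewrite mulmxDr mulmxDl !mulmxA ee -!mulmxA ee => /eqP.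
by rewrite -subr_eq0 addrK => /eqP.
Qed.
Let JL' : L'^T *m wJ R (bw X) = wJ R (bw X) *m L'.
Proof.
have := @hL_adj _ (hs (extO X s)); rewrite /= Lext tr_block_mx !mulmx_block.
by rewrite trmx0 !mul0mx !mulmx0 !addr0 !add0r => /eq_block_mx[].
Qed.

Lemma bridge_compat : compat (X := hs X) M.
Proof.
split=> /=.
- have ed := @hE_deg _ (hs X).
  have hL : shiftm (@wgr R n (bw X)) (@wgr R n (bw X)) 0 L'.
    apply: shiftm_evm => i j; rewrite mxE.
    have hh : homm (@wgr R n (bw X)) (@wgr R n (bw X)) 1 (Lam (bw X) (lin S la)).
      by apply: Lam_homog; exact: phom_lin.
    have := ihomog_dem s (hh i j).
    by rewrite (_ : _ - 1 = (wgr j)%:Z + 0 - (wgr i)%:Z) //; ring.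
  by have := shiftmM (shiftmM ed hL) ed; rewrite !addr0.
- have eJ := @hE_adj _ (hs X); rewrite /= in eJ.
  rewrite /M !trmx_mul -!mulmxA eJ (mulmxA _ (wJ R (bw X))) JL' -!mulmxA.
  by rewrite (mulmxA e^T) eJ !mulmxA.
- by rewrite /M !mulmxA ee -!mulmxA ee.
Qed.

Let c := compat_affine 1 z bridge_compat.
Let psi : 'M[R]_(wdim (bw X) + wdim (bw X)) := block_mx e 0 (e *m h) e.

Let psiE : psi = block_mx e 0 0 e *m block_mx e 0 h e.
Proof. by rewrite /psi mulmx_block !mul0mx !mulmx0 !addr0 !add0r ee. Qed.

Let EEE : block_mx e 0 h e *m block_mx e 0 h e = block_mx e 0 h e.
Proof. by rewrite -Eext -evmM (be_idem (extO X s)). Qed.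

(** The reduced idempotent of an extension has an off-diagonal block h. Multiplying by diag(e, e)
    straightens it into the idempotent of [extH], and e h e = 0 makes this an isometry; the block of
    the operator becomes e L' e + z. *)
Lemma bridge_hom : ishom (X := hsz X s z) (Y := extH c) 0 psi.
Proof.
split=> /=.
- have h2 := @hE_deg _ (hsz X s z); rewrite /= Eext in h2.
  by have := shiftmM (@hE_deg _ (extH c)) h2; rewrite addr0 psiE.
- rewrite Lext evm_nilm scale_block_mx !scaler0 add_block_mx !addr0.
  rewrite /psi !mulmx_block !mul0mx !mulmx0 !addr0 !add0r -/e -/h -/L -/L' scale1r.
  rewrite eL; congr (block_mx _ _ _ _).
  have : block_mx e 0 h e *m block_mx L 0 L' L = block_mx L 0 L' L *m block_mx e 0 h e.
    by rewrite -Eext -Lext; exact: (@hEL _ (hs (extO X s))).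
  rewrite !mulmx_block !mul0mx !mulmx0 !addr0 !add0r => /eq_block_mx[_ _ E _].
  have E2 : e *m h *m L + e *m L' = e *m L' *m e + e *m L *m h.
    by rewrite -{2}ee -!mulmxA -mulmxDr E mulmxDr !mulmxA.
  rewrite mulmxDr addrA E2 /M mulmxDl -!mulmxA ee -addrA (addrC (e *m (L *m h))).
  rewrite addrA; congr (_ + _ + _); first by rewrite -scalemxAr -scalemxAl mul1mx mulmx1.
  by rewrite mulmxA eL mulmxA.
- by rewrite Eext psiE -mulmxA EEE.
- by rewrite psiE mulmxA mulmx_block !mul0mx !mulmx0 !addr0 !add0r ee.
Qed.

Let psia : hadj (X := hsz X s z) (Y := extH c) psi =
  block_mx e 0 h e *m block_mx e 0 0 e.
Proof.
have E1 := @hE_adj _ (hsz X s z); have E2 := @hE_adj _ (extH c).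
have JJ := @hJK _ (hsz X s z).
rewrite /hadj psiE trmx_mul; rewrite /= Eext in E1; rewrite /= in E2 JJ *.
set J := block_mx 0 _ _ 0 in E2 *; rewrite -/J in E1 JJ.
rewrite -[LHS]mulmxA -[_ *m _ *m J]mulmxA E2 (mulmxA _ J) E1.
by rewrite -(mulmxA J) (mulmxA J J) JJ mul1mx.
Qed.

Lemma bridge_iso1 : hadj (X := hsz X s z) (Y := extH c) psi *m psi = hE (hsz X s z).
Proof.
rewrite psia psiE /= Eext -mulmxA (mulmxA (block_mx e 0 0 e)).
rewrite [block_mx e 0 0 e *m _]mulmx_block !mul0mx !mulmx0 !addr0 !add0r ee.
rewrite mulmx_block !mul0mx !mulmx0 !addr0 !add0r ee.
rewrite mulmx_block !mul0mx !mulmx0 !addr0 !add0r ee.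
by rewrite mulmxA ee he.
Qed.

Lemma bridge_iso2 : psi *m hadj (X := hsz X s z) (Y := extH c) psi = hE (extH c).
Proof.
rewrite psia psiE /= -mulmxA (mulmxA (block_mx e 0 h e)) EEE -/e.
rewrite !mulmx_block !mul0mx !mulmx0 !addr0 !add0r !mulmxA !ee ehe.
by rewrite mulmx0.
Qed.

End Bridge.

(** Deforming further from z only meets the parameters z + z1, which [HLall] covers. *)
Lemma HLall_HLR X s z : 0 <= z -> HLR (hs X) -> HLall X s -> HLR (hsz X s z).
Proof.
move=> z0 HX H.
apply: (HLR_emb (bridge_hom X s z) (bridge_iso1 X s z)) => //.
apply: ext_HLR => // z1 z10.
have hz := H (z + z1) (addr_ge0 z0 z10).
have h2 := hom_adj (bridge_hom X s (z + z1)).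
rewrite (_ : 0 + _ - _ = 0) in h2; last by rewrite /= add0r subrr.
have := @HL_emb _ _ _ _ _ _ h2 (bridge_iso2 X s (z + z1)).
move=> /(_ _ hz); rewrite !add0r => /(_ erefl) h3.
move: h3; set c1 := compat_affine 1 (z + z1) _; set c2 := compat_affine 1 z1 _.
have E : 1 *: (1 *: (evm (be X) *m evm (map_mx (dem s) (Lam (bw X) (lin S la))) *m evm (be X)) + z *: 1%:M) + z1 *: 1%:M =
  1 *: (evm (be X) *m evm (map_mx (dem s) (Lam (bw X) (lin S la))) *m evm (be X)) + (z + z1) *: 1%:M.
  by rewrite !scale1r scalerDl addrA.
by move: c2; rewrite E => c2; rewrite (Prop_irrelevance c2 c1).
Qed.

Lemma HLall_ext X s : HLR (hs X) -> HLall X s -> HLR (hs (extO X s)).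
Proof.
move=> HX H; apply: (@HLR_emb R (hsz X s 0) (hs (extO X s)) (evm (be (extO X s)))) => //.
- have [h1 h2 h3 h4] := hs_hom A_la (bhom_e (extO X s)).
  by split=> //=; rewrite scale0r addr0.
- rewrite /hadj -[X in X *m _](_ : evm (be (extO X s)) = _).
    by rewrite -evmM (be_idem (extO X s)).
  by rewrite -{1}(be_adj (extO X s)) evm_adj.
- exact: HLall_HLR.
Qed.

Lemma HLall_iso X Y s D f g : bhom (X := X) (Y := Y) D f ->
  bhom (X := Y) (Y := X) (- D) g -> g *m f = be X -> bdeg0 X Y D ->
  HLall Y s -> HLall X s.
Proof.
move=> hf hg gf hD HY z z0; apply: (@HL_emb R (hsz Y s z) (hsz X s z) D (evm (extm s f)) (evm (extm s g)) (hsz_hom s z hf) _ _ (HY z z0)).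
  by rewrite -evmM -extmM gf.
by move: hD; rewrite /bdeg0 /=; lia.
Qed.

(* The section [sg] has degree -1 once degrees are centred; it makes [extO X s] the sum
   of two shifted copies of [X]. *)
Definition tstable X s := exists2 sg, bhom (X := X) (Y := extO X s) 0 sg &
  blow X s *m sg = be X.

(** The entries of [extm s f] are s-invariant, so extending by s once more gives a block diagonal
    matrix, and the first copy is a section. *)
Lemma tstable_ext X s : tstable (extO X s) s.
Proof.
have E2 d d' (f : 'M[S]_(d', d)) : extm s (extm s f) =
    block_mx (extm s f) 0 0 (extm s f).
  have A2 : map_mx (avg s) (extm s f) = extm s f.
    rewrite /extm map_block_mx; congr block_mx; apply/matrixP => i j; rewrite !mxE.
    - by rewrite avg_inv // lact_avg.
    - by rewrite avg_inv // rmorphM /= lact_dem /qform rmorphM /= lact_hform mulrNN.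
    - by rewrite avg_inv // lact_dem.
    - by rewrite avg_inv // lact_avg.
  have D2 : map_mx (dem s) (extm s f) = 0.
    rewrite -[0]block_mx0 /extm map_block_mx; congr block_mx; apply/matrixP => i j; rewrite !mxE.
    - by rewrite dem_inv // lact_avg.
    - by rewrite dem_inv // rmorphM /= lact_dem /qform rmorphM /= lact_hform mulrNN.
    - by rewrite dem_inv // lact_dem.
    - by rewrite dem_inv // lact_avg.
  by rewrite {1}/extm A2 D2 scaler0.
set e := extm s (be X); exists (col_mx e 0).
  have [h i] := be_wmap (extO X s); split; first split.
  - move=> i0 j; rewrite -[i0]splitK; case: (fintype.split i0) => {}i0 /=.
      by rewrite egr_lshift col_mxEu; exact: h.
    by rewrite col_mxEd mxE ihomog0.
  - move=> p Ap; have {}i : e *m extm s (Lam (bw X) p) = extm s (Lam (bw X) p) *m e by exact: i.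
    rewrite /= E2; move: e (extm s (Lam (bw X) p)) i => e0 LL i.
    by rewrite mul_col_mx mul_block_col !mul0mx mulmx0 !addr0 i.
  - by rewrite /= mul_col_mx mul0mx -/e -extmM be_idem.
  - by rewrite /= E2 mul_block_col !mul0mx mulmx0 !addr0 -/e -extmM be_idem.
rewrite blowE /mlow /= -mulmxA mul_row_col mulmx0 addr0 mul1mx -/e -extmM be_idem.
by [].
Qed.

Lemma tstable_retract X Z s D p q : bhom (X := X) (Y := Z) D p ->
  bhom (X := Z) (Y := X) (- D) q -> q *m p = be X -> tstable Z s -> tstable X s.
Proof.
move=> hp hq qp [sg hsg Esg]; exists (extm s q *m sg *m p).
  rewrite -[0](addNr D) -[- D]addr0; apply: bhom_comp hp.
  by apply: bhom_comp hsg; exact: bhom_ext.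
have [_ fq fe] := hq.
have E1 : blow X s *m extm s q = q *m blow Z s.
  by rewrite blowE -mulmxA mlow_nat mulmxA fe blowE mulmxA fq.
by rewrite !mulmxA E1 -(mulmxA q) Esg fq qp.
Qed.

(** The nonzero entries of f strictly change the degree of basis vectors, so f is nilpotent. *)
Lemma idem_nil d (g : 'I_d -> nat) (f : 'M[S]_d) : homm g g 0 f -> f *m f = f ->
  evm f = 0 -> f = 0.
Proof.
move=> hf ff f0.
have lt i j : f i j != 0 -> (g i < g j)%N.
  move=> nz; have := hf i j; rewrite addr0 => hij; rewrite ltnNge; apply: contra nz => le.
  rewrite (ihomog_le0 hij); last by lia.
  by move/matrixP/(_ i j): f0; rewrite !mxE => ->; rewrite raddf0.
have lt_k k i j : f i j != 0 -> (g i + k < g j)%N.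
  elim: k i j => [|k IH] i j; first by rewrite addn0; exact: lt.
  rewrite -ff mxE => h; have [l hl] : exists l, f i l * f l j != 0.
    apply: contrapT => nex; case/eqP: h; apply: big1 => l _.
    by apply/eqP; apply: contrapT => /negP hl; apply: nex; exists l.
  move: hl; rewrite mulf_eq0 negb_or => /andP[/lt h1 /IH h2]; lia.
apply/matrixP => i j; rewrite mxE; apply/eqP; apply: contraT => /(lt_k (g j)); lia.
Qed.

Lemma evm_low_up X s : evm (blow X s *m bup X s) = 0.
Proof.
rewrite blowE /bup -mulmxA (mulmxA (mlow _ _ _)) mlow_mup.
by rewrite mul_scalar_mx evmM evmZ ev_lin scale0r mulmx0.
Qed.

(** The pairs (sg, m) and (tau, sga) exhibit two independent copies of E; tau is mu corrected so
    that m kills it. *)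
Lemma split_idem a b (E : 'M[S]_a) (m sga : 'M[S]_(a, b)) (mu sg : 'M[S]_(b, a)) :
  m *m sg = E -> E *m m = m -> sga *m sg = 0 -> sga *m mu = E -> sg *m E = sg ->
  E *m sga = sga -> let tau := mu - sg *m (m *m mu) in
  [/\ m *m tau = 0, sga *m tau = E &
    (sg *m m + tau *m sga) *m (sg *m m + tau *m sga) = sg *m m + tau *m sga].
Proof.
move=> Esg ml2 sgsg sgup sg1 sga2 tau.
have mtau : m *m tau = 0.
  by rewrite mulmxBr (mulmxA m sg) Esg (mulmxA E) ml2 subrr.
have satau : sga *m tau = E.
  by rewrite mulmxBr (mulmxA sga sg) sgsg mul0mx subr0 sgup.
split=> //; rewrite mulmxDl !mulmxDr -!mulmxA (mulmxA m sg) Esg (mulmxA m tau) mtau.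
rewrite (mulmxA sga sg) sgsg (mulmxA sga tau) satau !mul0mx !mulmx0 addr0 add0r.
by rewrite (mulmxA sg) sg1 sga2.
Qed.

Lemma stable_up X s sg : bhom (X := X) (Y := extO X s) 0 sg ->
  blow X s *m sg = be X -> badj (X := X) (Y := extO X s) sg *m bup X s = be X.
Proof.
move=> _ Esg; rewrite -(badj_low X s) /badj.
by rewrite -(@adjM _ _ S (bw X) (s :: bw X) (bw X)) Esg be_adj.
Qed.

(** The section is isotropic since [sga *m sg] has negative degree, so the section and its dual
    split off two copies of X. *)
Lemma stable_id X s sg : hard_lefschetz (hs X) ->
  bhom (X := X) (Y := extO X s) 0 sg -> blow X s *m sg = be X ->
  let sga := badj (X := X) (Y := extO X s) sg in
  sga *m sg = 0 /\
  be (extO X s) = sg *m blow X s + (bup X s - sg *m (blow X s *m bup X s)) *m sga.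
Proof.
move=> HX hsg Esg sga.
have hsga := bhom_adj hsg; rewrite -/sga in hsga.
have len : 0 + (blen X)%:Z - (blen (extO X s))%:Z = -1.
  by rewrite /blen /= -addn1 PoszD; lia.
rewrite len in hsga.
have sgsg : sga *m sg = 0.
  by apply: (bhom_neg HX HX (bhom_comp hsga hsg)); lia.
split=> //.
have sgup : sga *m bup X s = be X by exact: stable_up.
have [hl ml1 ml2] := bhom_low X s; have [hu mu1 mu2] := bhom_up X s.
have [hS sg1 sg2] := hsg; have [hSa sga1 sga2] := hsga.
have [mtau satau Psi2] := split_idem Esg ml2 sgsg sgup sg1 sga2.
pose m := blow X s; pose mu := bup X s; pose tau := mu - sg *m (m *m mu).
rewrite -/m -/mu -/tau in mtau satau Psi2 *.
have htau : bhom (X := X) (Y := extO X s) 1 tau.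
  apply: bhomB; first exact: bhom_up.
  rewrite -[1]add0r; apply: bhom_comp hsg _; rewrite -[1]add0r.
  exact: bhom_comp (bhom_low X s) (bhom_up X s).
have hPsi : bhom (X := extO X s) (Y := extO X s) 0 (sg *m m + tau *m sga).
  apply: bhomD; first by rewrite -[0]addr0; apply: bhom_comp hsg (bhom_low X s).
  by rewrite -[0](subrr 1); apply: bhom_comp htau hsga.
have [[hP _] P1 P2] := hPsi.
(* The complement of the two copies is an idempotent, so by [idem_nil] it is enough to show that its
   reduction vanishes. *)
apply/eqP; rewrite -subr_eq0; apply/eqP.
apply: (@idem_nil _ (@wgr R n (s :: bw X))).
- by apply: hommB => //; case: (be_wmap (extO X s)).
- by rewrite mulmxBl !mulmxBr (be_idem (extO X s)) P1 P2 Psi2 subrr subr0.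
have evtau : evm tau = evm mu.
  by rewrite /tau evmB (evmM sg) evm_low_up mulmx0 subr0.
pose a := usubmx (evm sg : 'M_(_ + _, _)); pose hh := dsubmx (evm sg : 'M_(_ + _, _)).
pose e := evm (be X); pose h0 := evm (map_mx (dem s) (be X)).
have Eext : evm (be (extO X s)) = block_mx e 0 h0 e by rewrite /= evm_extm.
have Em : evm m = row_mx e 0.
  by rewrite /m blowE evmM evm_mlow mul_mx_row mulmx1 mulmx0.
have Emu : evm mu = col_mx 0 e.
  by rewrite /mu /bup evmM evm_mup mul_col_mx mul1mx mul0mx.
have Esg2 : evm sg = col_mx e hh.
  rewrite -[evm sg](@vsubmxK _ (wdim (bw X)) (wdim (bw X))) -/a -/hh; congr col_mx.
  have := congr1 (@evm _ _ S _ _) sg2; rewrite evmM Eext.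
  rewrite -[evm sg](@vsubmxK _ (wdim (bw X)) (wdim (bw X))) -/a -/hh mul_block_col mul0mx addr0.
  move=> /eq_col_mx[Ea _]; have := congr1 (@evm _ _ S _ _) Esg; rewrite evmM -/m Em.
  rewrite -[evm sg](@vsubmxK _ (wdim (bw X)) (wdim (bw X))) -/a -/hh mul_row_col mul0mx addr0.
  by rewrite Ea.
have J := @hJK _ (hs X); have eJ := @hE_adj _ (hs X); rewrite /= -/e in J eJ.
pose ha := wJ R (bw X) *m hh^T *m wJ R (bw X).
have ea : wJ R (bw X) *m e^T *m wJ R (bw X) = e by rewrite -mulmxA eJ mulmxA J mul1mx.
have Esga : evm sga = row_mx ha e.
  rewrite /sga /badj evm_adj /= Esg2 tr_col_mx mul_mx_row mul_row_block.
  by rewrite !mulmx0 addr0 add0r ea.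
have q1 : ha *m e + e *m hh = 0.
  have := congr1 (@evm _ _ S _ _) sgsg; rewrite evmM Esga Esg2 mul_row_col => ->.
  exact: map_mx0.
have q2 : h0 *m e + e *m hh = hh.
  have := congr1 (@evm _ _ S _ _) sg2; rewrite evmM Eext Esg2 mul_block_col.
  by move=> /eq_col_mx[].
have h0a : wJ R (bw X) *m h0^T *m wJ R (bw X) = h0.
  have := congr1 (@evm _ _ S _ _) (be_adj (extO X s)); rewrite evm_adj Eext /=.
  rewrite tr_block_mx !mulmx_block !mul0mx !mulmx0 !addr0 !add0r trmx0.
  by move=> /eq_block_mx[].
have q3 : e *m h0 + ha *m e = ha.
  have := congr1 (fun B => wJ R (bw X) *m B^T *m wJ R (bw X)) q2.
  rewrite -/ha => Eq; rewrite -[RHS]Eq raddfD /= !trmx_mul mulmxDr mulmxDl; congr (_ + _).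
    rewrite -{1}ea -{1}h0a -!mulmxA (mulmxA (wJ R (bw X)) (wJ R (bw X))) J mul1mx.
    by [].
  rewrite -{1}ea /ha -!mulmxA (mulmxA (wJ R (bw X)) (wJ R (bw X))) J mul1mx.
  by [].
have ee : e *m e = e by rewrite /e -evmM be_idem.
have hhe : hh *m e = hh.
  have := congr1 (@evm _ _ S _ _) sg1; rewrite evmM Esg2 mul_col_mx.
  by move=> /eq_col_mx[].
have eha : e *m ha = ha.
  have := congr1 (@evm _ _ S _ _) sga2; rewrite evmM Esga mul_mx_row.
  by move=> /eq_row_mx[].
rewrite evmB evmD (evmM sg m) (evmM tau sga) evtau Em Emu Esga Esg2 Eext !mul_col_row !mul0mx mulmx0 ee.
rewrite mulmx0 add_block_mx !addr0 !add0r hhe eha opp_block_mx add_block_mx.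
rewrite !subrr -[RHS](@block_mx0 _ (wdim (bw X)) (wdim (bw X)) (wdim (bw X)) (wdim (bw X))).
congr block_mx.
rewrite -{1}q2 -{1}q3.
have -> : h0 *m e + e *m hh + (e *m h0 + ha *m e) = (h0 *m e + e *m h0) + (ha *m e + e *m hh).
  by rewrite -addrA (addrC (e *m hh)) -!addrA; congr (_ + _); rewrite !addrA.
rewrite q1 addr0.
have := congr1 (@evm _ _ S _ _) (be_idem (extO X s)); rewrite evmM Eext mulmx_block.
rewrite !mul0mx !mulmx0 !addr0 !add0r => /eq_block_mx[_ _ -> _].
by rewrite subrr.
Qed.

Section StableBridge.
Variables (X : bobj) (s : letter R n) (z : R).
Variable sg : 'M[S]_(wdim (bw X) + wdim (bw X), wdim (bw X)).
Hypothesis HX : hard_lefschetz (hs X).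
Hypothesis hsg : bhom (X := X) (Y := extO X s) 0 sg.
Hypothesis Esg : blow X s *m sg = be X.
Let sga := badj (X := X) (Y := extO X s) sg.

Definition stable_psi : 'M[R]_(wdim (bw X) + wdim (bw X)) :=
  col_mx (evm (blow X s)) (evm sga).

Let hsga : bhom (X := extO X s) (Y := X) (-1) sga.
Proof.
have := bhom_adj hsg; rewrite (_ : 0 + (blen X)%:Z - (blen (extO X s))%:Z = -1) //.
by rewrite /blen /= -addn1 PoszD; lia.
Qed.

(** In the two copies lambda acts diagonally and N maps the first identically onto the second, so
    the deformed operator is the extension with scalar block z. *)
Lemma stable_psi_hom :
  ishom (X := hsz X s z) (Y := extH (compatZ (hs X) z)) 0 stable_psi.
Proof.
have [l1 l2 l3 l4] := hsz_low X s z.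
have [a1 a2 a3 a4] := hs_hom A_la hsga.
split.
- move=> i j; rewrite /stable_psi -[i]splitK; case: (fintype.split i) => {}i /=.
    by rewrite egr_lshift col_mxEu; exact: l1.
  rewrite egr_rshift col_mxEd => /a1 /=; rewrite /egr /= => E; lia.
- rewrite /stable_psi mul_col_mx [RHS]mul_block_col mul0mx addr0 l2.
  congr col_mx; rewrite [hL (hsz _ _ _)]/= mulmxDr a2 addrC; congr (_ + _).
  rewrite -scalemxAr -scalemxAl mul1mx -evmM; congr (_ *: evm _).
  have [_ b1 _] := hsga; rewrite -b1 /nilm mulmxA -(mulmxA sga) -bupE.
  by rewrite stable_up // blowE.
- by rewrite /stable_psi mul_col_mx l3 a3.
- by rewrite /stable_psi [LHS]mul_block_col !mul0mx addr0 add0r l4 a4.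
Qed.

Let hadjE : hadj (X := hsz X s z) (Y := extH (compatZ (hs X) z)) stable_psi =
  row_mx (evm sg) (evm (bup X s)).
Proof.
have E1 := @hs_adj _ _ _ _ _ A_la (extO X s) X (blow X s); rewrite badj_low in E1.
have E2 := @hs_adj _ _ _ _ _ A_la (extO X s) X sga.
rewrite [badj _](_ : _ = sg) in E2; last by rewrite /badj adjK.
rewrite E1 E2 /hadj /stable_psi tr_col_mx mul_mx_row [X in X = _]mul_row_block.
by rewrite !mulmx0 addr0 add0r.
Qed.

Lemma stable_psi_iso : hadj (X := hsz X s z) (Y := extH (compatZ (hs X) z)) stable_psi
  *m stable_psi = hE (hsz X s z).
Proof.
have [_ E] := stable_id HX hsg Esg.
rewrite hadjE /stable_psi mul_row_col [RHS]/= -/(be (extO X s)).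
rewrite -[extm s (be X)]/(be (extO X s)) E evmD (evmM sg (blow X s)) (evmM (_ - _)) evmB.
by rewrite (evmM sg (_ *m _)) evm_low_up mulmx0 subr0.
Qed.

Lemma stable_psi_iso' : stable_psi *m
  hadj (X := hsz X s z) (Y := extH (compatZ (hs X) z)) stable_psi =
  hE (extH (compatZ (hs X) z)).
Proof.
have [E0 _] := stable_id HX hsg Esg.
rewrite hadjE /stable_psi mul_col_row -!evmM Esg evm_low_up E0 stable_up //.
by rewrite /evm map_mx0.
Qed.

End StableBridge.

Lemma tstable_semipos X s z : 0 <= z -> HLR (hs X) -> tstable X s ->
  semipos (hsz X s z).
Proof.
move=> z0 HX [sg hsg Esg].
apply: (semipos_emb (stable_psi_hom z hsg Esg) (stable_psi_iso z HX.1 hsg Esg)) => //.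
exact: ext_scalar_semipos.
Qed.

Lemma be_evm_neq0 X : be X != 0 -> evm (be X) != 0.
Proof.
apply: contra_neq => E; have [[h _] _ _] := bhom_e X; exact: (idem_nil h (be_idem X) E).
Qed.

Lemma tstable_not_HLall X s : HLR (hs X) -> be X != 0 -> tstable X s -> ~ HLall X s.
Proof.
move=> HX /be_evm_neq0 e0 [sg hsg Esg] /(_ 0 (lexx _)) H0.
apply: (@ext0_not_HL _ (hs X) HX.1 e0).
have h := hom_adj (stable_psi_hom 0 hsg Esg).
rewrite (_ : 0 + _ - _ = 0) in h; last by rewrite /= add0r subrr.
apply: (@HL_emb R _ _ 0 _ _ h (stable_psi_iso' 0 HX.1 hsg Esg)) H0.
by rewrite !add0r.
Qed.

(** [stable_psi] leaves (0, w) in the second copy, on which the deformed operator is that of X. This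
    replaces the strict inequality where only [semipos] holds. *)
Lemma tstable_ker X s z (k j : nat) (w : 'cV_(wdim (bw X))) :
  HLR (hs X) -> tstable X s -> (k + k + j)%N = blen X -> inV (X := hs X) k%:Z w ->
  hL (hsz X s z) ^+ j *m col_mx 0 w = 0 -> w = 0.
Proof.
move=> HX [sg hsg Esg] kj hw T0.
have h := stable_psi_hom z hsg Esg.
have E := @hom_LX R (hsz X s z) (extH (compatZ (hs X) z)) 0 (stable_psi s sg) j (col_mx 0 w) h; rewrite T0 mulmx0 in E.
apply: (HX.1 k j kj w hw).
have psiE : stable_psi s sg *m col_mx 0 w = col_mx 0 w.
  rewrite /stable_psi mul_col_mx blowE evmM evm_mlow mul_mx_row mul_row_col.
  rewrite mulmx0 mulmx0 mul0mx addr0; congr col_mx.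
  have [Ew _] := hw; rewrite -[RHS]Ew -[hE _]/(evm (be X)) -(stable_up hsg Esg).
  rewrite bupE mulmxA; have := bhom_adj hsg => -[_ -> _].
  by rewrite evmM evm_mup -mulmxA mul_col_mx mul0mx mul1mx.
rewrite psiE in E; have [b Eb] : exists b, hL (extH (compatZ (hs X) z)) ^+ j *m col_mx 0 w = col_mx b (hL (hs X) ^+ j *m w) /\ b = 0.
  elim: (j) => [|i [b [IH b0]]]; first by exists 0; rewrite !expr0 !mul1mx.
  exists 0; split=> //; rewrite mulXSl IH b0 [LHS]mul_block_col !mulmx0 mul0mx addr0 add0r.
  by rewrite -mulXSl.
by case: Eb => Eb _; move/eqP: E; rewrite Eb eq_sym col_mx_eq0 => /andP[_ /eqP].
Qed.

End Towers.

(** * Chains of simple summands *)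

Section Chains.
Variables (R : realType) (n : nat) (S : polyring R n).
Variables (A : S -> Prop) (la : 'rV[R]_n).
Hypothesis A_la : A (lin S la).
Variables (I : Type) (sl : I -> letter R n).
Notation bobj := (bobj A).
Notation hs := (hs A_la).
Notation HLall := (HLall A_la).
Implicit Types (X Y Z D C U : bobj) (s t : letter R n).

(** A summand without shift: the inclusion has centred degree 0, so newness and comparison of
    lengths are phrased with it. *)
Definition splits D C := exists j p q,
  [/\ bdeg0 D C j, bhom (X := D) (Y := C) j p, bhom (X := C) (Y := D) (- j) q
    & q *m p = be D].

Lemma splits_trans D C Z : splits D C -> splits C Z -> splits D Z.
Proof.
move=> [j [p [q [h1 hp hq E]]]] [j' [p' [q' [h1' hp' hq' E']]]].
exists (j' + j), (p' *m p), (q *m q'); split.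
- by move: h1 h1'; rewrite /bdeg0; lia.
- exact: bhom_comp hp' hp.
- by rewrite opprD addrC; apply: bhom_comp hq hq'.
- by have [_ _ e] := hp; rewrite mulmxA -(mulmxA q) E' -mulmxA e.
Qed.

(** [D] is a summand of [C] up to a shift of the grading. *)
Definition shsplits D C := exists j p q,
  [/\ bhom (X := D) (Y := C) j p, bhom (X := C) (Y := D) (- j) q & q *m p = be D].

Lemma splits_sh D C : splits D C -> shsplits D C.
Proof. by move=> [j [p [q [_ hp hq E]]]]; exists j, p, q. Qed.

Lemma shsplits_trans D C Z : shsplits D C -> shsplits C Z -> shsplits D Z.
Proof.
move=> [j [p [q [hp hq E]]]] [j' [p' [q' [hp' hq' E']]]].
exists (j' + j), (p' *m p), (q *m q'); split.
- exact: bhom_comp hp' hp.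
- by rewrite opprD addrC; apply: bhom_comp hq hq'.
- by have [_ _ e] := hp; rewrite mulmxA -(mulmxA q) E' -mulmxA e.
Qed.

Lemma shsplits_ext D C s : shsplits D C -> shsplits (extO D s) (extO C s).
Proof.
move=> [j [p [q [hp hq E]]]]; exists j, (extm s p), (extm s q); split.
- exact: bhom_ext.
- exact: bhom_ext.
- by rewrite -extmM E.
Qed.

Lemma shsplits_tstable D C s : shsplits D C -> tstable C s -> tstable D s.
Proof. by move=> [j [p [q [hp hq E]]]]; apply: tstable_retract hp hq E. Qed.

Lemma splits_tstable D C s : splits D C -> tstable C s -> tstable D s.
Proof. by move/splits_sh; exact: shsplits_tstable. Qed.

Lemma splits_HLall D C s : splits D C -> HLall C s -> HLall D s.
Proof. by move=> [j [p [q [h hp hq E]]]]; apply: HLall_iso hp hq E h. Qed.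

Lemma subO_in X f (hf : isproj (X := X) f) :
  bhom (X := subO hf) (Y := X) 0 f /\ bhom (X := X) (Y := subO hf) 0 f.
Proof.
have [[w fe ef] ff _] := hf.
by split; split.
Qed.

(** Morphisms of degree [D] which are sums of composites through objects in [Q]. *)
Inductive thr (Q : bobj -> Prop) X Y (D : int) :
  'M[S]_(wdim (bw Y), wdim (bw X)) -> Prop :=
| thr0 : thr Q D 0
| thrD f g : thr Q D f -> thr Q D g -> thr Q D (f + g)
| thr1 C j p q : Q C -> bhom (X := X) (Y := C) j p ->
    bhom (X := C) (Y := Y) (D - j) q -> thr Q D (q *m p).

Lemma thr_comp (Q : bobj -> Prop) X X' Y Y' (D D1 D2 : int) f g h :
  bhom (X := X') (Y := X) D1 f -> thr (X := X) (Y := Y) Q D g ->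
  bhom (X := Y) (Y := Y') D2 h -> thr (X := X') (Y := Y') Q (D2 + D + D1) (h *m g *m f).
Proof.
move=> hf + hh; elim=> [|g1 g2 _ IH1 _ IH2|C j p q QC hp hq].
- by rewrite mulmx0 mul0mx; exact: thr0.
- by rewrite mulmxDr mulmxDl; exact: thrD.
rewrite mulmxA -mulmxA; apply: (thr1 (j := j + D1)) QC _ _.
  exact: bhom_comp hp hf.
rewrite (_ : _ - _ = D2 + (D - j)); last by ring.
exact: bhom_comp hh hq.
Qed.

Lemma thr_trans (Q Q' : bobj -> Prop) X Y (D : int) g :
  (forall C, Q C -> thr (X := C) (Y := C) Q' 0 (be C)) ->
  thr (X := X) (Y := Y) Q D g -> thr (X := X) (Y := Y) Q' D g.
Proof.
move=> QQ; elim=> [|g1 g2 _ IH1 _ IH2|C j p q QC hp hq].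
- exact: thr0.
- exact: thrD.
have [_ qe _] := hq; rewrite -qe.
have := thr_comp hp (QQ C QC) hq; rewrite addr0 subrK; exact.
Qed.

Lemma thr_sub (Q Q' : bobj -> Prop) X Y (D : int) g : (forall C, Q C -> Q' C) ->
  thr (X := X) (Y := Y) Q D g -> thr (X := X) (Y := Y) Q' D g.
Proof.
move=> QQ; elim=> [|g1 g2 _ IH1 _ IH2|C j p q QC hp hq].
- exact: thr0.
- exact: thrD.
- exact: thr1 (QQ _ QC) hp hq.
Qed.

Lemma thr_nz (Q : bobj -> Prop) X Y (D : int) g : thr (X := X) (Y := Y) Q D g -> g != 0 ->
  exists C j p q, [/\ Q C, bhom (X := X) (Y := C) j p,
    bhom (X := C) (Y := Y) (D - j) q & q *m p != 0].
Proof.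
elim=> [|g1 g2 _ IH1 _ IH2|C j p q QC hp hq]; first by rewrite eqxx.
  by have [->|/IH1 //] := eqVneq g1 0; rewrite add0r => /IH2.
by move=> nz; exists C, j, p, q.
Qed.

Lemma thr_ext (Q : bobj -> Prop) X Y (D : int) g s : thr (X := X) (Y := Y) Q D g ->
  thr (X := extO X s) (Y := extO Y s) (fun C => exists2 C', Q C' & C = extO C' s) D
    (extm s g).
Proof.
elim=> [|g1 g2 _ IH1 _ IH2|C j p q QC hp hq].
- by rewrite raddf0; exact: thr0.
- by rewrite extmD; exact: thrD.
rewrite extmM; apply: thr1 (bhom_ext s hp) (bhom_ext s hq).
by exists C.
Qed.

Lemma simple_nz_split D C j p : bsimple D -> HLR (hs D) -> HLR (hs C) ->
  bhom (X := D) (Y := C) j p -> bdeg0 D C j -> p != 0 -> splits D C.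
Proof.
move=> sD HD HC hp hj nz; have [q hq E] := simple_split sD HD HC hp hj nz.
by exists j, p, q.
Qed.

(* A composite of total degree 0 has a factor of nonpositive centred degree. *)
Lemma simple_thr_split (Q : bobj -> Prop) D f : bsimple D -> HLR (hs D) ->
  (forall C, Q C -> HLR (hs C)) -> thr (X := D) (Y := D) Q 0 f -> f = be D ->
  exists2 C, Q C & splits D C.
Proof.
move=> sD HD HQ hf Ef; have [e0 _] := sD; move: e0; rewrite -Ef => nz.
have [C [j [p [q [QC hp hq qp]]]]] := thr_nz hf nz; rewrite sub0r in hq.
have HC := HQ C QC.
have p0 : p != 0 by apply: contraNneq qp => ->; rewrite mulmx0.
have q0 : q != 0 by apply: contraNneq qp => ->; rewrite mul0mx.
exists C => //; suff hj : bdeg0 D C j by exact: (simple_nz_split sD HD HC hp hj p0).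
rewrite /bdeg0; apply/eqP; rewrite eq_le; apply/andP; split.
  rewrite leNgt; apply: contraNN q0 => lt; apply/eqP.
  by apply: (bhom_neg HC.1 HD.1 hq); lia.
rewrite leNgt; apply: contraNN p0 => lt; apply/eqP.
exact: (bhom_neg HD.1 HC.1 hp).
Qed.

(** Nothing is assumed about the objects of Q, so the degrees of the two factors are not controlled
    and the summand may be shifted; the left inverse comes from a nonzero endomorphism of D of
    degree 0. *)
Lemma simple_thr_shsplit (Q : bobj -> Prop) D f : bsimple D -> HLR (hs D) ->
  thr (X := D) (Y := D) Q 0 f -> f = be D -> exists2 C, Q C & shsplits D C.
Proof.
move=> sD HD hf Ef; have [e0 _] := sD; move: e0; rewrite -Ef => nz.
have [C [j [p [q [QC hp hq qp]]]]] := thr_nz hf nz; rewrite sub0r in hq.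
have hqp : bhom (X := D) (Y := D) 0 (q *m p) by rewrite -(addNr j); apply: bhom_comp hq hp.
have [|g hg E] := simple_split sD HD HD hqp _ qp; first by rewrite /bdeg0 !add0r.
exists C => //; exists j, p, (g *m q); split=> //; last by rewrite -mulmxA.
by rewrite -[- j]add0r -[X in X + _]oppr0; apply: bhom_comp hg hq.
Qed.

Lemma shsplits_thr (Q : bobj -> Prop) D C : bsimple D -> HLR (hs D) ->
  shsplits D C -> thr (X := C) (Y := C) Q 0 (be C) -> exists2 Z, Q Z & shsplits D Z.
Proof.
move=> sD HD [j [p [q [hp hq E]]]] h.
have := thr_comp hp h hq; rewrite addr0 addNr => /(simple_thr_shsplit sD HD); apply.
by have [_ e _] := hq; rewrite e.
Qed.

Lemma shsplits_thr_HLR (Q : bobj -> Prop) D C : bsimple D -> HLR (hs D) ->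
  (forall Z, Q Z -> HLR (hs Z)) ->
  shsplits D C -> thr (X := C) (Y := C) Q 0 (be C) -> exists2 Z, Q Z & splits D Z.
Proof.
move=> sD HD HQ [j [p [q [hp hq E]]]] h.
have := thr_comp hp h hq; rewrite addr0 addNr => /(simple_thr_split sD HD HQ); apply.
by have [_ e _] := hq; rewrite e.
Qed.

Definition wobj w : bobj := @BObj R n S A w 1%:M (mulmx1 _) (adj1 S w) (wmap1 A w).

Lemma splits_wobj D : splits D (wobj (bw D)).
Proof.
have [h e1 e2] := bhom_e D; exists 0, (be D), (be D); rewrite oppr0; split=> //.
- by split=> //=; exact: mul1mx.
- by split=> //=; exact: mulmx1.
Qed.

Lemma wobj_ext w s : splits (wobj (s :: w)) (extO (wobj w) s) /\
  splits (extO (wobj w) s) (wobj (s :: w)).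
Proof.
have h : wmap A (w := s :: w) (w' := s :: w) 0 1%:M by exact: wmap1.
have E : extm s (1%:M : 'M[S]_(wdim w)) = 1%:M by exact: extm1.
by split; exists 0, 1%:M, 1%:M; rewrite oppr0; split=> //=;
  rewrite ?E ?mulmx1 // /bdeg0 ?add0r //; split=> //=; rewrite ?E ?mulmx1 ?mul1mx.
Qed.

(** [HLall] is a premise of each step, so chains satisfy the relations by construction; the work is
    to show that they are numerous enough, which is [nice_upto]. *)
Inductive chain : bobj -> Prop :=
| chain_nil : chain (wobj [::])
| chain_step Z i f (hf : isproj (X := extO Z (sl i)) f) :
    chain Z -> HLall Z (sl i) -> bsimple (subO hf) -> chain (subO hf).

Lemma nil_HLR : HLR (hs (wobj [::])).
Proof.
split=> k j; case: k => //; case: j => // _ v _.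
  by rewrite expr0 mul1mx.
move=> _ nz; rewrite !expr0 mul1r mul1mx /hB /= mulmx1.
have E : v = const_mx (v 0 0) by apply/matrixP => i j; rewrite !ord1 !mxE.
rewrite mxE big_ord_recl big_ord0 addr0 mxE -expr2 lt0r sqr_ge0 andbT sqrf_eq0.
by apply: contraNneq nz => v0; rewrite E v0.
Qed.

Lemma nil_simple : bsimple (wobj [::]).
Proof.
split; first exact: matrix_nonzero1.
move=> f [[[h _] _ _] ff _]; have h00 := h 0 0; rewrite /= in h00.
have E : f = (f 0 0)%:M by rewrite [LHS]mx11_scalar.
move: ff; rewrite E -scalar_mxM => /matrixP/(_ 0 0); rewrite !mxE !mulr1n => /eqP.
rewrite -[X in _ == X]mulr1 -subr_eq0 -mulrBr mulf_eq0 subr_eq0 => /orP[]/eqP ->.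
  by left; rewrite raddf0.
by right.
Qed.

Lemma chain_simple_HLR D : chain D -> bsimple D /\ HLR (hs D).
Proof.
elim=> [|Z i f hf hZ [sZ HZ] HZi sf]; first by split; [exact: nil_simple | exact: nil_HLR].
by split=> //; apply/subO_HLR/HLall_ext.
Qed.

Lemma chain_HLR D : chain D -> HLR (hs D).
Proof. by case/chain_simple_HLR. Qed.
Lemma chain_simple D : chain D -> bsimple D.
Proof. by case/chain_simple_HLR. Qed.

Lemma chain_word D : chain D -> exists v, bw D = map sl v.
Proof.
elim=> [|Z i f hf cZ [v Ev] _ _]; first by exists [::].
by exists (i :: v); rewrite /= Ev.
Qed.

(** In either case the extension by t is again made of chains ([nice_thr]). *)
Definition nice D t := tstable D t \/ HLall D t.

Lemma splits_nice D C t : splits D C -> nice C t -> nice D t.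
Proof.
by move=> h [] hC; [left; apply: splits_tstable hC | right; apply: splits_HLall hC].
Qed.

Definition chain_le k D := chain D /\ (blen D <= k)%N.

Lemma HLall_thr Z i : chain Z -> HLall Z (sl i) ->
  thr (X := extO Z (sl i)) (Y := extO Z (sl i)) (chain_le (blen Z).+1) 0 (be (extO Z (sl i))).
Proof.
move=> cZ HZ; have [r [hr <-]] := simple_decomposition (HLall_ext (chain_HLR cZ) HZ).
elim: r hr => [|g r IH] hr; first by rewrite big_nil; exact: thr0.
rewrite big_cons; apply: thrD; last by apply: IH => f hf; apply: hr; rewrite inE hf orbT.
have [hg sg] := hr g (mem_head _ _); have [h1 h2] := subO_in hg.
rewrite -(isproj_idem hg); apply: (thr1 (C := subO hg) (j := 0)) => //.
by split=> //; exact: chain_step.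
Qed.

Lemma tstable_thr Z t : chain Z -> tstable Z t ->
  thr (X := extO Z t) (Y := extO Z t) (eq Z) 0 (be (extO Z t)).
Proof.
move=> cZ [sg hsg Esg]; have [_ /[dup] E ->] := stable_id (chain_HLR cZ).1 hsg Esg.
have hsga : bhom (X := extO Z t) (Y := Z) (-1) (badj sg).
  have := bhom_adj hsg; rewrite (_ : 0 + (blen Z)%:Z - (blen (extO Z t))%:Z = -1) //.
  by rewrite /blen /= -addn1 PoszD; lia.
apply: thrD; first by apply: (thr1 (C := Z) (j := 0)) => //; exact: bhom_low.
apply: (thr1 (C := Z) (j := -1)) => //; rewrite sub0r opprK.
apply: bhomB; first exact: bhom_up.
rewrite -[1]add0r; apply: (bhom_comp hsg); rewrite -[1]add0r.
exact: bhom_comp (bhom_low Z t) (bhom_up Z t).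
Qed.

Lemma nice_thr Z i : chain Z -> nice Z (sl i) ->
  thr (X := extO Z (sl i)) (Y := extO Z (sl i)) (chain_le (blen Z).+1) 0 (be (extO Z (sl i))).
Proof.
move=> cZ [/(tstable_thr cZ)|]; last exact: HLall_thr.
by apply: thr_sub => C <-; split.
Qed.

Definition nice_upto k := forall D i, chain D -> (blen D < k)%N -> nice D (sl i).

Lemma nice_uptoW k l : (l <= k)%N -> nice_upto k -> nice_upto l.
Proof. by move=> lk N D i cD lD; apply: N => //; apply: leq_trans lk. Qed.

(** In terms of a Krull-Schmidt decomposition: the indecomposable summands of a Bott-Samelson
    bimodule are shifts of chains no longer than the word. *)
Theorem word_thr w : nice_upto (size w) ->
  (forall s, List.In s w -> exists i, s = sl i) ->
  thr (X := wobj w) (Y := wobj w) (chain_le (size w)) 0 1%:M.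
Proof.
elim: w => [|s w IH] /= Nk ls.
  rewrite -[1%:M]mulmx1; have h := bhom_e (wobj [::]).
  by apply: (thr1 (C := wobj [::]) (j := 0)) => //; split=> //; exact: chain_nil.
have [i Es] : exists i, s = sl i by apply: ls; left.
have {}IH : thr (X := wobj w) (Y := wobj w) (chain_le (size w)) 0 1%:M.
  by apply: IH => [|t ht]; [apply: nice_uptoW Nk | apply: ls; right].
have := thr_ext s IH; rewrite extm1 Es => h.
have [_ [j [p [q [_ hp hq E]]]]] := wobj_ext w s.
have {}h : thr (X := extO (wobj w) s) (Y := extO (wobj w) s) (chain_le (size w).+1) 0 1%:M.
  rewrite Es; apply: thr_trans h => _ [C [cC lC] ->].
  apply: thr_sub (nice_thr cC (Nk _ _ cC lC)) => D [cD lD]; split=> //.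
  exact: leq_trans lD _.
have [h1 h2] : bhom (X := wobj (s :: w)) (Y := extO (wobj w) s) 0 1%:M /\
   bhom (X := extO (wobj w) s) (Y := wobj (s :: w)) 0 1%:M.
  by split; split=> //=; rewrite ?extm1 ?mulmx1 ?mul1mx //; exact: (wmap1 A (s :: w)).
by have := thr_comp h1 h h2; rewrite !addr0 !mulmx1; rewrite Es.
Qed.

Fixpoint wprod (w : seq (letter R n)) : 'M[R]_n :=
  if w is s :: w' then wprod w' *m lrefl s else 1%:M.

(** The coefficient which [extm_lin] produces when the form that lambda has become behind w is moved
    past t. *)
Definition kap w t := pairing (la *m wprod w) (lroot t).

(** For a form positive exactly on the positive roots, these are the reduced words ([min_good],
    [good_min]). *)
Fixpoint goodword w : Prop :=
  if w is s :: w' then goodword w' /\ 0 < kap w' s else True.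

(** The counterpart of an indecomposable bimodule B_w presented by a reduced word: its length is its
    own. *)
Definition new D := forall C, chain C -> (blen C < blen D)%N -> ~ splits D C.

(** Positive combinations [g] of the squares of morphisms from [D] to chains of
colength one; [K] is the common kernel of these morphisms. *)
Inductive possum D : 'M[S]_(wdim (bw D)) -> ('cV[R]_(wdim (bw D)) -> Prop) -> Prop :=
| possum0 : possum 0 (fun _ => True)
| possumD g K g' K' : possum g K -> possum g' K' ->
    possum (g + g') (fun v => K v /\ K' v)
| possum1 c U d : 0 < c -> chain U -> (blen U).+1 = blen D ->
    bhom (X := D) (Y := U) 0 d ->
    possum (pC c *: (badj d *m d)) (fun v => evm d *m v = 0).

(** The last clause plays the part of the weak Lefschetz theorem, as the first differential of a
    Rouquier complex does for Elias and Williamson: jointly, the maps to colength one are injective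
    below the middle. *)
Definition hasdata D := exists g K, [/\ possum (D := D) g K,
  Lam (bw D) (lin S la) *m be D = g + lin S (la *m wprod (bw D)) *: be D &
  forall (k : nat) v, inV (X := hs D) k%:Z v -> (k + k < blen D)%N -> K v -> v = 0].

(** Each square pulls back the form of an extension of some U. As U is one shorter than D, the image
    of x is primitive there: weak positivity gives the sign, and the case of equality gives K, by
    Hodge-Riemann or by [tstable_ker]. *)
Lemma possum_form D t z (k j : nat) g K : (forall U, chain U -> (blen U).+1 = blen D -> nice U t) ->
  0 <= z -> (k + k + j)%N = blen D ->
  forall x, inV (X := hsz A_la D t z) k%:Z x -> hL (hsz A_la D t z) ^+ j.+1 *m x = 0 ->
  possum (D := D) g K ->
  let b := (-1) ^+ k * hB (X := hsz A_la D t z) (hL (hsz A_la D t z) ^+ j *m x) (evm (extm t g) *m x) in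
  0 <= b /\ (b = 0 -> forall w, x = col_mx 0 w -> K w).
Proof.
move=> HU z0 kj x hx Tx; elim=> [|g1 K1 g2 K2 _ [p1 k1] _ [p2 k2]|c U d c0 cU lU hd].
- by rewrite raddf0 /evm map_mx0 mul0mx hB0r mulr0 lexx; split.
- rewrite extmD evmD mulmxDl hBDr mulrDr; lazy zeta; rewrite addr_ge0 //; split=> // /eqP.
  rewrite paddr_eq0 // => /andP[/eqP e1 /eqP e2] w Ew.
  by split; [exact: k1 | exact: k2].
have hde := hsz_hom A_la t z hd; pose dl := evm (extm t d).
have Edl : evm (extm t (badj d)) = hadj (X := hsz A_la D t z) (Y := hsz A_la U t z) dl.
  by rewrite -[extm t (badj d)](adj_extm t d); exact: (@evm_adj _ _ S (t :: bw D) (t :: bw U) (extm t d)).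
have hxd : inV (X := hsz A_la U t z) k%:Z (dl *m x).
  by have := hom_inV hde hx; rewrite addr0.
have Td : hL (hsz A_la U t z) ^+ j.+1 *m (dl *m x) = 0.
  by rewrite -(hom_LX _ _ hde) Tx mulmx0.
rewrite extmZC evmZ evC -scalemxAl hBZr extmM evmM Edl -mulmxA.
lazy zeta; rewrite -(@hB_adj R (hsz A_la D t z) (hsz A_la U t z) dl) (hom_LX _ _ hde) hBsym mulrCA.
have kjU : (k + k + j)%N = hn (hsz A_la U t z) by rewrite kj -lU.
have HLU := chain_HLR cU.
have sp : semipos (hsz A_la U t z).
  case: (HU U cU lU) => hU; first exact: tstable_semipos.
  by apply/HLR_semipos/HLall_HLR.
have b0 := sp k j kjU _ hxd Td.
split; first exact: mulr_ge0 (ltW c0) b0.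
move/eqP; rewrite mulf_eq0 (gt_eqF c0) /= => /eqP be0 w Ew.
have Ed : dl *m x = col_mx 0 (evm d *m w).
  by rewrite Ew /dl evm_extm mul_block_col mulmx0 mul0mx add0r mulmx0 add0r.
case: (HU U cU lU) => hU; last first.
  have [_ RU] := HLall_HLR z0 HLU hU.
  have [E|nz] := eqVneq (dl *m x) 0.
    by move/eqP: E; rewrite Ed col_mx_eq0 => /andP[_ /eqP].
  by have := RU k j kjU _ hxd Td nz; rewrite be0 ltxx.
have [h1 h2 h3 h4] := hs_hom A_la hd.
have hdw : inV (X := hs U) (k%:Z - 1) (evm d *m w).
  case: hxd; rewrite Ed => Ex gx; split.
    by rewrite mulmxA h4.
  move=> i nz; have := gx (rshift _ i); rewrite /= egr_rshift col_mxEd => /(_ nz).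
  by move=> /=; lia.
case: k kj hx hxd kjU b0 be0 hdw => [|k] kj hx hxd kjU b0 be0 hdw.
  by apply: (inV_out hdw); rewrite sub0r.
rewrite (_ : k.+1%:Z - 1 = k%:Z) in hdw; last by lia.
apply: (tstable_ker (z := z) (j := j.+1) HLU hU _ hdw); first by lia.
by rewrite -Ed.
Qed.

(** If T^(j + 1) x = 0 then the form of T^j x and T x is 0. By [TE] it is, up to sign, a sum of
    nonnegative terms: the squares and kap + z times the form of the image of x in D. That image
    vanishes by Hodge-Riemann, so x = (0, w) with w in K and below the middle, whence w = 0. *)
Lemma data_HLall D t : HLR (hs D) -> hasdata D -> 0 < kap (bw D) t ->
  (forall U, chain U -> (blen U).+1 = blen D -> nice U t) -> HLall D t.
Proof.
move=> HD [g [K [hg ELam HK]]] k0 HU z z0 k [|j] kj x hx.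
  by rewrite expr0 mul1mx.
move=> Tx; have kjD : (k + k + j)%N = blen D by move: kj => /=; lia.
have [b0 bK] := possum_form HU z0 kjD hx Tx hg; move: b0 bK.
set b := _ * hB _ _ => b0 bK.
have hl := hsz_low A_la D t z; pose mu := evm (blow D t).
have hxm : inV (X := hs D) k%:Z (mu *m x) by have := hom_inV hl hx; rewrite addr0.
have Lm : hL (hs D) ^+ j.+1 *m (mu *m x) = 0 by rewrite -(hom_LX _ _ hl) Tx mulmx0.
have Emu : evm (bup D t) = hadj (X := hsz A_la D t z) (Y := hs D) mu.
  by rewrite -badj_low; exact: (@evm_adj _ _ S (t :: bw D) (bw D) (blow D t)).
have nilE : nilm D t *m be (extO D t) = bup D t *m blow D t.
  by rewrite /nilm -mulmxA -[mlow _ _ _ *m _]/(blow D t) /bup -mulmxA blowE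
    (mulmxA (be D) (be D)) be_idem.
(* The multiple of the identity in [hasdata] contributes only its commutator with t, since the
   linear form itself vanishes at 0. *)
have TE : hL (hsz A_la D t z) *m x = evm (extm t g) *m x +
    (kap (bw D) t + z) *: (evm (bup D t) *m (mu *m x)).
  have [Ex _] := hx; rewrite -[in LHS]Ex mulmxA [hL _]/= [hE _]/=.
  rewrite mulmxDl -scalemxAl -!evmM -[extm t (be D)]/(be (extO D t)) nilE.
  rewrite -extmM ELam extmD -mul_scalar_mx extmM extm_lin mulmxDl.
  rewrite -scalemxAl -[mupp _ _ _ *m mlow _ _ _]/(nilm D t).
  rewrite mulmxDl -scalemxAl -[extm t (be D)]/(be (extO D t)) nilE mul_scalar_mx !evmD !evmZ.
  rewrite /lact act_lin ev_lin scale0r add0r evC evmM -/(kap _ _).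
  by rewrite scalerDl addrA !mulmxDl -!scalemxAl -!mulmxA.
have hBT : hB (X := hsz A_la D t z) (hL (hsz A_la D t z) ^+ j *m x) (hL (hsz A_la D t z) *m x) = 0.
  by rewrite hB_LX -mulXS mulXSl -mulXSl Tx hB0r.
have hm : 0 <= (-1) ^+ k * hB (X := hs D) (mu *m x) (hL (hs D) ^+ j *m (mu *m x)).
  exact: (HLR_semipos HD kjD hxm Lm).
have kz : 0 < kap (bw D) t + z by rewrite ltr_wpDr.
move: hBT; rewrite TE hBDr hBZr Emu -(@hB_adj R (hsz A_la D t z) (hs D) mu) (hom_LX _ _ hl) => /(congr1 (fun c => (-1) ^+ k * c)).
rewrite mulr0 mulrDr (mulrCA _ (kap _ _ + z)) -/b => /eqP.
rewrite hBsym in hm.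
rewrite paddr_eq0 ?(mulr_ge0 (ltW kz) hm) // => /andP[/eqP be0].
rewrite mulf_eq0 (gt_eqF kz) /= => /eqP m0.
have mx0 : mu *m x = 0.
  apply/eqP; apply: contraT => nz; have := HD.2 k j kjD _ hxm Lm nz.
  by rewrite hBsym m0 ltxx.
have [Ex gx] := hx.
have Ew : x = col_mx 0 (dsubmx x).
  move: Ex mx0; rewrite /mu blowE evmM evm_mlow mul_mx_row mulmx1 mulmx0.
  rewrite -{1 2 3}[x](@vsubmxK _ (wdim (bw D)) (wdim (bw D))) [hE _]/= evm_extm mul_block_col mul_row_col !mul0mx !addr0.
  move=> /eq_col_mx[E1 _] E2; rewrite -{1}[x](@vsubmxK _ (wdim (bw D)) (wdim (bw D))).
  by congr col_mx; rewrite -E1 E2.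
have hw : inV (X := hs D) (k%:Z - 1) (dsubmx x).
  split.
    move: Ex; rewrite {1}Ew [hE _]/= evm_extm mul_block_col !mulmx0 add0r => E.
    by have := congr1 (@dsubmx _ (wdim (bw D)) (wdim (bw D)) 1) E; rewrite col_mxKd add0r.
  move=> i nz; have := gx (rshift _ i); rewrite /= egr_rshift {1}Ew col_mxEd => /(_ nz).
  by move=> /=; lia.
have w0 : dsubmx x = 0.
  case: k kj kjD hx b b0 bK hxm hm be0 m0 gx hw => [|k] kj kjD hx b b0 bK hxm hm be0 m0 gx hw.
    by apply: (inV_out hw); rewrite sub0r.
  rewrite (_ : k.+1%:Z - 1 = k%:Z) in hw; last by lia.
  apply: (HK k _ hw); first by lia.
  exact: bK be0 _ Ew.
by rewrite Ew w0 col_mx0.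
Qed.

(** If U is stable, newness forces the extended map into the isotropic copy of U and its square is
    0. If [HLall] holds for U, the extension of U is cut into simple chains, of colength one again,
    and the square is cut accordingly. *)
Lemma possum_ext Z i f (hf : isproj (X := extO Z (sl i)) f) g K :
  new (subO hf) -> bsimple (subO hf) -> HLR (hs (subO hf)) ->
  (forall U, chain U -> (blen U).+1 = blen Z -> nice U (sl i)) ->
  possum (D := Z) g K -> exists g' K', [/\ possum (D := subO hf) g' K',
    f *m extm (sl i) g *m f = g' & forall w, evm f *m col_mx 0 w = col_mx 0 w ->
      K' (col_mx 0 w) -> K w].
Proof.
move=> nD sD HD HU; have [[[hf1 hf2] f1 f2] ff fa] := hf; have [hi ho] := subO_in hf.
elim=> [|g1 K1 g2 K2 _ [g1' [K1' [p1 E1 k1]]] _ [g2' [K2' [p2 E2 k2]]]|c U d c0 cU lU hd].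
- exists 0, (fun _ => True); split=> //; first exact: possum0.
  by rewrite raddf0 mulmx0 mul0mx.
- exists (g1' + g2'), (fun v => K1' v /\ K2' v); split.
  + exact: possumD.
  + by rewrite extmD mulmxDr mulmxDl E1 E2.
  + by move=> w hw [/(k1 w hw) ? /(k2 w hw)].
pose Y := extm (sl i) d *m f.
have hY : bhom (X := subO hf) (Y := extO U (sl i)) 0 Y.
  by rewrite -[0]addr0; apply: bhom_comp (bhom_ext (sl i) hd) hi.
have EY : f *m extm (sl i) (pC c *: (badj d *m d)) *m f =
    pC c *: (badj (X := subO hf) (Y := extO U (sl i)) Y *m Y).
  rewrite extmZC -scalemxAr -scalemxAl /Y /badj.
  rewrite (@adjM _ _ S (bw (subO hf)) (sl i :: bw Z) (bw (extO U (sl i)))) /=.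
  by rewrite fa adj_extm extmM !mulmxA.
have evY w : evm f *m col_mx 0 w = col_mx 0 w -> evm Y *m col_mx 0 w = col_mx 0 (evm d *m w).
  move=> fw; rewrite /Y evmM -mulmxA fw evm_extm mul_block_col.
  by rewrite !mulmx0 mul0mx !add0r.
have [tU|HUi] := HU U cU lU.
  exists 0, (fun _ => True); have [sg hsg Esg] := tU.
  have [_ Eid] := stable_id (chain_HLR cU).1 hsg Esg.
  have hsga : bhom (X := extO U (sl i)) (Y := U) (-1) (badj sg).
    have := bhom_adj hsg; rewrite (_ : 0 + (blen U)%:Z - (blen (extO U (sl i)))%:Z = -1) //.
    by rewrite /blen /= -addn1 PoszD; lia.
  (* A map of centred degree 0 to a chain two letters shorter; if it were nonzero, a new object
     would split off from it. *)
  have sY : badj (X := U) (Y := extO U (sl i)) sg *m Y = 0.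
    apply/eqP; apply: contraT => nz; case: (nD U cU).
      by rewrite /blen /=; move: lU; rewrite /blen; lia.
    have hsY : bhom (X := subO hf) (Y := U) (-1) (badj (X := U) (Y := extO U (sl i)) sg *m Y).
      by have := bhom_comp hsga hY; rewrite addr0.
    apply: (simple_nz_split sD HD (chain_HLR cU) hsY _ nz).
    by rewrite /bdeg0; move: lU; rewrite /blen /=; lia.
  have YE : Y = sg *m (blow U (sl i) *m Y).
    by have [_ _ <-] := hY; rewrite {1}Eid mulmxDl -(mulmxA sg) -(mulmxA (_ - _)) sY mulmx0 addr0;
      have [_ _ ->] := hY.
  split=> //; first exact: possum0.
    rewrite EY {1}YE /badj.
    rewrite (@adjM _ _ S (bw (subO hf)) (bw U) (bw (extO U (sl i)))).
    by rewrite -[X in _ *: X]mulmxA [X in _ *m X]sY mulmx0 scaler0.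
  move=> w hw _; have := evY _ w hw; rewrite YE evmM evmM -!mulmxA evY //.
  rewrite blowE evmM evm_mlow mul_mx_row mul_row_col !mulmx0 mul0mx addr0 mulmx0.
  by move=> /eqP; rewrite eq_sym col_mx_eq0 => /andP[_ /eqP].
have [r [hr Er]] := simple_decomposition (HLall_ext (chain_HLR cU) HUi).
have [g' [K' [pg Eg kg]]] : exists g' K', [/\ possum (D := subO hf) g' K',
    g' = pC c *: (badj (X := subO hf) (Y := extO U (sl i)) Y *m (\sum_(h <- r) h) *m Y) &
    forall v, K' v -> evm (\sum_(h <- r) h) *m (evm Y *m v) = 0].
  elim: r hr {Er} => [|h r IH] hr.
    exists 0, (fun _ => True); split; first exact: possum0.
      by rewrite big_nil mulmx0 mul0mx scaler0.
    by move=> v _; rewrite big_nil /evm map_mx0 mul0mx.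
  have [|g1 [K1 [p1 E1 k1]]] := IH; first by move=> h' h'r; apply: hr; rewrite inE h'r orbT.
  have [hp sp] := hr h (mem_head _ _); have [_ hh ah] := hp; have [_ ho'] := subO_in hp.
  have hYh : bhom (X := subO hf) (Y := subO hp) 0 (h *m Y).
    by rewrite -[0]addr0; apply: bhom_comp ho' hY.
  have cC : chain (subO hp) by exact: chain_step.
  exists (pC c *: (badj (X := subO hf) (Y := subO hp) (h *m Y) *m (h *m Y)) + g1),
    (fun v => evm (h *m Y) *m v = 0 /\ K1 v); split.
  - apply: possumD p1; apply: possum1 => //.
    by move: lU; rewrite /blen /=; lia.
  - rewrite E1 -scalerDr big_cons mulmxDr mulmxDl; congr (_ *: (_ + _)).
    rewrite /badj (@adjM _ _ S (bw (subO hf)) (bw (extO U (sl i))) (bw (subO hp))).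
    have ah' : adj (bw (extO U (sl i))) (bw (subO hp)) h = h := ah.
    by rewrite ah' -(mulmxA _ h (h *m Y)) (mulmxA h h Y) hh (mulmxA _ h Y).
  - move=> v [v1 v2]; rewrite big_cons evmD mulmxDl k1 // addr0.
    by rewrite mulmxA -evmM.
exists g', K'; split=> //.
  by rewrite EY Eg Er -mulmxA; have [_ _ ->] := hY.
move=> w hw /kg; rewrite Er evY // evm_extm.
have Edw : evm (be U) *m (evm d *m w) = evm d *m w.
  by rewrite mulmxA -evmM; have [_ _ ->] := hd.
rewrite mul_block_col !mulmx0 !mul0mx !add0r Edw.
by move=> /eqP; rewrite col_mx_eq0 => /andP[_ /eqP].
Qed.

(** The commutator of the linear form with the new letter adds one square, of the map to Z, with
    coefficient kap > 0. Its kernel consists of vectors (0, w), which brings injectivity back to Z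
    one degree lower. *)
Lemma data_step Z i f (hf : isproj (X := extO Z (sl i)) f) :
  new (subO hf) -> bsimple (subO hf) -> HLR (hs (subO hf)) ->
  (forall U, chain U -> (blen U).+1 = blen Z -> nice U (sl i)) ->
  chain Z -> hasdata Z -> 0 < kap (bw Z) (sl i) -> hasdata (subO hf).
Proof.
move=> nD sD HD HU cZ [g [K [hg ELam HK]]] k0.
have [g' [K' [hg' Eg' kK]]] := possum_ext nD sD HD HU hg.
have [[[hf1 hf2] f1 f2] ff fa] := hf; have [hi ho] := subO_in hf.
have hl : bhom (X := subO hf) (Y := Z) 0 (blow Z (sl i) *m f).
  by rewrite -[0]addr0; apply: bhom_comp (bhom_low Z (sl i)) hi.
have nilE : nilm Z (sl i) *m be (extO Z (sl i)) = bup Z (sl i) *m blow Z (sl i).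
  by rewrite /nilm -mulmxA -[mlow _ _ _ *m _]/(blow Z (sl i)) /bup -mulmxA blowE
    (mulmxA (be Z) (be Z)) be_idem.
exists (g' + pC (kap (bw Z) (sl i)) *: (badj (X := subO hf) (Y := Z) (blow Z (sl i) *m f)
    *m (blow Z (sl i) *m f))), (fun v => K' v /\ evm (blow Z (sl i) *m f) *m v = 0); split.
- by apply: possumD hg' _; apply: possum1.
- have E1 : Lam (bw (extO Z (sl i))) (lin S la) *m be (extO Z (sl i)) =
    extm (sl i) g + (lin S (la *m wprod (bw (extO Z (sl i)))) *: be (extO Z (sl i)) +
    pC (kap (bw Z) (sl i)) *: (bup Z (sl i) *m blow Z (sl i))).
    rewrite /= -extmM ELam extmD -mul_scalar_mx extmM extm_lin mulmxDl mul_scalar_mx.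
    by rewrite /lact act_lin -mulmxA -scalemxAl -nilE.
  have E2 : Lam (bw (subO hf)) (lin S la) *m f = f *m (Lam (bw (extO Z (sl i))) (lin S la) *m be (extO Z (sl i))) *m f.
    by rewrite -!mulmxA f2 (mulmxA f (Lam _ _)) (hf2 _ A_la) -mulmxA ff.
  rewrite [LHS]E2 E1 !mulmxDr !mulmxDl Eg' -addrA; congr (_ + _).
  rewrite [RHS]addrC; congr (_ + _); first by rewrite -scalemxAr -scalemxAl f1 ff.
  rewrite -scalemxAr -scalemxAl /badj.
  rewrite (@adjM _ _ S (bw (subO hf)) (bw (extO Z (sl i))) (bw Z)) fa.
  have := badj_low Z (sl i); rewrite /badj => ->.
  by rewrite !mulmxA.
move=> k v hv k2 [hK hm].
have [Ev gv] := hv.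
have Efv : evm f *m v = v by exact: Ev.
have Eev : evm (be (extO Z (sl i))) *m v = v by rewrite -Efv mulmxA -evmM f2.
have Ew : v = col_mx 0 (dsubmx (v : 'cV_(wdim (bw Z) + wdim (bw Z)))).
  move: Eev hm; rewrite evmM -mulmxA Efv blowE evmM evm_mlow mul_mx_row mulmx1 mulmx0.
  rewrite -{1 2 3}[v](@vsubmxK _ (wdim (bw Z)) (wdim (bw Z))) evm_extm mul_block_col mul_row_col !mul0mx !addr0.
  move=> /eq_col_mx[E1 _] E2; rewrite -{1}[v](@vsubmxK _ (wdim (bw Z)) (wdim (bw Z))).
  by congr col_mx; rewrite -E1 E2.
move: Ew; set w := dsubmx _ => Ew.
have hw : inV (X := hs Z) (k%:Z - 1) w.
  split.
    move: Eev; rewrite {1}Ew evm_extm mul_block_col !mulmx0 add0r => E.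
    by have := congr1 (@dsubmx _ (wdim (bw Z)) (wdim (bw Z)) 1) E; rewrite col_mxKd add0r.
  move=> j nz; have := gv (rshift _ j); rewrite /= egr_rshift {1}Ew col_mxEd => /(_ nz).
  by move=> /=; lia.
have w0 : w = 0.
  case: k hv k2 gv hw => [|k] hv k2 gv hw; first by apply: (inV_out hw); rewrite sub0r.
  rewrite (_ : k.+1%:Z - 1 = k%:Z) in hw; last by lia.
  apply: (HK k _ hw); first by move: k2; rewrite /blen /=; lia.
  by apply: kK; rewrite -Ew.
by rewrite Ew w0 col_mx0.
Qed.

Lemma hasdata_nil : hasdata (wobj [::]).
Proof.
exists 0, (fun _ => True); split; first exact: possum0.
  by rewrite /= mulmx1 mulmx1 add0r scalemx1.
by move=> k v _; rewrite /blen ltn0.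
Qed.

(** If Z came from a shorter chain C, its summand would come from the extension of C, which consists
    of chains of length at most blen C + 1. *)
Lemma new_step Z i f (hf : isproj (X := extO Z (sl i)) f) :
  nice_upto (blen Z) -> bsimple (subO hf) -> HLR (hs (subO hf)) -> new (subO hf) -> new Z.
Proof.
move=> NZ sD HD nD C cC lC [j [p [q [hj hp hq E]]]].
have [e0 _] := sD; have [hi ho] := subO_in hf; have [_ f1 f2] := hi.
have h := thr_comp (bhom_comp (bhom_ext (sl i) hp) hi) (nice_thr cC (NZ C i cC lC))
  (bhom_comp ho (bhom_ext (sl i) hq)).
rewrite !addr0 add0r addNr in h.
have Ef : f *m extm (sl i) q *m be (extO C (sl i)) *m (extm (sl i) p *m f) = be (subO hf).
  have [_ _ e2] := bhom_ext (sl i) hp; rewrite -mulmxA (mulmxA (be (extO C (sl i)))) e2.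
  rewrite -(mulmxA f) (mulmxA (extm (sl i) q)) -extmM E -[extm _ _]/(be (extO Z (sl i))) f2.
  by have [_ ff _] := hf.
have [C' [cC' lC']] := simple_thr_split sD HD (fun C (h : chain_le _ C) => chain_HLR h.1) h Ef.
apply: nD => //; apply: leq_ltn_trans lC' _.
by rewrite /blen /= -/(blen C) -/(blen Z) ltnS.
Qed.

(** A new chain on which a simple reflection takes the wrong sign is a summand for a word
which ends in this reflection; this is the only input from the structure of the group. *)
Definition wrong_sign_split k := forall D i, chain D -> new D -> blen D = k ->
  goodword (bw D) -> kap (bw D) (sl i) <= 0 ->
  exists w, shsplits D (wobj (sl i :: w)).

Lemma wrong_sign_tstable D w i : shsplits D (wobj (sl i :: w)) -> tstable D (sl i).
Proof.
move=> h; apply: (shsplits_tstable (C := extO (wobj w) (sl i))).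
  by apply: shsplits_trans h _; apply: splits_sh; case: (wobj_ext w (sl i)).
exact: tstable_ext.
Qed.

Lemma chain_data k D : nice_upto k -> (forall j, (j < k)%N -> wrong_sign_split j) ->
  chain D -> new D -> (blen D <= k)%N -> hasdata D /\ goodword (bw D).
Proof.
move=> Nk Hk; elim=> [|Z i f hf cZ IH HZ sD] nD lD; first by split=> //; exact: hasdata_nil.
have cD : chain (subO hf) by exact: chain_step.
have lZ : (blen Z < k)%N by move: lD; rewrite /blen /=.
have nZ : new Z.
  apply: (new_step _ sD (chain_HLR cD) nD) => C j cC lC.
  by apply: Nk => //; lia.
have [dZ gZ] := IH nZ (ltnW lZ).
(* With the wrong sign Z would be stable under the letter, which excludes hard Lefschetz at z = 0
   for its extension. *)
have k0 : 0 < kap (bw Z) (sl i).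
  rewrite ltNge; apply/negP => /(Hk _ lZ Z i cZ nZ erefl gZ)[w /wrong_sign_tstable tZ].
  by apply: (tstable_not_HLall (chain_HLR cZ) (chain_simple cZ).1 tZ HZ).
split=> //; apply: data_step nD sD (chain_HLR cD) _ cZ dZ k0 => U cU lU.
by apply: Nk => //; lia.
Qed.

(** A chain that is not new inherits the alternative from a shorter one; for a new chain the sign of
    kap decides between hard Lefschetz and stability. *)
Theorem nice_upto_wrong_sign k :
  (forall j, (j < k)%N -> nice_upto j -> wrong_sign_split j) -> nice_upto k.
Proof.
elim: k => [|k IH] H D i cD; first by rewrite ltn0.
have {}IH : nice_upto k by apply: IH => j lj; apply: H; lia.
have Hle j : (j <= k)%N -> wrong_sign_split j.
  move=> lj; apply: H => // C t cC lC; apply: IH => //; lia.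
rewrite ltnS => lD; have [nD|oD] := pselect (new D); last first.
  have [C [cC [lC h]]] : exists C, chain C /\ (blen C < blen D)%N /\ splits D C.
    apply: contrapT => nex; apply: oD => C cC lC h; apply: nex; by exists C.
  by apply: splits_nice h _; apply: IH => //; lia.
have [dD gD] := chain_data IH (fun j lj => Hle j (ltnW lj)) cD nD lD.
have HU U : chain U -> (blen U).+1 = blen D -> nice U (sl i).
  by move=> cU lU; apply: IH => //; lia.
have [k0|k0] := ltP 0 (kap (bw D) (sl i)).
  by right; apply: data_HLall k0 HU => //; exact: chain_HLR.
by left; have [w] := Hle _ lD D i cD nD erefl gD k0; exact: wrong_sign_tstable.
Qed.

(** A shorter word would factor through chains shorter than D, and one of them would contain D
    without shift. *)
Lemma new_shsplits D w : nice_upto (blen D) -> chain D -> new D ->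
  (forall s, List.In s w -> exists i, s = sl i) -> shsplits D (wobj w) ->
  (blen D <= size w)%N.
Proof.
move=> N cD nD lw h; rewrite leqNgt; apply/negP => lt.
have hw := word_thr (nice_uptoW (ltnW lt) N) lw.
have [C [cC lC] sC] := shsplits_thr_HLR (chain_simple cD) (chain_HLR cD)
  (fun C (h : chain_le _ C) => chain_HLR h.1) h hw.
by apply: (nD C cC _ sC); apply: leq_ltn_trans lt.
Qed.

End Chains.

(** * Rank two *)

Section GradedRank.
Variables (R : realType) (n : nat) (S : polyring R n).
Variables (A : S -> Prop) (la : 'rV[R]_n).
Hypothesis A_la : A (lin S la).
Notation bobj := (bobj A).
Notation hs := (hs A_la).
Implicit Types (X Y Z D C U : bobj) (s t : letter R n) (w : seq (letter R n)).

Lemma trace_idem d (E : 'M[R]_d) : E *m E = E -> \tr E = (\rank E)%:R.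
Proof.
move=> EE; have E1 := mulmx_base E; have fr := row_base_free E.
have fc : row_full (col_base E) by exact: col_base_full.
have RC : row_base E *m col_base E = 1%:M.
  apply: (row_full_inj fc); apply: (row_free_inj fr).
  by rewrite mulmx1 mulmxA -mulmxA E1 EE.
by rewrite -{1}E1 mxtrace_mulC RC mxtrace1.
Qed.

Definition rkd w (f : 'M[S]_(wdim w)) (d : int) : nat :=
  \rank (gproj R (@wgr R n w) d *m evm f).

Definition dimh X d := rkd (w := bw X) (be X) d.

Lemma dimhE X d : dimh X d = \rank (hP (hs X) d).
Proof. by []. Qed.

Lemma rkd_trace X f d : isproj (X := X) f ->
  \tr (gproj R (@wgr R n (bw X)) d *m evm f) = (rkd (w := bw X) f d)%:R.
Proof.
move=> [[[hf _] _ _] ff _]; apply: trace_idem.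
rewrite -mulmxA (mulmxA (evm f)) -(gproj_comm _ (shiftm_evm hf)) -mulmxA -evmM ff.
by rewrite mulmxA gproj_idem.
Qed.

(** The rank of an idempotent is its trace, and traces add up without any orthogonality. *)
Lemma rkd_sum X (r : seq 'M[S]_(wdim (bw X))) g d :
  (forall f, f \in r -> isproj (X := X) f) -> isproj (X := X) g ->
  \sum_(f <- r) f = g -> rkd (w := bw X) g d = (\sum_(f <- r) rkd (w := bw X) f d)%N.
Proof.
move=> hr hg Eg; apply/eqP; rewrite -(@eqr_nat R) -rkd_trace // natr_sum -Eg.
rewrite evm_sum mulmx_sumr raddf_sum big_seq [X in _ == X]big_seq; apply/eqP.
by apply: eq_bigr => f fr; exact: (rkd_trace d (hr f fr)).
Qed.

Lemma isproj_be X : isproj (X := X) (be X).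
Proof. by split; [exact: bhom_e | exact: be_idem | exact: be_adj]. Qed.

Lemma dimh_out X (d : int) : (d < 0) || ((blen X)%:Z < d) -> dimh X d = 0%N.
Proof.
move=> hd; rewrite dimhE; apply/eqP; rewrite mxrank_eq0; apply/eqP/mx_eq0_cV => v.
exact: (inV_out (inV_P d v)).
Qed.

Lemma dimh_ext X s (d : int) : dimh (extO X s) d = (dimh X d + dimh X (d - 1))%N.
Proof.
apply/eqP; rewrite -(@eqr_nat R) natrD -!(rkd_trace _ (isproj_be _)) /=.
rewrite evm_extm.
have -> : gproj R (egr (@wgr R n (bw X))) d =
    block_mx (gproj R (@wgr R n (bw X)) d) 0 0 (gproj R (@wgr R n (bw X)) (d - 1)).
  apply/matrixP => i j; rewrite /gproj -[i]splitK -[j]splitK.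
  case: (fintype.split i) => {}i; case: (fintype.split j) => {}j /=;
    rewrite ?block_mxEul ?block_mxEur ?block_mxEdl ?block_mxEdr !mxE
      ?egr_lshift ?egr_rshift.
  - by rewrite (inj_eq (@lshift_inj _ _)).
  - by rewrite eq_lrshift.
  - by rewrite eq_rlshift.
  - by rewrite (inj_eq (@rshift_inj _ _)) -(inj_eq (addIr (-1))) PoszS addrK.
by rewrite mulmx_block !mul0mx !mulmx0 !addr0 !add0r mxtrace_block.
Qed.

Lemma dimh_splits X Y j p q (d : int) : bhom (X := X) (Y := Y) j p ->
  q *m p = be X -> (dimh X d <= dimh Y (d + j))%N.
Proof.
move=> hp qp; have [h1 h2 h3 h4] := hs_hom A_la hp; rewrite !dimhE.
have E : hP (hs X) d = evm q *m (hP (hs Y) (d + j) *m (evm p *m hP (hs X) d)).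
  have -> : hP (hs Y) (d + j) *m (evm p *m hP (hs X) d) = evm p *m hP (hs X) d.
    apply/matrixP => a b; have /inVP := hom_inV (hs_hom A_la hp) (inV_P d (delta_mx b 0 : 'cV_(hd (hs X)))).
    by rewrite (mulmxA (evm p)) mulmxA -!colE => /colP/(_ a); rewrite !mxE.
  rewrite mulmxA -evmM qp; apply/esym/matrixP => a b.
  have [] := inV_P d (delta_mx b 0 : 'cV_(hd (hs X))).
  by rewrite mulmxA -!colE => /colP/(_ a) + _; rewrite !mxE.
rewrite E; apply: leq_trans (mxrankM_maxr _ _) _; exact: mxrankM_maxl.
Qed.

Lemma dimh_eq0 X : (forall d, dimh X d = 0%N) -> be X = 0.
Proof.
move=> h; have [[hf _] _ _] := bhom_e X; apply: (idem_nil hf (be_idem X)).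
apply: mx_eq0_cV => v.
have Ev : hE (hs X) *m (evm (be X) *m v) = evm (be X) *m v.
  by rewrite mulmxA -evmM be_idem.
rewrite (@inV_decomp _ (hs X) _ Ev) big1 // => k _.
have /eqP : \rank (hP (hs X) k%:Z) = 0%N := h k%:Z.
by rewrite mxrank_eq0 => /eqP ->; rewrite mul0mx.
Qed.

Lemma rank2_ge X d (v1 v2 : 'cV[R]_(wdim (bw X))) :
  inV (X := hs X) d v1 -> inV (X := hs X) d v2 ->
  (forall a b, a *: v1 + b *: v2 = 0 -> a = 0 /\ b = 0) ->
  (2 <= dimh X d)%N /\ (dimh X d = 2%N -> forall v, inV (X := hs X) d v ->
     exists a b, v = a *: v1 + b *: v2).
Proof.
move=> /inV_sub h1 /inV_sub h2 ind; pose M := col_mx v1^T v2^T.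
have M2 (z : 'rV_(1 + 1)) : z *m M = (z 0 (lshift 1 0) *: v1 + z 0 (rshift 1 0) *: v2)^T.
  rewrite -[z]hsubmxK mul_row_col raddfD /= ![(_ *: _)^T]linearZ /=.
  rewrite row_mxEl row_mxEr {1}[lsubmx z]mx11_scalar {1}[rsubmx z]mx11_scalar.
  by rewrite !mul_scalar_mx.
have fM : row_free M.
  rewrite -kermx_eq0; apply/rowV0P => z /sub_kermxP; rewrite M2 => /(congr1 trmx).
  rewrite trmxK trmx0 => /ind[z0 z1]; apply/rowP => i; rewrite mxE.
  by rewrite -[i]splitK; case: (fintype.split i) => j; rewrite [j]ord1.
have rM : \rank M = 2%N by exact/eqP.
have sM : (M <= (hP (hs X) d)^T)%MS by rewrite col_mx_sub h1 h2.
split; first by rewrite dimhE -(mxrank_tr (hP _ _)) -[2%N]rM mxrankS.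
move=> r2 v /inV_sub hv.
have : ((hP (hs X) d)^T <= M)%MS.
  by rewrite -(geq_leqif (mxrank_leqif_sup sM)) mxrank_tr -dimhE r2 rM.
move=> /(submx_trans hv) /submxP[z]; rewrite M2 => /trmx_inj ->.
by exists (z 0 (lshift 1 0)), (z 0 (rshift 1 0)).
Qed.

Lemma rank1_ge X d (v1 : 'cV[R]_(wdim (bw X))) :
  inV (X := hs X) d v1 -> v1 != 0 ->
  (1 <= dimh X d)%N /\ (dimh X d = 1%N -> forall v, inV (X := hs X) d v ->
     exists a, v = a *: v1).
Proof.
move=> /inV_sub h1 nz.
have nzt : v1^T != 0 by rewrite -trmx0 (inj_eq trmx_inj).
have r1 : \rank v1^T = 1%N.
  by apply/eqP; rewrite eqn_leq rank_leq_row lt0n mxrank_eq0.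
split; first by rewrite dimhE -(mxrank_tr (hP _ _)) -[1%N]r1 mxrankS.
move=> r2 v /inV_sub hv.
have : ((hP (hs X) d)^T <= v1^T)%MS.
  by rewrite -(geq_leqif (mxrank_leqif_sup h1)) mxrank_tr -dimhE r2 r1.
move=> /(submx_trans hv) /sub_rVP[a] Ea; exists a; apply: trmx_inj.
by rewrite linearZ.
Qed.

(** The element 1 (x) ... (x) 1; it spans degree 0 ([deg0_bot]). *)
Fixpoint bot (B : pzRingType) w : 'cV[B]_(wdim w) :=
  if w is s :: w' then col_mx (bot B w') 0 else 1%:M.

Lemma evm_bot w : evm (bot S w) = bot R w.
Proof.
elim: w => [|s w IH] /=; first exact: map_mx1.
by rewrite /evm map_col_mx map_mx0 -/(evm _) IH.
Qed.

Lemma bot_neq0 w : bot R w != 0.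
Proof.
elim: w => [|s w IH] /=; first exact: matrix_nonzero1.
by rewrite col_mx_eq0 negb_and IH.
Qed.

Lemma bot_deg0 w : homv (@wgr R n w) 0 (bot R w).
Proof.
elim: w => [|s w IH] //= i.
rewrite -[i]splitK; case: (fintype.split i) => {}i /=.
  by rewrite egr_lshift col_mxEu; exact: IH.
by rewrite col_mxEd mxE eqxx.
Qed.

Lemma deg0_bot w v : homv (@wgr R n w) 0 v -> exists c, v = c *: bot R w.
Proof.
elim: w v => [|s w IH] /= v hv.
  by exists (v 0 0); rewrite scalemx1 [LHS]mx11_scalar.
rewrite -[v]vsubmxK; have [i nz|c Ec] := IH (usubmx v).
  by have := hv (lshift _ i); rewrite egr_lshift => ->; rewrite // -[v]vsubmxK col_mxEu.
exists c; rewrite scale_col_mx Ec scaler0; congr col_mx; apply/colP => i.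
rewrite [RHS]mxE; apply/eqP; apply: contraT => nz.
have := hv (rshift _ i); rewrite egr_rshift => h; have /h // : v (rshift _ i) 0 != 0.
by move: nz; rewrite mxE.
Qed.

Definition hasbot X := evm (be X) *m bot R (bw X) = bot R (bw X).

Lemma hasbot_inV X : hasbot X -> inV (X := hs X) 0 (bot R (bw X)).
Proof. by move=> hb; split=> //; exact: bot_deg0. Qed.

Lemma hasbot_dimh X : hasbot X <-> (0 < dimh X 0)%N.
Proof.
split=> [hb|].
  by have [] := rank1_ge (hasbot_inV hb) (bot_neq0 _).
rewrite lt0n dimhE mxrank_eq0 => nz.
have [v nzv] : exists v : 'cV_(wdim (bw X)), hP (hs X) 0 *m v != 0.
  apply: contrapT => nex; move/eqP: nz; apply; apply: mx_eq0_cV => v.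
  by apply/eqP; apply: contrapT => /negP h; apply: nex; exists v.
have [Ev /deg0_bot[c Ec]] := @inV_P _ (hs X) 0 v.
move: Ev nzv; rewrite Ec -scalemxAr scaler_eq0 negb_or => + /andP[c0 _].
by move/(scalerI c0).
Qed.

Lemma isproj_bot X f : isproj (X := X) f ->
  evm f *m bot R (bw X) = bot R (bw X) \/ evm f *m bot R (bw X) = 0.
Proof.
move=> [[[hf _] _ _] ff _].
have h : homv (@wgr R n (bw X)) 0 (evm f *m bot R (bw X)).
  by have := homv_mul (shiftm_evm hf) (@bot_deg0 (bw X)); rewrite addr0.
have [c Ec] := deg0_bot h.
have : evm f *m (evm f *m bot R (bw X)) = evm f *m bot R (bw X).
  by rewrite mulmxA -evmM ff.
rewrite !Ec -scalemxAr Ec => /eqP; rewrite -subr_eq0 -scalerBr scaler_eq0.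
move=> /orP[/eqP ->|]; first by right; rewrite scale0r.
rewrite -[X in _ - X]scale1r -scalerBl scaler_eq0 (negbTE (bot_neq0 _)) orbF subr_eq0.
by move=> /eqP ->; left; rewrite scale1r.
Qed.

Lemma hasbot_deg X Y j p q : bhom (X := X) (Y := Y) j p -> q *m p = be X ->
  hasbot X -> 0 <= j.
Proof.
move=> hp qp /hasbot_dimh h0; rewrite leNgt; apply/negP => j0.
have := dimh_splits 0 hp qp; rewrite add0r (@dimh_out Y j) ?j0 // => le0.
by move: h0; rewrite ltnNge le0.
Qed.

Lemma Lam_bot X d (p : S) : A p -> hasbot X -> phom d p ->
  inV (X := hs X) d%:Z (evm (Lam (bw X) p) *m bot R (bw X)).
Proof.
move=> Ap hb hp; split.
  have [[_ i] _ _] := bhom_e X.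
  by rewrite mulmxA [hE _]/= -evmM i // evmM -mulmxA hb.
have := homv_mul (shiftm_evm (@Lam_homog _ _ S (bw X) d p hp)) (@bot_deg0 (bw X)).
by rewrite add0r.
Qed.

Lemma L_bot X i (p : S) : hL (hs X) ^+ i *m (evm (Lam (bw X) p) *m bot R (bw X)) =
  evm (Lam (bw X) (lin S la ^+ i * p)) *m bot R (bw X).
Proof.
elim: i => [|i IH]; first by rewrite !expr0 mul1r mul1mx.
by rewrite mulXSl IH exprS -mulrA (LamM _ (lin S la)) evmM -mulmxA.
Qed.

End GradedRank.

(** * Localization and the annihilator of the bottom vector *)

Section Localization.
Variables (R : realType) (n : nat) (S : polyring R n).
Implicit Types (w : seq (letter R n)) (s : letter R n) (y : 'M[R]_n).

Inductive subprod : seq (letter R n) -> 'M[R]_n -> Prop :=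
| subprod0 : subprod [::] 1%:M
| subprod_skip s w y : subprod w y -> subprod (s :: w) y
| subprod_take s w y : subprod w y -> subprod (s :: w) (y *m lrefl s).

Lemma subprod_cons s w y : subprod (s :: w) y ->
  exists y', subprod w y' /\ (y = y' \/ y = y' *m lrefl s).
Proof.
move E : (s :: w) => v h; case: h E => //= s' w' y' h [-> ->]; exists y'.
  by split=> //; left.
by split=> //; right.
Qed.

(** Row vectors on which the left action of [S] is twisted by [y]: they decompose
a Bott-Samelson bimodule over the fraction field. *)
Inductive locrow : forall w, 'rV[S]_(wdim w) -> 'M[R]_n -> Prop :=
| locrow0 : @locrow [::] 1%:M 1%:M
| locrow_skip s w u y : @locrow w u y ->
    @locrow (s :: w) (row_mx u (hform s *: u)) y
| locrow_take s w u y : @locrow w u y ->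
    @locrow (s :: w) (row_mx (map_mx (lact s) u) (- (hform s *: map_mx (lact s) u)))
      (y *m lrefl s).

Lemma locrow_exists w y : subprod w y -> exists u, locrow (w := w) u y.
Proof.
elim=> [|s w' y' _ [u hu]|s w' y' _ [u hu]].
- by exists 1%:M; exact: locrow0.
- by eexists; exact: locrow_skip hu.
- by eexists; exact: locrow_take hu.
Qed.

Lemma locrow_subprod w u y : locrow (w := w) u y -> subprod w y.
Proof.
elim=> [|s w' u' y' _ IH|s w' u' y' _ IH].
- exact: subprod0.
- exact: subprod_skip.
- exact: subprod_take.
Qed.

Lemma lact_extm s d d' (f : 'M[S]_(d', d)) : map_mx (lact s) (extm s f) = extm s f.
Proof.
rewrite /extm map_block_mx; congr block_mx; apply/matrixP => i j; rewrite !mxE.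
- exact: lact_avg.
- by rewrite rmorphM /= lact_dem /qform rmorphM /= lact_hform mulrNN.
- exact: lact_dem.
- exact: lact_avg.
Qed.

Lemma mlow_row s d (u : 'rV[S]_d) : u *m mlow S s d = row_mx u (hform s *: u).
Proof. by rewrite /mlow mul_mx_row mulmx1 mul_mx_scalar. Qed.

Lemma locrow_Lam w u y p : locrow (w := w) u y -> u *m Lam w p = act y p *: u.
Proof.
elim=> [|s w' u' y' _ IH|s w' u' y' _ IH] /=.
- by rewrite act1 mul1mx scalemx1.
- rewrite -mlow_row -mulmxA mlow_nat mulmxA IH -scalemxAl.
  by [].
have E : row_mx (map_mx (lact s) u') (- (hform s *: map_mx (lact s) u')) =
    map_mx (lact s) (u' *m mlow S s (wdim w')).
  rewrite mlow_row map_row_mx; congr row_mx; apply/matrixP => i j; rewrite !mxE.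
  by rewrite rmorphM /= lact_hform mulNr.
rewrite E -[extm s _]lact_extm -map_mxM /= -mulmxA mlow_nat mulmxA IH -scalemxAl.
by rewrite map_mxZ actM.
Qed.

Lemma locrow_bot w u y : locrow (w := w) u y -> u *m bot S w = 1%:M.
Proof.
elim=> [|s w' u' y' _ IH|s w' u' y' _ IH] /=; first by rewrite mulmx1.
  by rewrite mul_row_col mulmx0 addr0.
rewrite mul_row_col mulmx0 addr0.
have E : map_mx (lact s) (bot S w') = bot S w'.
  elim: (w') => [|t v IHv] /=; first exact: map_mx1.
  by rewrite map_col_mx IHv map_mx0.
by rewrite -E -map_mxM /= IH map_mx1.
Qed.

(** The two rows over the same u detect a + h b and, up to the action of s, a - h b, where h =
    [hform s]; these determine a and b because 2 h is not 0 in a domain. *)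
Lemma locrow_faithful w (v : 'cV[S]_(wdim w)) :
  (forall u y, locrow (w := w) u y -> u *m v = 0) -> v = 0.
Proof.
elim: w v => [|s w IH] v h.
  by have := h _ _ locrow0; rewrite mul1mx.
rewrite -[v]vsubmxK; set a := usubmx _; set b := dsubmx _.
have E1 : a + hform s *: b = 0.
  apply: IH => u y hu; have := h _ _ (locrow_skip s hu).
  by rewrite -[v]vsubmxK mul_row_col -scalemxAl mulmxDr -scalemxAr.
have E2 : a - hform s *: b = 0.
  suff h2 : map_mx (lact s) (a - hform s *: b) = 0.
    apply/matrixP => i j; move/matrixP/(_ i j): h2; rewrite !mxE => h2.
    by rewrite -[LHS](lactK s) h2 raddf0.
  apply: IH => u y hu; have := h _ _ (locrow_take s hu).
  rewrite -[v]vsubmxK mul_row_col mulNmx -scalemxAl scalemxAr -mulmxBr => h2.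
  have : map_mx (lact s) (map_mx (lact s) u *m (a - hform s *: b)) = 0.
    by rewrite h2 map_mx0.
  rewrite map_mxM /= (_ : map_mx (lact s) (map_mx (lact s) u) = u) //.
  by apply/matrixP => i j; rewrite !mxE lactK.
have two (B : 'cV[S]_(wdim w)) : B + B = 0 -> B = 0.
  move=> BB; apply/matrixP => i j; move/matrixP/(_ i j): BB; rewrite !mxE => BB.
  by rewrite -[LHS]mul1r -pC_half2 -mulrA mulr2n mulrDl !mul1r BB mulr0.
have a0 : a = 0.
  apply: two; have : (a + hform s *: b) + (a - hform s *: b) = 0 by rewrite E1 E2 addr0.
  by rewrite addrACA subrr addr0.
have h0 : hform s != 0 :> S.
  by apply: contra_eq_neq (hform2 S s) => ->; rewrite addr0 eq_sym linf_neq0.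
have b0 : b = 0.
  move: E1; rewrite a0 add0r => E1; apply/matrixP => i j; move/matrixP/(_ i j): E1.
  by rewrite !mxE => /eqP; rewrite mulf_eq0 (negbTE h0) => /eqP.
by rewrite a0 b0 col_mx0.
Qed.

(** The list r stands for a tensor in S (x) S, which acts on the bottom vector from both sides. *)
Definition cyceval w (r : seq (S * S)) : 'cV[S]_(wdim w) :=
  \sum_(x <- r) x.2 *: (Lam w x.1 *m bot S w).

(** So the annihilator of the bottom vector depends only on the set of products of subwords, not on
    the word. *)
Lemma cyceval_eq0 w r : cyceval w r = 0 <->
  forall y, subprod w y -> \sum_(x <- r) x.2 * act y x.1 = 0.
Proof.
have E u y : locrow (w := w) u y ->
    u *m cyceval w r = (\sum_(x <- r) x.2 * act y x.1)%:M.
  move=> hu; rewrite /cyceval mulmx_sumr raddf_sum; apply: eq_bigr => x _ /=.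
  rewrite -scalemxAr mulmxA (locrow_Lam _ hu) -scalemxAl (locrow_bot hu).
  by rewrite scalerA scalemx1.
split=> [h y /locrow_exists[u hu]|h].
  have := E u y hu; rewrite h mulmx0 => /matrixP/(_ 0 0).
  by rewrite !mxE eqxx mulr1n.
apply: locrow_faithful => u y hu; rewrite (E u y hu) h ?raddf0 //.
exact: locrow_subprod hu.
Qed.

Lemma cyceval_cat w r1 r2 : cyceval w (r1 ++ r2) = cyceval w r1 + cyceval w r2.
Proof. by rewrite /cyceval big_cat. Qed.

Lemma cyceval_scale w c r : cyceval w [seq (x.1, c * x.2) | x <- r] = c *: cyceval w r.
Proof.
rewrite /cyceval big_map scaler_sumr; apply: eq_bigr => x _ /=.
by rewrite scalerA.
Qed.

Lemma cyceval_Lam w p r :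
  cyceval w [seq (p * x.1, x.2) | x <- r] = Lam w p *m cyceval w r.
Proof.
rewrite /cyceval big_map mulmx_sumr; apply: eq_bigr => x _ /=.
by rewrite LamM -scalemxAr mulmxA.
Qed.

Lemma cyceval_flatten w (rr : seq (seq (S * S))) :
  cyceval w (flatten rr) = \sum_(r <- rr) cyceval w r.
Proof. by rewrite /cyceval big_flatten. Qed.

Definition cychom d (r : seq (S * S)) := forall x, x \in r ->
  exists a a' : nat, [/\ phom a x.1, phom a' x.2 & (a + a')%N = d].

Definition rank1gr := fun _ : 'I_1 => 0%N.

Lemma bot_homm w : homm rank1gr (@wgr R n w) 0 (bot S w).
Proof.
elim: w => [|s w IH] /=; first by exact: (@homm1 _ _ S 1 rank1gr).
move=> i j; rewrite -[i]splitK; case: (fintype.split i) => {}i /=.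
  by rewrite egr_lshift col_mxEu; exact: IH.
by rewrite col_mxEd mxE ihomog0.
Qed.

Lemma cyceval_homm w d r : cychom d r -> homm rank1gr (@wgr R n w) d%:Z (cyceval w r).
Proof.
move=> hr; rewrite /cyceval big_seq; apply: homm_sum => x xr.
have [a [a' [ha ha' <-]]] := hr x xr.
move=> i j; rewrite mxE.
rewrite (_ : _ - _ = a'%:Z + ((rank1gr j)%:Z + (a%:Z + 0) - (wgr i)%:Z)).
  by apply: ihomogM; [exact: ha' | exact: (hommM (@Lam_homog _ _ S w _ _ ha) (@bot_homm w) i j)].
by rewrite PoszD /rank1gr; ring.
Qed.

Lemma ihomog_pos z (p : S) : ihomog z p -> ev p = 0 -> p != 0 -> 0 < z.
Proof.
move=> hp p0 nz; rewrite ltNge; apply: contraNN nz => z0.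
by rewrite (ihomog_le0 hp z0) p0 raddf0.
Qed.

End Localization.

(** * Chains for alternating words in two letters *)

Section Rank2.
Variables (R : realType) (n : nat) (S : polyring R n) (la : 'rV[R]_n).
Variables (sl : bool -> letter R n) (m : nat).
Notation T := (fun _ : S => True).
Notation A_la := (I : T (lin S la)).
Notation bobj := (bobj T).
Notation hs := (hs A_la).
Notation chain := (chain A_la sl).
Implicit Types (X Y Z D C U E : bobj) (b c : bool) (k l : nat).

Fixpoint alts b k : seq bool := if k is k'.+1 then b :: alts (~~ b) k' else [::].
Definition alt b k := map sl (alts b k).

Hypothesis good : forall b, goodword la (alt b m).
Hypothesis dual : forall b, exists2 mu, pairing mu (lroot (sl b)) = 1 &
  pairing mu (lroot (sl (~~ b))) = 0.

Lemma altS b k : alt b k.+1 = sl b :: alt (~~ b) k.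
Proof. by []. Qed.

Lemma good_alt b k : (k <= m)%N -> goodword la (alt b k).
Proof.
move=> km; suff H j c : goodword la (alt c (j + k)) -> exists c', goodword la (alt c' k) /\ c = c' (+) odd j.
  have [|c' [hg E]] := H (m - k)%N (b (+) odd (m - k)); first by rewrite subnK.
  by move: E hg; case: (odd _); case: (b); case: (c').
elim: j c => [|j IH] c; first by exists c; rewrite addbF.
by move=> [/IH[c' [hg E]] _]; exists c'; split=> //=; rewrite addbN -E negbK.
Qed.

Lemma kap_alt b k : (k < m)%N -> 0 < kap la (alt b k) (sl (~~ b)).
Proof. by move=> km; have [_] := good_alt (~~ b) km; rewrite negbK. Qed.

Lemma kap_self (w : seq (letter R n)) s : kap la (s :: w) s = - kap la w s.
Proof.
rewrite /kap /= mulmxA pairing_mul reflection_mul letterP scaler_nat mulr2n.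
by rewrite opprD addrA subrr add0r pairingNr.
Qed.

Lemma sl_inj : injective sl.
Proof.
move=> b c E; apply/eqP; apply: contraT => ne; have [mu p1 p2] := dual b.
move: p2; have <- : c = ~~ b by case: (b) (c) ne => [] [].
by rewrite -E p1 => /eqP; rewrite oner_eq0.
Qed.

Lemma good_word_alt (v : seq bool) : goodword la (map sl v) ->
  exists b, map sl v = alt b (size v).
Proof.
move=> gv; suff [b {1}->] : exists b, v = alts b (size v) by exists b.
elim: v gv => [|c v IH] /= gv; first by exists true.
have [b Eb] := IH gv.1; exists c; congr (_ :: _).
case: v gv Eb {IH} => [|c' v] //= [[gv k0] k1] [Ec Ev].
have bc : b = ~~ c.
  apply/eqP; apply: contraT => h; have Ecc : c' = c by rewrite Ec; case: (b) (c) h => [] [].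
  by move: k1; rewrite -Ecc kap_self oppr_gt0 ltNge (ltW k0).
by rewrite -bc -Ev Ec.
Qed.

(** Good words alternate, and below length m the letter that continues the alternation has the right
    sign; so the wrong sign occurs only for the letter with which the word already ends. *)
Lemma wrong_sign_rank2 k : (k < m)%N -> wrong_sign_split A_la sl k.
Proof.
move=> km D i cD nD lD gD k0; have [v Ev] := chain_word cD; rewrite Ev in gD.
have [b Eb] := good_word_alt gD.
have sv : size v = k by rewrite -lD /blen Ev size_map.
have EbD : bw D = alt b k by rewrite Ev Eb sv.
move: k0; rewrite EbD leNgt => /negP; case: k km EbD {lD sv} => [|k] km EbD.
  by case; have := kap_alt (~~ i) km; rewrite negbK.
have [ib|ib] := eqVneq i b.
  move=> _; exists (alt (~~ b) k); have := splits_sh (splits_wobj D).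
  by rewrite EbD ib.
by case; have -> : i = ~~ b; [case: (i) (b) ib => [] [] | exact: kap_alt].
Qed.

Lemma nice_rank2 : nice_upto A_la sl m.
Proof. by apply: nice_upto_wrong_sign => j jm _; apply: wrong_sign_rank2. Qed.

Lemma new_alt D : chain D -> new A_la sl D -> (blen D <= m)%N ->
  hasdata A_la sl D /\ exists b, bw D = alt b (blen D).
Proof.
move=> cD nD lD; have [dD gD] := chain_data nice_rank2 wrong_sign_rank2 cD nD lD.
split=> //; have [v Ev] := chain_word cD; move: gD; rewrite Ev => /good_word_alt[b Eb].
by exists b; rewrite Eb /blen Ev size_map.
Qed.

Lemma new_HLall D b : chain D -> new A_la sl D -> (blen D < m)%N ->
  bw D = alt b (blen D) -> HLall A_la D (sl (~~ b)).
Proof.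
move=> cD nD lD Eb; have [dD _] := new_alt cD nD (ltnW lD).
apply: (data_HLall (chain_HLR cD) dD).
  by rewrite Eb; exact: kap_alt.
by move=> U cU lU; apply: nice_rank2 => //; lia.
Qed.

Lemma lin_bot b k mu : evm (Lam (alt b k.+2) (lin S mu)) *m bot R (alt b k.+2) = 0 ->
  forall c, pairing mu (lroot (sl c)) = 0.
Proof.
elim: k b => [|k IH] b; last first.
  rewrite (altS b k.+2) /= evm_extm mul_block_col mul0mx !mulmx0 !addr0.
  by move=> /eqP; rewrite col_mx_eq0 => /andP[/eqP /IH].
rewrite !altS /= evm_extm mul_block_col mul0mx !mulmx0 !addr0.
move=> /eqP; rewrite col_mx_eq0 => /andP[/eqP E1 /eqP E2].
have p1 : pairing mu (lroot (sl (~~ b))) = 0.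
  move: E1; rewrite evm_extm mul_block_col mul0mx mulmx0 !addr0 mulmx1.
  move=> /eqP; rewrite col_mx_eq0 => /andP[_ /eqP/matrixP/(_ 0 0)].
  by rewrite mulmx1 !mxE mulr1n dem_lin evC.
suff p2 : pairing mu (lroot (sl b)) = 0.
  by move=> c; have [->//|] := eqVneq c b; move: p1; case: (b) (c) => [] [].
move: E2; rewrite /extm map_block_mx /evm map_block_mx mul_block_col !mulmx0 !addr0 mulmx1.
move=> /eqP; rewrite col_mx_eq0 => /andP[/eqP/matrixP/(_ 0 0) + _].
rewrite !mxE mulr1n avg_inv; first by rewrite dem_lin evC.
by rewrite lact_lin p1 rmorph0 mul0r subr0.
Qed.

(** The sequence 1, 2, ..., 2, 1: the number of elements of each length below an element of length l
    in a dihedral group. *)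
Definition dm l d : nat :=
  if l is 0 then (d == 0)%N else ((d < l) + (0 < d <= l))%N.

(** Strictly between the extreme degrees, a power of lambda times either of the two forms dual to
    the simple roots acts on the bottom vector, independently since that power is injective on
    degree 1. If the bound is attained, the bottom vector generates. *)
Lemma bot_dims X b : hard_lefschetz (hs X) -> hasbot X -> bw X = alt b (blen X) ->
  (forall d : nat, (dm (blen X) d <= dimh X d%:Z)%N) /\
  ((forall d : nat, dimh X d%:Z = dm (blen X) d) ->
   forall (d : nat) v, inV (X := hs X) d%:Z v ->
     exists2 p : S, phom d p & v = evm (Lam (bw X) p) *m bot R (bw X)).
Proof.
move=> HX hb Eb; suff main d : (dm (blen X) d <= dimh X d%:Z)%N /\
    (dimh X d%:Z = dm (blen X) d ->
     forall v, inV (X := hs X) d%:Z v ->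
     exists2 p : S, phom d p & v = evm (Lam (bw X) p) *m bot R (bw X)).
  by split=> [d|h d]; [case: (main d) | case: (main d) => _; apply; apply: h].
have E1 : evm (Lam (bw X) (1 : S)) *m bot R (bw X) = bot R (bw X).
  by rewrite Lam1 /evm map_mx1 mul1mx.
have phla i : phom i (lin S la ^+ i).
  elim: i => [|i IH]; first by rewrite expr0 -(rmorph1 pC) phomC.
  by rewrite exprS -add1n; apply: phomM => //; exact: phom_lin.
have single j : (j == 0)%N || (j == blen X) -> d = j -> dm (blen X) j = 1%N ->
   (dm (blen X) d <= dimh X d%:Z)%N /\
    (dimh X d%:Z = dm (blen X) d ->
     forall v, inV (X := hs X) d%:Z v ->
     exists2 p : S, phom d p & v = evm (Lam (bw X) p) *m bot R (bw X)).
  move=> hj -> ->; have hv := Lam_bot A_la I hb (phla j).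
  have nz : evm (Lam (bw X) (lin S la ^+ j)) *m bot R (bw X) != 0.
    rewrite -[lin S la ^+ j]mulr1 -(L_bot A_la X j 1) E1.
    apply/eqP => E; move/eqP: (bot_neq0 (bw X)); apply.
    apply: (HL_inj (j := blen X) (i := j) HX _ _ (hasbot_inV A_la hb) E) => //.
    by case/orP: hj => /eqP ->.
  have [h1 h2] := rank1_ge hv nz; split=> // hd v /(h2 hd)[a Ea].
  exists (pC a * lin S la ^+ j); first exact: phomCM.
  by rewrite LamM LamC mul_scalar_mx evmZ evC -scalemxAl.
have [d0|d0] := eqVneq d 0%N.
  by apply: (single 0%N) => //; rewrite /dm; case: (blen X).
have [dl|dl] := eqVneq d (blen X).
  apply: (single (blen X)) => //; first by rewrite eqxx orbT.
  by move: d0; rewrite dl /dm; case: (blen X) => // l _; rewrite ltnn leqnn.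
have [lt|lt] := ltnP (blen X) d.
  have -> : dm (blen X) d = 0%N by rewrite /dm; case: (blen X) lt d0 dl => [|l]; lia.
  split=> // h v hv; exists 0; first exact: phom0.
  rewrite raddf0 /evm map_mx0 mul0mx; apply: (inV_out hv); apply/orP; right.
  by rewrite -[hn _]/(blen X); lia.
have -> : dm (blen X) d = 2%N by rewrite /dm; case: (blen X) lt d0 dl => [|l]; lia.
have [mu1 p11 p12] := dual true; have [mu2 p21 p22] := dual false.
case: d d0 dl lt {single} => // d _ dl lt.
have hmu mu : phom d.+1 (lin S la ^+ d * lin S mu).
  by rewrite -addn1; apply: phomM => //; exact: phom_lin.
have hv mu := Lam_bot A_la I hb (hmu mu).
have comb (a b' : R) : a *: (evm (Lam (bw X) (lin S la ^+ d * lin S mu1)) *m bot R (bw X)) +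
    b' *: (evm (Lam (bw X) (lin S la ^+ d * lin S mu2)) *m bot R (bw X)) =
    evm (Lam (bw X) (lin S la ^+ d * lin S (a *: mu1 + b' *: mu2))) *m bot R (bw X).
  rewrite raddfD /= !linZ mulrDr LamD evmD mulmxDl !(mulrCA _ (pC _)).
  by rewrite ![Lam _ (pC _ * _)]LamM !LamC !mul_scalar_mx !evmZ !evC -!scalemxAl.
have ind (a b' : R) : a *: (evm (Lam (bw X) (lin S la ^+ d * lin S mu1)) *m bot R (bw X)) +
    b' *: (evm (Lam (bw X) (lin S la ^+ d * lin S mu2)) *m bot R (bw X)) = 0 ->
    a = 0 /\ b' = 0.
  rewrite comb -(L_bot A_la) => E.
  have lX : exists k, blen X = k.+2 by case: (blen X) lt dl => [|[|k]]; [lia|lia|exists k].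
  have [k lk] := lX.
  have Z0 : evm (Lam (bw X) (lin S (a *: mu1 + b' *: mu2))) *m bot R (bw X) = 0.
    have h1 := Lam_bot A_la I hb (phom_lin S (a *: mu1 + b' *: mu2)).
    by apply: (HL_inj (k := 1) (j := k) (i := d) HX _ _ h1 E); rewrite /= -/(blen X); lia.
  rewrite Eb lk in Z0; have h := lin_bot Z0.
  have := h true; have := h false; rewrite !pairingDl !pairingZl p11 p22 p21 p12.
  by rewrite !mulr0 !mulr1 add0r addr0 => -> ->.
have [h1 h2] := rank2_ge (hv mu1) (hv mu2) ind; split=> // hd v /(h2 hd)[a [b' Ev]].
by rewrite Ev comb; exists (lin S la ^+ d * lin S (a *: mu1 + b' *: mu2)).
Qed.

Lemma splits_dimh D C d : blen D = blen C -> splits D C -> (dimh D d <= dimh C d)%N.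
Proof.
move=> lDC [j [p [q [hj hp hq E]]]]; have j0 : j = 0 by move: hj; rewrite /bdeg0 lDC; lia.
by have := dimh_splits A_la d hp E; rewrite j0 addr0.
Qed.

Lemma splits_sym D C : bsimple D -> HLR (hs D) -> bsimple C -> HLR (hs C) ->
  splits D C -> splits C D.
Proof.
move=> sD HD sC HC [j [p [q [hj hp hq E]]]].
apply: (simple_nz_split sC HC HD hq); first by move: hj; rewrite /bdeg0; lia.
by apply: contraNneq sD.1 => q0; rewrite -E q0 mul0mx.
Qed.

Lemma hasbot_new D : chain D -> hasbot D -> new A_la sl D.
Proof.
move=> cD bD C cC lC [j [p [q [hj hp hq E]]]].
by have := hasbot_deg A_la hp E bD; move: hj lC; rewrite /bdeg0; lia.
Qed.

Lemma chain_inv D : chain D -> (0 < blen D)%N -> exists Z i f,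
  exists hf : isproj (X := extO Z (sl i)) f, [/\ D = subO hf, chain Z & HLall A_la Z (sl i)].
Proof. by case=> // Z i f hf cZ HZ sD _; exists Z, i, f, hf. Qed.

(** The dimensions are the least that [bot_dims] allows, so the reduction is cyclic: this is the
    rational smoothness of dihedral Schubert varieties. *)
Definition flat D b := [/\ chain D, bw D = alt b (blen D), hasbot D &
  forall d : nat, dimh D d%:Z = dm (blen D) d].

Lemma flat_new D b : flat D b -> new A_la sl D.
Proof. by case=> cD _ bD _; exact: hasbot_new. Qed.

Lemma alt_tstable D b k : bw D = alt b k.+1 -> tstable D (sl b).
Proof.
move=> E; apply: (@wrong_sign_tstable R n S T bool sl D (alt (~~ b) k) b).
by have := splits_sh (splits_wobj D); rewrite E.
Qed.

(* The map from Z.s to Z' exists because Z' is s-stable. *)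
Lemma flat_cap Z b k : flat Z b -> blen Z = k.+2 -> (k.+2 < m)%N ->
  (forall E, chain E -> new A_la sl E -> (blen E < k.+2)%N -> exists c, flat E c) ->
  exists Z' cap, [/\ flat Z' (~~ b), blen Z' = k.+1,
    bhom (X := extO Z (sl (~~ b))) (Y := Z') (-1) cap & cap != 0].
Proof.
move=> fZ lZ km IH; have [cZ EZ bZ dZ] := fZ.
have nZ := flat_new fZ; have := chain_inv cZ; rewrite lZ => /(_ isT)[Z' [c [f [hf [EZs cZ' HZ']]]]].
have lZ' : blen Z' = k.+1 by move: lZ; rewrite EZs /blen /= => -[].
have nZ' : new A_la sl Z'.
  apply: (@new_step _ _ _ _ _ A_la _ sl Z' c f hf).
  - by apply: nice_uptoW nice_rank2; rewrite lZ'; lia.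
  - by rewrite -EZs; exact: (chain_simple cZ).
  - by rewrite -EZs; exact: (chain_HLR cZ).
  - by rewrite -EZs.
have [c' fZ'] : exists c, flat Z' c by apply: IH => //; rewrite lZ'.
have EZ' : bw Z' = alt (~~ b) k.+1.
  by move: EZ; rewrite EZs /blen /= -/(blen Z') lZ' altS => -[].
have c'b : c' = ~~ b.
  have [_ E2 _ _] := fZ'; move: E2; rewrite EZ' lZ' !altS => -[E2 _].
  exact/esym/sl_inj.
rewrite c'b in fZ'; have [sg hsg Esg] := alt_tstable EZ'.
have hsga : bhom (X := extO Z' (sl (~~ b))) (Y := Z') (-1) (badj sg).
  have := bhom_adj hsg; rewrite (_ : 0 + (blen Z')%:Z - (blen (extO Z' (sl (~~ b))))%:Z = -1) //.
  by rewrite /blen /= -addn1 PoszD; lia.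
move: fZ cZ EZ bZ dZ nZ lZ; rewrite EZs => fZ cZ EZ bZ dZ nZ lZ {EZs Z}.
pose Z := subO hf; rewrite -/Z in fZ cZ EZ bZ dZ nZ lZ *.
have [hi ho] := subO_in hf.
pose mu := blow Z' (sl c) *m f.
have hmu : bhom (X := Z) (Y := Z') 0 mu.
  by rewrite -[0]addr0; apply: bhom_comp (bhom_low Z' (sl c)) hi.
pose cap := badj (X := Z') (Y := extO Z' (sl (~~ b))) sg *m extm (sl (~~ b)) mu.
exists Z', cap; split=> //.
  by rewrite -[-1]addr0; apply: bhom_comp hsga (bhom_ext _ hmu).
(* Composed with the inclusion of Z, [cap] gives back the projection to Z', which is nonzero on the
   bottom vector. *)
have capE : cap *m bup Z (sl (~~ b)) = mu.
  rewrite /cap -mulmxA /bup (mulmxA (extm _ _)) mup_nat -(mulmxA (mupp _ _ _)).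
  have [_ e1 e2] := hmu; rewrite e1 -e2 (mulmxA (mupp _ _ _)) -/(bup Z' (sl (~~ b))).
  by rewrite mulmxA stable_up // mulmxA be_idem.
have mu0 : mu != 0.
  apply: contraNneq (bot_neq0 (R := R) (bw Z')) => E0.
  have Eb : evm mu *m bot R (bw Z) = bot R (bw Z').
    rewrite /mu evmM -mulmxA bZ blowE evmM evm_mlow mul_mx_row mulmx1 mulmx0.
    rewrite /= mul_row_col mul0mx addr0.
    have [_ _ bZ' _] := fZ'; exact: bZ'.
  by rewrite -Eb E0 /evm map_mx0 mul0mx.
by apply: contraNneq mu0 => c0; rewrite -capE c0 mul0mx.
Qed.

(** The multiplication rule of the dihedral Hecke algebra: for l >= 2, extending a flat object of
    length l by the other letter yields flat pieces of lengths l + 1 (the summand with the bottom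
    vector) and l - 1 (detected by [cap]); for l <= 1 there is only the first. *)
Lemma flat_step Z b : flat Z b -> (blen Z < m)%N ->
  (forall E, chain E -> new A_la sl E -> (blen E < blen Z)%N -> exists c, flat E c) ->
  exists r, [/\ \sum_(g <- r) g = be (extO Z (sl (~~ b))),
    (exists g (hg : isproj (X := extO Z (sl (~~ b))) g), g \in r /\ flat (subO hg) (~~ b)) &
    forall g, g \in r -> exists hg : isproj (X := extO Z (sl (~~ b))) g,
      chain (subO hg) /\ (flat (subO hg) (~~ b) \/
        exists2 Z', flat Z' (~~ b) & (blen Z').+1 = blen Z /\ splits (subO hg) Z')].
Proof.
move=> fZ lm IH; have [cZ EZ bZ dZ] := fZ; have nZ := flat_new fZ.
pose s := sl (~~ b); pose X := extO Z s.
have HZ : HLall A_la Z s by exact: new_HLall.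
have HX := HLall_ext (chain_HLR cZ) HZ.
have [r [hr Er]] := simple_decomposition HX; exists r.
have cr g : g \in r -> exists hg : isproj (X := X) g, chain (subO hg).
  by move=> /hr[hg sg]; exists hg; exact: chain_step.
have dX (d : nat) : dimh X d%:Z = (dm (blen Z) d + if d is d'.+1 then dm (blen Z) d' else 0)%N.
  rewrite dimh_ext dZ; congr (_ + _)%N; case: d => [|d]; last first.
    by rewrite -dZ; congr (dimh Z _); lia.
  by apply: (@dimh_out _ _ _ _ _ A_la).
have bX : hasbot X.
  by apply/(hasbot_dimh A_la); rewrite (dX 0%N) addn0 -dZ; apply/(hasbot_dimh A_la).
have sumr d : dimh X d = (\sum_(g <- r) rkd (w := bw X) g d)%N.
  apply: (rkd_sum (A := T)) => //; last exact: isproj_be.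
  by move=> f /cr[].
have [g0 g0r g0b] : exists2 g, g \in r & evm g *m bot R (bw X) = bot R (bw X).
  apply: contrapT => nex; have := bX; rewrite /hasbot -Er evm_sum mulmx_suml.
  rewrite big_seq big1 => [/eqP|g gr]; first by rewrite eq_sym (negbTE (bot_neq0 _)).
  have [hg _] := cr g gr; case: (isproj_bot hg) => // h; case: nex; by exists g.
have [hg0 cg0] := cr g0 g0r.
have Ew : bw (subO hg0) = alt (~~ b) (blen Z).+1.
  by rewrite /= EZ altS negbK.
have lg0 : blen (subO hg0) = (blen Z).+1 by [].
have [dg0 _] := bot_dims (chain_HLR cg0).1 (g0b : hasbot (subO hg0)) Ew.
have other g : g \in r -> (forall d : nat, rkd (w := bw X) g d%:Z = 0%N) -> False.
  move=> gr h0; have [hg cg] := cr g gr; case: (chain_simple cg) => /eqP; case.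
  apply: (dimh_eq0 A_la) => -[d|d]; first exact: h0.
  exact: (@dimh_out _ _ _ _ _ A_la).
have sumg0 d : dimh X d = (rkd (w := bw X) g0 d + \sum_(g <- rem g0 r) rkd (w := bw X) g d)%N.
  by rewrite sumr (big_rem g0).
have flat0 : (forall d : nat, rkd (w := bw X) g0 d%:Z = dm (blen Z).+1 d) -> flat (subO hg0) (~~ b).
  by move=> h; split.
have mem_le (T' : eqType) (r' : seq T') (F : T' -> nat) g :
    g \in r' -> (F g <= \sum_(h <- r') F h)%N.
  by move=> gr; rewrite (big_rem g) //= leq_addr.
have [l2|l2] := leqP (blen Z) 1.
  have E0 (d : nat) : (rkd (w := bw X) g0 d%:Z = dm (blen Z).+1 d) /\
      (\sum_(g <- rem g0 r) rkd (w := bw X) g d%:Z = 0)%N.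
    have := sumg0 d; rewrite dX; have := dg0 d; rewrite /dimh lg0 /=.
    by case: (blen Z) l2 => [|[|l]] // _; case: d => [|[|[|d]]] /=; lia.
  split=> //; first by exists g0, hg0; split=> //; apply: flat0 => d; case: (E0 d).
  move=> g gr; have [hg cg] := cr g gr; exists hg; split=> //; left.
  have [Eg|ne] := eqVneq g g0; last first.
    case: (other g gr) => d; have [_ E] := E0 d.
    apply/eqP; rewrite -leqn0 -E.
    exact: (mem_le _ _ (fun g => rkd (w := bw X) g d%:Z) g (rem_mem ne gr)).
  subst g; rewrite (Prop_irrelevance hg hg0).
  by apply: flat0 => d; case: (E0 d).
have [k lk] : exists k, blen Z = k.+2 by case: (blen Z) l2 => [|[|k]] //; exists k.
rewrite lk in lm IH; have [Z' [cap [fZ' lZ' hcap cap0]]] := flat_cap fZ lk lm IH.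
have [g1 g1r g1c] : exists2 g, g \in r & cap *m g != 0.
  apply: contrapT => nex; have [_ Ec _] := hcap; case/eqP: cap0.
  rewrite -Ec -Er mulmx_sumr big_seq big1 // => g gr.
  by apply/eqP; apply: contraT => nz; case: nex; exists g.
have [hg1 cg1] := cr g1 g1r; have [hi1 _] := subO_in hg1.
have [cZ' EZ' bZ' dZ'] := fZ'.
have hc1 : bhom (X := subO hg1) (Y := Z') (-1) (cap *m g1).
  by rewrite -[-1]addr0; apply: bhom_comp hcap hi1.
have lg1 : blen (subO hg1) = k.+3 by rewrite -lk.
have bd1 : bdeg0 (subO hg1) Z' (-1) by rewrite /bdeg0 lg1 lZ'; lia.
have s1 : splits (subO hg1) Z'.
  exact: (simple_nz_split (chain_simple cg1) (chain_HLR cg1) (chain_HLR cZ') hc1 bd1 g1c).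
have s1' := splits_sym (chain_simple cg1) (chain_HLR cg1) (chain_simple cZ') (chain_HLR cZ') s1.
have d1 (d : nat) : (dm k.+1 d <= rkd (w := bw X) g1 d.+1%:Z)%N.
  have [j [p [q [hj hp hq E]]]] := s1'.
  have j1 : j = 1 by move: hj; rewrite /bdeg0 lg1 lZ'; lia.
  have := dimh_splits A_la d%:Z hp E; rewrite dZ' lZ' j1 /dimh.
  by rewrite (_ : d%:Z + 1 = d.+1%:Z) //; lia.
have g10 : g1 != g0.
  apply: contraNneq g1c => E0; subst g1.
  have [j [p [q [hj hp hq E]]]] := s1.
  have := hasbot_deg A_la hp E (g0b : hasbot (subO hg1)).
  by move: hj; rewrite /bdeg0 lg1 lZ'; lia.
(* The two lower bounds fill the extension, since dm l d + dm l (d - 1) = dm (l + 1) d + dm (l - 1)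
   (d - 1). *)
have E0 (d : nat) : (rkd (w := bw X) g0 d%:Z = dm (blen Z).+1 d) /\
    (\sum_(g <- rem g1 (rem g0 r)) rkd (w := bw X) g d%:Z = 0)%N.
  have := sumg0 d; rewrite (big_rem g1) /=; last exact: rem_mem.
  rewrite dX; have := dg0 d; rewrite /dimh lg0 /= lk.
  case: d => [|d]; first by rewrite /=; lia.
  by have := d1 d; rewrite /=; case: (ltngtP d k.+1) => //; case: (d) => //=; lia.
split=> //; first by exists g0, hg0; split=> //; apply: flat0 => d; case: (E0 d).
move=> g gr; have [hg cg] := cr g gr; exists hg; split=> //.
have [Eg|ne] := eqVneq g g0.
  subst g; rewrite (Prop_irrelevance hg hg0); left.
  by apply: flat0 => d; case: (E0 d).
have [Eg|ne1] := eqVneq g g1.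
  subst g; rewrite (Prop_irrelevance hg hg1); right.
  by exists Z' => //; rewrite lZ' lk.
case: (other g gr) => d; have [_ E] := E0 d.
apply/eqP; rewrite -leqn0 -E.
exact: (mem_le _ _ (fun g => rkd (w := bw X) g d%:Z) g (rem_mem ne1 (rem_mem ne gr))).
Qed.

Lemma summand_in_decomp X (r : seq 'M[S]_(wdim (bw X))) f (hf : isproj (X := X) f) :
  bsimple (subO hf) -> HLR (hs X) -> \sum_(g <- r) g = be X ->
  (forall g, g \in r -> isproj (X := X) g) ->
  exists g (hg : isproj (X := X) g), g \in r /\ splits (subO hf) (subO hg).
Proof.
move=> sf HX Er hr; have [[_ f1 f2] _ _] := hf; have [hi ho] := subO_in hf.
have [g gr gf] : exists2 g, g \in r & g *m f != 0.
  apply: contrapT => nex; case: sf => /eqP[] /=.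
  rewrite -f2 -Er mulmx_suml big_seq big1 // => g gr.
  by apply/eqP; apply: contraT => nz; case: nex; exists g.
have hg := hr g gr; exists g, hg; split=> //; have [hi' ho'] := subO_in hg.
have h : bhom (X := subO hf) (Y := subO hg) 0 (g *m f).
  by rewrite -[0]addr0; apply: bhom_comp ho' hi.
apply: (simple_nz_split sf (subO_HLR hf HX) (subO_HLR hg HX) h _ gf).
by rewrite /bdeg0 !add0r.
Qed.

Lemma flat_nil b : flat (wobj T [::]) b.
Proof.
split=> //; first exact: chain_nil.
  by rewrite /hasbot /= /evm map_mx1 mul1mx.
move=> d; rewrite /dimh /rkd.
have -> : gproj R (@wgr R n [::]) d%:Z *m evm (1%:M : 'M[S]_1) = ((d == 0)%N%:R)%:M.
  rewrite /evm map_mx1 mulmx1; apply/matrixP => i j; rewrite !ord1 !mxE.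
  by rewrite eqxx !mulr1n eqz_nat eq_sym.
by case: d => [|d] /=; rewrite ?mxrank1 // raddf0 mxrank0.
Qed.

(** D is a summand of the extension of a flat object; being new it cannot match the shorter piece of
    [flat_step]. *)
Lemma new_flat k D : chain D -> new A_la sl D -> blen D = k -> (k <= m)%N ->
  exists b, flat D b.
Proof.
have [l] := ubnP k; elim: l k D => // l IHl k D kl cD nD lD km.
case: k lD kl km => [|k] lD kl km.
  case: cD lD nD => [_ _|Z i f hf _ _ _]; last by rewrite /blen.
  by exists true; exact: flat_nil.
have := chain_inv cD; rewrite lD => /(_ isT)[Z [i [f [hf [ED cZ HZ]]]]].
have sD := chain_simple cD; have HD := chain_HLR cD.
have [_ [bD EbD]] := new_alt cD nD (eq_ind_r (fun j => (j <= m)%N) km lD).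
move: cD nD lD sD HD EbD; rewrite ED => cD nD lD sD HD EbD {ED D}.
have lZ : blen Z = k by move: lD; rewrite /blen /= => -[].
have nZ : new A_la sl Z.
  apply: (new_step (A_la := A_la) _ sD HD nD).
  by apply: nice_uptoW nice_rank2; rewrite lZ ltnW.
have [b [fZ ib]] : exists b, flat Z b /\ i = ~~ b.
  case: k lZ {lD} km kl => [|k] lZ km kl.
    exists (~~ i); rewrite negbK; split=> //.
    by case: cZ lZ => [_|Z' i' f' hf' _ _ _]; [exact: flat_nil | rewrite /blen].
  have [b fZ] : exists b, flat Z b by apply: (IHl k.+1) => //; lia.
  exists b; split=> //; have [_ EZ _ _] := fZ; move: EbD; rewrite /= EZ /blen /= -/(blen Z) lZ.
  by rewrite !altS => -[/sl_inj -> /sl_inj ->]; rewrite negbK.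
subst i.
have lZm : (blen Z < m)%N by rewrite lZ.
have [|r [Er [g0 [hg0 [g0r fg0]]] hr]] := flat_step fZ lZm.
  move=> E cE nE lE; apply: (IHl (blen E)) => //; lia.
have [|g [hg [gr sg]]] := summand_in_decomp (hf := hf) sD (HLall_ext (chain_HLR cZ) HZ) Er.
  by move=> g /hr[].
have [hg' [cg hh]] := hr g gr.
rewrite (Prop_irrelevance hg' hg) in cg hh.
case: hh => [fg|[Z' fZ' [lZ' sZ']]]; last first.
  have [cZ' _ _ _] := fZ'; case: (nD Z' cZ'); first by rewrite lD -lZ -lZ'; lia.
  exact: splits_trans sg sZ'.
have sg' := splits_sym sD HD (chain_simple cg) (chain_HLR cg) sg.
have lgD : blen (subO hf) = blen (subO hg) by [].
have dD (d : nat) : dimh (subO hf) d%:Z = dm k.+1 d.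
  have [_ _ _ dg] := fg; rewrite -lD lgD -dg; apply/eqP.
  by rewrite eqn_leq !splits_dimh.
exists (~~ b); split=> //.
- have [_ Eg _ _] := fg; exact: Eg.
- apply/(hasbot_dimh A_la); rewrite (dD 0%N); by [].
- by move=> d; rewrite dD lD.
Qed.

Lemma exists_flat b k : (k <= m)%N -> exists2 E, flat E b & blen E = k.
Proof.
elim: k b => [|k IH] b km; first by exists (wobj T [::]); [exact: flat_nil |].
have [Z fZ lZ] := IH (~~ b) (ltnW km).
have lZm : (blen Z < m)%N by rewrite lZ.
have [|r [Er [g0 [hg0 [g0r fg0]]] _]] := flat_step fZ lZm.
  move=> E cE nE lE; apply: (new_flat (k := blen E)) => //; lia.
by rewrite negbK in hg0 g0r fg0 *; exists (subO hg0) => //; rewrite /blen /= -/(blen Z) lZ.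
Qed.

Lemma alt_thr b k : (k <= m)%N ->
  thr (X := wobj T (alt b k)) (Y := wobj T (alt b k))
    (fun E => flat E b /\ exists2 j, (blen E + j.*2 = k)%N & true) 0 1%:M.
Proof.
elim: k b => [|k IH] b km.
  have h := bhom_e (wobj T (alt b 0)); rewrite -[1%:M]mulmx1.
  apply: (thr1 (C := wobj T [::]) (j := 0)) => //; split; first exact: flat_nil.
  by exists 0%N.
have := thr_ext (sl b) (IH (~~ b) (ltnW km)); rewrite extm1 => h.
have {}h : thr (X := extO (wobj T (alt (~~ b) k)) (sl b)) (Y := extO (wobj T (alt (~~ b) k)) (sl b))
    (fun E => flat E b /\ exists2 j, (blen E + j.*2 = k.+1)%N & true) 0 1%:M.
  apply: thr_trans h => _ [C [fC [j lC _]] ->].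
  have lCm : (blen C < m)%N by lia.
  have [|r [Er _ hr]] := flat_step fC lCm.
    move=> E cE nE lE; apply: (new_flat (k := blen E)) => //; lia.
  rewrite negbK in Er hr; rewrite -Er; elim: r hr {Er} => [|g r IHr] hr.
    by rewrite big_nil; exact: thr0.
  rewrite big_cons; apply: thrD; last by apply: IHr => f fr; apply: hr; rewrite inE fr orbT.
  have [hg [cg hh]] := hr g (mem_head _ _); have [h1 h2] := subO_in hg.
  rewrite -(isproj_idem hg); case: hh => [fg|[Z' fZ' [lZ' [i [p [q [_ hp hq E]]]]]]].
    apply: (thr1 (C := subO hg) (j := 0)) => //; split=> //.
    by exists j; rewrite // -lC /blen /= -/(blen C).
  have gE : g *m g = (g *m q) *m (p *m g).
    by rewrite mulmxA -(mulmxA g) E [be _]/= (isproj_idem hg) (isproj_idem hg).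
  rewrite gE; apply: (thr1 (C := Z') (j := i)).
  - by split=> //; exists j.+1 => //; lia.
  - by rewrite -[i]addr0; apply: bhom_comp hp h2.
  - by rewrite sub0r -[- i]add0r; apply: bhom_comp h1 hq.
have [[j [p [q [_ hp hq E]]]] _] := wobj_ext T (alt (~~ b) k) (sl b).
have [h1 h2] : bhom (X := wobj T (sl b :: alt (~~ b) k)) (Y := extO (wobj T (alt (~~ b) k)) (sl b)) 0 1%:M /\
   bhom (X := extO (wobj T (alt (~~ b) k)) (sl b)) (Y := wobj T (sl b :: alt (~~ b) k)) 0 1%:M.
  split; split=> //=; rewrite ?extm1 ?mulmx1 ?mul1mx //; exact: (wmap1 T (sl b :: alt (~~ b) k)).
by have := thr_comp h1 h h2; rewrite !addr0 !mulmx1.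
Qed.

(** The products of subwords are all shorter alternating products and the full one: a Bruhat
    interval. *)
Lemma subprod_alt b k y : subprod (alt b k) y <->
  exists c j, y = wprod (alt c j) /\ ((j < k)%N \/ j = k /\ c = b).
Proof.
split.
  elim: k b y => [|k IH] b y; rewrite ?altS => h.
    by inversion h; exists b, 0%N; split=> //; right.
  have H : exists y', subprod (alt (~~ b) k) y' /\ (y = y' \/ y = y' *m lrefl (sl b)).
    exact: subprod_cons h.
  have [y' [/IH[c [j [Ey hj]]] [->|->]]] := H.
    exists c, j; split=> //; left; case: hj => [|[-> _]]; lia.
  rewrite Ey; case: j Ey hj => [|j] Ey hj.
    exists b, 1%N; split=> //; case: k hj {IH h H} => [|k] hj; first by right.
    by left.
  have [cb|cb] := eqVneq c b.
    exists (~~ b), j; rewrite cb altS /= -mulmxA lreflK mulmx1; split=> //.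
    by left; case: hj => [|[-> _]]; lia.
  have {}cb : c = ~~ b by case: (c) (b) cb => [] [].
  exists b, j.+2; rewrite cb (altS b j.+1) /=; split=> //.
  by case: hj => [lt|[-> _]]; [left; lia | right].
move=> [c [j [-> hj]]]; elim: k b c j hj => [|k IH] b c j hj.
  by case: hj => [//|[-> _]]; exact: subprod0.
rewrite altS; case: j hj => [|j] hj.
  apply: subprod_skip; apply: (IH (~~ b) (~~ b) 0%N).
  by case: k {IH hj} => [|k]; [right | left].
have [cb|cb] := eqVneq c b.
  rewrite cb altS /=; apply: subprod_take; apply: IH.
  by case: hj => [lt|[[->] _]]; [left | right]; lia.
have {}cb : c = ~~ b by case: (c) (b) cb => [] [].
apply: subprod_skip; apply: IH; rewrite cb.
case: hj => [lt|[_ E]]; last by move: E cb; case: (c) (b) => [] [].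
by have [->|ne] := eqVneq j.+1 k; [right | left; lia].
Qed.

Section Cyclic.
Variables (D : bobj) (b : bool).
Hypothesis fD : flat D b.
Let w := bw D.
Let e : 'M[S]_(wdim w) := be D.

Let cD : chain D. Proof. by case: fD. Qed.
Let bD : hasbot D. Proof. by case: fD. Qed.
Let e_Lam p : e *m Lam w p = Lam w p *m e.
Proof. by have [[_ i] _ _] := bhom_e D; exact: i. Qed.
Let ehomm : homm (@wgr R n w) (@wgr R n w) 0 e.
Proof. by have [[h _] _ _] := bhom_e D. Qed.

Let ebot : e *m bot S w = bot S w.
Proof.
apply/eqP; rewrite -subr_eq0; apply/eqP/matrixP => i j; rewrite [RHS]mxE.
have hh : homm rank1gr (@wgr R n w) 0 (e *m bot S w - bot S w).
  by apply: hommB _ (@bot_homm _ _ S w); rewrite -[0]addr0; apply: hommM ehomm (@bot_homm _ _ S w).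
rewrite (ihomog_le0 (hh i j)); last by rewrite /rank1gr; lia.
have : evm (e *m bot S w - bot S w) = 0 by rewrite evmB evmM evm_bot bD subrr.
by move/matrixP/(_ i j); rewrite [in LHS]mxE => ->; rewrite mxE raddf0.
Qed.

(** A graded Nakayama lemma: the reduction is generated by the bottom vector, and the remainder v
    vanishes at 0, hence involves only basis vectors of smaller degree. *)
Lemma flat_cyclic (i : 'I_(wdim w)) :
  exists2 r, cychom (wgr i) r & e *m delta_mx i 0 = cyceval w r.
Proof.
have [k] := ubnP (wgr i); elim: k i => // k IH i; rewrite ltnS => hi.
have Edim := (bot_dims (chain_HLR cD).1 bD (let: And4 _ h _ _ := fD in h)).2
  (let: And4 _ _ _ h := fD in h).
have hv : inV (X := hs D) (wgr i)%:Z (evm e *m delta_mx i 0).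
  split; first by rewrite [hE _]/= mulmxA -evmM be_idem.
  have hd : homv (@wgr R n w) (wgr i)%:Z (delta_mx i 0 : 'cV[R]_(wdim w)).
    by move=> j; rewrite mxE; have [-> _ //|_] := eqVneq j i; rewrite /= eqxx.
  by have := homv_mul (shiftm_evm ehomm) hd; rewrite addr0.
have [p hp Ep] := Edim _ _ hv.
pose v := e *m delta_mx i 0 - Lam w p *m bot S w.
have ev0 : evm v = 0.
  rewrite /v evmB !evmM evm_bot -Ep [evm (delta_mx i 0)](_ : _ = delta_mx i 0) ?subrr //.
  by apply/matrixP => a c; rewrite !mxE rmorph_nat.
have vE : v = e *m v.
  by rewrite /v mulmxBr mulmxA be_idem mulmxA e_Lam -mulmxA ebot.
have vh : homm rank1gr (@wgr R n w) (wgr i)%:Z v.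
  apply: hommB; last first.
    by rewrite -[(wgr i)%:Z]addr0; apply: hommM (@Lam_homog _ _ S w _ _ hp) (@bot_homm _ _ S w).
  rewrite -[(wgr i)%:Z]add0r; apply: hommM ehomm _ => a c; rewrite mxE.
  have [->|_] := eqVneq a i; last by rewrite ihomog0.
  rewrite /= ord1 eqxx /rank1gr (_ : _ - _ = 0); last by lia.
  by rewrite -(rmorph1 pC); exact: ihomogC.
have vsum : v = \sum_j v j 0 *: (e *m delta_mx j 0).
  rewrite {1}vE [v in LHS]matrix_sum_delta mulmx_sumr; apply: eq_bigr => j _.
  by rewrite big_ord_recl big_ord0 addr0 -scalemxAr.
have /choice[rr hrr] : forall j, exists rj : seq (S * S),
    cychom (wgr i) rj /\ v j 0 *: (e *m delta_mx j 0) = cyceval w rj.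
  move=> j.
  have [v0|nz] := eqVneq (v j 0) 0.
    by exists [::]; rewrite v0 scale0r /cyceval big_nil.
  have lt : (wgr j < wgr i)%N.
    have := ihomog_pos (vh j 0) _ nz; rewrite /rank1gr => h.
    have : ev (v j 0) = 0 by move/matrixP/(_ j 0): ev0; rewrite !mxE.
    by move/h; lia.
  have [r hr Er] := IH j (leq_trans lt hi).
  exists [seq (x.1, v j 0 * x.2) | x <- r]; split; last by rewrite Er cyceval_scale.
  move=> y /mapP[x xr ->]; have [a [a' [ha ha' aa]]] := hr x xr.
  exists a, (wgr i - wgr j + a')%N; split=> //=; last by rewrite -aa; lia.
  apply: phomM => //; have := vh j 0; rewrite /rank1gr.
  by rewrite (_ : _ - _ = (wgr i - wgr j)%N%:Z) //; lia.
exists ((p, 1) :: flatten [seq rr j | j <- enum 'I_(wdim w)]).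
  move=> x; rewrite inE => /orP[/eqP ->|/flattenP[r /mapP[j _ ->] xr]].
    exists (wgr i), 0%N; split=> //=; first by rewrite -(rmorph1 pC); exact: phomC.
    by rewrite addn0.
  by have [h _] := hrr j; exact: h.
rewrite -[(p, 1) :: _]cat1s cyceval_cat cyceval_flatten big_map big_enum /=.
rewrite /cyceval big_seq1 scale1r /= -[LHS](subrK (Lam w p *m bot S w)) -/v addrC.
by congr (_ + _); rewrite vsum; apply: eq_bigr => j _; case: (hrr j).
Qed.

Variable w' : seq (letter R n).
Hypothesis sub_w : forall y, subprod w' y -> subprod w y.

(** D is cyclic, and by [cyceval_eq0] what annihilates its generator also annihilates the bottom
    vector of w'. One representing tensor is chosen for each column of e, and the choice does not
    matter. *)
Lemma cyclic_map : exists2 f : 'M[S]_(wdim w', wdim w),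
  bhom (X := D) (Y := wobj T w') 0 f & f *m bot S w = bot S w'.
Proof.
have /choice[rr hrr] : forall i, exists r : seq (S * S),
    cychom (wgr i) r /\ e *m delta_mx i 0 = cyceval w r.
  move=> i.
  by have [r h1 h2] := flat_cyclic i; exists r.
have ann r : cyceval w r = 0 -> cyceval w' r = 0.
  by move/cyceval_eq0 => h; apply/cyceval_eq0 => y /sub_w; exact: h.
pose f : 'M[S]_(wdim w', wdim w) := \matrix_(i', i) cyceval w' (rr i) i' 0.
have fcol v : f *m v = \sum_i v i 0 *: cyceval w' (rr i).
  apply/matrixP => a c; rewrite ord1 mxE summxE; apply: eq_bigr => i _.
  by rewrite !mxE mulrC.
have fE r v : v = cyceval w r -> e *m v = v -> f *m v = cyceval w' r.
  move=> Ev eE; apply/eqP; rewrite -subr_eq0; apply/eqP.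
  pose r' := flatten [seq [seq (x.1, v i 0 * x.2) | x <- rr i] | i <- enum 'I_(wdim w)] ++
    [seq (x.1, (-1) * x.2) | x <- r].
  have Er' u : cyceval u r' = \sum_i v i 0 *: cyceval u (rr i) - cyceval u r.
    rewrite /r' cyceval_cat cyceval_flatten big_map big_enum /= cyceval_scale scaleN1r.
    by congr (_ - _); apply: eq_bigr => i _; exact: cyceval_scale.
  have vs : v = \sum_i v i 0 *: (e *m delta_mx i 0).
    rewrite -{1}eE {1}[v]matrix_sum_delta mulmx_sumr; apply: eq_bigr => i _.
    by rewrite big_ord_recl big_ord0 addr0 -scalemxAr.
  rewrite fcol -Er'; apply: ann; rewrite Er' -Ev; apply/eqP.
  rewrite subr_eq0 [X in _ == X]vs; apply/eqP/eq_bigr => i _.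
  by have [_ ->] := hrr i.
have feE : f *m e = f.
  apply/matrixP => a i.
  have -> : (f *m e) a i = (f *m (e *m (delta_mx i 0 : 'cV_(wdim w)))) a 0.
    by rewrite mulmxA -colE [RHS]mxE.
  have [_ Ei] := hrr i; rewrite (fE (rr i)) ?Ei //; first by rewrite mxE.
  by rewrite -Ei mulmxA be_idem.
exists f; last first.
  have E1 u : cyceval u [:: ((1 : S), (1 : S))] = bot S u.
    by rewrite /cyceval big_seq1 /= scale1r Lam1 mul1mx.
  by rewrite -(E1 w'); apply: fE.
split=> //; last by rewrite /= mul1mx.
split.
  move=> a i; have [hi _] := hrr i; have := @cyceval_homm _ _ S w' _ _ hi a 0.
  by rewrite /rank1gr mxE add0r addr0.
move=> p _; apply/matrixP => a i.
have -> : (f *m Lam w p) a i = (f *m (Lam w p *m (e *m (delta_mx i 0 : 'cV_(wdim w))))) a 0.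
  have fL : f *m Lam w p = f *m (Lam w p *m e) by rewrite -e_Lam (mulmxA f e) feE.
  rewrite fL (mulmxA (Lam w p) e) (mulmxA f (Lam w p *m e) (delta_mx i 0)).
  by rewrite -colE [RHS]mxE.
have -> : (Lam w' p *m f) a i = (Lam w' p *m (f *m (e *m (delta_mx i 0 : 'cV_(wdim w))))) a 0.
  by rewrite (mulmxA f) feE mulmxA -colE [RHS]mxE.
have [_ Ei] := hrr i; have ee : e *m e = e := be_idem D.
have f1 : f *m (e *m (delta_mx i 0 : 'cV_(wdim w))) = cyceval w' (rr i).
  by apply: fE => //; rewrite mulmxA ee.
have f2 : f *m (Lam w p *m (e *m (delta_mx i 0 : 'cV_(wdim w)))) =
    Lam w' p *m cyceval w' (rr i).
  rewrite -cyceval_Lam; apply: fE; first by rewrite cyceval_Lam -Ei.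
  by rewrite (mulmxA e) e_Lam -(mulmxA _ e) (mulmxA e e) ee.
by rewrite f1 f2.
Qed.

End Cyclic.

Hypothesis braid : wprod (alt true m) = wprod (alt false m).

(** By the braid relation both alternating words of length m have the same products of subwords, so
    the bottom vector of E can be sent to that of the flat object C on the other side; this map is
    nonzero of centred degree 0. *)
Lemma flat_splits E b : flat E b -> blen E = m ->
  splits E (wobj T (alt (~~ b) m)).
Proof.
move=> fE lE; have [C fC lC] := exists_flat (~~ b) (leqnn m).
have [cE EE bE _] := fE; have [cC EC bC _] := fC.
have sub y : subprod (bw C) y -> subprod (bw E) y.
  rewrite EC EE lC lE => /subprod_alt[c [j [Ey [lt|[Ej Ec]]]]]; apply/subprod_alt.
    by exists c, j; split=> //; left.
  exists b, m; split; last by right.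
  by rewrite Ey Ej Ec; case: (b).
have [f hf fb] := cyclic_map fE sub.
have hp : bhom (X := E) (Y := C) 0 (be C *m f).
  have [[hh hi] f1 f2] := hf; have [[gh gi] g1 g2] := bhom_e C.
  split; last by rewrite mulmxA be_idem.
    by rewrite -[0]addr0; apply: wmapM.
  by rewrite -mulmxA f1.
have nz : be C *m f != 0.
  apply: contraNneq (bot_neq0 (R := R) (bw C)) => E0.
  have := congr1 (@evm _ _ S _ _) (congr1 (mulmx (be C)) fb).
  by rewrite mulmxA E0 mul0mx evmM evm_bot bC /evm map_mx0 => <-.
have := simple_nz_split (chain_simple cE) (chain_HLR cE) (chain_HLR cC) hp _ nz.
rewrite /bdeg0 lE lC !add0r => /(_ erefl) sEC; apply: splits_trans sEC _.
by have := splits_wobj C; rewrite EC lC.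
Qed.

(** One side of the braid relation consists of flat objects of lengths m, m - 2, ...; only that of
    length m has to be moved to the other side. *)
Theorem dihedral b : thr (X := wobj T (alt b m)) (Y := wobj T (alt b m))
  (fun C => C = wobj T (alt (~~ b) m) \/ exists c j, (j.+2 <= m)%N /\ C = wobj T (alt c j))
  0 1%:M.
Proof.
apply: thr_trans (alt_thr b (leqnn m)) => E [fE [j lj _]].
have [cE EE bE _] := fE.
have H C : splits E C -> thr (X := E) (Y := E) (eq C) 0 (be E).
  move=> [i [p [q [_ hp hq <-]]]].
  by apply: (thr1 (C := C) (j := i)) => //; rewrite sub0r.
case: j lj => [|j] lj.
  have lE : blen E = m by rewrite -lj addn0.
  by apply: thr_sub (H _ (flat_splits fE lE)) => C <-; left.
have := H _ (splits_wobj E); rewrite EE; apply: thr_sub => C <-; right.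
by exists b, (blen E); split=> //; lia.
Qed.

End Rank2.

(** * Words and simple systems *)

Section LeftTensor.
Variables (R : realType) (n : nat) (S : polyring R n).
Variable (q : seq (letter R n)).
Implicit Types (w x y z : seq (letter R n)) (s : letter R n).

Fixpoint ixl x : 'I_(wdim (x ++ q)) -> 'I_(wdim x) :=
  match x with
  | [::] => fun _ => ord0
  | _ :: x' => fun i => match fintype.split i with
      | inl j => lshift _ (ixl j) | inr j => rshift _ (ixl j) end
  end.

Fixpoint ixr x : 'I_(wdim (x ++ q)) -> 'I_(wdim q) :=
  match x with
  | [::] => id
  | _ :: x' => fun i => match fintype.split i with
      | inl j => ixr j | inr j => ixr j end
  end.

(** [X_(x ++ q)] is the tensor product of [X_q] and [X_x], in this order; [kron g]
is the tensor product of the identity of [X_q] and [g]. *)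
Definition kron y x (g : 'M[S]_(wdim y, wdim x)) : 'M[S]_(wdim (y ++ q), wdim (x ++ q)) :=
  \matrix_(i, j) (g (ixl i) (ixl j) *+ (ixr i == ixr j)).

Lemma ix_inj x (i j : 'I_(wdim (x ++ q))) : ixl i = ixl j -> ixr i = ixr j -> i = j.
Proof.
elim: x i j => [|s x IH] //= i j; rewrite -[i]splitK -[j]splitK.
case: (fintype.split i) => {}i; case: (fintype.split j) => {}j; rewrite !unsplitK /=.
- by move=> /lshift_inj h1 h2; rewrite (IH i j).
- by move/eqP; rewrite eq_lrshift.
- by move/eqP; rewrite eq_rlshift.
- by move=> /rshift_inj h1 h2; rewrite (IH i j).
Qed.

Lemma ix_sum x (F : 'I_(wdim x) -> 'I_(wdim q) -> S) :
  \sum_(k < wdim (x ++ q)) F (ixl k) (ixr k) = \sum_i \sum_j F i j.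
Proof.
elim: x F => [|s x IH] /= F.
  by rewrite big_ord_recl big_ord0 addr0.
rewrite !big_split_ord /=; congr (_ + _); rewrite -IH;
  by apply: eq_bigr => k _; rewrite -1?[lshift _ k]/(unsplit (inl k))
    -1?[rshift _ k]/(unsplit (inr k)) unsplitK.
Qed.

Lemma wgr_cat x (i : 'I_(wdim (x ++ q))) : wgr i = (wgr (ixl i) + wgr (ixr i))%N.
Proof.
elim: x i => [|s x IH] //= i; rewrite -[i]splitK.
by case: (fintype.split i) => {}i; rewrite unsplitK /= ?egr_lshift ?egr_rshift IH.
Qed.

Lemma Lam_cat x (p : S) i j : Lam (x ++ q) p i j = Lam x (Lam q p (ixr i) (ixr j)) (ixl i) (ixl j).
Proof.
elim: x i j => [|s x IH] i j; first by rewrite /= !mxE mulr1n.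
rewrite /= -[i]splitK -[j]splitK /extm.
case: (fintype.split i) => {}i; case: (fintype.split j) => {}j; rewrite !unsplitK /=.
- by rewrite !block_mxEul !mxE IH.
- by rewrite !block_mxEur !mxE IH.
- by rewrite !block_mxEdl !mxE IH.
- by rewrite !block_mxEdr !mxE IH.
Qed.

Lemma kron1 x : kron (1%:M : 'M_(wdim x)) = 1%:M.
Proof.
apply/matrixP => i j; rewrite !mxE; have [->|ij] := eqVneq i j; first by rewrite !eqxx.
case: (eqVneq (ixl i) (ixl j)) => hl; case: (eqVneq (ixr i) (ixr j)) => hr;
  rewrite ?mul0rn ?mulr0n //.
by case/eqP: ij; exact: ix_inj.
Qed.

Lemma kron0 y x : kron (0 : 'M_(wdim y, wdim x)) = 0.
Proof. by apply/matrixP => i j; rewrite !mxE mul0rn. Qed.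

Lemma kronD y x (f g : 'M_(wdim y, wdim x)) : kron (f + g) = kron f + kron g.
Proof. by apply/matrixP => i j; rewrite !mxE mulrnDl. Qed.

Lemma kronM z y x (f : 'M_(wdim z, wdim y)) (g : 'M_(wdim y, wdim x)) :
  kron (f *m g) = kron f *m kron g.
Proof.
apply/matrixP => i j; rewrite !mxE; under [RHS]eq_bigr do rewrite !mxE.
rewrite (ix_sum (fun a b => f (ixl i) a *+ (ixr i == b) * (g a (ixl j) *+ (b == ixr j)))).
rewrite -sumrMnl; apply: eq_bigr => a _; rewrite (bigD1 (ixr i)) //= eqxx mulr1n.
rewrite big1 ?addr0 ?mulrnAr // => b; rewrite eq_sym => /negbTE ->.
by rewrite mulr0n mul0r.
Qed.

(** The left action of p on the longer word reaches x through the entries of [Lam q p], which are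
    arbitrary in S; hence g has to commute with all of S, and rank two is treated without a
    restriction to A. *)
Lemma kron_wmap (A : S -> Prop) y x D (g : 'M_(wdim y, wdim x)) : wmap (fun _ => True) D g ->
  wmap A (w := x ++ q) (w' := y ++ q) D (kron g).
Proof.
move=> [h c]; split=> [i j|p _].
  rewrite mxE; case: eqVneq => [E|_]; last by rewrite ihomog0.
  rewrite mulr1n !wgr_cat E !PoszD.
  by rewrite (_ : _ - _ = (wgr (ixl j))%:Z + D - (wgr (ixl i))%:Z) //; ring.
apply/matrixP => i j.
transitivity ((g *m Lam x (Lam q p (ixr i) (ixr j))) (ixl i) (ixl j)).
  rewrite !mxE; under eq_bigr do rewrite mxE Lam_cat.
  rewrite (ix_sum (fun a b => g (ixl i) a *+ (ixr i == b) * Lam x (Lam q p b (ixr j)) a (ixl j))).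
  apply: eq_bigr => a _; rewrite (bigD1 (ixr i)) //= eqxx mulr1n big1 ?addr0 // => b.
  by rewrite eq_sym => /negbTE ->; rewrite mulr0n mul0r.
rewrite c // !mxE; under [RHS]eq_bigr do rewrite mxE Lam_cat.
rewrite (ix_sum (fun a b => Lam y (Lam q p (ixr i) b) (ixl i) a * (g a (ixl j) *+ (b == ixr j)))).
apply: eq_bigr => a _; rewrite (bigD1 (ixr j)) //= eqxx mulr1n big1 ?addr0 // => b.
by move/negbTE ->; rewrite mulr0n mulr0.
Qed.

End LeftTensor.

Section Transport.
Variables (R : realType) (n : nat) (S : polyring R n) (A : S -> Prop).
Implicit Types (w x y q : seq (letter R n)).
Local Notation T := (fun _ : S => True).
Local Notation wT := (wobj T).
Local Notation wA := (wobj A).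

Lemma bhom_wobj (B : S -> Prop) x y D (f : 'M_(wdim y, wdim x)) : wmap B D f ->
  bhom (X := wobj B x) (Y := wobj B y) D f.
Proof. by move=> h; split=> //=; rewrite ?mulmx1 ?mul1mx. Qed.

Lemma thr_kron (P : seq (letter R n) -> Prop) x y D f q :
  thr (X := wT x) (Y := wT y) (fun C => exists2 u, P u & C = wT u) D f ->
  thr (X := wA (x ++ q)) (Y := wA (y ++ q)) (fun C => exists2 u, P u & C = wA (u ++ q)) D
    (kron q f).
Proof.
elim=> [|f1 f2 _ IH1 _ IH2|C j p r [u Pu EC] [hp _ _] [hr _ _]].
- by rewrite kron0; exact: thr0.
- by rewrite kronD; exact: thrD.
subst C; rewrite kronM; apply: (thr1 (C := wA (u ++ q)) (j := j)); first by exists u.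
  exact/bhom_wobj/kron_wmap.
exact/bhom_wobj/kron_wmap.
Qed.

Lemma thr_word_ext1 (P : seq (letter R n) -> Prop) x a :
  thr (X := wA x) (Y := wA x) (fun C => exists2 u, P u & C = wA u) 0 1%:M ->
  thr (X := wA (a ++ x)) (Y := wA (a ++ x)) (fun C => exists2 u, P u & C = wA (a ++ u)) 0 1%:M.
Proof.
elim: a P => [|s a IH] P h //=.
have : thr (X := wA (a ++ x)) (Y := wA (a ++ x))
  (fun C => exists2 u, P u & C = wA (a ++ u)) 0 1%:M by exact: IH.
rewrite -[X in thr (X := wA (s :: _)) _ _ X](extm1 S s (wdim (a ++ x))).
move: (1%:M : 'M[S]_(wdim (a ++ x))) => f.
elim=> [|f1 f2 _ IH1 _ IH2|C j p r [u Pu EC] [hp _ _] [hr _ _]].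
- by rewrite raddf0; exact: thr0.
- by rewrite extmD; exact: thrD.
subst C; rewrite extmM; apply: (thr1 (C := wA (s :: a ++ u)) (j := j)); first by exists u.
  exact/bhom_wobj/wmap_ext.
exact/bhom_wobj/wmap_ext.
Qed.

Lemma thr_subword (P : seq (letter R n) -> Prop) a x q :
  thr (X := wT x) (Y := wT x) (fun C => exists2 u, P u & C = wT u) 0 1%:M ->
  thr (X := wA (a ++ x ++ q)) (Y := wA (a ++ x ++ q))
    (fun C => exists2 u, P u & C = wA (a ++ u ++ q)) 0 1%:M.
Proof.
move/(thr_kron q); rewrite kron1.
have Q : forall C, (exists2 u, P u & C = wA (u ++ q)) ->
  exists2 u, (exists2 v, P v & u = v ++ q) & C = wA u.
  by move=> C [u Pu ->]; exists (u ++ q) => //; exists u.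
move=> /(thr_sub Q) /(thr_word_ext1 a); apply: thr_sub => C [_ [v Pv ->] ->].
by exists v.
Qed.

End Transport.

Lemma size_alts b k : size (alts b k) = k.
Proof. by elim: k b => //= k IH b; rewrite IH. Qed.

(** * Reduced words by signs of roots *)

Section SimpleSystem.
Variables (R : realType) (n : nat) (I : finType).
Variables (sl : I -> letter R n) (root : 'cV[R]_n -> Prop).
Variables (la0 : 'rV[R]_n) (mu : I -> 'rV[R]_n).
Local Notation W v := (wprod (map sl v)).
Local Notation a i := (lroot (sl i)).
Implicit Types (i j : I) (v w x y z : seq I) (b : 'cV[R]_n).

(** A root is positive when [la0] is positive on it; [mu] is the basis dual to the simple
roots. *)
Record simple_system : Prop := SimpleSystem {
  ss_root : forall i, root (a i);
  ss_opp : forall b, root b -> root (- b);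
  ss_stab : forall i b, root b -> root (lrefl (sl i) *m b);
  ss_red : forall i c, root (c *: a i) -> c = 1 \/ c = -1;
  ss_dual : forall i j, pairing (mu i) (a j) = (i == j)%:R;
  ss_exp : forall b, b = \sum_i pairing (mu i) b *: a i;
  ss_ht : forall b, root b -> pairing la0 b != 0;
  ss_pos : forall i b, root b -> 0 < pairing la0 b -> 0 <= pairing (mu i) b;
  ss_conj : forall v i j, W v *m a i = a j ->
    W v *m lrefl (sl i) = lrefl (sl j) *m W v }.

Hypothesis H : simple_system.

Lemma pairing_sumr (f : 'rV[R]_n) (J : Type) (r : seq J) (P : pred J) (F : J -> 'cV[R]_n) :
  pairing f (\sum_(i <- r | P i) F i) = \sum_(i <- r | P i) pairing f (F i).
Proof. by rewrite /pairing mulmx_sumr summxE. Qed.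

Lemma wprod_cat (v w : seq (letter R n)) : wprod (v ++ w) = wprod w *m wprod v.
Proof. by elim: v => [|s v IH] /=; rewrite ?mulmx1 // IH mulmxA. Qed.

Lemma W_cat v w : W (v ++ w) = W w *m W v.
Proof. by rewrite map_cat wprod_cat. Qed.

Lemma W_rev v : W (rev v) *m W v = 1%:M.
Proof.
elim: v => [|i v IH] /=; first by rewrite mulmx1.
rewrite rev_cons -cats1 W_cat /= mul1mx -mulmxA (mulmxA (W (rev v))) IH mul1mx.
exact: lreflK.
Qed.

Lemma W_revK v : W v *m W (rev v) = 1%:M.
Proof. by rewrite -{1}[v]revK W_rev. Qed.

Lemma root_W v b : root b -> root (W v *m b).
Proof.
elim: v b => [|i v IH] b hb /=; first by rewrite mul1mx.
by rewrite -mulmxA; apply/IH/(ss_stab H).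
Qed.

Lemma refl_simple i : lrefl (sl i) *m a i = - a i.
Proof.
by rewrite /lrefl reflection_mul letterP scaler_nat mulr2n opprD addrA subrr add0r.
Qed.

Lemma W_cons_self v i : W (i :: v) *m a i = - (W v *m a i).
Proof. by rewrite /= -mulmxA refl_simple mulmxN. Qed.

Lemma not_pos b : root b -> ~ 0 < pairing la0 b -> pairing la0 b < 0.
Proof. by move=> /(ss_ht H) nz; case: ltgtP nz. Qed.

Lemma mu_W (P : {pred I}) v i : {subset v <= P} -> i \notin P -> mu i *m W v = mu i.
Proof.
move=> sv iP; elim: v sv => [|j v IH] sv /=; first by rewrite mulmx1.
rewrite mulmxA IH => [|k kv]; last by apply: sv; rewrite inE kv orbT.
rewrite /lrefl mul_reflection (ss_dual H); case: eqP => [ij|_]; last by rewrite scale0r subr0.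
by move: iP; rewrite ij sv // mem_head.
Qed.

Lemma ht_simple i : 0 < pairing la0 (a i).
Proof.
apply: contrapT => /(not_pos (ss_root H i)) lt.
have := ss_pos H i (ss_opp H (ss_root H i)).
by rewrite !pairingNr (ss_dual H) eqxx /= oppr_gt0 => /(_ lt); rewrite oppr_ge0 ler10.
Qed.

Lemma pos_perm b i : root b -> 0 < pairing la0 b -> b <> a i ->
  0 < pairing la0 (lrefl (sl i) *m b).
Proof.
move=> rb pb bi; apply: contrapT => /(not_pos (ss_stab H i rb)) lt; apply: bi.
have mu0 j : j != i -> pairing (mu j) b = 0.
  move=> ji; apply/eqP; rewrite eq_le (ss_pos H) // andbT.
  have := ss_pos H j (ss_opp H (ss_stab H i rb)); rewrite !pairingNr oppr_gt0 => /(_ lt).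
  rewrite /lrefl reflection_mul pairingDr pairingNr pairingZr (ss_dual H) (negbTE ji).
  by rewrite mulr0 subr0 oppr_ge0.
have E : b = pairing (mu i) b *: a i.
  rewrite {1}[b](ss_exp H) (bigD1 i) //= big1 ?addr0 // => j /mu0 ->.
  by rewrite scale0r.
have := rb; rewrite E => /(ss_red H)[->|c1]; first by rewrite scale1r.
by move: (ss_pos H i rb pb); rewrite c1 oppr_ge0 ler10.
Qed.

(** A simple reflection permutes the positive roots other than its own, so the sign changes only
    where b has become the simple root of the next letter. *)
Lemma sign_flip v b : root b -> 0 < pairing la0 b -> pairing la0 (W v *m b) < 0 ->
  exists x y i, v = x ++ i :: y /\ W x *m b = a i.
Proof.
elim: v b => [|i v IH] b rb pb /=; first by rewrite mul1mx ltNge ltW.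
rewrite -mulmxA => lt; have [E|ne] := pselect (b = a i).
  by exists [::], v, i; rewrite mul1mx.
have [x [y [j [-> E]]]] := IH _ (ss_stab H i rb) (pos_perm rb pb ne) lt.
by exists (i :: x), y, j; rewrite /= -mulmxA.
Qed.

Lemma exchange v i : pairing la0 (W v *m a i) < 0 ->
  exists x y j, v = x ++ j :: y /\ W (i :: v) = W (x ++ y).
Proof.
move=> /(sign_flip (ss_root H i) (ht_simple i))[x [y [j [-> E]]]].
exists x, y, j; split=> //; rewrite /= !W_cat /= -!mulmxA (ss_conj H E).
by rewrite !mulmxA -(mulmxA (W y)) lreflK mulmx1.
Qed.

Definition minword v := forall w, W w = W v -> (size v <= size w)%N.
Local Notation good v := (goodword la0 (map sl v)).

Lemma root_kap v i : root (W v *m a i).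
Proof. exact/root_W/ss_root. Qed.

Lemma kapE (la : 'rV[R]_n) v i : kap la (map sl v) (sl i) = pairing la (W v *m a i).
Proof. by rewrite /kap pairing_mul. Qed.

(** A letter with the wrong sign could be cancelled by [exchange]. *)
Lemma min_good v : minword v -> good v.
Proof.
elim: v => [|i v IH] //= hm; have mv : minword v.
  by move=> w E; have := hm (i :: w); rewrite /= E ltnS; apply.
split; first exact: IH.
rewrite kapE; apply: contrapT => /(not_pos (root_kap v i)) /exchange[x [y [j [Ev E]]]].
by have := hm _ (esym E); rewrite Ev /= !size_cat /=; lia.
Qed.

Lemma good_min v : good v -> minword v.
Proof.
elim: v => [|i v IH] //= [gv kv] w E; rewrite kapE in kv.
have /exchange[x [y [j [Ew Exy]]]] : pairing la0 (W w *m a i) < 0.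
  by rewrite E -[X in pairing _ X]/(W (i :: v) *m a i) W_cons_self pairingNr oppr_lt0.
have := IH gv (x ++ y); rewrite -Exy /= E -mulmxA lreflK mulmx1 => /(_ erefl).
by rewrite Ew !size_cat /=; lia.
Qed.

Lemma good_eq v w : good v -> W w = W v -> (size w <= size v)%N -> good w.
Proof.
move=> /good_min mv E lw; apply: min_good => u Eu.
by apply: leq_trans lw _; apply: mv; rewrite Eu.
Qed.

Lemma good_size v w : good v -> good w -> W v = W w -> size v = size w.
Proof.
move=> /good_min mv /good_min mw E; apply/eqP; rewrite eqn_leq.
by rewrite mv // mw.
Qed.

Lemma exists_good v : exists2 w, {subset w <= v} & good w /\ W w = W v.
Proof.
elim: v => [|i v [w sw [gw Ew]]]; first by exists [::].
have [p|/(not_pos (root_kap w i)) lt] := pselect (0 < pairing la0 (W w *m a i)).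
  exists (i :: w); last by split; [split; rewrite ?kapE | rewrite /= Ew].
  by move=> c; rewrite !inE => /orP[->|/sw ->]; rewrite ?orbT.
have [x [y [j [E Exy]]]] := exchange lt; exists (x ++ y).
  move=> c hc; rewrite inE sw ?orbT // E !mem_cat inE.
  by move: hc; rewrite mem_cat => /orP[->|->]; rewrite ?orbT.
split; last by rewrite -Exy /= Ew.
apply: min_good => u Eu; have mw : minword w := good_min gw; have := mw (i :: u).
rewrite /= Eu -Exy /= -mulmxA lreflK mulmx1 => /(_ erefl).
by rewrite E !size_cat /=; lia.
Qed.

Lemma good_strip v i : good v -> pairing la0 (W v *m a i) < 0 ->
  exists w, [/\ {subset w <= v}, good (i :: w), W (i :: w) = W v & size v = (size w).+1].
Proof.
move=> gv /exchange[x [y [j [Ev E]]]].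
have E2 : W (i :: x ++ y) = W v by rewrite /= -E /= -mulmxA lreflK mulmx1.
have sz : size v = (size (x ++ y)).+1 by rewrite Ev !size_cat /= addnS.
exists (x ++ y); split=> //; last by apply: good_eq gv E2 _; rewrite sz.
by move=> c; rewrite Ev !mem_cat inE => /orP[->|->]; rewrite ?orbT.
Qed.

Lemma good_catr v w : good (v ++ w) -> good w.
Proof. by elim: v => //= i v IH [/IH]. Qed.

(** * Elements with two descents *)

Section Dihedral.
Variables (i j : I).
Local Notation st := (fun b : bool => if b then i else j).
Local Notation al b k := (map st (alts b k)).

(** Descents are stripped alternately: removing one letter makes its own sign positive, so only the
    other letter can be the next descent. What remains is a minimal coset representative. *)
Lemma strip v (b : bool) : good v -> 0 < pairing la0 (W v *m a (st (~~ b))) ->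
  exists k w, [/\ {subset w <= v}, good (al b k ++ w), W (al b k ++ w) = W v &
    forall c, 0 < pairing la0 (W w *m a (st c))].
Proof.
have [N lN] := ubnP (size v); elim: N v b lN => // N IH v b lN gv p1.
have [p2|n2] := pselect (0 < pairing la0 (W v *m a (st b))).
  by exists 0%N, v; split=> // c; case: c; case: b p1 p2.
have [w [sw gw Ew sz]] := good_strip gv (not_pos (root_kap v (st b)) n2).
have [gw1 gw2] := gw; rewrite kapE in gw2.
have [|||k [u [su gu Eu pu]]] := IH w (~~ b).
- by move: lN; rewrite sz.
- by [].
- by rewrite negbK.
exists k.+1, u; split=> //=.
- by move=> c /su /sw.
- by split=> //; rewrite kapE Eu.
- by rewrite Eu -Ew.
Qed.

(** A positive root of the dihedral subsystem is a nonnegative combination of the two simple roots,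
    and q makes both of them positive. *)
Lemma sign_dihedral q u c : {subset u <= [:: i; j]} -> c \in [:: i; j] ->
  (forall d, 0 < pairing la0 (W q *m a (st d))) ->
  0 < pairing la0 (W u *m a c) -> 0 < pairing la0 (W q *m (W u *m a c)).
Proof.
move=> su cij hq hp; apply: contrapT => /(not_pos (root_W _ (root_kap u c))).
apply/negP; rewrite -leNgt; have mu0 l : l \notin [:: i; j] -> pairing (mu l) (W u *m a c) = 0.
  move=> lij; rewrite -pairing_mul (mu_W su lij) (ss_dual H).
  by case: eqP lij => // ->; rewrite cij.
rewrite [W u *m a c](ss_exp H) mulmx_sumr -[X in X <= _](_ : \sum_(l : I) 0 = 0); last exact: big1.
have -> : pairing la0 (\sum_l W q *m (pairing (mu l) (W u *m a c) *: a l)) =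
  \sum_l pairing (mu l) (W u *m a c) * pairing la0 (W q *m a l).
  rewrite /pairing mulmx_sumr summxE; apply: eq_bigr => l _.
  by rewrite -!scalemxAr !mxE.
apply: ler_sum => l _; have [lij|/mu0 ->] := boolP (l \in [:: i; j]); last by rewrite mul0r.
apply: mulr_ge0; first exact: ss_pos H _ _ (root_kap u c) hp.
by move: lij (hq true) (hq false); rewrite !inE => /orP[] /eqP ->; move=> /ltW ? /ltW ?.
Qed.

Lemma al_sub (b : bool) k : {subset al b k <= [:: i; j]}.
Proof. by move=> c /mapP[d _ ->]; rewrite !inE; case: d; rewrite eqxx ?orbT. Qed.

Lemma stin c : st c \in [:: i; j].
Proof. by rewrite !inE; case: c; rewrite eqxx ?orbT. Qed.

Lemma size_al (b : bool) k : size (al b k) = k.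
Proof. by rewrite size_map size_alts. Qed.

(** After the minimal coset representative q is removed, the dihedral factor has both descents. So
    it is the longest element and has a reduced expression starting with either letter; equality of
    lengths makes this the braid relation. *)
Theorem dihedral_strip v : good v -> pairing la0 (W v *m a i) < 0 ->
  pairing la0 (W v *m a j) < 0 ->
  exists m q, (forall b : bool, [/\ good (al b m.+1 ++ q), W (al b m.+1 ++ q) = W v
      & good (al b m.+1)]) /\
    W (al true m.+1) = W (al false m.+1).
Proof.
move=> gv hi hj; have [w [_ gw Ew sz]] := good_strip gv hi.
have [gw1 gw2] := gw; rewrite kapE in gw2.
have [k [q [_ gq Eq hq]]] := @strip w false gw1 gw2.
pose m := k.+1; have gm : good (al true m ++ q) by split=> //; rewrite kapE Eq.
have Em : W (al true m ++ q) = W v by rewrite /= Eq -Ew.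
have gal : good (al true m).
  elim: (al true m) (@al_sub true m) gm {Em} => [|d u IH] //= su [gu k1].
  have su' : {subset u <= [:: i; j]} by move=> c hc; apply: su; rewrite inE hc orbT.
  split; first exact: IH.
  rewrite kapE W_cat -mulmxA in k1; rewrite kapE; apply: contrapT.
  move=> /(not_pos (root_kap _ _)) lt.
  have := @sign_dihedral q (d :: u) d su (su _ (mem_head _ _)) hq.
  by rewrite W_cons_self mulmxN !pairingNr !oppr_gt0 lt => /(_ erefl); rewrite ltNge ltW.
have neg : pairing la0 (W (al true m) *m a j) < 0.
  apply: not_pos (root_kap _ _) _ => p.
  have := sign_dihedral (@al_sub true m) (stin false) hq p.
  by rewrite mulmxA -W_cat Em ltNge ltW.
have [w2 [sw2 gw2' Ew2 _]] := good_strip gal neg.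
have [g1 g2] := gw2'; rewrite kapE in g2.
have [k2 [q2 [sq2 gq2 Eq2 hq2]]] := @strip w2 true g1 g2.
have {}sq2 : {subset q2 <= [:: i; j]} by move=> c /sq2 /sw2; exact: al_sub.
case: q2 sq2 gq2 Eq2 hq2 => [|c q2] sq2 gq2 Eq2 hq2; last first.
  have [_ kc] := good_catr gq2; rewrite kapE in kc.
  have := sq2 c (mem_head _ _); rewrite !inE => /orP[]/eqP cE.
    by have := hq2 true; rewrite -cE W_cons_self pairingNr oppr_gt0 ltNge ltW.
  by have := hq2 false; rewrite -cE W_cons_self pairingNr oppr_gt0 ltNge ltW.
rewrite cats0 in gq2 Eq2.
have gf : good (al false k2.+1) by split=> //; rewrite kapE Eq2.
have Ef : W (al true m) = W (al false k2.+1) by rewrite -[LHS]Ew2 /= Eq2.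
have mk : m = k2.+1 by have := good_size gal gf Ef; rewrite !size_al.
rewrite -mk in gf Ef.
have Efq : W (al false m ++ q) = W v by rewrite W_cat -Ef -W_cat.
exists k, q; split=> // -[] //; split=> //.
apply: (good_eq gm); first by rewrite Em.
by rewrite !size_cat !size_al.
Qed.

End Dihedral.

(** * Braid moves on summands, and the wrong sign *)

Section Transport.
Variables (S : polyring R n) (A : S -> Prop) (la : 'rV[R]_n) (A_la : A (lin S la)).
Local Notation wA v := (wobj A (map sl v)).

Lemma In_map_sl v : forall s, List.In s (map sl v) -> exists i, s = sl i.
Proof. by move=> s; elim: v => //= i v IH [<-|/IH //]; exists i. Qed.

(* Matsumoto's theorem, each braid move being carried out by [dihedral]; the words of
   length smaller by 2 or more that occur in [dihedral] are excluded by hypothesis. *)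
Theorem good_transport D x v w : bsimple D -> HLR (hs A_la D) -> good v -> good w ->
  W v = W w ->
  (forall u, (size u + 2 <= size x + size v)%N -> ~ shsplits D (wA u)) ->
  shsplits D (wA (x ++ v)) -> shsplits D (wA (x ++ w)).
Proof.
move=> sD HD; have [N lN] := ubnP (size v); elim: N v w x lN => // N IH v w x lN gv gw E hu.
have sz := good_size gv gw E.
case: v w lN gv gw E sz hu => [|i v] [|j w] // lN gv gw E sz hu.
have tail d p r : good (d :: p) -> good (d :: r) -> W (d :: p) = W (d :: r) ->
    (size p < N)%N -> size p = size v ->
    shsplits D (wA (x ++ d :: p)) -> shsplits D (wA (x ++ d :: r)).
  move=> [gp _] [gr _] Epr lp sp; rewrite -!cat_rcons; apply: IH => //.
    have := congr1 (mulmx^~ (lrefl (sl d))) Epr.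
    by rewrite /= -!mulmxA lreflK !mulmx1.
  by move=> u; rewrite size_rcons sp addSnnS; exact: hu.
have lv : (size v < N)%N by [].
have [Eij|ij] := eqVneq i j; first by move: gw E sz; rewrite -Eij => gw E sz; exact: tail.
move=> hv.
have hi : pairing la0 (W (i :: v) *m a i) < 0.
  by have [_] := gv; rewrite kapE W_cons_self pairingNr oppr_lt0.
have hj : pairing la0 (W (i :: v) *m a j) < 0.
  by rewrite E; have [_] := gw; rewrite kapE W_cons_self pairingNr oppr_lt0.
have [m [q [hm braid]]] := dihedral_strip gv hi hj.
pose st (b : bool) := if b then i else j; pose sl' := fun b : bool => sl (st b).
have Eal (b : bool) k : map sl (map st (alts b k)) = alt sl' b k by rewrite /alt -map_comp.
have sm (b : bool) : size (map st (alts b m.+1) ++ q) = (size v).+1.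
  by have [g1 g2 _] := hm b; rewrite -/st (good_size g1 gv g2).
(* Rank two is applied with the regular form [la0]: the resulting factorization of the identity no
   longer mentions a Lefschetz form. *)
have dt := dihedral S (la := la0) (sl := sl') (m := m.+1).
have {}dt : thr (X := wobj (fun _ : S => True) (alt sl' true m.+1))
    (Y := wobj (fun _ : S => True) (alt sl' true m.+1))
    (fun C => exists2 u, (u = alt sl' false m.+1 \/ exists c k,
      (k.+2 <= m.+1)%N /\ u = alt sl' c k) & C = wobj _ u) 0 1%:M.
  apply: thr_sub (dt _ _ _ true) => [C [->|[c [k [km ->]]]]|b|b|].
  - by exists (alt sl' false m.+1); [left | ].
  - by exists (alt sl' c k); [right; exists c, k | ].
  - by rewrite -Eal; case: (hm b).
  - exists (mu (st b)); first by rewrite (ss_dual H) eqxx.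
    by rewrite (ss_dual H); case: b => /=; rewrite ?(negbTE ij) // eq_sym (negbTE ij).
  - by rewrite -!Eal.
have ht : shsplits D (wA (x ++ map st (alts true m.+1) ++ q)).
  have [g1 g2 _] := hm true; have s1 := sm true.
  by apply: (tail i v) hv => //; case: s1.
have /(shsplits_thr sD HD ht) : thr (X := wA (x ++ map st (alts true m.+1) ++ q))
    (Y := wA (x ++ map st (alts true m.+1) ++ q))
    (fun C => exists2 u, (u = alt sl' false m.+1 \/ exists c k,
      (k.+2 <= m.+1)%N /\ u = alt sl' c k) & C = wobj A (map sl x ++ u ++ map sl q)) 0 1%:M.
  by rewrite !map_cat Eal; exact: thr_subword dt.
move=> [_ [u hu' ->]] hs; have [g1 g2 _] := hm false; have s1 := sm false.
have {}hu' : u = alt sl' false m.+1.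
  case: hu' => // -[c [k [km Eu]]]; case: (hu (x ++ map st (alts c k) ++ q)).
    move: s1; rewrite !size_cat !size_map !size_alts /=; lia.
  by rewrite !map_cat Eal -Eu.
apply: (tail j (map st (alts true m) ++ q)) => //.
- by rewrite -E -g2.
- by case: s1 => ->.
- by case: s1 => ->.
by move: hs; rewrite hu' -Eal -!map_cat.
Qed.

(** The last letter of a list is the first tensor factor, next to the action of A; for s-invariant
    elements that factor is just two copies of S. *)
Lemma shsplits_inner s (v : seq (letter R n)) : (forall p, A p -> lact s p = p) ->
  shsplits (wobj A v) (wobj A (v ++ [:: s])).
Proof.
move=> As; elim: v => [|t v IH] /=; last first.
  apply: shsplits_trans (splits_sh (wobj_ext A v t).1) _.
  apply: shsplits_trans (shsplits_ext t IH) _.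
  exact: splits_sh (wobj_ext A _ t).2.
have E p : A p -> extm s (p%:M : 'M[S]_1) = block_mx p%:M 0 0 p%:M.
  by move=> Ap; rewrite extm_scalar dem_inv ?As // avg_inv ?As // mulr0 raddf0.
exists 0, (col_mx 1%:M 0), (row_mx 1%:M 0); split.
- apply: bhom_wobj; split=> [i j|p Ap].
    rewrite -[i]splitK; case: (fintype.split i) => {}i; rewrite [unsplit _]/= [in X in _ - X]/= ?egr_lshift ?egr_rshift.
      by rewrite col_mxEu; exact: homm1.
    by rewrite col_mxEd mxE ihomog0.
  by rewrite /= E // mul_col_mx mul0mx mul_block_col !mulmx0 mul0mx !addr0 mul1mx mulmx1.
- rewrite oppr0; apply: bhom_wobj; split=> [i j|p Ap].
    rewrite -[j]splitK; case: (fintype.split j) => {}j; rewrite [unsplit _]/= [wgr _]/= ?egr_lshift ?egr_rshift.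
      by rewrite row_mxEl; exact: homm1.
    by rewrite row_mxEr mxE ihomog0.
  by rewrite /= E // mul_mx_row mulmx0 mul_row_block !mul0mx !mulmx0 !addr0 mul1mx mulmx1.
- by rewrite mul_row_col mul0mx addr0 mulmx1.
Qed.

Hypothesis dom : forall b, root b -> 0 < pairing la b -> 0 < pairing la0 b.
Hypothesis fixA : forall i, pairing la (a i) = 0 -> forall p, A p -> lact (sl i) p = p.

Lemma dom_ge0 b : root b -> 0 < pairing la0 b -> 0 <= pairing la b.
Proof.
move=> rb pb; rewrite leNgt; apply/negP => lt.
have := dom (ss_opp H rb); rewrite !pairingNr !oppr_gt0 => /(_ lt).
by rewrite ltNge ltW.
Qed.

Lemma good_dom v : goodword la (map sl v) -> good v.
Proof.
elim: v => [|i v IH] //= [/IH gv]; rewrite kapE => /(dom (root_kap v i)) h.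
by split=> //; rewrite kapE.
Qed.

(** By dominance lambda vanishes on every simple root a_l that occurs in the root, and goodness for
    lambda makes the preimages of these a_l positive. Then a_t is a positive combination of positive
    roots, so each of them is proportional to a_t, hence equal to it. *)
Lemma zero_simple v t : goodword la (map sl v) -> 0 < pairing la0 (W v *m a t) ->
  pairing la (W v *m a t) = 0 ->
  exists i, W v *m a t = a i /\ pairing la (a i) = 0.
Proof.
move=> gv pb b0; set b := W v *m a t in pb b0 *.
have rb : root b := root_kap v t.
have c0 i : 0 <= pairing (mu i) b by exact: ss_pos H _ _ rb pb.
have la_b : \sum_i pairing (mu i) b * pairing la (a i) = 0.
  transitivity (pairing la b) => //; rewrite [in RHS](ss_exp H b) pairing_sumr.
  by apply: eq_bigr => i _; rewrite pairingZr.
have [i ci] : exists i, pairing (mu i) b != 0.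
  apply: contrapT => nex; have b00 : b = 0.
    rewrite (ss_exp H b) big1 // => i _.
    have [->|nz] := eqVneq (pairing (mu i) b) 0; first by rewrite scale0r.
    by case: nex; exists i.
  by move: pb; rewrite b00 /pairing mulmx0 mxE ltxx.
have lai l : pairing (mu l) b != 0 -> pairing la (a l) = 0.
  move=> nz; move/eqP: la_b; rewrite psumr_eq0 => [/allP/(_ l (mem_index_enum _))|k _].
    by rewrite mulf_eq0 (negbTE nz) => /eqP.
  by apply: mulr_ge0 => //; apply: dom_ge0; [exact: ss_root H k | exact: ht_simple].
have inv l : pairing (mu l) b != 0 -> 0 < pairing la0 (W (rev v) *m a l).
  move=> nz; apply: contrapT => /(not_pos (root_kap _ _)) lt.
  have rd := ss_opp H (root_kap (rev v) l).
  have [||x [y [j [Ev Ex]]]] := sign_flip (v := v) rd.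
  - by rewrite pairingNr oppr_gt0.
  - by rewrite mulmxN mulmxA W_revK mul1mx pairingNr oppr_lt0 ht_simple.
  have El : W y *m a j = a l.
    apply: oppr_inj; rewrite -W_cons_self -Ex mulmxA -W_cat -Ev mulmxN mulmxA.
    by rewrite W_revK mul1mx.
  have : goodword la (map sl (j :: y)).
    by move: gv; rewrite Ev map_cat; elim: (map sl x) => //= c u IHx [/IHx].
  by move=> [_]; rewrite kapE El lai // ltxx.
have Et : a t = \sum_l pairing (mu l) b *: (W (rev v) *m a l).
  rewrite -[a t]mul1mx -(W_rev v) -mulmxA -/b {1}(ss_exp H b) mulmx_sumr.
  by apply: eq_bigr => l _; rewrite -scalemxAr.
have mu0 k : k != t -> pairing (mu k) (W (rev v) *m a i) = 0.
  move=> kt; have : \sum_l pairing (mu l) b * pairing (mu k) (W (rev v) *m a l) = 0.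
    transitivity (pairing (mu k) (a t)); last by rewrite (ss_dual H) (negbTE kt).
    by rewrite Et pairing_sumr; apply: eq_bigr => l _; rewrite pairingZr.
  move/eqP; rewrite psumr_eq0 => [/allP/(_ i (mem_index_enum _))|l _].
    by rewrite mulf_eq0 (negbTE ci) => /eqP.
  have [->|nz] := eqVneq (pairing (mu l) b) 0; first by rewrite mul0r.
  by apply: mulr_ge0 => //; apply: ss_pos H _ _ (root_kap _ _) (inv l nz).
exists i; split; last exact: lai.
set d := W (rev v) *m a i in mu0.
have Ed : d = pairing (mu t) d *: a t.
  rewrite {1}[d](ss_exp H) (bigD1 t) //= big1 ?addr0 // => k /mu0 ->.
  by rewrite scale0r.
have Edt : d = a t.
  have := root_kap (rev v) i; rewrite -/d {1}Ed => /(ss_red H)[] E; rewrite Ed E ?scale1r //.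
  have := inv i ci; rewrite -/d Ed E pairingZr mulN1r oppr_gt0.
  by rewrite ltNge ltW // ht_simple.
by rewrite /b -Edt mulmxA W_revK mul1mx.
Qed.

Theorem wrong_sign k : nice_upto A_la sl k -> wrong_sign_split A_la sl k.
Proof.
move=> Nk D t cD nD lD gD k0; have [v Ev] := chain_word cD; rewrite Ev in gD k0.
have hv : shsplits D (wA v) by rewrite -Ev; exact/splits_sh/splits_wobj.
have gv := good_dom gD; rewrite kapE in k0.
have sz : size v = k by rewrite -lD /blen Ev size_map.
have hu u : (size u < k)%N -> ~ shsplits D (wA u).
  move=> lu /(new_shsplits _ cD nD) h; move: lu; rewrite ltnNge -lD.
  by rewrite -(size_map sl) h // ?lD //; exact: In_map_sl.
have [sD HD] := chain_simple_HLR cD.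
have [p|/(not_pos (root_kap v t)) lt] := pselect (0 < pairing la0 (W v *m a t)); last first.
  have [w [_ gw Ew _]] := good_strip gv lt; exists (map sl w).
  apply: (@good_transport D [::] v (t :: w)) => // u; rewrite sz addn2 => lu.
  by apply: hu; apply: ltn_trans lu.
(* Here t is no descent of v, so lambda is nonnegative on the root by dominance, while the wrong
   sign makes it nonpositive. *)
have la_0 : pairing la (W v *m a t) = 0.
  by apply/eqP; rewrite eq_le k0 dom_ge0 //; exact: root_kap.
have [i [Ei la_i]] := zero_simple gD p la_0.
(* Appending i on the inner side keeps D as a summand because A is fixed by s_i, and the words v i
   and t v present the same element, so braid moves bring t to the outer end. *)
exists (map sl v); apply: (@good_transport D [::] (v ++ [:: i]) (t :: v)) => //.
- apply: (@good_eq (t :: v)); rewrite ?size_cat ?addn1 //=; last by rewrite W_cat /= mul1mx -(ss_conj H Ei).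
  by split=> //; rewrite kapE.
- by split=> //; rewrite kapE.
- by rewrite W_cat /= mul1mx -(ss_conj H Ei).
- by move=> u; rewrite size_cat /= sz addn2 addn1 ltnS => lu; apply: hu.
by apply: shsplits_trans hv _; rewrite /= map_cat; apply: shsplits_inner; exact: fixA.
Qed.

Theorem nice_all k : nice_upto A_la sl k.
Proof. by apply: nice_upto_wrong_sign => j _; exact: wrong_sign. Qed.

End Transport.
End SimpleSystem.

(** * Antisymmetrization and the coinvariant ideal *)

Section LinearFactors.
Variables (R : realType) (n : nat) (S : polyring R n).
Notation lin := (lin S).
Implicit Types (p q : S) (u : 'rV[R]_n).

Definition dvd u p := exists q, p = lin u * q.

Definition lproj (s : letter R n) : 'M[R]_n := 1%:M - 2^-1 *: (lroot s *m lform s).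

Lemma lproj_lin s u : act (lproj s) (lin u) = lin (u - (2^-1 * pairing u (lroot s)) *: lform s).
Proof.
rewrite act_lin /lproj mulmxBr mulmx1 -scalemxAr mulmxA pairingE mul_scalar_mx.
by rewrite scalerA.
Qed.

Lemma lin0 : lin 0 = 0. Proof. exact: raddf0. Qed.

(** [lproj s] is the projection onto the hyperplane along the root, so this tests vanishing on the
    hyperplane; it shows that linear forms are prime. *)
Lemma lprojP s p : dvd (lform s) p <-> act (lproj s) p = 0.
Proof.
split=> [[q ->]|E].
  by rewrite rmorphM /= lproj_lin letterP mulVf ?pnatr_eq0 // scale1r subrr lin0 mul0r.
suff [q Eq] : exists q, p - act (lproj s) p = lin (lform s) * q.
  by exists q; rewrite -Eq E subr0.
elim/polyring_ind: {E} p => [c|u|p q [p' Ep] [q' Eq]|p q [p' Ep] [q' Eq]].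
- by exists 0; rewrite actC subrr mulr0.
- exists (pC (2^-1 * pairing u (lroot s))).
  by rewrite lproj_lin raddfB /= linZ opprB addrC subrK mulrC.
- by exists (p' + q'); rewrite mulrDr -Ep -Eq raddfD /=; ring.
- exists (p' * q + act (lproj s) p * q').
  have -> : lin (lform s) * (p' * q + act (lproj s) p * q') =
    (lin (lform s) * p') * q + act (lproj s) p * (lin (lform s) * q') by ring.
  by rewrite -Ep -Eq rmorphM /=; ring.
Qed.

Lemma dvd_prime s p q : dvd (lform s) (p * q) -> dvd (lform s) p \/ dvd (lform s) q.
Proof.
move/lprojP; rewrite rmorphM /= => /eqP; rewrite mulf_eq0 => /orP[]/eqP E.
  by left; apply/lprojP.
by right; apply/lprojP.
Qed.

Lemma dvd_lin s u : dvd (lform s) (lin u) -> exists c, u = c *: lform s.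
Proof.
move/lprojP; rewrite lproj_lin -lin0 => /lin_inj/eqP; rewrite subr_eq0 => /eqP E.
by eexists; exact: E.
Qed.

Definition lprod (ls : seq (letter R n)) : S := \prod_(s <- ls) lin (lform s).

Fixpoint nonprop (ls : seq (letter R n)) : Prop :=
  if ls is s :: ls' then
    (forall t, List.In t ls' -> forall c, lform t <> c *: lform s) /\ nonprop ls'
  else True.

Lemma lprod_neq0 ls : lprod ls != 0.
Proof.
rewrite /lprod; elim: ls => [|s ls IH]; first by rewrite big_nil oner_eq0.
by rewrite big_cons mulf_neq0 // linf_neq0.
Qed.

Lemma lprod_homog ls : phom (size ls) (lprod ls).
Proof.
rewrite /lprod; elim: ls => [|s ls IH]; first by rewrite big_nil -(rmorph1 pC) phomC.
by rewrite big_cons -[size _]/(1 + size ls)%N phomM ?phom_lin.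
Qed.

Lemma half_add p : pC 2^-1 * (p + p) = p.
Proof. have -> : p + p = 2 * p by ring.
by rewrite mulrA pC_half2 mul1r. Qed.

Lemma two_inj p : p + p = 0 -> p = 0.
Proof. by move=> E; rewrite -[p]half_add E mulr0. Qed.

Lemma antisym_dvd s p : lact s p = - p -> dvd (lform s) p.
Proof.
move=> E; exists (pC 2^-1 * dem s p).
by rewrite mulrCA demP E opprK half_add.
Qed.

Lemma antisym_lprod ls p : nonprop ls -> (forall s, List.In s ls -> lact s p = - p) ->
  exists q, p = lprod ls * q.
Proof.
elim: ls => [|s ls IH] /= h hp; first by exists p; rewrite /lprod big_nil mul1r.
have [h1 h2] := h; have [|q Eq] := IH h2; first by move=> t ht; apply: hp; right.
have := antisym_dvd (hp s (or_introl erefl)); rewrite Eq => /dvd_prime[]; last first.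
  by move=> [q' Eq']; exists q'; rewrite Eq' /lprod big_cons; ring.
move=> hd; exfalso; elim: ls {IH h hp h2 p Eq} h1 hd => [|t ls IH] h1.
  rewrite /lprod big_nil => /lprojP; rewrite rmorph1 => /eqP.
  by rewrite oner_eq0.
rewrite /lprod big_cons => /dvd_prime[/dvd_lin[c Ec]|]; last first.
  by apply: IH => u hu; apply: h1; right.
by apply: (h1 t (or_introl erefl) c).
Qed.

Lemma lprod_homogK ls d q : phom (size ls + d) (lprod ls * q) -> phom d q.
Proof.
elim: ls => [|s ls IH]; first by rewrite /lprod big_nil mul1r.
rewrite /lprod big_cons -mulrA => /(phom_linK (lform_neq0 s)).
exact: IH.
Qed.

Lemma lprod_homog_lt ls d q : (d < size ls)%N -> phom d (lprod ls * q) -> q = 0.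
Proof.
elim: ls d => [|s ls IH] d //=; rewrite /lprod big_cons -mulrA.
case: d => [_ /phom0C E|d]; last by move=> ld /(phom_linK (lform_neq0 s)); exact: IH.
apply/eqP; move/eqP: E; rewrite rmorphM /= ev_lin mul0r rmorph0.
by rewrite !mulf_eq0 (negbTE (linf_neq0 _ s)) (negbTE (lprod_neq0 ls)).
Qed.

End LinearFactors.

(** * Sums over finite matrix groups *)

Section Antisymmetrizer.
Variables (R : realType) (n : nat) (S : polyring R n).
Implicit Types (p q : S) (g h : 'M[R]_n).

Lemma ev_act g p : ev (act g p) = ev p.
Proof.
elim/polyring_ind: p => [c|u|p q IHp IHq|p q IHp IHq].
- by rewrite actC.
- by rewrite act_lin !ev_lin.
- by rewrite !raddfD /= IHp IHq.
- by rewrite !rmorphM /= IHp IHq.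
Qed.

Record group_list (L : seq 'M[R]_n) : Prop := GroupList {
  gl_uniq : uniq L;
  gl_mul : forall g h, g \in L -> h \in L -> g *m h \in L;
  gl_inv : forall g, g \in L -> exists2 g', g' \in L & g' *m g = 1%:M /\ g *m g' = 1%:M }.

Variable L : seq 'M[R]_n.
Hypothesis HL : group_list L.

Definition asym p : S := \sum_(g <- L) pC (\det g) * act g p.
Definition gsum p : S := \sum_(g <- L) act g p.

Lemma perm_mulr h : h \in L -> perm_eq [seq g *m h | g <- L] L.
Proof.
move=> hL; have [h' h'L [h'h hh']] := gl_inv HL hL.
have uL := gl_uniq HL; apply: uniq_perm => [||g]; last 1 first.
- apply/mapP/idP => [[x xL ->]|gL]; first exact: (gl_mul HL).
  by exists (g *m h'); [exact: (gl_mul HL) | rewrite -mulmxA h'h mulmx1].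
- rewrite map_inj_uniq // => x y /(congr1 (mulmx^~ h')).
  by rewrite -!mulmxA hh' !mulmx1.
- exact: uL.
Qed.

Lemma perm_mull h : h \in L -> perm_eq [seq h *m g | g <- L] L.
Proof.
move=> hL; have [h' h'L [h'h hh']] := gl_inv HL hL.
have uL := gl_uniq HL; apply: uniq_perm => [||g]; last 1 first.
- apply/mapP/idP => [[x xL ->]|gL]; first exact: (gl_mul HL).
  by exists (h' *m g); [exact: (gl_mul HL) | rewrite mulmxA hh' mul1mx].
- rewrite map_inj_uniq // => x y /(congr1 (mulmx h')).
  by rewrite !mulmxA h'h !mul1mx.
- exact: uL.
Qed.

Lemma act_asym h p : h \in L -> pC (\det h) * act h (asym p) = asym p.
Proof.
move=> hL; rewrite /asym -[in RHS](perm_big _ (perm_mulr hL)) big_map (rmorph_sum (act h)) /= mulr_sumr.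
by apply: eq_bigr => g _; rewrite rmorphM /= actC actM det_mulmx rmorphM /=; ring.
Qed.

Lemma asym_act h p : h \in L -> pC (\det h) * asym (act h p) = asym p.
Proof.
move=> hL; rewrite /asym -[in RHS](perm_big _ (perm_mull hL)) big_map mulr_sumr /=.
by apply: eq_bigr => g _; rewrite actM det_mulmx rmorphM /=; ring.
Qed.

Lemma act_gsum h p : h \in L -> act h (gsum p) = gsum p.
Proof.
move=> hL; rewrite /gsum -[in RHS](perm_big _ (perm_mulr hL)) big_map (rmorph_sum (act h)) /=.
by apply: eq_bigr => g _; rewrite actM.
Qed.

Lemma asym0 : asym 0 = 0.
Proof. by rewrite /asym big1 // => g _; rewrite raddf0 mulr0. Qed.

Lemma asymD p q : asym (p + q) = asym p + asym q.
Proof. by rewrite /asym -big_split /=; apply: eq_bigr => g _; rewrite raddfD mulrDr. Qed.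

Lemma asym_sum (T : Type) (r : seq T) (F : T -> S) :
  asym (\sum_(x <- r) F x) = \sum_(x <- r) asym (F x).
Proof. by elim: r => [|x r IH]; rewrite ?big_nil ?asym0 // !big_cons asymD IH. Qed.

Lemma asym_inv p q : (forall g, g \in L -> act g q = q) -> asym (p * q) = asym p * q.
Proof.
move=> hq; rewrite /asym mulr_suml big_seq [RHS]big_seq; apply: eq_bigr => g gL.
by rewrite rmorphM /= hq // mulrA.
Qed.

Lemma asymC c p : asym (pC c * p) = pC c * asym p.
Proof. by rewrite [pC c * p]mulrC asym_inv => [|g _]; [exact: mulrC | exact: actC]. Qed.

Lemma asym_homog d p : phom d p -> phom d (asym p).
Proof.
move=> hp; apply: (big_ind (phom d)) => [||g _]; [exact: phom0 | exact: phomD |].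
exact/phomCM/phom_act.
Qed.

Lemma gsum_homog d p : phom d p -> phom d (gsum p).
Proof.
move=> hp; apply: (big_ind (phom d)) => [||g _]; [exact: phom0 | exact: phomD |].
exact: phom_act.
Qed.

(** The identity det (1 - a f) = 1 - f(a), from two block factorizations of one matrix. *)
Lemma det_lrefl (s : letter R n) : \det (lrefl s) = -1.
Proof.
have E : block_mx (1%:M : 'M_1) 0 (lroot s) 1%:M *m block_mx 1%:M (lform s) 0 (lrefl s) =
  block_mx 1%:M (lform s) 0 1%:M *m block_mx (1%:M - lform s *m lroot s) 0 (lroot s) 1%:M.
  rewrite !mulmx_block !mul1mx !mulmx1 !(mul0mx, mulmx0) ?addr0 ?add0r subrK.
  by rewrite /lrefl /reflection addrC subrK.
have := congr1 determinant E; rewrite !det_mulmx !det_lblock !det_ublock !det1 !mul1r !mulr1 => ->.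
by rewrite pairingE letterP -raddfB /= det_scalar1; ring.
Qed.

Lemma lact_asym s p : lrefl s \in L -> lact s (asym p) = - asym p.
Proof.
by move=> sL; rewrite -[in RHS](act_asym p sL) det_lrefl rmorphN1 mulN1r opprK.
Qed.

Lemma asym_sinv s p : lrefl s \in L -> lact s p = p -> asym p = 0.
Proof.
move=> sL sp; apply: two_inj; rewrite -{1}(asym_act p sL) det_lrefl rmorphN1 mulN1r.
by rewrite -/(lact s p) sp addNr.
Qed.

(* With [x = p * s(q)], the difference of the two sides is the image of [dem s x]. *)
Lemma asym_dem s p q : lrefl s \in L -> asym (dem s p * q) = asym (p * dem s q).
Proof.
move=> sL; have E : dem s p * q = p * dem s q + dem s (p * lact s q).
  apply: (mulfI (linf_neq0 S s)); rewrite mulrDr mulrA demP mulrCA !demP rmorphM /= lactK.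
  by ring.
by rewrite E asymD (asym_sinv sL (lact_dem s _)) addr0.
Qed.

Lemma asym_lprod ls p : nonprop ls -> (forall s, List.In s ls -> lrefl s \in L) ->
  exists q, asym p = lprod S ls * q.
Proof. by move=> h hs; apply: antisym_lprod => // s /hs; exact: lact_asym. Qed.

End Antisymmetrizer.

Section HomogeneousSpan.
Variables (R : realType) (n : nat) (S : polyring R n).

Fixpoint hspan d : seq S :=
  if d is d'.+1 then [seq lin S (delta_mx 0 i) * e | i <- enum 'I_n, e <- hspan d'] else [:: 1].

Lemma hspan_homog d e : e \in hspan d -> phom d e.
Proof.
elim: d e => [|d IH] e /=; first by rewrite inE => /eqP ->; rewrite -(rmorph1 pC) phomC.
move=> /allpairsP[[i f] /= [_ hf ->]]; rewrite -[d.+1]/(1 + d)%N phomM ?phom_lin //.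
exact: IH.
Qed.

Definition insp (E : seq S) p := exists c : S -> R, p = \sum_(e <- E) pC (c e) * e.

Lemma insp0 E : insp E 0.
Proof. by exists (fun _ => 0); rewrite big1 // => e _; rewrite rmorph0 mul0r. Qed.

Lemma inspD E p q : insp E p -> insp E q -> insp E (p + q).
Proof.
move=> [c ->] [c' ->]; exists (fun e => c e + c' e); rewrite -big_split /=.
by apply: eq_bigr => e _; rewrite rmorphD mulrDl.
Qed.

Lemma inspZ E k p : insp E p -> insp E (pC k * p).
Proof.
move=> [c ->]; exists (fun e => k * c e); rewrite mulr_sumr.
by apply: eq_bigr => e _; rewrite rmorphM mulrA.
Qed.

Lemma insp_mem E e : uniq E -> e \in E -> insp E e.
Proof.
move=> uE eE; exists (fun f => (f == e)%:R).
rewrite (bigD1_seq e) //= eqxx rmorph1 mul1r big1 ?addr0 // => f /negbTE ->.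
by rewrite rmorph0 mul0r.
Qed.

Lemma hspanP d p : phom d p -> insp (undup (hspan d)) p.
Proof.
move: d p; apply: (phom_ind (P := fun d p => insp (undup (hspan d)) p)).
- by move=> d; exact: insp0.
- by apply: insp_mem; rewrite ?undup_uniq // mem_undup inE.
- by move=> d c p; exact: inspZ.
- by move=> d p q; exact: inspD.
move=> d p u [c ->]; rewrite mulr_sumr big_seq.
apply: (big_ind (insp _)) => [||e he]; [exact: insp0 | exact: inspD |].
rewrite mulrCA; apply: inspZ; rewrite [u]row_sum_delta raddf_sum mulr_suml /=.
apply: (big_ind (insp _)) => [||i _]; [exact: insp0 | exact: inspD |].
rewrite linZ -mulrA; apply/inspZ/insp_mem; rewrite ?undup_uniq // mem_undup.
apply/allpairsP; exists (i, e); split=> //=; first by rewrite mem_enum.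
by rewrite mem_undup in he.
Qed.

End HomogeneousSpan.

(* The head of the word acts last. *)
Fixpoint dems (R : realType) (n : nat) (S : polyring R n) (v : seq (letter R n)) (p : S) : S :=
  if v is s :: v' then dem s (dems v' p) else p.

(** * The ideal of the invariants and divided differences *)

Section Coinvariants.
Variables (R : realType) (n : nat) (S : polyring R n) (L : seq 'M[R]_n).
Hypothesis HL : group_list L.
Hypothesis L0 : (0 < size L)%N.
Implicit Types (p q x : S).

Definition linv p := forall g, g \in L -> act g p = p.

Definition cideal p := exists2 s : seq (S * S),
  (forall x : S * S, x \in s -> linv x.2 /\ ev x.2 = 0) & p = \sum_(x <- s) x.1 * x.2.

Lemma cideal0 : cideal 0.
Proof. by exists [::]; rewrite ?big_nil. Qed.

Lemma cidealD p q : cideal p -> cideal q -> cideal (p + q).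
Proof.
move=> [s hs ->] [t ht ->]; exists (s ++ t); last by rewrite big_cat.
by move=> x; rewrite mem_cat => /orP[/hs|/ht].
Qed.

Lemma cidealM p q : cideal p -> cideal (p * q).
Proof.
move=> [s hs ->]; exists [seq (z.1 * q, z.2) | z <- s].
  by move=> _ /mapP[x /hs h ->].
by rewrite big_map mulr_suml; apply: eq_bigr => x _ /=; rewrite mulrAC.
Qed.

Lemma cidealMl p q : cideal q -> cideal (p * q).
Proof. by rewrite mulrC; exact: cidealM. Qed.

Lemma cidealN p : cideal p -> cideal (- p).
Proof. by rewrite -mulrN1; exact: cidealM. Qed.

Lemma cidealB p q : cideal p -> cideal q -> cideal (p - q).
Proof. by move=> hp hq; apply: cidealD => //; exact: cidealN. Qed.

Lemma cideal_sum (T : Type) (r : seq T) (P : pred T) (F : T -> S) :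
  (forall i, P i -> cideal (F i)) -> cideal (\sum_(i <- r | P i) F i).
Proof. by move=> h; apply: (big_ind cideal) => //; [exact: cideal0 | exact: cidealD]. Qed.

Lemma cideal_inv p : linv p -> ev p = 0 -> cideal p.
Proof.
move=> h e0; exists [:: (1, p)]; last by rewrite big_seq1 mul1r.
by move=> x; rewrite inE => /eqP ->.
Qed.

Lemma cideal_ev p : cideal p -> ev p = 0.
Proof.
move=> [s hs ->]; rewrite rmorph_sum big_seq big1 //= => x /hs[_ e0].
by rewrite rmorphM /= e0 mulr0.
Qed.

Lemma cideal_act g p : g \in L -> cideal p -> cideal (act g p).
Proof.
move=> gL [s hs ->]; exists [seq (act g z.1, z.2) | z <- s].
  by move=> _ /mapP[x /hs h ->].
rewrite big_map rmorph_sum /= big_seq [RHS]big_seq; apply: eq_bigr => x /hs[h _].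
by rewrite rmorphM /= h.
Qed.

Lemma cideal_dem s p : lrefl s \in L -> cideal p -> cideal (dem s p).
Proof.
move=> sL [r hr ->]; rewrite raddf_sum /= big_seq; apply: cideal_sum => x /hr[h e0].
have sx : lact s x.2 = x.2 by exact: h.
by rewrite demM (dem_inv sx) (avg_inv sx) mulr0 addr0; apply/cidealMl/cideal_inv.
Qed.

Lemma natL_neq0 : (size L)%:R != 0 :> R.
Proof. by rewrite pnatr_eq0 -lt0n. Qed.

Lemma mean_sum p : p = pC (size L)%:R^-1 * \sum_(g <- L) p.
Proof.
rewrite big_const_seq count_predT iter_addr addr0 -[p *+ _]mulr_natl mulrA -(rmorph_nat pC).
by rewrite -rmorphM mulVf ?natL_neq0 // rmorph1 mul1r.
Qed.

(** Modulo the ideal p equals its mean, an invariant without constant term. *)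
Lemma cideal_mean p : ev p = 0 -> (forall g, g \in L -> cideal (act g p - p)) -> cideal p.
Proof.
move=> e0 h; pose c := (size L)%:R^-1 : R.
have -> : p = pC c * gsum L p - pC c * \sum_(g <- L) (act g p - p).
  by rewrite sumrB mulrBr opprB addrCA subrr addr0 -mean_sum.
apply: cidealB; last by apply/cidealMl; rewrite big_seq; exact: cideal_sum.
apply/cidealMl/cideal_inv; first by move=> g gL; rewrite act_gsum.
rewrite rmorph_sum big1 // => g _ /=.
by rewrite ev_act e0.
Qed.

Lemma linv_representative (M : seq 'M[R]_n) d p : group_list M -> (0 < size M)%N ->
  phom d p -> (forall g, g \in M -> cideal (act g p - p)) ->
  exists q, [/\ forall g, g \in M -> act g q = q, phom d q & cideal (p - q)].
Proof.
move=> HM M0 hp h; exists (pC (size M)%:R^-1 * gsum M p); split.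
- by move=> g gM; rewrite rmorphM /= actC act_gsum.
- exact/phomCM/gsum_homog.
have E : p = pC (size M)%:R^-1 * \sum_(g <- M) p.
  rewrite big_const_seq count_predT iter_addr addr0 -[p *+ _]mulr_natl mulrA -(rmorph_nat pC).
  by rewrite -rmorphM mulVf ?rmorph1 ?mul1r // pnatr_eq0 -lt0n.
rewrite {1}E /gsum -mulrBr -sumrB; apply: cidealMl; rewrite big_seq; apply: cideal_sum => g gM.
by rewrite -opprB; apply/cidealN/h.
Qed.

Lemma phom1_lin p : phom 1 p -> exists u, p = lin S u.
Proof.
suff h : forall d q, phom d q -> phom d q /\ (d = 1%N -> exists u, q = lin S u).
  by move=> /h[_]; apply.
apply: (phom_ind (P := fun d p => phom d p /\ (d = 1%N -> exists u, p = lin S u))).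
- by move=> d; split=> [|_]; [exact: phom0 | exists 0; rewrite raddf0].
- by rewrite -(rmorph1 pC); split; first exact: phomC.
- move=> d c q [hp E]; split=> [|/E[u ->]]; first exact: phomCM.
  by exists (c *: u); rewrite linZ.
- move=> d q q' [hp E] [hq E']; split=> [|d1]; first exact: phomD.
  by have [u ->] := E d1; have [v ->] := E' d1; exists (u + v); rewrite raddfD.
move=> d q u [hp _]; split=> [|[d0]]; first by rewrite -add1n phomM ?phom_lin.
rewrite d0 in hp; exists (ev q *: u); rewrite linZ mulrC.
by congr (_ * _); exact: phom0C.
Qed.

Section Descent.
Variables (I : Type) (t : I -> letter R n).
Hypothesis tL : forall i, lrefl (t i) \in L.
Hypothesis tgen : forall g, g \in L -> exists v, g = wprod (map t v).

(** A generator moves p by a multiple of its divided difference, so all translates of p are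
    congruent to p. *)
Lemma cideal_dems p : ev p = 0 -> (forall i, cideal (dem (t i) p)) -> cideal p.
Proof.
move=> e0 h; apply: cideal_mean => // g /tgen[v ->].
elim: v => [|i v IH] /=; first by rewrite act1 subrr; exact: cideal0.
rewrite actM; have -> : act (lrefl (t i)) (act (wprod (map t v)) p) - p =
    lact (t i) (act (wprod (map t v)) p - p) - lin S (lform (t i)) * dem (t i) p.
  by rewrite demP raddfB /= -/(lact (t i) _) -/(lact (t i) _); ring.
by apply: cidealB; [exact: cideal_act | exact: cidealMl].
Qed.

Lemma dems_cat v w p : dems (v ++ w) p = dems v (dems w p).
Proof. by elim: v => //= s v ->. Qed.

Lemma exists_dems d p : phom d p -> ~ cideal p -> exists v, size v = d /\ ev (dems (map t v) p) != 0.
Proof.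
elim: d p => [|d IH] p hp np.
  exists [::]; split=> //=; apply/eqP => e0; apply: np.
  by rewrite (phom0C hp) e0 rmorph0; exact: cideal0.
have [i hi] : exists i, ~ cideal (dem (t i) p).
  apply: contrapT => nex; apply: np; apply: cideal_dems; first exact: (phom_ev hp).
  by move=> i; apply: contrapT => h; apply: nex; exists i.
have [v [sv ev_v]] := IH _ (dem_homog (t i) hp).1 hi.
exists (rcons v i); rewrite size_rcons sv; split=> //.
by rewrite map_rcons -cats1 dems_cat.
Qed.

End Descent.

Lemma dems_homog v e p : phom e p -> phom (e - size v) (dems v p) /\
  ((e < size v)%N -> dems v p = 0).
Proof.
elim: v => [|s v IH] hp /=; first by rewrite subn0.
have [h1 h2] := IH hp; have [h3 h4] := dem_homog s h1; split.
  by rewrite subnS.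
by rewrite ltnS leq_eqVlt => /orP[/eqP E|/h2 ->]; [apply: h4; rewrite E subnn | rewrite raddf0].
Qed.

Lemma asym_dems v p q : (forall s, List.In s v -> lrefl s \in L) ->
  asym L (dems v p * q) = asym L (p * dems (rev v) q).
Proof.
elim: v p q => //= s v IH p q h; rewrite (asym_dem HL); last by apply: h; left.
by rewrite IH => [|t ht]; [rewrite rev_cons -cats1 dems_cat | apply: h; right].
Qed.

End Coinvariants.

(** * Root systems *)

Section Roots.
Variables (R : realType) (n : nat) (Phi : root_system R n).
Local Notation rs := (root_seq Phi).
Local Notation cor := (coroot Phi).
Implicit Types (b x : 'cV[R]_n) (f h : 'rV[R]_n) (g : 'M[R]_n).

Definition rstable g := forall b, b \in rs -> g *m b \in rs.
Definition rrefl b : 'M[R]_n := reflection b (cor b).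

Lemma span_mx0 k (M : 'M[R]_(k, n)) : (forall b, b \in rs -> M *m b = 0) -> M = 0.
Proof.
move=> h; suff h' b : M *m b = 0.
  apply/matrixP => i j; have := congr1 (fun z : 'cV_k => z i 0) (h' (delta_mx j 0)).
  by rewrite -colE !mxE.
have : b \in <<in_tuple rs>>%VS by rewrite (roots_span Phi) memvf.
move/coord_span ->; rewrite mulmx_sumr big1 // => i _.
by rewrite -scalemxAr h ?scaler0 // mem_nth.
Qed.

(* Its powers [1 + k x h] would otherwise give infinitely many roots. *)
Lemma unipotent_trivial x h : pairing h x = 0 -> rstable (1%:M + x *m h) -> x *m h = 0.
Proof.
move=> hx st; apply: span_mx0 => b rb; rewrite -mulmxA pairingE mul_mx_scalar.
apply: contrapT => /eqP nz; set y := _ *: x in nz.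
have hy k : pairing h (b + k%:R *: y) = pairing h b.
  by rewrite pairingDr !pairingZr hx !mulr0 addr0.
have mem k : b + k%:R *: y \in rs.
  elim: k => [|k IH]; first by rewrite scale0r addr0.
  have := st _ IH; rewrite mulmxDl mul1mx -mulmxA pairingE hy mul_mx_scalar -/y.
  by rewrite -addrA -{2}[y]scale1r -scalerDl -natr1.
pose L := [seq b + (k : nat)%:R *: y | k <- iota 0 (size rs).+1].
have U : uniq L.
  rewrite map_inj_uniq ?iota_uniq // => j k /addrI/eqP.
  by rewrite -subr_eq0 -scalerBl scaler_eq0 (negbTE nz) orbF subr_eq0 eqr_nat => /eqP.
suff : (size L <= size rs)%N.
  by rewrite size_map size_iota ltnn.
by apply: uniq_leq_size U _ => _ /mapP[k _ ->].
Qed.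

Lemma rstableM g g' : rstable g -> rstable g' -> rstable (g *m g').
Proof. by move=> sg sh b rb; rewrite -mulmxA; apply/sg/sh. Qed.

Lemma rstable_rrefl b : b \in rs -> rstable (rrefl b).
Proof. by move=> rb c rc; apply: roots_stable. Qed.

Lemma root_neq0 b : b \in rs -> b != 0.
Proof. by move=> rb; apply: contraNneq (roots_neq0 Phi) => <-. Qed.

Lemma col_row_eq0 b h : b != 0 -> b *m h = 0 -> h = 0.
Proof.
move=> nz E; have [i bi] : exists i, b i 0 != 0.
  apply: contrapT => nex; case/eqP: nz; apply/colP => i; rewrite mxE.
  by have [//|bi] := eqVneq (b i 0) 0; case: nex; exists i.
apply/rowP => j; have := congr1 (fun M : 'M_n => M i j) E.
rewrite !mxE big_ord_recl big_ord0 addr0 => /eqP; rewrite mulf_eq0 (negbTE bi) /=.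
by move/eqP.
Qed.

Lemma mul_reflections b f b' f' : reflection b f *m reflection b' f' =
  1%:M - b *m f - b' *m f' + pairing f b' *: (b *m f').
Proof.
rewrite /reflection mulmxBl mul1mx mulmxBr mulmx1 opprB addrA.
have -> : b *m f *m (b' *m f') = pairing f b' *: (b *m f').
  by rewrite -mulmxA (mulmxA f) pairingE mul_scalar_mx -scalemxAr.
move: (b *m f) (b' *m f') (b *m f') => X Y Z.
by apply/matrixP => i j; rewrite !mxE; ring.
Qed.

(** The product of two reflections with the same root is unipotent and preserves the finite set of
    roots, hence is trivial. *)
Lemma coroot_uniq b f : b \in rs -> pairing f b = 2 -> rstable (reflection b f) ->
  f = cor b.
Proof.
move=> rb fb st; suff : cor b - f = 0 by move/subr0_eq.
apply: (col_row_eq0 (root_neq0 rb)).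
apply: unipotent_trivial; first by rewrite pairingDl pairingNl fb coroot_root ?subrr.
suff -> : 1%:M + b *m (cor b - f) = reflection b f *m rrefl b.
  exact: rstableM st (rstable_rrefl rb).
rewrite mul_reflections fb mulmxBr; move: (b *m f) (b *m cor b) => X Y.
by apply/matrixP => i j; rewrite !mxE; ring.
Qed.

Lemma refl_uniq b f b' c : pairing (c *: f) b = 2 -> pairing f b' = 2 ->
  rstable (reflection b (c *: f)) -> rstable (reflection b' f) ->
  reflection b (c *: f) = reflection b' f.
Proof.
move=> fb fb' st st'; have E : (c *: b - b') *m f = 0.
  apply: unipotent_trivial.
    by move: fb; rewrite pairingDr pairingNr pairingZl pairingZr fb' => ->; rewrite subrr.
  suff -> : 1%:M + (c *: b - b') *m f = reflection b (c *: f) *m reflection b' f.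
    exact: rstableM.
  rewrite mul_reflections pairingZl fb' -scalemxAr mulmxBl -scalemxAl.
  move: (b *m f) (b' *m f) => X Y.
  by apply/matrixP => i j; rewrite !mxE; ring.
by rewrite /reflection -scalemxAr; move/eqP: E; rewrite mulmxBl -scalemxAl subr_eq0 => /eqP ->.
Qed.

Lemma coroot_conj g g' b : g' *m g = 1%:M -> g *m g' = 1%:M -> rstable g -> rstable g' ->
  b \in rs -> cor (g *m b) = cor b *m g' /\ rrefl (g *m b) = g *m rrefl b *m g'.
Proof.
move=> g'g gg' sg sg' rb; have E : reflection (g *m b) (cor b *m g') = g *m rrefl b *m g'.
  by rewrite /rrefl /reflection mulmxBr mulmxBl mulmx1 gg' !mulmxA.
have Ec : cor b *m g' = cor (g *m b).
  apply: coroot_uniq; first exact: sg.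
    by rewrite pairing_mul mulmxA g'g mul1mx coroot_root.
  by rewrite E; apply: rstableM sg'; apply: rstableM sg _; exact: rstable_rrefl.
by rewrite /rrefl -Ec.
Qed.

Lemma root_opp b : b \in rs -> - b \in rs.
Proof.
move=> rb; have := rstable_rrefl rb rb.
by rewrite /rrefl reflection_mul coroot_root // scaler_nat mulr2n opprD addrA subrr add0r.
Qed.

Section Base.
Variables (Delta : n.-tuple 'cV[R]_n) (HD : is_base Phi Delta).

Lemma base_root i : tnth Delta i \in rs.
Proof. by have [h _ _] := HD; apply/h/mem_tnth. Qed.

Definition sletter i : letter R n := Letter (coroot_root (base_root i)).
Definition dual i : 'rV[R]_n := \row_j coord Delta i (delta_mx j 0).

Lemma pairing_dual i b : pairing (dual i) b = coord Delta i b.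
Proof.
rewrite [b in RHS](matrix_sum_delta b) linear_sum /= /pairing mxE.
apply: eq_bigr => j _; rewrite big_ord_recl big_ord0 addr0 linearZ /= mxE mulrC.
by [].
Qed.

(** The regular form is the height, the sum of the coordinates in the base. *)
Lemma base_simple_system :
  simple_system sletter (fun b => b \in rs) (\sum_i dual i) dual.
Proof.
have [_ hb hc] := HD; have fr : free Delta := basis_free hb.
have hdual i j : pairing (dual i) (tnth Delta j) = (i == j)%:R.
  by rewrite pairing_dual (tnth_nth 0) coord_free // eq_sym.
have hexp b : b = \sum_i pairing (dual i) b *: tnth Delta i.
  have : b \in <<Delta>>%VS by rewrite (span_basis hb) memvf.
  move/coord_span => {1}->; apply: eq_bigr => i _.
  by rewrite pairing_dual (tnth_nth 0).
have hsum b : pairing (\sum_i dual i) b = \sum_i pairing (dual i) b.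
  by rewrite /pairing mulmx_suml summxE.
have hco (c : 'I_n -> nat) i : pairing (dual i) (\sum_(k < n) (c k)%:R *: tnth Delta k) = (c i)%:R.
  rewrite pairing_sumr (bigD1 i) //= pairingZr hdual eqxx mulr1 big1 ?addr0 // => k.
  by rewrite pairingZr hdual eq_sym => /negbTE ->; rewrite mulr0.
have hsgn b : b \in rs -> exists c : 'I_n -> nat, \sum_i (c i)%:R != 0 :> R /\
    ((forall i, pairing (dual i) b = (c i)%:R) \/ (forall i, pairing (dual i) b = - (c i)%:R)).
  move=> rb; have [c Ec] := hc b rb; exists c; split; last first.
    by case: Ec => ->; [left | right] => i; rewrite ?pairingNr hco.
  apply/eqP => s0; case/eqP: (root_neq0 rb).
  have c0 i : (c i)%:R = 0 :> R.
    have := psumr_eq0P (fun i _ => ler0n R (c i)) s0; exact.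
  by case: Ec => ->; rewrite big1 ?oppr0 // => i _; rewrite c0 scale0r.
split=> //=.
- exact: base_root.
- exact: root_opp.
- by move=> i b rb; apply: (rstable_rrefl (base_root i)).
- by move=> i c; apply: roots_reduced; exact: base_root.
- move=> b /hsgn[c [nz [h|h]]]; rewrite hsum; under eq_bigr do rewrite h; first by [].
  by rewrite sumrN oppr_eq0.
- move=> i b /hsgn[c [nz [h|h]]]; rewrite hsum; first by rewrite h ler0n.
  under eq_bigr do rewrite h; rewrite sumrN oppr_gt0 ltNge sumr_ge0 //.
move=> v i j E; have st u : rstable (wprod (map sletter u)).
  elim: u => [|k u IH] /=; first by move=> b rb; rewrite mul1mx.
  by apply: rstableM IH _; exact: (rstable_rrefl (base_root k)).
have [_] := coroot_conj (W_rev sletter v) (W_revK sletter v) (st _) (st _) (base_root i).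
rewrite -[tnth Delta i]/(lroot (sletter i)) E => Er.
change (lrefl (sletter j)) with (rrefl (lroot (sletter j))); rewrite Er.
by rewrite -!mulmxA W_rev mulmx1.
Qed.

End Base.

(** The rest of the combinatorics is done for an arbitrary simple system, since the
base has to be adapted to the Lefschetz element. *)
Section Group.
Variables (I : finType) (sl : I -> letter R n) (la0 : 'rV[R]_n) (mu : I -> 'rV[R]_n).
Hypothesis H : simple_system sl (fun b => b \in rs) la0 mu.
Local Notation W v := (wprod (map sl v)).
Local Notation a i := (lroot (sl i)).
Implicit Types (i j : I) (v w u : seq I) (P : {pred I}).

Lemma rstable_W v : rstable (W v).
Proof. by move=> b rb; exact: (root_W H). Qed.

Lemma lform_coroot i : lform (sl i) = cor (a i).
Proof.
apply: coroot_uniq; [exact: (ss_root H) | exact: letterP | exact: (ss_stab H)].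
Qed.

Lemma lrefl_rrefl i : lrefl (sl i) = rrefl (a i).
Proof. by rewrite /lrefl lform_coroot. Qed.

Lemma rrefl_W v b : b \in rs -> rrefl (W v *m b) = W v *m rrefl b *m W (rev v).
Proof.
by move=> rb; case: (coroot_conj (W_rev sl v) (W_revK sl v) (rstable_W _) (rstable_W _) rb).
Qed.

Definition inW P g := exists2 v, {subset v <= P} & g = W v.

Lemma inW1 P : inW P 1%:M.
Proof. by exists [::]. Qed.

Lemma inWM P g g' : inW P g -> inW P g' -> inW P (g *m g').
Proof.
move=> [v sv ->] [w sw ->]; exists (w ++ v); last by rewrite W_cat.
by move=> c; rewrite mem_cat => /orP[/sw|/sv].
Qed.

Lemma inW_rev P v : {subset v <= P} -> inW P (W (rev v)).
Proof. by move=> sv; exists (rev v) => // c; rewrite mem_rev => /sv. Qed.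

Lemma inW_simple P i : i \in P -> inW P (lrefl (sl i)).
Proof.
move=> iP; exists [:: i]; last by rewrite /= mul1mx.
by move=> c; rewrite inE => /eqP ->.
Qed.

Lemma inW_inv P g : inW P g -> exists2 g', inW P g' & g' *m g = 1%:M /\ g *m g' = 1%:M.
Proof.
move=> [v sv ->]; exists (W (rev v)); first exact: inW_rev.
by rewrite W_rev W_revK.
Qed.

Lemma inW_sub P g : inW P g -> inW predT g.
Proof. by move=> [v _ ->]; exists v. Qed.

Lemma inW_stable P g : inW P g -> rstable g.
Proof. by move=> [v _ ->]; exact: rstable_W. Qed.

(** Selection by membership of the reflection in the parabolic subgroup fits the hypothesis on l;
    [posP_mu] shows that these roots lie in the span of the simple roots of P. *)
Definition posP P := [seq b <- undup rs | (0 < pairing la0 b) && `[< inW P (rrefl b) >]].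

Lemma mem_posP P b : reflect [/\ b \in rs, 0 < pairing la0 b & inW P (rrefl b)] (b \in posP P).
Proof.
rewrite mem_filter mem_undup; apply: (iffP idP).
  by move=> /andP[/andP[h1 /asboolP h2] h3].
by move=> [-> -> h]; rewrite andbT; exact/asboolP.
Qed.

Lemma uniq_posP P : uniq (posP P).
Proof. by rewrite filter_uniq // undup_uniq. Qed.

Lemma simple_posP P i : i \in P -> a i \in posP P.
Proof.
move=> iP; apply/mem_posP; split; [exact: (ss_root H) | exact: (ht_simple H) |].
by rewrite -lrefl_rrefl; exact: inW_simple.
Qed.

Lemma posP_simple P i b : i \in P -> b \in posP P -> b != a i ->
  lrefl (sl i) *m b \in posP P /\ lrefl (sl i) *m b != a i.
Proof.
move=> iP /mem_posP[rb pb wb] /eqP ne; split.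
  apply/mem_posP; split; [exact: (ss_stab H) | exact: (pos_perm H) |].
  have := rrefl_W [:: i] rb; rewrite /= !mul1mx => ->.
  by apply: inWM; [apply: inWM => // | ]; exact: inW_simple.
apply/eqP => E; have : lrefl (sl i) *m (lrefl (sl i) *m b) = - a i.
  by rewrite E refl_simple.
rewrite mulmxA lreflK mul1mx => Eb; move: pb; rewrite Eb pairingNr oppr_gt0.
by rewrite ltNge ltW // (ht_simple H).
Qed.

Definition cnt P (la : 'rV[R]_n) v := count (fun b => pairing la (W v *m b) < 0) (posP P).

Lemma posP_perm P i : i \in P -> exists Q, perm_eq (posP P) (a i :: Q) /\
  perm_eq [seq lrefl (sl i) *m b | b <- Q] Q.
Proof.
move=> iP; pose Q := [seq b <- posP P | b != a i]; exists Q; split.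
  apply: uniq_perm; first exact: uniq_posP.
    by rewrite /= filter_uniq ?uniq_posP // mem_filter eqxx.
  move=> b; rewrite inE [_ \in Q]mem_filter; have [->|_ //] := eqVneq b (a i).
  by rewrite simple_posP.
have inj : injective (mulmx (lrefl (sl i)) : 'cV_n -> 'cV_n).
  by apply: (can_inj (g := mulmx (lrefl (sl i)))) => b; rewrite mulmxA lreflK mul1mx.
have st b : b \in Q -> lrefl (sl i) *m b \in Q.
  rewrite ![_ \in Q]mem_filter => /andP[ne hb]; apply/andP.
  by have [] := posP_simple iP hb ne.
have uQ : uniq Q by rewrite filter_uniq ?uniq_posP.
apply: uniq_perm; rewrite ?map_inj_uniq // => b.
apply/mapP/idP => [[c hc ->]|hb]; first exact: st.
by exists (lrefl (sl i) *m b); [exact: st | rewrite mulmxA lreflK mul1mx].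
Qed.

Lemma cnt_cons P la i v : i \in P ->
  (cnt P la (i :: v) + (pairing la (W v *m a i) < 0)%R)%N =
  (cnt P la v + (0 < pairing la (W v *m a i))%R)%N.
Proof.
move=> /posP_perm[Q [pm pQ]]; rewrite /cnt.
have Ec : count (fun b => pairing la (W (i :: v) *m b) < 0) Q =
    count (fun b => pairing la (W v *m b) < 0) Q.
  by rewrite -[in RHS](permP pQ) count_map; apply: eq_count => b /=; rewrite -mulmxA.
rewrite !(permP pm) [count _ _]/= [count _ (_ :: _)]/= Ec.
by rewrite -(mulmxA (W v)) refl_simple mulmxN pairingNr oppr_lt0 addnC addnA addnAC.
Qed.

(** As long as some simple root of P has negative value, one more reflection lowers the number of
    positive roots with negative value. *)
Lemma dominant P la : exists2 v, {subset v <= P} &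
  forall i, i \in P -> 0 <= pairing la (W v *m a i).
Proof.
suff h k v : {subset v <= P} -> cnt P la v = k -> exists2 w, {subset w <= P} &
    forall i, i \in P -> 0 <= pairing la (W w *m a i).
  by apply: (h _ [::]).
elim/ltn_ind: k v => k IH v sv Ek.
have [h|h] := pselect (forall i, i \in P -> 0 <= pairing la (W v *m a i)); first by exists v.
have [i iP] : exists2 i, i \in P & pairing la (W v *m a i) < 0.
  apply: contrapT => nex; apply: h => i iP; rewrite leNgt; apply/negP => lt.
  by apply: nex; exists i.
move=> lt; have := cnt_cons la v iP; rewrite lt (ltNge 0) ltW //= addn0 addn1 => E.
apply: (IH _ _ (i :: v)); last exact: erefl.
  by rewrite -Ek -E.
by move=> c; rewrite inE => /orP[/eqP ->|/sv].
Qed.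

Lemma longest P : exists2 v, {subset v <= P} &
  forall i, i \in P -> pairing la0 (W v *m a i) < 0.
Proof.
have [v sv h] := dominant P (- la0); exists v => // i iP.
apply: (not_pos H) (root_kap H v i) _; apply/negP; rewrite -leNgt.
by have := h i iP; rewrite pairingNl oppr_ge0.
Qed.

Lemma expand_neg P v b : (forall i, i \in P -> pairing la0 (W v *m a i) < 0) ->
  b \in rs -> 0 < pairing la0 b -> (forall i, i \notin P -> pairing (mu i) b = 0) ->
  pairing la0 (W v *m b) < 0.
Proof.
move=> hv rb pb h0; apply: (not_pos H) (root_W H v rb) _; apply/negP; rewrite -leNgt.
rewrite [b](ss_exp H) mulmx_sumr pairing_sumr; apply: sumr_le0 => i _.
rewrite -scalemxAr pairingZr; have [iP|iP] := boolP (i \in P); last by rewrite h0 ?mul0r.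
by rewrite mulr_ge0_le0 // ?(ss_pos H) // ltW // hv.
Qed.

Lemma posP_mu P b i : b \in posP P -> i \notin P -> pairing (mu i) b = 0.
Proof.
move=> /mem_posP[rb _ [v sv Ev]] iP; have := mu_W H sv iP; rewrite -Ev /rrefl mul_reflection.
move/eqP; rewrite -subr_eq0 addrAC subrr add0r oppr_eq0 scaler_eq0 => /orP[/eqP //|/eqP c0].
have := coroot_root rb; rewrite c0 /pairing mul0mx mxE => /eqP.
by rewrite eq_sym pnatr_eq0.
Qed.

Lemma size_good P v : {subset v <= P} -> goodword la0 (map sl v) -> size v = cnt P la0 v.
Proof.
elim: v => [|i v IH] sv /=.
  move=> _; apply/esym/eqP; rewrite -leqn0 leqNgt -has_count; apply/hasP => -[b].
  by move=> /mem_posP[_ pb _]; rewrite mul1mx ltNge ltW.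
move=> [gv]; rewrite kapE => kv.
have iP : i \in P by apply: sv; exact: mem_head.
have := cnt_cons la0 v iP; rewrite kv (ltNge _ 0) ltW //= addn0 addn1 => ->.
by rewrite IH // => c cv; apply: sv; rewrite inE cv orbT.
Qed.

(** A longest word makes every positive root negative, and by [sign_flip] the root passes through a
    simple one on the way. *)
Lemma exists_root_word b : b \in rs -> exists v i, b = W v *m a i.
Proof.
have pos c : c \in rs -> 0 < pairing la0 c -> exists v i, c = W v *m a i.
  move=> rc pc; have [v _ hv] := longest predT.
  have lt : pairing la0 (W v *m c) < 0 by apply: (expand_neg hv rc pc) => i; rewrite inE.
  have [x [y [i [_ E]]]] := sign_flip H rc pc lt.
  by exists (rev x), i; rewrite -E mulmxA W_rev mul1mx.
move=> rb; have [p|/(not_pos H rb) n0] := pselect (0 < pairing la0 b); first exact: pos.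
have [||v [i E]] := pos (- b); [exact: root_opp | by rewrite pairingNr oppr_gt0 |].
by exists (i :: v), i; rewrite W_cons_self -E opprK.
Qed.

Lemma rrefl_inW b : b \in rs -> inW predT (rrefl b).
Proof.
move=> /exists_root_word[v [i ->]]; rewrite rrefl_W; last exact: (ss_root H).
apply: inWM; last exact: inW_rev.
by apply: inWM; [exists v | rewrite -lrefl_rrefl; exact: inW_simple].
Qed.

Lemma weyl_inW g : weyl_group Phi g <-> inW predT g.
Proof.
split=> [|[v _ ->]].
  elim=> [_ [b rb <-]||x y _ hx _ hy|x _ /inW_inv[y wy [yx xy]]].
  - exact: rrefl_inW.
  - exact: inW1.
  - exact: inWM.
  - suff -> : invmx x = y by [].
    have [ux _] := mulmx1_unit xy.
    by rewrite -[LHS]mulmx1 -xy mulmxA mulVmx // mul1mx.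
elim: v => [|i v IH] /=; first exact: generated_1.
apply: generated_mul => //; apply: generated_in; exists (a i); first exact: (ss_root H).
by rewrite lrefl_rrefl.
Qed.

Lemma finite_inW P : exists2 L : seq 'M[R]_n, uniq L & forall g, g \in L <-> inW P g.
Proof.
pose fix L k := if k is k'.+1 then
  L k' ++ [seq g *m lrefl (sl i) | g <- L k', i <- enum P] else [:: 1%:M].
have LP k g : g \in L k <-> exists2 v, {subset v <= P} & (size v <= k)%N /\ g = W v.
  elim: k g => [|k IH] g /=.
    rewrite inE; split=> [/eqP ->|[v _ []]]; first by exists [::].
    by rewrite leqn0 size_eq0 => /eqP -> ->; apply/eqP.
  rewrite mem_cat; split=> [/orP[/IH[v sv [lv ->]]|/allpairsP[[h i] /= [/IH[v sv [lv ->]] hi ->]]]|].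
  - by exists v => //; split=> //; exact: leqW.
  - exists (i :: v); last by [].
    by move=> c; rewrite inE => /orP[/eqP ->|/sv //]; rewrite mem_enum in hi.
  move=> [v sv [lv ->]]; have [lk|lk] := leqP (size v) k.
    by apply/orP; left; apply/IH; exists v.
  case: v sv lv lk => [//|i v] sv lv lk; apply/orP; right; apply/allpairsP.
  exists (W v, i); split=> //=; last by rewrite mem_enum; apply: sv; exact: mem_head.
  by apply/IH; exists v => // c cv; apply: sv; rewrite inE cv orbT.
exists (undup (L (size (posP P)))); first exact: undup_uniq.
move=> g; rewrite mem_undup; split=> [/LP[v sv [_ ->]]|[v sv ->]]; first by exists v.
have [w sw [gw Ew]] := exists_good H v; have sw' : {subset w <= P} by move=> c /sw /sv.
apply/LP; exists w => //; split=> //.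
by rewrite (size_good sw' gw) count_size.
Qed.

Lemma mulmx_big v : \big[mulmx/1%:M]_(i <- v) lrefl (sl i) = W (rev v).
Proof.
elim: v => [|i v IH]; first by rewrite big_nil.
by rewrite big_cons rev_cons -cats1 W_cat /= mul1mx IH.
Qed.

Section Lengths.
Variables (P : {pred I}) (gen : set 'M[R]_n).
Hypothesis genP : forall g, gen g <-> exists2 i, i \in P & lrefl (sl i) = g.

Lemma is_word_lengthP g k :
  is_word_length gen g k <-> exists2 v, {subset v <= P} & size v = k /\ W v = g.
Proof.
split=> [[s [hs <- <-]]|[v sv [<- <-]]].
  have [v sv Ev] : exists2 v, {subset v <= P} & s = [seq lrefl (sl i) | i <- v].
    elim: s hs => [|x s IH] hs; first by exists [::].
    have [|v sv ->] := IH; first by move=> y ys; apply: hs; rewrite inE ys orbT.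
    have /genP[i iP <-] : gen x by apply: hs; exact: mem_head.
    by exists (i :: v) => // c; rewrite inE => /orP[/eqP ->|/sv].
  exists (rev v); first by move=> c; rewrite mem_rev => /sv.
  by rewrite Ev big_map mulmx_big size_rev size_map.
exists [seq lrefl (sl i) | i <- rev v]; split.
- by move=> x /mapP[i]; rewrite mem_rev => iv ->; apply/genP; exists i => //; exact: sv.
- by rewrite size_map size_rev.
- by rewrite big_map mulmx_big revK.
Qed.

Lemma word_length_good v : {subset v <= P} -> goodword la0 (map sl v) ->
  word_length gen (W v) = size v.
Proof.
move=> sv gv; have h : is_word_length gen (W v) (size v).
  by apply/is_word_lengthP; exists v.
have hm (j : nat) : is_word_length gen (W v) j -> (size v <= j)%N.
  by move=> /is_word_lengthP[w _ [<- Ew]]; apply: (good_min H gv).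
apply: xget_unique; first by split.
move=> j [hj mj]; apply/eqP; rewrite eqn_leq; apply/andP; split; [exact: mj | exact: hm].
Qed.

Lemma longest_length_posP (G : set 'M[R]_n) : (forall g, G g <-> inW P g) ->
  longest_length G gen = size (posP P).
Proof.
move=> GP; have len g : inW P g -> exists w, [/\ {subset w <= P}, g = W w,
    word_length gen g = size w & size w = cnt P la0 w].
  move=> [v sv ->]; have [w sw [gw Ew]] := exists_good H v.
  have sw' : {subset w <= P} by move=> c /sw /sv.
  by exists w; split=> //; [rewrite -Ew word_length_good | exact: size_good].
have [v sv hv] := longest P.
have [w [sw Ew lw cw]] : exists w, _ := len (W v) (ex_intro2 _ _ v sv erefl).
have full : cnt P la0 w = size (posP P).
  apply/eqP; rewrite /cnt -all_count; apply/allP => b hb; rewrite -Ew.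
  have [rb pb _] := mem_posP P b hb; apply: expand_neg hv rb pb _ => i; exact: posP_mu.
apply: xget_unique.
  split; first by exists (W v); [apply/GP; exists v | rewrite lw cw full].
  by move=> g /GP/len[u [_ _ -> ->]]; exact: count_size.
move=> k [[g /GP/len[u [_ _ Eg cu]] <-] mk]; apply/eqP; rewrite eqn_leq; apply/andP; split.
  by rewrite Eg cu count_size.
by rewrite -full -cw -lw; apply: mk; apply/GP; exists v.
Qed.

End Lengths.

(** Conjugating the simple system makes the Lefschetz form dominant without touching the form, the
    group or A. *)
Lemma conj_system v : exists sl' : I -> letter R n, exists la0' mu',
  [/\ simple_system sl' (fun b => b \in rs) la0' mu',
    (forall i, lroot (sl' i) = W v *m a i),
    (forall i, lrefl (sl' i) = W v *m lrefl (sl i) *m W (rev v)) &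
    (forall w, wprod (map sl' w) = W v *m W w *m W (rev v))].
Proof.
set g := W v; set g' := W (rev v).
have g'g : g' *m g = 1%:M by exact: W_rev.
have gg' : g *m g' = 1%:M by exact: W_revK.
have ra i : g *m a i \in rs by exact: (root_kap H).
pose sl' i := Letter (coroot_root (ra i)).
have Er i : lrefl (sl' i) = g *m lrefl (sl i) *m g'.
  by rewrite lrefl_rrefl -(rrefl_W v (ss_root H i)).
have Ew w : wprod (map sl' w) = g *m W w *m g'.
  elim: w => [|i w IH] /=; first by rewrite mulmx1 gg'.
  by rewrite IH Er !mulmxA -(mulmxA _ g') g'g mulmx1.
have rg' b : b \in rs -> g' *m b \in rs by exact: rstable_W.
exists sl', (la0 *m g'), (fun i => mu i *m g'); split=> //.
split=> //.
- exact: root_opp.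
- by move=> i b rb; apply: (rstable_rrefl (ra i)).
- by move=> i c h; exact: (roots_reduced (ra i) h).
- by move=> i j; rewrite pairing_mul /= mulmxA g'g mul1mx (ss_dual H).
- move=> b; rewrite -[LHS]mul1mx -gg' -mulmxA {1}[g' *m b](ss_exp H) mulmx_sumr.
  by apply: eq_bigr => i _; rewrite -scalemxAr pairing_mul.
- by move=> b rb; rewrite pairing_mul (ss_ht H) // rg'.
- by move=> i b rb; rewrite !pairing_mul; apply: (ss_pos H); exact: rg'.
move=> w i j; rewrite !Ew !Er /= !mulmxA -(mulmxA _ g' g) g'g mulmx1 => E.
have {}E : W w *m a i = a j.
  by have := congr1 (mulmx g') E; rewrite !mulmxA g'g !mul1mx.
rewrite -!(mulmxA _ g' g) g'g !mulmx1.
by rewrite -(mulmxA g) (ss_conj H E) !mulmxA.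
Qed.

(** Proportional coroots give the same reflection by [refl_uniq], hence proportional roots;
    reducedness and positivity finish. *)
Lemma pos_form_inj b b' c : b \in rs -> b' \in rs -> 0 < pairing la0 b -> 0 < pairing la0 b' ->
  cor b' = c *: cor b -> b = b'.
Proof.
move=> rb rb' pb pb' E; have st := rstable_rrefl rb; have st' := rstable_rrefl rb'.
rewrite /rrefl E in st'; have /eqP : reflection b' (c *: cor b) = reflection b (cor b).
  by apply: (refl_uniq _ _ st' st); rewrite -?E coroot_root.
rewrite /reflection -scalemxAr.
rewrite (inj_eq (addrI _)) eqr_opp -subr_eq0 scalemxAl -mulmxBl => /eqP E0.
have Eb : c *: b' = b.
  apply/eqP; rewrite -subr_eq0; apply/eqP; apply: contrapT => /eqP nz.
  have := coroot_root rb; rewrite (col_row_eq0 nz E0) /pairing mul0mx mxE => /eqP.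
  by rewrite eq_sym pnatr_eq0.
have := rb; rewrite -Eb => /(roots_reduced rb')[] c1; rewrite c1 ?scale1r // in Eb *.
by move: pb; rewrite -Eb pairingZr mulN1r oppr_gt0 ltNge ltW.
Qed.

Lemma posP_letters P : exists ls : seq (letter R n), [/\ size ls = size (posP P),
  (forall s, List.In s ls -> lroot s \in posP P /\ lform s = cor (lroot s)), nonprop ls &
  forall S : polyring R n, lprod S ls = \prod_(b <- posP P) lin S (cor b)].
Proof.
suff h (bs : seq 'cV[R]_n) : uniq bs -> {subset bs <= posP P} ->
    exists ls : seq (letter R n), [/\ size ls = size bs,
      (forall s, List.In s ls -> lroot s \in bs /\ lform s = cor (lroot s)), nonprop ls &
      forall S : polyring R n, lprod S ls = \prod_(b <- bs) lin S (cor b)].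
  by apply: h => //; exact: uniq_posP.
elim: bs => [_ _|b bs IH /= /andP[bbs ubs] sb].
  by exists [::]; split=> // S; rewrite /lprod !big_nil.
have [|ls [sz hls np Els]] := IH ubs; first by move=> c cs; apply: sb; rewrite inE cs orbT.
have [rb pb wb] := mem_posP P b (sb b (mem_head _ _)).
exists (Letter (coroot_root rb) :: ls); split=> [|s|/=|S].
- by rewrite /= sz.
- move=> /= [<-|/hls[hs ->]]; first by rewrite mem_head.
  by rewrite inE hs orbT.
- split=> // t /hls[ht ->] c E; have hb : lroot t \in posP P by apply: sb; rewrite inE ht orbT.
  have [rt pt _] := mem_posP P _ hb.
  by move: bbs; rewrite (pos_form_inj rb rt pb pt E) ht.
- by rewrite /lprod !big_cons; congr (_ * _); exact: Els.
Qed.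

Lemma lact_prod_posP (S : polyring R n) P i : i \in P ->
  lact (sl i) (\prod_(b <- posP P) lin S (cor b)) = - \prod_(b <- posP P) lin S (cor b).
Proof.
move=> iP; have [Q [pm pQ]] := posP_perm iP; rewrite !(perm_big _ pm) !big_cons rmorphM /=.
rewrite -lform_coroot lact_lform mulNr; congr (- (_ * _)).
rewrite -[in RHS](perm_big _ pQ) big_map rmorph_prod /= big_seq [RHS]big_seq.
apply: eq_bigr => b bQ; have [rb _ _] : [/\ b \in rs, 0 < pairing la0 b & inW P (rrefl b)].
  by apply/mem_posP; rewrite (perm_mem pm) inE bQ orbT.
have ss : lrefl (sl i) *m lrefl (sl i) = 1%:M by exact: lreflK.
have st : rstable (lrefl (sl i)) by move=> c; exact: (ss_stab H).
by have [-> _] := coroot_conj ss ss st st rb; rewrite /lact act_lin.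
Qed.

Lemma prod_posP_antisym (S : polyring R n) P g : inW P g ->
  pC (\det g) * act g (\prod_(b <- posP P) lin S (cor b)) = \prod_(b <- posP P) lin S (cor b).
Proof.
move=> [v sv ->]; elim: v sv => [|i v IH] sv /=; first by rewrite det1 rmorph1 mul1r act1.
rewrite det_mulmx det_lrefl actM mulrN1 rmorphN.
rewrite -[in RHS]IH; last by move=> c cv; apply: sv; rewrite inE cv orbT.
have E := lact_prod_posP S (sv i (mem_head _ _)); rewrite /lact in E.
have E2 : act (lrefl (sl i)) (pC (\det (W v)) * act (W v) (\prod_(b <- posP P) lin S (cor b))) =
    - \prod_(b <- posP P) lin S (cor b).
  by rewrite IH ?E // => c cv; apply: sv; rewrite inE cv orbT.
move: E2; rewrite rmorphM /= actC mulNr => ->; rewrite opprK IH // => c cv.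
by apply: sv; rewrite inE cv orbT.
Qed.

Lemma group_list_inW P L : uniq L -> (forall g, g \in L <-> inW P g) -> group_list L.
Proof.
move=> uL hL; split=> // [g h /hL hg /hL hh|g /hL/inW_inv[g' /hL hg' E]].
  by apply/hL; exact: inWM.
by exists g'.
Qed.

End Group.
End Roots.

(** * Duality and the Lefschetz property *)

Section Duality.
Variables (R : realType) (n : nat) (S : polyring R n) (L LP : seq 'M[R]_n).
Hypotheses (HL : group_list L) (HLP : group_list LP) (LPL : {subset LP <= L}).
Hypotheses (L1 : 1%:M \in L) (LP1 : 1%:M \in LP).
Variables (ls lsP : seq (letter R n)).
Hypotheses (npL : nonprop ls) (npP : nonprop lsP).
Hypothesis lsL : forall s, List.In s ls -> lrefl s \in L.
Hypothesis lsLP : forall s, List.In s lsP -> lrefl s \in LP.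
Hypothesis szP : (size lsP <= size ls)%N.
Local Notation D := (lprod S ls).
Local Notation DP := (lprod S lsP).
Hypothesis D_anti : forall g, g \in L -> pC (\det g) * act g D = D.
Hypothesis DP_anti : forall g, g \in LP -> pC (\det g) * act g DP = DP.
Variables (I : Type) (t : I -> letter R n).
Hypothesis tL : forall i, lrefl (t i) \in L.
Hypothesis tgen : forall g, g \in L -> exists v, g = wprod (map t v).
Local Notation N := (size ls).
Local Notation NP := (size lsP).
Local Notation cideal := (@cideal R n S L).
Local Notation G := (asym L).
Local Notation A := (@linv R n S LP).
Implicit Types (p q x y : S).

Lemma size_gt0 (M : seq 'M[R]_n) : 1%:M \in M -> (0 < size M)%N.
Proof. by case: M. Qed.
Let L0 := size_gt0 L1.

Lemma pC_inj c (p : S) : c != 0 -> pC c * p = 0 -> p = 0.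
Proof.
move=> c0 /(congr1 (fun z => pC c^-1 * z)); rewrite mulrA -rmorphM mulVf // rmorph1 mul1r.
by rewrite mulr0.
Qed.

Lemma asym_D : G D = pC (size L)%:R * D.
Proof.
rewrite /asym big_seq (eq_bigr (fun _ => D)) => [|g gL]; last exact: D_anti.
by rewrite -big_seq big_const_seq count_predT iter_addr addr0 rmorph_nat mulr_natl.
Qed.

(** G is linear over invariants and its values are divisible by D, so G x = D z with z(0) = 0; in
    degree N the factor z is a constant. *)
Lemma asym_cideal x : phom N x -> cideal x -> G x = 0.
Proof.
move=> hx [s hs Ex]; suff [z Ez e0] : exists2 z, G x = D * z & ev z = 0.
  have := asym_homog L hx; rewrite Ez -[N]addn0 => /lprod_homogK/phom0C.
  by rewrite e0 rmorph0 => ->; rewrite mulr0.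
rewrite Ex (asym_sum L) => {x hx Ex}; elim: s hs => [|x s IH] hs.
  by exists 0; rewrite ?big_nil ?mulr0 ?rmorph0.
have [|z Ez ez] := IH; first by move=> y ys; apply: hs; rewrite inE ys orbT.
have [hx ex] := hs x (mem_head _ _); have [q Eq] := asym_lprod HL x.1 npL lsL.
exists (q * x.2 + z); last by rewrite rmorphD rmorphM /= ex ez mulr0 addr0.
by rewrite big_cons Ez (asym_inv _ hx) Eq mulrDr mulrA.
Qed.

Lemma asym_top y : phom N y -> exists c, G y = pC c * D.
Proof.
move=> hy; have [z Ez] := asym_lprod HL y npL lsL.
have := asym_homog L hy; rewrite Ez -[N]addn0 => /lprod_homogK/phom0C Ez'.
by exists (ev z); rewrite {1}Ez' mulrC.
Qed.

(** Divided differences are self-adjoint for G. A sequence of them that takes p to a nonzero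
    constant, applied to D in reverse order, gives the dual element. *)
Lemma duality d p : phom d p -> ~ cideal p ->
  exists q, [/\ (d <= N)%N, phom (N - d) q & G (p * q) != 0].
Proof.
move=> hp np; have [v [sv ev_v]] := exists_dems HL L0 tL tgen hp np.
have [hv _] := dems_homog (map t v) hp; rewrite size_map sv subnn in hv.
have [hq hq0] := dems_homog (rev (map t v)) (lprod_homog S ls).
rewrite size_rev size_map sv in hq hq0.
have tv s : List.In s (map t v) -> lrefl s \in L.
  by elim: (v) => //= i w IH [<-|/IH].
have E : G (p * dems (rev (map t v)) D) = pC (ev (dems (map t v) p) * (size L)%:R) * D.
  by rewrite -(asym_dems HL _ _ tv) (phom0C hv) asymC // asym_D rmorphM /= evC mulrA.
have nz : G (p * dems (rev (map t v)) D) != 0.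
  rewrite E mulf_neq0 ?lprod_neq0 // fmorph_eq0 mulf_neq0 //.
  by rewrite pnatr_eq0 -lt0n.
exists (dems (rev (map t v)) D); split=> //.
rewrite leqNgt; apply/negP => lt; case/eqP: nz.
by rewrite hq0 // mulr0 asym0.
Qed.

Lemma asym_asym (M : seq 'M[R]_n) p : {subset M <= L} ->
  G (asym M p) = pC (size M)%:R * G p.
Proof.
move=> ML; rewrite {2}/asym asym_sum.
rewrite big_seq (eq_bigr (fun _ => G p)) => [|g gM]; last by rewrite asymC // asym_act // ML.
by rewrite -big_seq big_const_seq count_predT iter_addr addr0 rmorph_nat mulr_natl.
Qed.

(** As p is invariant, antisymmetrizing its dual over the parabolic group only multiplies the
    pairing by the order of that group; the result is DP times an invariant q. *)
Lemma duality_inv d p : A p -> phom d p -> ~ cideal p ->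
  exists q, [/\ (d <= N - NP)%N, A q, phom (N - NP - d) q & G (p * q * DP) != 0].
Proof.
move=> Ap hp np; have [q0 [dN hq0 nz]] := duality hp np.
have [q Eq] := asym_lprod HLP q0 npP lsLP.
have nz' : G (p * q * DP) != 0.
  apply: contraNneq nz => E; apply/eqP.
  apply: (@pC_inj (size LP)%:R); first by rewrite pnatr_eq0 -lt0n size_gt0.
  rewrite -asym_asym // (mulrC p) (asym_inv _ Ap) Eq.
  by rewrite -E; congr (G _); ring.
have hDq : phom (N - d) (DP * q) by rewrite -Eq; exact: asym_homog.
have le : (NP <= N - d)%N.
  rewrite leqNgt; apply/negP => lt; case/eqP: nz'.
  by rewrite (lprod_homog_lt lt hDq) mulr0 mul0r asym0.
have dle : (d <= N - NP)%N by lia.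
exists q; split=> //.
  move=> g gLP; apply: (mulfI (lprod_neq0 S lsP)).
  rewrite -[RHS]Eq -(act_asym HLP q0 gLP) Eq rmorphM /= mulrA.
  by rewrite DP_anti.
by apply: (@lprod_homogK _ _ _ lsP); rewrite (_ : _ + _ = N - d)%N //; lia.
Qed.

Lemma top_inv x : A x -> phom (N - NP) x -> G (x * DP) = 0 -> cideal x.
Proof.
move=> Ax hx E; apply: contrapT => nx; have [q [_ _]] := duality_inv Ax hx nx.
rewrite subnn => /phom0C ->; rewrite (_ : x * _ * DP = pC (ev q) * (x * DP)); last by ring.
by rewrite asymC // E mulr0 eqxx.
Qed.

Lemma top_cideal x : phom (N - NP) x -> cideal x -> G (x * DP) = 0.
Proof.
move=> hx Jx; apply: asym_cideal; last exact: cidealM.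
by rewrite -{1}(subnK szP); apply: phomM => //; exact: lprod_homog.
Qed.

Lemma one_notin_cideal : ~ cideal 1.
Proof. by move=> /cideal_ev/eqP; rewrite rmorph1 oner_eq0. Qed.

Lemma exists_top : exists f, [/\ A f, phom (N - NP) f, ~ cideal f & G (f * DP) != 0].
Proof.
have A1 : A 1 by move=> g _; rewrite rmorph1.
have h1 : phom 0 (1 : S) by rewrite -(rmorph1 pC) phomC.
have [q [_ Aq hq nz]] := duality_inv A1 h1 one_notin_cideal.
rewrite subn0 in hq; rewrite mul1r in nz; exists q; split=> // Jq.
by move: nz; rewrite top_cideal ?eqxx.
Qed.

Lemma top_multiple f x : A f -> phom (N - NP) f -> G (f * DP) != 0 ->
  A x -> phom (N - NP) x -> exists c, cideal (x - pC c * f).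
Proof.
move=> Af hf nz Ax hx.
have hD y : phom (N - NP) y -> phom N (y * DP).
  by move=> hy; rewrite -{1}(subnK szP); apply: phomM => //; exact: lprod_homog.
have [a Ea] := asym_top (hD _ hf); have [b Eb] := asym_top (hD _ hx).
have a0 : a != 0 by apply: contraNneq nz => a0; rewrite Ea a0 rmorph0 mul0r.
pose c := b / a; exists c; apply: top_inv.
- by move=> g gL; rewrite rmorphB rmorphM /= actC Af // Ax.
- apply: phomD => //; rewrite -mulNr -rmorphN; exact: phomCM.
- rewrite (_ : _ * DP = x * DP + pC (- c) * (f * DP)); last by rewrite rmorphN; ring.
  by rewrite asymD asymC // Eb Ea mulrA -rmorphM -mulrDl -rmorphD mulNr divfK // subrr
    rmorph0 mul0r.
Qed.

Lemma linvM p q : A p -> A q -> A (p * q).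
Proof. by move=> hp hq g gL; rewrite rmorphM /= hp // hq. Qed.

Lemma linvX p k : A p -> A (p ^+ k).
Proof. by move=> hp g gL; rewrite rmorphXn /= hp. Qed.

(* The element [x] is fixed by the group generated by [LP] and [M], over which the
antisymmetrization of [DP] has too many linear factors for its degree. *)
Lemma asym_fixed (M : seq 'M[R]_n) s x : group_list M -> 1%:M \in M -> {subset M <= L} ->
  {subset LP <= M} -> nonprop (s :: lsP) -> lrefl s \in M ->
  (forall g, g \in M -> act g x = x) -> G (x * DP) = 0.
Proof.
move=> HM M1 ML LPM np sM hx; have [q Eq] : exists q, asym M DP = lprod S (s :: lsP) * q.
  by apply: asym_lprod => // u /= [<- //|/lsLP/LPM].
apply: (@pC_inj (size M)%:R); first by rewrite pnatr_eq0 -lt0n size_gt0.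
rewrite -asym_asym // mulrC asym_inv // Eq.
have := asym_homog M (lprod_homog S lsP); rewrite Eq => /lprod_homog_lt -> //.
by rewrite mulr0 mul0r asym0.
Qed.

Lemma linv_span d : exists E : seq S, (forall e, e \in E -> A e /\ phom d e) /\
  forall p, A p -> phom d p -> insp E p.
Proof.
pose m e : S := pC (size LP)%:R^-1 * gsum LP e.
have mh e : phom d e -> phom d (m e) by move=> he; exact/phomCM/gsum_homog.
exists (undup (map m (undup (hspan S d)))); split=> [e|p Ap hp].
  rewrite mem_undup => /mapP[f]; rewrite mem_undup => /hspan_homog hf ->.
  by split; [move=> g gL; rewrite rmorphM /= actC act_gsum | exact: mh].
have [c Ep] := hspanP hp; have -> : p = m p.
  rewrite /m /gsum big_seq (eq_bigr (fun _ => p)) => [|g gL]; last exact: Ap.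
  by rewrite -big_seq; apply: mean_sum; exact: size_gt0.
have mD x y : m (x + y) = m x + m y.
  rewrite /m /gsum -mulrDr -big_split; congr (_ * _).
  by apply: eq_bigr => g _; rewrite rmorphD.
have mZ k x : m (pC k * x) = pC k * m x.
  rewrite /m /gsum [RHS]mulrCA; congr (_ * _); rewrite [RHS]mulr_sumr.
  by apply: eq_bigr => g _; rewrite rmorphM /= actC.
have m0 : m 0 = 0 by rewrite /m /gsum big1 ?mulr0 // => g _; rewrite raddf0.
rewrite Ep; have : {subset undup (hspan S d) <= undup (hspan S d)} by [].
elim: {1 4}(undup (hspan S d)) => [|e r IH] sr; first by rewrite big_nil m0; exact: insp0.
rewrite big_cons mD mZ; apply: inspD; last by apply: IH => f hf; apply: sr; rewrite inE hf orbT.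
by apply/inspZ/insp_mem; rewrite ?undup_uniq // mem_undup map_f // sr // mem_head.
Qed.

(** If multiplication by [z] from degree [i] to the complementary degree is injective
modulo the ideal, the Gram matrix of the form [(p, p') |-> G (z * p * p' * DP)] on a
spanning family solves the equation [z * p = y]. *)
Lemma duality_surj i k z y : (i + k + i = N - NP)%N -> A z -> phom k z ->
  (forall p, A p -> phom i p -> cideal (z * p) -> cideal p) ->
  A y -> phom (N - NP - i) y ->
  exists p, [/\ A p, phom i p & cideal (z * p - y)].
Proof.
move=> eqN Az hz inj Ay hy; have [E [hE spE]] := linv_span i.
have ri : (N - NP - i = k + i)%N by lia.
have hD x : phom (N - NP) x -> phom N (x * DP).
  by move=> hx; rewrite -{1}(subnK szP); apply: phomM => //; exact: lprod_homog.
(* In top degree G takes values in the multiples of D; [phi] turns them into real numbers. *)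
have [phi phiD phiM] := phom_coef (lprod_homog S ls) (lprod_neq0 S ls).
pose ga x := phi (G (x * DP)).
have gaD x x' : ga (x + x') = ga x + ga x' by rewrite /ga mulrDl asymD raddfD.
have ga_sum (T : Type) (r : seq T) F : ga (\sum_(j <- r) F j) = \sum_(j <- r) ga (F j).
  elim: r => [|j r IH]; last by rewrite !big_cons gaD IH.
  by rewrite !big_nil /ga mul0r asym0 raddf0.
have gaZ c x : phom (N - NP) x -> ga (pC c * x) = c * ga x.
  move=> hx; rewrite /ga -mulrA asymC // (phiM N) ?evC //.
  exact/asym_homog/hD.
have ga0 x : phom (N - NP) x -> ga x = 0 -> G (x * DP) = 0.
  move=> /hD/asym_top[c Ec]; rewrite /ga Ec (phiM N) ?evC //; last exact: lprod_homog.
  by move/eqP; rewrite mulf_eq0 (negbTE phiD) orbF => /eqP ->; rewrite rmorph0 mul0r.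
have nul x : A x -> phom (k + i) x -> (forall e, e \in E -> ga (e * x) = 0) -> cideal x.
  move=> Ax hx h; apply: contrapT => nx; have [q [_ Aq hq /eqP nz]] := duality_inv Ax hx nx.
  have eqi : (N - NP - (k + i) = i)%N by lia.
  rewrite eqi in hq; apply: nz; apply: ga0.
    by rewrite -eqN -addnA addnC; apply: phomM.
  have [c ->] := spE _ Aq hq; rewrite mulr_sumr ga_sum big_seq big1 // => e eE.
  rewrite mulrCA gaZ ?[x * e]mulrC ?h ?mulr0 //.
  by rewrite -eqN -addnA; apply: phomM => //; case: (hE e eE).
pose M := \matrix_(j < size E, l < size E) ga (E`_j * (z * E`_l)).
pose b := \row_(j < size E) ga (E`_j * y).
have AE (j : 'I_(size E)) : A E`_j /\ phom i E`_j by apply: hE; rewrite mem_nth.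
have hzE (j : 'I_(size E)) : phom (k + i) (z * E`_j) by apply: phomM => //; case: (AE j).
have hEx x (j : 'I_(size E)) : phom (k + i) x -> phom (N - NP) (E`_j * x).
  by move=> hx; rewrite -eqN -addnA; apply: phomM => //; case: (AE j).
have sym j l : M j l = M l j by rewrite !mxE; congr ga; ring.
have comb (c : 'I_(size E) -> R) : let p := \sum_j pC (c j) * E`_j in
    A p /\ phom i p.
  split=> [g gL|].
    rewrite rmorph_sum /=; apply: eq_bigr => j _; rewrite rmorphM /= actC.
    by have [-> //] := AE j.
  apply: (big_ind (phom i)) => [||j _]; [exact: phom0 | exact: phomD |].
  by apply: phomCM; case: (AE j).
(* The Fredholm alternative: a column in the cokernel of M gives an element p with z p, hence p, in
   the ideal, and such a p pairs to 0 with y. *)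
have : (b <= M)%MS.
  rewrite submxE; apply/eqP/rowP => l; rewrite [RHS]mxE.
  pose c j := cokermx M j l; pose p := \sum_j pC (c j) * E`_j.
  have [Ap hp] := comb c.
  have Mc j : \sum_k0 M j k0 * c k0 = 0.
    by have /matrixP/(_ j l) := mulmx_coker M; rewrite !mxE.
  have Jp : cideal p.
    apply: inj => //; apply: nul; [exact: linvM | exact: phomM |].
    move=> e /(nthP 0)[j lj <-]; pose j' := Ordinal lj; rewrite -[j]/(val j').
    rewrite -[RHS](Mc j') /p mulr_sumr mulr_sumr ga_sum; apply: eq_bigr => l' _.
    rewrite (mulrCA z) (mulrCA E`_j') gaZ; last exact: hEx.
    by rewrite mxE mulrC.
  transitivity (ga (p * y)).
    rewrite mxE /p mulr_suml ga_sum; apply: eq_bigr => j _.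
    rewrite -mulrA gaZ; last by apply: hEx; rewrite -ri.
    by rewrite mxE mulrC.
  rewrite /ga top_cideal ?raddf0 //; last exact: cidealM.
  by rewrite -eqN -addnA -ri; apply: phomM.
move=> /submxP[c Ec]; pose p := \sum_j pC (c 0 j) * E`_j.
have [Ap hp] := comb (c 0); exists p; split=> //.
apply: nul.
- move=> g gL; rewrite rmorphB rmorphM /=.
  by rewrite (Az g gL) (Ap g gL) (Ay g gL).
- apply: phomD; first exact: phomM.
  by rewrite -ri -mulN1r -(rmorph1 pC) -rmorphN; exact: phomCM.
move=> e /(nthP 0)[j lj <-]; pose j' := Ordinal lj; rewrite -[j]/(val j').
rewrite mulrDr mulrN -mulN1r -(rmorph1 pC) -rmorphN gaD gaZ; last by apply: hEx; rewrite -ri.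
have := congr1 (fun B : 'rV_(size E) => B 0 j') Ec; rewrite !mxE => ->.
rewrite mulN1r /p mulr_sumr mulr_sumr ga_sum -sumrB big1 // => l _.
rewrite (mulrCA z) (mulrCA E`_j') gaZ; last exact: hEx.
rewrite [X in _ - X](_ : _ = c 0 l * M l j'); last by rewrite mxE.
by rewrite -sym mxE subrr.
Qed.

End Duality.

(** * From chains to injectivity *)

Section LefschetzInjective.
Variables (R : realType) (n : nat) (S : polyring R n).
Variables (A : S -> Prop) (la : 'rV[R]_n) (A_la : A (lin S la)).
Variables (I : Type) (sl : I -> letter R n).
Hypothesis nice : forall k, nice_upto A_la sl k.
Implicit Types (w : seq (letter R n)) (p q f : S).

Fixpoint ibot w : 'I_(wdim w) := if w is _ :: w' then lshift _ (ibot w') else ord0.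
Fixpoint itop w : 'I_(wdim w) := if w is _ :: w' then rshift _ (itop w') else ord0.

(** The corner entry of the left multiplication is the iterated divided difference; it links the
    coinvariants to the bottom vector. *)
Lemma Lam_dems w f : Lam w f (itop w) (ibot w) = dems w f.
Proof.
elim: w => [|s w IH] /=; first by rewrite mxE eqxx.
by rewrite block_mxEdl mxE IH.
Qed.

Lemma mulmx_bot w d (M : 'M[R]_(d, wdim w)) i : (M *m bot R w) i 0 = M i (ibot w).
Proof.
elim: w M => [|s w IH] /= M; first by rewrite mulmx1.
by rewrite -{1}[M]hsubmxK mul_row_col mulmx0 addr0 IH mxE.
Qed.

Lemma dems_bot w f : ev (dems w f) != 0 -> evm (Lam w f) *m bot R w != 0.
Proof.
apply: contraNneq => /matrixP/(_ (itop w) 0).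
by rewrite mulmx_bot !mxE Lam_dems => ->.
Qed.

Lemma exists_bottom_chain u f : A f -> phom (size u) f -> ev (dems (map sl u) f) != 0 ->
  exists C, [/\ chain A_la sl C, blen C = size u, hasbot C
    & evm (Lam (bw C) f) *m bot R (bw C) != 0].
Proof.
move=> Af hf /dems_bot nz; set w := map sl u in nz.
have sw : size w = size u by rewrite size_map.
have : thr (X := wobj A w) (Y := wobj A w) (chain_le A_la sl (size w)) 0 1%:M.
  apply: word_thr; first exact: nice.
  by rewrite /w; elim: (u) => //= i v IH s [<-|/IH //]; exists i.
have : evm (1%:M : 'M[S]_(wdim w)) *m (evm (Lam w f) *m bot R w) != 0 by rewrite evm1 mul1mx.
move: (1%:M : 'M[S]_(wdim w)) => g + hg; elim: hg => [|g1 g2 _ IH1 _ IH2|].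
- by rewrite /evm map_mx0 mul0mx eqxx.
- have [E|/IH1 //] := eqVneq (evm g1 *m (evm (Lam w f) *m bot R w)) 0.
  by rewrite evmD mulmxDl E add0r.
move=> C j p q [cC lC] [[hp ip] _ ep] [[hq iq] _ _] {}nz; exists C.
have E : evm (q *m p) *m (evm (Lam w f) *m bot R w) =
    evm q *m (evm (Lam (bw C) f) *m (evm p *m bot R w)).
  have -> : evm (q *m p) *m (evm (Lam w f) *m bot R w) = evm q *m (evm (p *m Lam w f) *m bot R w).
    by rewrite !evmM !mulmxA.
  by rewrite ip // evmM !mulmxA.
rewrite E in nz; set v := evm p *m bot R w in nz E.
have Lv : evm (Lam (bw C) f) *m v != 0 by apply: contraNneq nz => ->; rewrite mulmx0.
have Ev : evm (be C) *m v = v by rewrite /v mulmxA -evmM ep.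
have vj : homv (@wgr R n (bw C)) j v.
  by have := homv_mul (shiftm_evm hp) (@bot_deg0 R n w); rewrite add0r.
have inv : inV (X := hs A_la C) j v by split.
have inL : inV (X := hs A_la C) (j + (size u)%:Z) (evm (Lam (bw C) f) *m v).
  split.
    have [[_ i] _ _] := bhom_e C.
    by rewrite mulmxA [hE _]/= -evmM i // evmM -mulmxA Ev.
  exact: homv_mul (shiftm_evm (@Lam_homog _ _ S (bw C) _ f hf)) vj.
have v0 : v != 0 by apply: contraNneq Lv => ->; rewrite mulmx0.
have j0 : 0 <= j.
  rewrite leNgt; apply: contraNN v0 => lt; apply/eqP; apply: (inV_out inv).
  by rewrite lt.
have jr : j + (size u)%:Z <= (blen C)%:Z.
  rewrite leNgt; apply: contraNN Lv => lt; apply/eqP; apply: (inV_out inL).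
  by apply/orP; right.
have lu : (blen C <= size u)%N by rewrite -sw.
(* The bounds 0 <= j and j + size u <= blen C <= size u leave no freedom. *)
have Ej : j = 0 by lia.
have Eb : blen C = size u by lia.
move: vj; rewrite Ej => /deg0_bot[c Ec].
have c0 : c != 0 by apply: contraNneq v0 => c0; rewrite Ec c0 scale0r.
split=> //.
  by apply: (scalerI c0); rewrite scalemxAr -Ec Ev.
by apply: contraNneq Lv => E0; rewrite Ec -scalemxAr E0 scaler0.
Qed.

Variables (J : S -> Prop) (r : nat) (u : seq I) (f : S).
Hypothesis J_Lam : forall x w, J x -> (forall s, List.In s w -> exists i, s = sl i) ->
  evm (Lam w x) = 0.
Hypotheses (Af : A f) (hf : phom r f) (su : size u = r).
Hypothesis uf : ev (dems (map sl u) f) != 0.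
Hypothesis J_dual : forall d p, A p -> phom d p -> ~ J p ->
  exists q c, c != 0 /\ J (p * q - pC c * f).

Theorem lefschetz_injective i k p : (i + i + k)%N = r -> A p -> phom i p ->
  J (lin S la ^+ k * p) -> J p.
Proof.
move=> ik Ap hp Jlp; apply: contrapT => nJ.
have [|C [cC lC bC nz]] := @exists_bottom_chain u f Af _ uf; first by rewrite su.
have ls s : List.In s (bw C) -> exists i, s = sl i.
  have [v ->] := chain_word cC.
  by elim: v => //= l v IH [<-|/IH //]; exists l.
have x0 : evm (Lam (bw C) p) *m bot R (bw C) = 0.
  have [HL _] := chain_HLR cC; apply: (HL i k); first by rewrite -[hn _]/(blen C) lC su.
    exact: Lam_bot.
  by rewrite L_bot J_Lam // mul0mx.
have [q [c [c0 Jq]]] := J_dual Ap hp nJ.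
have Epq : evm (Lam (bw C) (p * q)) *m bot R (bw C) = 0.
  by rewrite mulrC LamM evmM -mulmxA x0 mulmx0.
have := J_Lam Jq ls; rewrite raddfB /= evmB (LamM _ (pC c)) LamC mul_scalar_mx evmZ evC => E.
have := congr1 (mulmx^~ (bot R (bw C))) E; rewrite mulmxBl Epq mul0mx sub0r -scalemxAl.
move/eqP; rewrite oppr_eq0 scaler_eq0 (negbTE c0) /= => /eqP E0.
by rewrite E0 eqxx in nz.
Qed.

End LefschetzInjective.

(** * The Lefschetz property for invariants of a parabolic subgroup *)

Section Parabolic.
Variables (R : realType) (n : nat) (S : polyring R n) (Phi : root_system R n).
Local Notation rs := (root_seq Phi).
Local Notation cor := (coroot Phi).
Variables (I : finType) (sl : I -> letter R n) (la0 : 'rV[R]_n) (mu : I -> 'rV[R]_n).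
Hypothesis H : simple_system sl (fun b => b \in rs) la0 mu.
Variables (P : {pred I}) (L LP : seq 'M[R]_n).
Hypotheses (uL : uniq L) (hL : forall g, g \in L <-> inW sl predT g).
Hypotheses (uLP : uniq LP) (hLP : forall g, g \in LP <-> inW sl P g).
Variable u : 'rV[R]_n.
Hypothesis hu : forall i, i \in P -> u *m lrefl (sl i) = u.
Local Notation posP := (posP Phi sl la0).
Local Notation r := (size (posP predT) - size (posP P))%N.
Local Notation cideal := (@cideal R n S L).
Local Notation A := (@linv R n S LP).
Local Notation W v := (wprod (map sl v)).

Let HL : group_list L := group_list_inW uL hL.
Let HLP : group_list LP := group_list_inW uLP hLP.
Let LPL : {subset LP <= L}.
Proof. by move=> g /hLP/inW_sub/hL. Qed.
Let L1 : 1%:M \in L.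
Proof. by apply/hL; exact: inW1. Qed.
Let LP1 : 1%:M \in LP.
Proof. by apply/hLP; exact: inW1. Qed.
Let tL i : lrefl (sl i) \in L.
Proof. by apply/hL; exact: inW_simple. Qed.
Let tgen g : g \in L -> exists v, g = W v.
Proof. by move=> /hL[v _ ->]; exists v. Qed.

Lemma size_posP : (size (posP P) <= size (posP predT))%N.
Proof.
apply: uniq_leq_size; first exact: uniq_posP.
by move=> b /mem_posP[rb pb /inW_sub wb]; apply/mem_posP.
Qed.

Lemma linv_lin : A (lin S u).
Proof.
move=> g /hLP[v sv ->]; rewrite act_lin; suff -> : u *m W v = u by [].
elim: v sv => [|i v IH] sv /=; first by rewrite mulmx1.
rewrite mulmxA IH => [|c cv]; last by apply: sv; rewrite inE cv orbT.
by rewrite hu // sv // mem_head.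
Qed.

Lemma letters_mem Q (M : seq 'M[R]_n) ls : (forall g, g \in M <-> inW sl Q g) ->
  (forall s, List.In s ls -> lroot s \in posP Q /\ lform s = cor (lroot s)) ->
  forall s, List.In s ls -> lrefl s \in M.
Proof.
move=> hM hs s /hs[/mem_posP[_ _ wb] Ef]; apply/hM.
by rewrite /lrefl Ef.
Qed.

Lemma lprod_antisym Q (M : seq 'M[R]_n) ls : (forall g, g \in M <-> inW sl Q g) ->
  lprod S ls = \prod_(b <- posP Q) lin S (cor b) ->
  forall g, g \in M -> pC (\det g) * act g (lprod S ls) = lprod S ls.
Proof. by move=> hM -> g /hM; exact: (prod_posP_antisym H). Qed.

(** Invariants pass through all tensor factors to the right, where their vanishing at 0 kills
    them. *)
Lemma cideal_Lam x w : (forall s, List.In s w -> lrefl s \in L) -> cideal x -> evm (Lam w x) = 0.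
Proof.
move=> hw [s hs ->]; rewrite raddf_sum evm_sum big_seq big1 // => z /hs[hz ez].
rewrite /= LamM; have -> : Lam w z.2 = z.2%:M.
  elim: w hw => [|t w IH] hw //=; rewrite IH => [|c hc]; last by apply: hw; right.
  have st : lact t z.2 = z.2 by apply: hz; apply: hw; left.
  by rewrite extm_scalar (dem_inv st) (avg_inv st) mulr0 raddf0 -scalar_mx_block.
by rewrite mul_mx_scalar evmZ ez scale0r.
Qed.

Theorem parabolic_lefschetz_inj : (forall b, b \in rs -> u *m rrefl Phi b = u -> inW sl P (rrefl Phi b)) ->
  forall i k p, (i + i + k)%N = r -> A p -> phom i p -> cideal (lin S u ^+ k * p) -> cideal p.
Proof.
move=> hfix i k p ik Ap hp.
have [ls [szl hls npl El]] := posP_letters Phi sl la0 predT.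
have [lsP [szlP hlsP nplP ElP]] := posP_letters Phi sl la0 P.
have lsL := letters_mem hL hls; have lsLP := letters_mem hLP hlsP.
have D_anti := lprod_antisym hL (El S); have DP_anti := lprod_antisym hLP (ElP S).
have szP : (size lsP <= size ls)%N by rewrite szl szlP size_posP.
(* In the system conjugated by v0 the form u is dominant; P stays attached to the original
   system. *)
have [v0 _ hv0] := dominant H predT u.
have [sl' [la0' [mu' [H' Er Es Ew]]]] := conj_system H v0.
have A_la : A (lin S u) := linv_lin.
have dom b : b \in rs -> 0 < pairing u b -> 0 < pairing la0' b.
  move=> rb pb; apply: contrapT => /(not_pos H' rb) lt.
  have pn : 0 < pairing la0' (- b) by rewrite pairingNr oppr_gt0.
  have : 0 <= pairing u (- b).
    rewrite [- b](ss_exp H') pairing_sumr; apply: sumr_ge0 => j _.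
    by rewrite pairingZr mulr_ge0 ?Er ?hv0 // (ss_pos H') // root_opp.
  by rewrite pairingNr oppr_ge0 leNgt pb.
have wsl' j : inW sl predT (lrefl (sl' j)).
  rewrite Es; apply: inWM; last by exists (rev v0).
  by apply: inWM; [exists v0 | exact: inW_simple].
(* The condition on l enters here: a simple reflection that fixes u lies in the parabolic subgroup,
   hence fixes A. *)
have fixA j : pairing u (lroot (sl' j)) = 0 -> forall x, A x -> lact (sl' j) x = x.
  move=> u0 x Ax; apply: Ax; apply/hLP; rewrite (lrefl_rrefl H'); apply: hfix.
    exact: (ss_root H').
  by rewrite -(lrefl_rrefl H') /lrefl mul_reflection u0 scale0r subr0.
have nice := nice_all H' (A_la := A_la) dom fixA.
have tL' j : lrefl (sl' j) \in L by exact/hL.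
have tgen' g : g \in L -> exists v, g = wprod (map sl' v).
  move=> /hL wg; have [w _ E] : inW sl predT (W (rev v0) *m g *m W v0).
    by apply: inWM; [apply: inWM => //; exists (rev v0) | exists v0].
  exists w; rewrite Ew -E !mulmxA W_revK mul1mx -mulmxA W_revK mulmx1.
  by [].
have [f [Af hf nf nz]] := exists_top HL HLP LPL L1 LP1 npl nplP lsL lsLP szP D_anti DP_anti tL tgen.
have [v [sv ev_v]] := exists_dems HL (size_gt0 L1) tL' tgen' hf nf.
rewrite szl szlP in sv hf; apply: (lefschetz_injective (A_la := A_la) nice (J := cideal) _ Af hf sv ev_v _ ik Ap hp).
- move=> x w Jx hw; apply: cideal_Lam => // s /hw[j ->]; exact: tL'.
move=> d q Aq hq nq; have [q' [dr Aq' hq' nz']] :=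
  duality_inv HL HLP LPL L1 LP1 nplP lsLP szP D_anti DP_anti tL tgen Aq hq nq.
have hqq : phom (size ls - size lsP) (q * q').
  by rewrite -(subnKC dr); apply: phomM.
have hf' : phom (size ls - size lsP) f by rewrite szl szlP.
have [c Jc] := top_multiple HL HLP LPL L1 LP1 npl nplP lsL lsLP szP D_anti DP_anti tL tgen
  Af hf' nz (linvM Aq Aq') hqq.
exists q', c; split=> //; apply: contraNneq nz' => c0.
rewrite c0 rmorph0 mul0r subr0 in Jc.
by rewrite (top_cideal HL npl lsL szP hqq Jc).
Qed.

Theorem parabolic_lefschetz_surj : (forall b, b \in rs -> u *m rrefl Phi b = u -> inW sl P (rrefl Phi b)) ->
  forall i k y, (i + i + k)%N = r -> A y -> phom (r - i) y ->
  exists p, [/\ A p, phom i p & cideal (lin S u ^+ k * p - y)].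
Proof.
move=> hfix i k y ik Ay hy.
have [ls [szl hls npl El]] := posP_letters Phi sl la0 predT.
have [lsP [szlP hlsP nplP ElP]] := posP_letters Phi sl la0 P.
have lsL := letters_mem hL hls; have lsLP := letters_mem hLP hlsP.
have D_anti := lprod_antisym hL (El S); have DP_anti := lprod_antisym hLP (ElP S).
have szP : (size lsP <= size ls)%N by rewrite szl szlP size_posP.
rewrite -szl -szlP in hy ik.
apply: (duality_surj HL HLP LPL L1 LP1 npl nplP lsL lsLP szP D_anti DP_anti tL tgen _ _ _ _ Ay hy).
- by rewrite -ik addnAC.
- exact/linvX/linv_lin.
- elim: (k) => [|j IH]; first by rewrite expr0 -(rmorph1 pC) phomC.
  by rewrite exprS -add1n; apply: phomM => //; exact: phom_lin.
- move=> p Ap hp; apply: (parabolic_lefschetz_inj hfix) hp => //.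
  by rewrite -szl -szlP.
Qed.

Theorem parabolic_lefschetz_fixed s : lrefl s \in L -> u *m lrefl s = u -> ~ inW sl P (lrefl s) ->
  cideal (lin S u ^+ r).
Proof.
move=> sL us nsP.
have [ls [szl hls npl El]] := posP_letters Phi sl la0 predT.
have [lsP [szlP hlsP nplP ElP]] := posP_letters Phi sl la0 P.
have lsL := letters_mem hL hls; have lsLP := letters_mem hLP hlsP.
have D_anti := lprod_antisym hL (El S); have DP_anti := lprod_antisym hLP (ElP S).
have szP : (size lsP <= size ls)%N by rewrite szl szlP size_posP.
rewrite -szl -szlP.
apply: (top_inv HL HLP LPL L1 LP1 nplP lsLP szP D_anti DP_anti tL tgen).
- exact/linvX/linv_lin.
- elim: (_ - _)%N => [|j IH]; first by rewrite expr0 -(rmorph1 pC) phomC.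
  by rewrite exprS -add1n; apply: phomM => //; exact: phom_lin.
pose M := [seq g <- L | u *m g == u].
have memM g : g \in M <-> inW sl predT g /\ u *m g = u.
  rewrite mem_filter; split=> [/andP[/eqP ug /hL]|[/hL -> ->]]; first by split.
  by rewrite eqxx.
have HM : group_list M.
  split=> [|g g' /memM[wg ug] /memM[wg' ug']|g /memM[wg ug]].
  - exact: filter_uniq.
  - by apply/memM; rewrite mulmxA ug ug'; split=> //; exact: inWM.
  - have [g' wg' [E1 E2]] := inW_inv wg; exists g'; last by split.
    by apply/memM; split=> //; rewrite -{1}ug -mulmxA E2 mulmx1.
have lin_inv g : g \in LP -> u *m g = u.
  by move=> /linv_lin; rewrite act_lin => /lin_inj.
apply: (@asym_fixed R n S L LP HL lsP lsLP M s) => //.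
- by apply/memM; rewrite mulmx1; split=> //; exact: inW1.
- by move=> g /memM[/hL].
- by move=> g gLP; apply/memM; split; [exact/hL/LPL | exact: lin_inv].
(* A coroot of the parabolic proportional to that of s would make the two reflections equal, and s
   would lie in the parabolic subgroup. *)
- split=> // t /hlsP[/mem_posP[rt _ wt] Et] c E; apply: nsP.
  have c0 : c != 0.
    by apply: contraNneq (lform_neq0 t) => c0; rewrite E c0 scale0r.
  have Es : lform s = c^-1 *: cor (lroot t) by rewrite -Et E scalerA mulVf // scale1r.
  suff -> : lrefl s = rrefl Phi (lroot t) by [].
  have sst : rstable Phi (lrefl s) by have /hL := sL; exact: (inW_stable H).
  have := @refl_uniq R n Phi (lroot s) (cor (lroot t)) (lroot t) c^-1.
  rewrite -Es /lrefl => -> //; [exact: letterP | exact: coroot_root | exact: rstable_rrefl].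
- by apply/memM; split=> //; exact/hL.
- by move=> g /memM[_ ug]; rewrite rmorphXn /= act_lin ug.
Qed.

(** Divided differences of a linear form are constants, and the ideal contains no nonzero constant;
    the simple roots span V. Thus the degree one part of R is the dual of V, and fixing l means
    fixing u. *)
Lemma cideal_lin v : cideal (lin S v) -> v = 0.
Proof.
move=> Jv; have v0 i : pairing v (lroot (sl i)) = 0.
  have := cideal_ev (cideal_dem (tL i) Jv).
  by rewrite dem_lin evC.
have vb b : pairing v b = 0.
  by rewrite [b](ss_exp H) pairing_sumr big1 // => i _; rewrite pairingZr v0 mulr0.
apply/rowP => j; have := vb (delta_mx j 0); rewrite /pairing -colE !mxE.
by [].
Qed.

Lemma cideal_act_lin v g : cideal (act g (lin S v) - lin S v) <-> v *m g = v.
Proof.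
rewrite act_lin -raddfB; split=> [/cideal_lin/eqP|->].
  by rewrite subr_eq0 => /eqP.
by rewrite subrr raddf0; exact: cideal0.
Qed.

End Parabolic.

(** * Translation to the quotient ring *)

Section CoinvariantRing.
Variables (R : realType) (n : nat) (Phi : root_system R n).
Variables (Delta : n.-tuple 'cV[R]_n) (HD : is_base Phi Delta) (P : {set 'I_n}).
Local Notation W := (weyl_group Phi).
Local Notation WP := (parabolic Phi Delta P).
Local Notation S := (mpoly_polyring R n).
Local Notation rs := (root_seq Phi).
Local Notation sl := (sletter HD).
Local Notation H := (base_simple_system HD).
Local Notation pi := (coinvariant_pi W).
Variables (L LP : seq 'M[R]_n).
Hypotheses (uL : uniq L) (hL : forall g, g \in L <-> inW sl predT g).
Hypotheses (uLP : uniq LP) (hLP : forall g, g \in LP <-> inW sl (mem P) g).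

Lemma simple_reflectionsP (Q : {set 'I_n}) g :
  simple_reflections Phi Delta Q g <-> exists2 i, i \in mem Q & lrefl (sl i) = g.
Proof. by split=> -[i iQ <-]; exists i. Qed.

Lemma parabolic_inW g : WP g <-> inW sl (mem P) g.
Proof.
split=> [|[v sv ->]].
  elim=> [x /simple_reflectionsP[i iP <-]||x y _ hx _ hy|x _ /inW_inv[y wy [yx xy]]].
  - exact: inW_simple.
  - exact: inW1.
  - exact: inWM.
  - suff -> : invmx x = y by [].
    have [ux _] := mulmx1_unit xy.
    by rewrite -[LHS]mulmx1 -xy mulmxA mulVmx // mul1mx.
elim: v sv => [|i v IH] sv /=; first exact: generated_1.
apply: generated_mul; first by apply: IH => c cv; apply: sv; rewrite inE cv orbT.
by apply: generated_in; apply/simple_reflectionsP; exists i => //; apply: sv; exact: mem_head.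
Qed.

Lemma W_L g : W g <-> g \in L.
Proof. by split=> [/(weyl_inW H)/hL|/hL/(weyl_inW H)]. Qed.

Lemma WP_LP g : WP g <-> g \in LP.
Proof. by split=> [/parabolic_inW/hLP|/hLP/parabolic_inW]. Qed.

Lemma weyl_inv g : W g -> W (invmx g) /\ invmx (invmx g) = g.
Proof. by split; [exact: generated_inv | exact: invmxK]. Qed.

Lemma parabolic_sub g : WP g -> W g.
Proof. by move=> /parabolic_inW/inW_sub/(weyl_inW H). Qed.

Lemma invariant_linv p : invariant_poly W p <-> linv (S := S) L p.
Proof.
split=> h g.
  move=> /W_L/weyl_inv[wg gK]; have := h _ wg; rewrite poly_actE gK; exact.
by move=> /weyl_inv[/W_L/h E _]; rewrite poly_actE.
Qed.

Lemma ideal_cideal p : in_coinvariant_ideal W p <-> cideal (S := S) L p.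
Proof.
split=> -[s hs Es]; exists s => // x /hs[h e]; split=> //; exact/invariant_linv.
Qed.

Lemma pi_eq p q : pi p = pi q <-> cideal (S := S) L (p - q).
Proof.
rewrite -ideal_cideal /coinvariant_pi; split.
  by move/eqP; rewrite -Quotient.idealrBE => /asboolP.
by move=> h; apply/eqP; rewrite -Quotient.idealrBE; apply/asboolP.
Qed.

Lemma piM p q : pi (p * q) = pi p * pi q.
Proof. exact: (rmorphM (\pi_{ideal_quot (coinvariant_idealr W)}%qT)). Qed.

Lemma piX p k : pi (p ^+ k) = pi p ^+ k.
Proof. exact: (rmorphXn (\pi_{ideal_quot (coinvariant_idealr W)}%qT)). Qed.

Lemma pi0 : pi 0 = 0.
Proof. exact: (rmorph0 (\pi_{ideal_quot (coinvariant_idealr W)}%qT)). Qed.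

(** Averaging over the parabolic subgroup lifts an invariant class to an invariant polynomial of the
    same degree. *)
Lemma coinvariant_invP d x :
  coinvariant_inv W WP d x <-> exists p : S, [/\ linv LP p, phom d p & x = pi p].
Proof.
split=> [[[p0 hp0 <-] hinv]|[p [Ap hp ->]]]; last first.
  split; first by exists p.
  move=> g wg; rewrite coinvariant_act_pi ?poly_actE; last exact: parabolic_sub.
  by congr pi; apply: Ap; apply/WP_LP; exact: generated_inv.
have LP0 : (0 < size LP)%N by apply: size_gt0; apply/hLP; exact: inW1.
have [g gL|p [Ap hp Jp]] := @linv_representative R n S L LP d p0
  (group_list_inW uLP hLP) LP0 hp0; last first.
  by exists p; split=> //; apply/pi_eq.
have wg : WP (invmx g) by apply: generated_inv; apply/WP_LP.
apply/pi_eq; rewrite -[RHS](hinv _ wg) coinvariant_act_pi ?poly_actE ?invmxK //.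
exact: parabolic_sub.
Qed.

Lemma coinvariant_act_lin u g : W g ->
  coinvariant_act g (pi (lin S u)) = pi (lin S u) <-> u *m g = u.
Proof.
move=> wg; have gu : g \in unitmx by have /(weyl_inW H)/inW_inv[y _ [_ /mulmx1_unit[]]] := wg.
rewrite coinvariant_act_pi // pi_eq poly_actE.
rewrite (cideal_act_lin S H hL u (invmx g)); split=> E.
  by rewrite -{1}E -mulmxA mulVmx // mulmx1.
by rewrite -{1}E -mulmxA mulmxV // mulmx1.
Qed.

End CoinvariantRing.

Lemma reflection_letter (R : realType) (n : nat) (g : 'M[R]_n) :
  is_reflection g -> exists s : letter R n, lrefl s = g.
Proof.
move=> [[a a0 ga] [f f0 fg]]; have fa : pairing f a != 0.
  apply/eqP => /fg; rewrite ga => /eqP; rewrite eq_sym -addr_eq0 -mulr2n -scaler_nat.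
  by rewrite scaler_eq0 pnatr_eq0 (negbTE a0).
pose f' := (2 / pairing f a) *: f.
have f'a : pairing f' a = 2 by rewrite pairingZl divfK.
exists (Letter f'a); rewrite /lrefl /=; apply/matrixP => i j.
suff E (v : 'cV_n) : reflection a f' *m v = g *m v.
  by have := congr1 (fun z : 'cV_n => z i 0) (E (delta_mx j 0)); rewrite -!colE !mxE.
have [x [c [hx ->]]] : exists x c, pairing f x = 0 /\ v = x + c *: a.
  exists (v - (2^-1 * pairing f' v) *: a), (2^-1 * pairing f' v); rewrite subrK; split=> //.
  by rewrite pairingDr pairingNr pairingZr pairingZl; field; rewrite fa.
rewrite !mulmxDr -!scalemxAr (fg _ hx) ga !reflection_mul f'a pairingZl hx mulr0 scale0r subr0.
by rewrite scaler_nat mulr2n opprD addrA subrr add0r.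
Qed.

Lemma is_reflection_rrefl (R : realType) (n : nat) (Phi : root_system R n) b :
  b \in root_seq Phi -> is_reflection (rrefl Phi b).
Proof.
move=> rb; have cb := coroot_root rb; split.
  exists b; first exact: (root_neq0 rb).
  by rewrite /rrefl reflection_mul cb scaler_nat mulr2n opprD addrA subrr add0r.
exists (coroot Phi b); last by move=> v v0; rewrite /rrefl reflection_mul v0 scale0r subr0.
apply: contra_eqN cb => /eqP ->.
by rewrite /pairing mul0mx mxE eq_sym pnatr_eq0.
Qed.

Theorem theorem2 (R : realType) (n : nat) (Phi : root_system R n)
    (Delta : n.-tuple 'cV[R]_n) (Delta_base : is_base Phi Delta)
    (S : {set 'I_n}) (l : coinvariant_ring (weyl_group Phi)) :
  let W := weyl_group Phi in
  let W_S := parabolic Phi Delta S in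
  let m := longest_length W (simple_reflections Phi Delta [set: 'I_n]%SET) in
  let m_S := longest_length W_S (simple_reflections Phi Delta S) in
  coinvariant_inv W W_S 1 l ->
  (strong_lefschetz (coinvariant_inv W W_S) (m - m_S) l <->
   (forall s : 'M[R]_n, W s -> is_reflection s -> ~ W_S s ->
      coinvariant_act s l <> l)).
Proof.
move=> W W_S m m_S hl; have H := base_simple_system Delta_base.
pose sl := sletter Delta_base; pose la0 : 'rV[R]_n := \sum_i dual Delta i.
have [L uL hL] := finite_inW H predT; have [LP uLP hLP] := finite_inW H (mem S).
pose r := (size (posP Phi sl la0 predT) - size (posP Phi sl la0 (mem S)))%N.
have -> : (m - m_S)%N = r.
  rewrite /r /m /m_S; congr (_ - _)%N; symmetry; apply/esym.
    apply: (longest_length_posP H (P := predT)) => g; last exact: (weyl_inW H).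
    split=> [/simple_reflectionsP|]; first by move=> /(_ Delta_base)[i _ <-]; exists i.
    by move=> [i _ <-]; apply/(simple_reflectionsP Delta_base); exists i; rewrite ?inE.
  apply: (longest_length_posP H (P := mem S)) => g; first exact: simple_reflectionsP.
  exact: parabolic_inW.
have invP := coinvariant_invP hL uLP hLP.
have [p [Ap hp El]] := (invP 1%N l).1 hl; have [u Eu] := phom1_lin hp.
have hu i : i \in mem S -> u *m lrefl (sl i) = u.
  move=> iS; have := Ap (lrefl (sl i)); rewrite Eu act_lin => h; apply: lin_inj; apply: h.
  by apply/hLP; exact: inW_simple.
have fixP g : W g -> coinvariant_act g l = l <-> u *m g = u.
  by move=> wg; rewrite El Eu; exact: (coinvariant_act_lin (HD := Delta_base) hL).
split=> [[_ SL] s ws rs_ nws Es|hfix].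
  have [t Et] := reflection_letter rs_.
  have us : u *m lrefl t = u by rewrite Et; exact/fixP.
  have J : cideal (S := mpoly_polyring R n) L (lin _ u ^+ r).
    apply: (parabolic_lefschetz_fixed (mpoly_polyring R n) H uL hL uLP hLP hu (s := t)) => //.
      by rewrite Et; exact/hL/(weyl_inW H).
    by rewrite Et => /(parabolic_inW Delta_base).
  (* Degree 0 suffices: l^r = 0 sends the classes of 1 and 0 to the same element. *)
  have [_ inj _] := SL 0%N (leq0n _).
  have A0 c : coinvariant_inv W W_S 0 (coinvariant_pi W c%:MP).
    apply/invP; exists c%:MP; split=> //; last exact: (phomC (mpoly_polyring R n)).
    by move=> g _; exact: (@actC R n (mpoly_polyring R n)).
  have l0 : l ^+ (r - 2 * 0) = 0.
    rewrite muln0 subn0 El Eu -piX -(pi0 Phi).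
    by apply/(pi_eq hL); rewrite subr0.
  have := inj _ _ (mem_set (A0 1)) (mem_set (A0 0)); rewrite l0 !mul0r => /(_ erefl).
  move/(pi_eq hL); rewrite mpolyC0 subr0; exact: one_notin_cideal.
have hfix' b : b \in root_seq Phi -> u *m rrefl Phi b = u -> inW sl (mem S) (rrefl Phi b).
  move=> rb ub; have wb : W (rrefl Phi b) by apply/(weyl_inW H); exact: (rrefl_inW H).
  apply: contrapT => nb; apply: (hfix _ wb (is_reflection_rrefl rb)).
    by move=> /(parabolic_inW Delta_base).
  exact/fixP.
split=> // i ir; have ri : (i + i + (r - 2 * i))%N = r by lia.
have pl : @phom R n (mpoly_polyring R n) (r - 2 * i) (lin _ u ^+ (r - 2 * i)).
  elim: (r - 2 * i)%N => [|j IH]; first by rewrite expr0; exact: dhomog1.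
  by rewrite exprS -add1n; apply: phomM => //; exact: phom_lin.
have Al : linv LP (lin (mpoly_polyring R n) u ^+ (r - 2 * i)) by exact/linvX/(linv_lin _ hLP hu).
have lE (q : mpoly_polyring R n) : l ^+ (r - 2 * i) * coinvariant_pi W q =
    coinvariant_pi W (lin (mpoly_polyring R n) u ^+ (r - 2 * i) * q).
  by rewrite El Eu piM piX.
split.
- move=> x /invP[q [Aq hq ->]]; apply/invP; rewrite lE.
  exists (lin (mpoly_polyring R n) u ^+ (r - 2 * i) * q); split=> //; first exact: linvM.
  by rewrite (_ : (r - i = (r - 2 * i) + i)%N); [exact: phomM | lia].
- move=> x y /set_mem/invP[q [Aq hq ->]] /set_mem/invP[q' [Aq' hq' ->]].
  rewrite !lE => /(pi_eq hL); rewrite -mulrBr => J; apply/(pi_eq hL).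
  apply: (parabolic_lefschetz_inj H uL hL uLP hLP hu hfix' ri _ _ J).
    by move=> g gL; rewrite rmorphB /= Aq // Aq'.
  exact: (@ihomogB R n (mpoly_polyring R n) i).
move=> y /invP[q [Aq hq ->]].
have [q' [Aq' hq' J]] := parabolic_lefschetz_surj H uL hL uLP hLP hu hfix' ri Aq hq.
exists (coinvariant_pi W q'); first by apply/invP; exists q'.
by rewrite lE; apply/(pi_eq hL).
Qed.
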